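(* Let $T=\prod_{i=1}^N[a_i,b_i]\subset\mathbb{R}^N$ with $-\infty<a_i<b_i<\infty$, and let $\{X(t),\,t\in T\}$ be a centered real-valued Gaussian random field with the following two properties. Smoothness: $X\in C^2(\mathbb{R}^N)$ almost surely and there exist constants $C,\delta>0$ such that $\mathbb{E}(X_{ij}(t)-X_{ij}(t'))^2\le C\|t-t'\|^{2\delta}$ for all $t,t'\in T$, $i,j=1,\dots,N$. Regularity: for every pair $(t,t')\in T^2$ with $t\ne t'$, the Gaussian vector $(X(t),\nabla X(t),X_{ij}(t),X(t'),\nabla X(t'),X_{ij}(t'),\ 1\le i\le j\le N)$ is non-degenerate. Suppose also that $X$ satisfies the boundary condition $$ \Big\{t\in J:\ \nu(t)=\sigma_T^2,\ \prod_{i\notin\tau(J)}\nu_i(t)=0\Big\}=\emptyset\qquad\text{for every face }J\subset T . $$ Then there exists a constant $\alpha>0$ such that as $u\to\infty$, $$ \mathbb{P}\Big\{\sup_{t\in T}X(t)\ge u\Big\} =\sum_{k=0}^N\sum_{K\in\partial_kT}(-1)^k\int_K\mathbb{E}\big\{\det\nabla^2X_{|K}(t)\,\mathbf{1}_{\{X(t)\ge u\}}\,\big|\,\nabla X_{|K}(t)=0\big\}\,p_{\nabla X_{|K}(t)}(0)\,dt +o\Big(\exp\Big\{-\frac{u^2}{2\sigma_T^2}-\alpha u^2\Big\}\Big). $$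
   Context: Variance: $\nu(t)=\mathrm{Var}(X(t))$ and $\sigma_T^2=\sup_{t\in T}\nu(t)$. Subscripts denote partial derivatives: $X_i=\partial X/\partial t_i$, $X_{ij}=\partial^2X/\partial t_i\partial t_j$, and similarly $\nu_i$. Faces: a face $K$ of $T$ of dimension $k$ ($0\le k\le N$) is determined by a subset $\tau(K)\subset\{1,\dots,N\}$ of size $k$ and numbers $\varepsilon(K)=\{\varepsilon_j\in\{0,1\}:j\notin\tau(K)\}$, via $K=\{t\in T: a_j<t_j<b_j\text{ if }j\in\tau(K),\ t_j=(1-\varepsilon_j)a_j+\varepsilon_jb_j\text{ if }j\notin\tau(K)\}$. $\partial_kT$ is the collection of all $k$-dimensional faces, so that $T$ is the disjoint union of all its faces (the interior being the unique $N$-dimensional face). $\nabla X_{|K}(t)=(X_i(t))_{i\in\tau(K)}$; $\nabla^2X_{|K}(t)=(X_{ij}(t))_{i,j\in\tau(K)}$; $p_{\nabla X_{|K}(t)}(0)$ is the density of $\nabla X_{|K}(t)$ at $0$; $\int_K\cdot\,dt$ is with respect to $k$-dimensional Lebesgue measure. Convention for $k=0$: if $K=\{t\}$, all quantities involving $\nabla X_{|K}$ and $\nabla^2X_{|K}$ are dropped and the corresponding term is $\mathbb{P}\{X(t)\ge u\}$. An empty product equals $1$; thus the boundary condition says that for any $t\in J$ with $\nu(t)=\sigma_T^2$ one has $\nu_i(t)\neq0$ for all $i\notin\tau(J)$. (H1) $X\in C^2(\mathbb{R}^N)$ almost surely and there exist constants $C,\delta>0$ such that $\mathbb{E}(X_{ij}(t)-X_{ij}(t'))^2\le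 C\|t-t'\|^{2\delta}$ for all $t,t'\in T$, $i,j=1,\dots,N$. (H2) For every pair $(t,t')\in T^2$ with $t\ne t'$, the Gaussian vector $(X(t),\nabla X(t),X_{ij}(t),X(t'),\nabla X(t'),X_{ij}(t'),\ 1\le i\le j\le N)$ is non-degenerate. *)

(* Defs.v *)
From HB Require Import structures.
From mathcomp Require Import all_boot all_order all_algebra.
From mathcomp Require Import all_classical all_reals all_analysis.

Set Implicit Arguments.
Unset Strict Implicit.
Unset Printing Implicit Defensive.

Import Order.TTheory GRing.Theory Num.Theory.
Import numFieldNormedType.Exports.

Local Open Scope classical_set_scope.
Local Open Scope ring_scope.

(** Lets Landau notations be used at [+oo]. *)
Canonical pinfty_filter_on (R : realType) :=
  FilterType (pinfty_nbhs R) (@proper_pinfty_nbhs R).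

(** The library has the product sigma-algebra on [k.-tuple R] but no measure on
    it; [lebesgue_tuple R k] is the [k]-fold product of [lebesgue_measure]. *)

Section cons_measure.
Context {d} {T : measurableType d} {R : realType} (k : nat).
Local Open Scope ereal_scope.

Definition cons_pair (p : T * k.-tuple T) : k.+1.-tuple T :=
  [the k.+1.-tuple T of p.1 :: p.2].

Definition uncons_pair (v : k.+1.-tuple T) : T * k.-tuple T :=
  (tnth v ord0, [tuple of behead v]).

Lemma cons_pairK : cancel cons_pair uncons_pair.
Proof. by case=> x v; congr pair; apply/val_inj. Qed.

Lemma measurable_cons_pair : measurable_fun setT cons_pair.
Proof. exact: measurable_cons. Qed.

Lemma measurable_uncons_pair : measurable_fun setT uncons_pair.
Proof.
apply: measurable_fun_pair; first exact: measurable_tnth.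
exact: measurable_behead.
Qed.

Variable m1 : {sigma_finite_measure set T -> \bar R}.
Variable m : {sigma_finite_measure set (k.-tuple T) -> \bar R}.

Definition cons_measure : set (k.+1.-tuple T) -> \bar R :=
  pushforward (m1 \x m) cons_pair.

Let cons_measure0 : cons_measure set0 = 0.
Proof. by rewrite /cons_measure /pushforward preimage_set0 measure0. Qed.

Let cons_measure_ge0 A : (0 <= cons_measure A)%E.
Proof. exact: (measure_ge0 (m1 \x m)). Qed.

Let cons_measure_sigma_additive : semi_sigma_additive cons_measure.
Proof.
exact: (@measure_semi_sigma_additive _ _ _
  (@measure_function_pushforward__canonical__measure_function_Measure
    _ _ _ _ _ (m1 \x m) _ measurable_cons_pair)).
Qed.

HB.instance Definition _ := isMeasure.Build _ _ _ cons_measure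
  cons_measure0 cons_measure_ge0 cons_measure_sigma_additive.

Let cons_measure_sigma_finite : sigma_finite setT cons_measure.
Proof.
have /sigma_finiteP[F [FT ndF Foo]] := sigma_finiteT m1.
have /sigma_finiteP[G [GT ndG Goo]] := sigma_finiteT m.
exists (fun n => uncons_pair @^-1` (F n `*` G n)).
  rewrite -preimage_bigcup -[LHS](preimage_setT uncons_pair); congr (_ @^-1` _).
  rewrite -setXTT FT GT predeqE => -[x y]; split.
    move=> [/= [n _ Fnx] [p _ Gpy]]; exists (maxn n p) => //; split.
    - by move: x Fnx; exact/subsetPset/ndF/leq_maxl.
    - by move: y Gpy; exact/subsetPset/ndG/leq_maxr.
  by move=> [n _ []/= ? ?]; split; exists n.
move=> n; have [mF Fnoo] := Foo n; have [mG Gnoo] := Goo n; split.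
  rewrite -[X in measurable X]setTI; apply: measurable_uncons_pair => //.
  exact: measurableX.
rewrite /cons_measure /pushforward -comp_preimage.
rewrite (_ : _ \o _ = id); last by apply/funext => p; exact: cons_pairK.
by rewrite preimage_id product_measure1E// lte_mul_pinfty// ge0_fin_numE.
Qed.

HB.instance Definition _ := Measure_isSigmaFinite.Build _ _ _ cons_measure
  cons_measure_sigma_finite.

End cons_measure.

Section lebesgue_tuple.
Variable R : realType.

Fixpoint lebesgue_tuple (k : nat) :
    {sigma_finite_measure set (k.-tuple (measurableTypeR R)) -> \bar R} :=
  match k with
  | 0%N => \d_([tuple] : 0.-tuple (measurableTypeR R))
  | k'.+1 => cons_measure lebesgue_measure (lebesgue_tuple k')
  end.

End lebesgue_tuple.

Definition row_of_tuple {R : realType} {k} (v : k.-tuple R) : 'rV[R]_k :=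
  \row_i tnth v i.

Definition borel {R : realType} k : set (set 'rV[R]_k) := <<s [set U | open U] >>.

(** The norm of ['rV[R]_N] in the library is the sup norm. *)
Definition enorm {R : realType} {N} (t : 'rV[R]_N) : R :=
  Num.sqrt (\sum_i t ord0 i ^+ 2).

Section partial.
Context {R : realType} {N : nat}.
Implicit Types (f : 'rV[R]_N -> R) (i : 'I_N).

Definition e_ i : 'rV[R]_N := delta_mx ord0 i.

Definition partial i f : 'rV[R]_N -> R := 'D_(e_ i) f.

Definition C1 f :=
  continuous f /\
  forall i, (forall t, derivable f t (e_ i)) /\ continuous (partial i f).

Definition C2 f := C1 f /\ forall i, C1 (partial i f).

(** Partial derivative of a function whose domain is [A]: the increments are
    restricted to those that stay in [A], so that it is one-sided at the points
    of a box lying on a facet orthogonal to [e_ i]. *)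
Definition partial_within (A : set 'rV[R]_N) i f (t : 'rV[R]_N) : R :=
  lim ((fun h : R => h^-1 * (f (h *: e_ i + t) - f t))
       @ within [set h | A (h *: e_ i + t)] 0^').

End partial.

Section gaussian.
Context {d} {Omega : measurableType d} {R : realType} (P : probability Omega R).

(** Coincides with [fine (P A)] for measurable [A] and, unlike it, does not
    change when [A] is modified on a [P]-negligible set; needed because events
    about the paths of an almost surely regular field are only measurable up to
    such a set. *)
Definition prob (A : set Omega) : R := fine ('E_P[\1_A])%E.

(** [normal_prob m 0] is not the Dirac mass at [m], hence the case split. *)
Definition gaussian_variable (Y : Omega -> R) :=
  exists m s : R, forall A : set (measurableTypeR R), measurable A ->
    P (Y @^-1` A) = if s == 0 then \d_m A else normal_prob m s A.

Definition gaussian_field {I : Type} (T : set I) (X : I -> {RV P >-> R}) :=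
  forall n (t : 'I_n -> I) (c : 'I_n -> R), (forall i, T (t i)) ->
    gaussian_variable (fun w => \sum_(i < n) c i * X (t i) w).

Definition centered {I : Type} (T : set I) (X : I -> {RV P >-> R}) :=
  forall t, T t -> ('E_P[X t] = 0)%E.

Definition covariance_matrix (V : seq (Omega -> R)) : 'M[R]_(size V) :=
  \matrix_(i, j) fine (covariance P (tnth (in_tuple V) i) (tnth (in_tuple V) j)).

Definition nondegenerate (V : seq (Omega -> R)) :=
  covariance_matrix V \in unitmx.

Definition is_continuous_density k (Z : Omega -> 'rV[R]_k) (p : 'rV[R]_k -> R) :=
  [/\ continuous p, forall z, 0 <= p z &
      forall B, borel B ->
        ('E_P[\1_(Z @^-1` B)] =
         \int[lebesgue_tuple R k]_(v in row_of_tuple @^-1` B)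
           (p (row_of_tuple v))%:E)%E].

(** The continuous density of [Z] when there is one; it is then unique. *)
Definition density k (Z : Omega -> 'rV[R]_k) : 'rV[R]_k -> R :=
  xget (cst 0) [set p | is_continuous_density Z p].

(** [phi (Z w)] is a version of the conditional expectation of [W] given the
    sigma-algebra of [Z]. *)
Definition is_continuous_regression k (W : Omega -> R) (Z : Omega -> 'rV[R]_k)
    (phi : 'rV[R]_k -> R) :=
  continuous phi /\
  forall B, borel B ->
    (\int[P]_(w in Z @^-1` B) (W w)%:E = \int[P]_(w in Z @^-1` B) (phi (Z w))%:E)%E.

(** [E (W | Z = z)]. As [Z = z] is a null event, the value at the single point
    [z] is that of the continuous version of the regression function of [W] on
    [Z]; it is unique as soon as the law of [Z] has full support, e.g. when [Z]
    is a nondegenerate Gaussian vector. *)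
Definition cond_expectation k (W : Omega -> R) (Z : Omega -> 'rV[R]_k) :
    'rV[R]_k -> R :=
  xget (cst 0) [set phi | is_continuous_regression W Z phi].

End gaussian.


(** [K j = None] stands for [j \in tau K] and [K j = Some e] for [j \notin tau K]
    with [e] the number attached to [j]. *)
Definition face (N : nat) := {ffun 'I_N -> option bool}.

Definition tau {N} (K : face N) : {set 'I_N} := [set j | K j == None].

Section box.
Context {R : realType} {N : nat} (a b : 'rV[R]_N).

Definition box : set 'rV[R]_N :=
  [set t | forall i, a ord0 i <= t ord0 i <= b ord0 i].

Definition corner (e : bool) (j : 'I_N) : R :=
  (1 - e%:R) * a ord0 j + e%:R * b ord0 j.

Definition face_set (K : face N) : set 'rV[R]_N :=
  [set t | forall j, match K j with
                     | None => a ord0 j < t ord0 j < b ord0 j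
                     | Some e => t ord0 j = corner e j
                     end].

(** The point whose coordinates along [tau K], listed in increasing order, are
    the entries of [v], the other ones being those prescribed by [K]. *)
Definition face_point (K : face N) (v : seq R) : 'rV[R]_N :=
  \row_j match K j with
         | None => nth 0 v (index j (enum (tau K)))
         | Some e => corner e j
         end.

(** Integral over [K] with respect to the [#|tau K|]-dimensional Lebesgue
    measure. *)
Definition face_integral (K : face N) (g : 'rV[R]_N -> R) : R :=
  \int[lebesgue_tuple R #|tau K|]_(v in [set v | face_set K (face_point K v)])
    g (face_point K v).

End box.

Section field.
Context {d} {Omega : measurableType d} {R : realType} (P : probability Omega R).
Context {N : nat} (a b : 'rV[R]_N) (X : 'rV[R]_N -> {RV P >-> R}).
Implicit Types (t : 'rV[R]_N) (i j : 'I_N).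

Local Notation T := (box a b).

Definition sample_path (w : Omega) : 'rV[R]_N -> R := fun t => X t w.

Definition grad i t : Omega -> R := fun w => partial i (sample_path w) t.

Definition hess i j t : Omega -> R := fun w => partial i (partial j (sample_path w)) t.

Definition nu t : R := fine ('V_P[X t])%E.

(** Only the restriction of [nu] to the box is constrained by a Gaussian field on
    the box. *)
Definition nu_ i t : R := partial_within T i nu t.

(** [sigma_T^2] *)
Definition sigma2 : R := sup [set nu t | t in T].

Definition jet t : seq (Omega -> R) :=
  (X t : Omega -> R) :: [seq grad i t | i <- enum 'I_N]
    ++ [seq hess p.1 p.2 t | p <- enum [pred p : 'I_N * 'I_N | (p.1 <= p.2)%N]].

Definition smooth :=
  {ae P, forall w, C2 (sample_path w)} /\
  exists C delta : R, [/\ 0 < C, 0 < delta &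
    forall t t' i j, T t -> T t' ->
      ('E_P[(hess i j t \- hess i j t') ^+ 2] <=
       (C * enorm (t - t') `^ (2 * delta))%:E)%E].

Definition regular :=
  forall t t', T t -> T t' -> t != t' -> nondegenerate P (jet t ++ jet t').

Definition boundary_condition :=
  forall J : face N,
    [set t | [/\ face_set a b J t, nu t = sigma2 &
                 \prod_(i | i \notin tau J) nu_ i t = 0]] = set0.

Definition exceeds t (u : R) : set Omega := [set w | u <= X t w].

Definition sup_exceeds (u : R) : set Omega :=
  [set w | (u%:E <= ereal_sup [set (X t w)%:E | t in T])%E].

Definition grad_face (K : face N) t (w : Omega) : 'rV[R]_#|tau K| :=
  \row_i grad (enum_val i) t w.

Definition hess_face (K : face N) t (w : Omega) : 'M[R]_#|tau K| :=
  \matrix_(i, j) hess (enum_val i) (enum_val j) t w.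

(** For a vertex [face_point K [::]] is its only point. *)
Definition face_term (K : face N) (u : R) : R :=
  if #|tau K| == 0%N then prob P (exceeds (face_point a b K [::]) u)
  else face_integral a b K (fun t =>
    cond_expectation P (fun w => \det (hess_face K t w) * \1_(exceeds t u) w)
      (grad_face K t) 0
    * density P (grad_face K t) 0).

(** The Kac-Rice expression of the mean Euler characteristic of the excursion set
    of [X] above [u]. *)
Definition mean_euler_char (u : R) : R :=
  \sum_(k < N.+1) \sum_(K : face N | #|tau K| == k)
    (-1) ^+ k * face_term K u.

End field.

(* Main.v *)
Require Import Defs.
From HB Require Import structures.
From mathcomp Require Import all_boot all_order all_algebra.
From mathcomp Require Import all_classical all_reals all_analysis.
From mathcomp Require Import perm measurable_realfun ring lra.

(** The field is replaced by a version [F] with C2 paths, so that the values and the derivatives of [F]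
    lie in a Gaussian Hilbert space [H]; in [H] uncorrelated vectors are independent, nondegenerate
    vectors have a continuous density and regressions are continuous.

    Where the variance is maximal, the boundary condition and the second order condition for the
    variance give the sign of [cov (F t) (F_i t)] along the outer normals and make
    [cov (F t) (F_ij t)] negative definite along the face of [t]. Regressing on [F t], which is at
    least [(1 - eta) u], transfers these properties to the paths: outside an event [B u] whose
    probability is at most [exp (- u^2 / (2 sigma^2) - alpha u^2)], the set [F >= (1 - eta) u] lies
    in a small ball around the maximizer, the gradient points outwards off a face [J] and the Hessian
    is negative definite along [J].

    On a face [K] of dimension [k] the critical points above [u] are counted, with signs, by the
    integral of [det (- Hess F) 1 {F >= u} 1 {|grad F| <= eps} / (2 eps)^k]. Outside [B u] the sum over
    the faces of these integrals tends, as [eps] tends to 0, to the indicator of [sup F >= u]; on [B u]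
    its mean is as small as the probability of [B u], because the counted quantity has Gaussian
    exponential moments uniformly in [eps]. Finally the mean of the integral over [K] tends to the
    Kac-Rice term of [K], by continuity of the density and of the regression. *)

Set Implicit Arguments.
Unset Strict Implicit.
Unset Printing Implicit Defensive.

Import Order.TTheory GRing.Theory Num.Theory.
Import numFieldNormedType.Exports.

Local Open Scope classical_set_scope.
Local Open Scope ring_scope.

(** * Changes of variables *)

Section density.
Context {d} {T : measurableType d} {R : realType}.
Local Open Scope ereal_scope.
Import HBNNSimple.

(** Outside the rare event the only critical point that the smoothed integral sees is the maximizer
    itself, so its value comes from a change of variables near one strict maximum. The Kac-Rice
    terms come from the same integral over the product of a face and the probability space:
    integrated along the face first, for a fixed path, it gives the indicator; integrated over the
    probability space first, it gives the conditional expectations. The obstacle is that the count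
    is unbounded on the rare event. A small probability says nothing of a mean there, and Hölder's
    inequality does not help, because the higher moments of the smoothed integrand blow up as [eps]
    tends to 0. Hence rarity is demanded under every weight with Gaussian exponential moments. A
    second obstacle is a maximum equal to [u], where the smoothed count has no reason to converge; a
    window of width [2 * h] around the level shows that it has probability zero outside the rare
    event. The constant [alpha] survives because compactness turns each strict condition into a
    uniform gap, which is then tested at finitely many grid points; chaining controls the second
    derivatives in between. *)

Lemma ge0_integral_density (mu nu : {measure set T -> \bar R}) (g : T -> R) (F : T -> \bar R) :
  measurable_fun setT g -> (forall x, 0 <= g x)%R ->
  measurable_fun setT F -> (forall x, 0 <= F x) ->
  (forall A, measurable A -> nu A = \int[mu]_(x in A) (g x)%:E) ->
  \int[nu]_x F x = \int[mu]_x (F x * (g x)%:E).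
Proof.
move=> mg g0 mF F0 nuE.
pose F_ := nnsfun_approx measurableT mF.
have nd x : nondecreasing_seq (fun n => (F_ n x)%:E).
  by move=> m n mn; rewrite lee_fin; exact/lefP/nd_nnsfun_approx.
have cF x : (F_ n x)%:E @[n --> \oo] --> F x.
  by apply: cvg_nnsfun_approx => // *; exact: F0.
transitivity (limn (fun n => \int[nu]_x (F_ n x)%:E)).
  rewrite -monotone_convergence//.
  - by apply: eq_integral => x _; apply/esym/cvg_lim.
  - by move=> n; exact/measurable_EFinP/measurable_funP.
  - by move=> n x _; rewrite lee_fin.
transitivity (limn (fun n => \int[mu]_x ((F_ n x)%:E * (g x)%:E))); last first.
  rewrite -monotone_convergence//.
  - apply: eq_integral => x _; apply/cvg_lim => //.
    by apply: cvgeZr.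
  - move=> n; apply: emeasurable_funM; last exact/measurable_EFinP.
    exact/measurable_EFinP/measurable_funP.
  - by move=> n x _; rewrite mule_ge0// lee_fin.
  - by move=> x _ m n mn; apply: lee_wpmul2r; [rewrite lee_fin|exact: nd].
congr (limn _); apply/funext => n.
rewrite integralT_nnsfun sintegralE.
under [RHS]eq_integral => x _.
  rewrite fimfunE -fsumEFin// ge0_mule_fsuml; last first.
    by move=> i; exact: nnfun_muleindic_ge0.
  over.
rewrite ge0_integral_fsum//; last 2 first.
- move=> r. apply: emeasurable_funM; apply/measurable_EFinP => //.
  by apply: measurable_funM.
- by move=> r x _; rewrite mule_ge0 ?lee_fin//; exact: nnfun_muleindic_ge0.
apply: eq_fsbigr => r; rewrite inE/= => -[y _ Fyr].
have r0 : (0 <= r)%R by rewrite -Fyr.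
rewrite nuE//.
under [RHS]eq_integral do rewrite EFinM -muleA.
rewrite ge0_integralZl//=; last 2 first.
- by apply: emeasurable_funM; apply/measurable_EFinP.
- by move=> x _; rewrite mule_ge0// lee_fin.
congr (_ * _); rewrite [LHS]integral_mkcond; apply: eq_integral => x _.
rewrite epatch_indic indicE/= muleC; congr (_ * _).
Qed.
End density.

Definition pushm {d1 d2} {T1 : measurableType d1} {T2 : measurableType d2}
    {R : realType} (m : {measure set T1 -> \bar R}) (f : T1 -> T2)
    (mf : measurable_fun setT f) : {measure set T2 -> \bar R} :=
  @measure_function_pushforward__canonical__measure_function_Measure
    _ _ _ _ _ m _ mf.

Section lebesgue_affine.
Context {R : realType}.
Local Notation lebR := (@lebesgue_measure R).
Local Open Scope ereal_scope.

(** Lebesgue measure is determined by its values on half-open intervals, so [l] times the image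
    measure only has to be computed there. *)
Lemma lebesgue_measure_affine (l c : R) (A : set (measurableTypeR R)) :
  (0 < l)%R -> measurable A ->
  pushforward lebR (fun x : measurableTypeR R => l * x + c : measurableTypeR R)%R A
  = l^-1%:E * lebR A.
Proof.
move=> l0 mA.
have mphi : measurable_fun setT (fun x : measurableTypeR R => l * x + c : measurableTypeR R)%R.
  by apply: measurable_funD => //; apply: measurable_funM.
have l0' : (0 <= l)%R by exact: ltW.
have -> : lebR A = mscale (NngNum l0') (pushm lebR mphi) A.
  apply: lebesgue_measure_unique => //= _ [[a b]] _ <-.
  rewrite /mscale /= /pushforward.
  have -> : (fun x : R => (l * x + c)%R) @^-1` `]a, b]%classic = `]((a - c) / l)%R, ((b - c) / l)%R]%classic.
    rewrite predeqE => x /=; rewrite !in_itv/= ltr_pdivrMr// ler_pdivlMr// (mulrC x).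
    by rewrite ltrBlDr lerBrDr.
  rewrite !lebesgue_measure_itv/= !lte_fin ltr_pM2r ?invr_gt0// ltrD2r.
  case: ifPn => _; rewrite ?mule0// -EFinB -EFinM; congr EFin.
  by field; rewrite gt_eqF.
by rewrite /mscale/= muleA -EFinM mulVf ?gt_eqF// mul1e.
Qed.

Lemma ge0_integral_affine (l c : R) (F : R -> \bar R) :
  (0 < l)%R -> measurable_fun setT F -> (forall x, 0 <= F x) ->
  \int[lebR]_x F (l * x + c)%R = l^-1%:E * \int[lebR]_x F x.
Proof.
move=> l0 mF F0.
have mphi : measurable_fun setT (fun x : measurableTypeR R => l * x + c : measurableTypeR R)%R.
  by apply: measurable_funD => //; apply: measurable_funM.
have l0' : (0 <= l^-1)%R by rewrite invr_ge0 ltW.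
transitivity (\int[pushm lebR mphi]_x F x).
  by rewrite ge0_integral_pushforward.
transitivity (\int[mscale (NngNum l0') lebR]_x F x).
  by apply: eq_measure_integral => A mA _; exact: lebesgue_measure_affine.
by rewrite ge0_integral_mscale.
Qed.

Lemma ge0_integral_lebesgue_tuple0 (F : 0.-tuple (measurableTypeR R) -> \bar R) :
  measurable_fun setT F ->
  \int[lebesgue_tuple R 0]_v F v = F [tuple].
Proof. by move=> mF; rewrite /= integral_dirac// diracT mul1e. Qed.

Lemma ge0_integral_lebesgue_tupleS k
    (F : k.+1.-tuple (measurableTypeR R) -> \bar R) :
  measurable_fun setT F -> (forall v, 0 <= F v) ->
  \int[lebesgue_tuple R k.+1]_v F v =
  \int[lebR]_x \int[lebesgue_tuple R k]_v F [the k.+1.-tuple _ of x :: v].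
Proof.
move=> mF F0 /=.
rewrite /cons_measure ge0_integral_pushforward//; last exact: measurable_cons_pair.
rewrite preimage_setT fubini_tonelli1//.
- by apply: measurableT_comp => //; exact: measurable_cons_pair.
- by move=> x /=.
Qed.

Lemma lebesgue_tuple_fubini k (F : R * k.-tuple (measurableTypeR R) -> \bar R) :
  measurable_fun setT F -> (forall v, 0 <= F v) ->
  \int[lebR]_x \int[lebesgue_tuple R k]_v F (x, v) =
  \int[lebesgue_tuple R k]_v \int[lebR]_x F (x, v).
Proof. by move=> mF F0; rewrite (@fubini_tonelli _ _ _ _ _ lebR (lebesgue_tuple R k) F). Qed.

End lebesgue_affine.

(** * The standard normal law *)

Section integral_density.
Context {d} {T : measurableType d} {R : realType}.
Local Open Scope ereal_scope.

Lemma integral_density (mu nu : {measure set T -> \bar R}) (g : T -> R) (F : T -> \bar R) :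
  measurable_fun setT g -> (forall x, 0 <= g x)%R ->
  measurable_fun setT F ->
  (forall A, measurable A -> nu A = \int[mu]_(x in A) (g x)%:E) ->
  \int[nu]_x F x = \int[mu]_x (F x * (g x)%:E).
Proof.
move=> mg g0 mF nuE.
have E x : 0 <= (g x)%:E by rewrite lee_fin.
rewrite integralE [RHS]integralE.
rewrite (ge0_integral_density mg g0 (measurable_funepos mF) _ nuE)//.
rewrite (ge0_integral_density mg g0 (measurable_funeneg mF) _ nuE)//.
congr (_ - _); apply: eq_integral => x _.
  by rewrite !funeposE muleC maxe_pMr// mule0 muleC.
by rewrite !funenegE muleC maxe_pMr// mule0 muleN muleC.
Qed.
End integral_density.

Section standard_normal.
Context {R : realType}.
Local Notation lebR := (@lebesgue_measure R).

Definition std_pdf : R -> R := normal_pdf 0 1.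
Definition std_normal : probability (measurableTypeR R) R := normal_prob 0 1.
Definition std_peak : R := normal_peak 1.

Lemma std_pdfE x : std_pdf x = std_peak * expR (- x ^+ 2 / 2).
Proof. by rewrite /std_pdf normal_pdfE ?oner_neq0//= /normal_fun subr0 expr1n. Qed.

Lemma std_peak_gt0 : 0 < std_peak.
Proof. by apply: normal_peak_gt0; rewrite oner_neq0. Qed.

Lemma std_pdf_ge0 x : 0 <= std_pdf x. Proof. exact: normal_pdf_ge0. Qed.

Lemma measurable_std_pdf : measurable_fun setT std_pdf.
Proof. exact: measurable_normal_pdf. Qed.

Lemma continuous_std_pdf : continuous std_pdf.
Proof. by apply: continuous_normal_pdf; rewrite oner_neq0. Qed.

Lemma integral_std_normal (F : R -> \bar R) : measurable_fun setT F ->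
  (\int[std_normal]_x F x = \int[lebR]_x (F x * (std_pdf x)%:E))%E.
Proof.
move=> mF; apply: (@integral_density _ (measurableTypeR R) R lebR std_normal) => //.
- exact: measurable_std_pdf.
- exact: std_pdf_ge0.
Qed.

Lemma is_derive_std_pdf (x : R) : is_derive x 1 std_pdf (- x * std_pdf x).
Proof.
have -> : std_pdf = (fun x => std_peak * expR (- x ^+ 2 / 2)).
  by apply/funext => y; rewrite std_pdfE.
have h1 : is_derive x 1 (fun x : R => - x ^+ 2 / 2) (- x).
  have -> : (fun x : R => - x ^+ 2 / 2) = - 2^-1 *: (fun x : R => x ^+ 2).
    by apply/funext => y; rewrite fctE /GRing.scale/=; field.
  by apply: is_derive_eq; rewrite /GRing.scale/=; field.
have h2 := is_derive1_comp (is_derive_expR _) h1.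
have -> : (fun x : R => std_peak * expR (- x ^+ 2 / 2)) =
   std_peak *: (expR \o (fun x : R => - x ^+ 2 / 2)).
  by apply/funext => y; rewrite fctE.
by apply: is_derive_eq; rewrite /GRing.scale/=; ring.
Qed.

(** Half of the exponent is spent on the polynomial: [1 + y <= expR y] is used twice with
    [y = x ^+ 2 / 8], and 64 is the square of 8. What remains is a multiple of the normal density of
    variance 2, hence integrable. *)
Lemma sqr_expR_le (x : R) : (1 + x ^+ 2) ^+ 2 * expR (- x ^+ 2 / 2) <= 64 * expR (- x ^+ 2 / 4).
Proof.
have -> : - x ^+ 2 / 2 = - x ^+ 2 / 4 + - (x ^+ 2 / 8 + x ^+ 2 / 8) by field.
rewrite expRD mulrCA mulrC ler_wpM2r ?expR_ge0// expRN ler_pdivrMr ?expR_gt0//.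
rewrite expRD.
have h : (1 + x ^+ 2) / 8 <= expR (x ^+ 2 / 8).
  apply: le_trans (expR_ge1Dx _); have := sqr_ge0 x; lra.
have h0 : 0 <= (1 + x ^+ 2) / 8 by have := sqr_ge0 x; lra.
have := ler_pM h0 h0 h h; set e := expR _ * _; lra.
Qed.

Let dom (x : R) := expR (- x ^+ 2 / 4).

Let integrable_dom : lebR.-integrable setT (EFin \o dom).
Proof.
have s0 : Num.sqrt 2 != 0 :> R by rewrite gt_eqF// sqrtr_gt0.
have := integrable_normal_pdf 0 (Num.sqrt 2 : R).
move=> /(integrableZl measurableT (normal_peak (Num.sqrt 2))^-1).
apply: eq_integrable => // x _ /=.
rewrite -EFinM normal_pdfE//= mulKf; last by rewrite gt_eqF ?normal_peak_gt0.
by rewrite /normal_fun subr0 sqr_sqrtr// /dom -mulr_natr; congr (expR (_ / _))%:E; ring.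
Qed.

Lemma dominated_std_pdf (f : R -> R) M : measurable_fun setT f ->
  (forall x, `|f x| <= M * (1 + x ^+ 2) ^+ 2) ->
  lebR.-integrable setT (fun x => (f x * std_pdf x)%:E).
Proof.
move=> mf fM.
have := integrable_dom.
move=> /(integrableZl measurableT (M * std_peak * 64)); apply: le_integrable => //.
  by apply/measurable_EFinP/measurable_funM => //; exact: measurable_std_pdf.
move=> x _; rewrite /= lee_fin normrM (ger0_norm (std_pdf_ge0 _)).
have M0 : 0 <= M.
  have := le_trans (normr_ge0 _) (fM 0); rewrite expr0n/= addr0 expr1n mulr1//.
rewrite [leRHS]ger0_norm; last by rewrite !mulr_ge0 ?expR_ge0// ltW// std_peak_gt0.
apply: le_trans (ler_wpM2r (std_pdf_ge0 _) (fM x)) _.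
rewrite std_pdfE [leLHS](_ : _ = M * std_peak * ((1 + x ^+ 2) ^+ 2 * expR (- x ^+ 2 / 2))); last by ring.
rewrite -[leRHS]mulrA ler_wpM2l//; first by rewrite mulr_ge0// ltW// std_peak_gt0.
exact: sqr_expR_le.
Qed.

(** Stein's identity: the integrand is the derivative of [h * std_pdf], which vanishes at infinity.
    The fundamental theorem of calculus on growing intervals and dominated convergence give the
    value 0. The first two moments and the cosine transform below are read off from it. *)
Lemma std_stein (h dh : R -> R) M :
  (forall x : R, is_derive x 1 h (dh x)) -> continuous dh ->
  (forall x, `|h x| <= M * (1 + x ^+ 2)) -> (forall x, `|dh x| <= M * (1 + x ^+ 2)) ->
  \int[lebR]_x ((dh x - x * h x) * std_pdf x) = 0.
Proof.
move=> dhh cdh hM dhM.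
pose f x := (dh x - x * h x) * std_pdf x.
have ch : continuous h.
  move=> x; apply: differentiable_continuous; apply/derivable1_diffP.
  by have [] := dhh x.
have M0 : 0 <= M.
  by have := le_trans (normr_ge0 _) (hM 0); rewrite expr0n/= addr0 mulr1.
have cf0 : continuous (fun x => dh x - x * h x).
  move=> x; apply: cvgB; first exact: cdh.
  by apply: cvgM; [exact: cvg_id|exact: ch].
have cf : continuous f by move=> x; apply: cvgM; [exact: cf0|exact: continuous_std_pdf].
have mf0 : measurable_fun setT (fun x => dh x - x * h x).
  exact: continuous_measurable_fun.
have f0M x : `|dh x - x * h x| <= (2 * M) * (1 + x ^+ 2) ^+ 2.
  have x2 : 0 <= x ^+ 2 by exact: sqr_ge0.
  have nx : 1 + `|x| <= 2 * (1 + x ^+ 2).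
    rewrite -(real_normK (num_real x)).
    have := sqr_ge0 (`|x| - 1); have := sqr_ge0 `|x|; rewrite !expr2; nra.
  apply: le_trans (ler_normB _ _) _; rewrite normrM.
  apply: (@le_trans _ _ (M * (1 + x ^+ 2) * (1 + `|x|))).
    rewrite mulrDr mulr1 lerD// mulrC ler_wpM2r//; exact: hM.
  rewrite expr2 mulrA -!mulrA (mulrCA 2) ler_wpM2l// mulrCA ler_wpM2l//; lra.
have if_ : lebR.-integrable setT (EFin \o f) by exact: dominated_std_pdf f0M.
pose D n : set R := `[- n.+1%:R, n.+1%:R]%classic.
have DE n : (\int[lebR]_(x in D n) (f x)%:E =
    (h n.+1%:R * std_pdf n.+1%:R)%:E - (h (- n.+1%:R) * std_pdf (- n.+1%:R))%:E)%E.
  have dF x : is_derive (x : R) 1 (fun x => h x * std_pdf x) (f x).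
    have h1 := is_derive_std_pdf x.
    have -> : (fun x => h x * std_pdf x) = h * std_pdf by [].
    by apply: is_derive_eq; rewrite /f /GRing.scale/=; ring.
  have cF : continuous (fun x => h x * std_pdf x).
    by move=> x; apply: cvgM; [exact: ch|exact: continuous_std_pdf].
  rewrite (@continuous_FTC2 _ f (fun x => h x * std_pdf x))//.
  - by have : 0 < n.+1%:R :> R by []; lra.
  - exact: continuous_subspaceT.
  - split.
    + by move=> x _; have [] := dF x.
    + exact/cvg_at_right_filter/cF.
    + exact/cvg_at_left_filter/cF.
  - by move=> x _; rewrite derive1E; have [_ ->] := dF x.
have mD n : measurable (D n) by exact: measurable_itv.
have c1 : (\int[lebR]_(x in D n) (f x)%:E)%E @[n --> \oo] --> (\int[lebR]_x (f x)%:E)%E.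
  under eq_fun do rewrite integral_mkcond.
  apply: (@dominated_cvg _ _ _ lebR setT measurableT _ _ (fun x => `|(f x)%:E|)%E) => //=.
  - move=> n; apply/(measurable_restrictT _ (mD n)).
    by apply: measurable_funS (measurable_int lebR if_).
  - move=> x _; apply: cvg_near_cst; near=> n.
    rewrite patchE mem_set// /D /= in_itv/= -ler_norml.
    apply: (@le_trans _ _ n%:R); last by rewrite ler_nat.
    by near: n; exact: nbhs_infty_ger.
  - by have := integrable_abse if_; apply: eq_integrable.
  - by move=> n x _; rewrite patchE; case: ifPn => // _; rewrite abse0.
have c2 : (\int[lebR]_(x in D n) (f x)%:E)%E @[n --> \oo] --> 0%E.
  under eq_fun do rewrite DE -EFinB.
  apply: cvg_EFin; first exact: nearW.
  have b x : `|h x * std_pdf x| <= M * std_peak * 64 * dom x.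
    rewrite normrM (ger0_norm (std_pdf_ge0 _)).
    apply: le_trans (ler_wpM2r (std_pdf_ge0 _) (hM x)) _.
    rewrite std_pdfE [leLHS](_ : _ = M * std_peak * ((1 + x ^+ 2) * expR (- x ^+ 2 / 2))); last by ring.
    rewrite -[leRHS]mulrA ler_wpM2l//; first by rewrite mulr_ge0// ltW// std_peak_gt0.
    apply: le_trans (sqr_expR_le x); rewrite ler_wpM2r ?expR_ge0// ler_eXnr//.
    by rewrite lerDl sqr_ge0.
  have e n : dom n.+1%:R <= harmonic n.
    rewrite /dom /harmonic mulNr expRN lef_pV2 ?posrE ?expR_gt0//.
    apply: le_trans (expR_ge1Dx _).
    have := sqr_ge0 (n.+1%:R / 2 - 1 : R); rewrite !expr2; nra.
  pose C := 2 * (M * std_peak * 64).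
  have C0 : 0 <= C by rewrite !mulr_ge0// ltW// std_peak_gt0.
  have cC : C * harmonic n @[n --> \oo] --> (0 : R).
    by rewrite -[X in _ --> X](mulr0 C); apply: cvgMr; exact: cvg_harmonic.
  apply: norm_cvg0; apply: (squeeze_cvgr _ (cvg_cst 0) cC).
  apply: nearW => n; rewrite normr_ge0/=; apply: le_trans (ler_normB _ _) _.
  have e1 := b n.+1%:R; have e2 := b (- n.+1%:R).
  have e3 : dom (- n.+1%:R) = dom n.+1%:R by rewrite /dom sqrrN.
  rewrite e3 in e2.
  apply: le_trans (lerD e1 e2) _.
  rewrite [leLHS](_ : _ = C * dom n.+1%:R); last by rewrite /C; ring.
  exact: (ler_wpM2l C0 (e n)).
have c3 := cvg_unique _ c1 c2.
by rewrite /Rintegral -/f c3.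
Unshelve. all: by end_near. Qed.

Let std_wrap (f : R -> R) M : measurable_fun setT f ->
  (forall x, `|f x| <= M * (1 + x ^+ 2) ^+ 2) ->
  std_normal.-integrable setT (EFin \o f) /\
  \int[std_normal]_x f x = \int[lebR]_x (f x * std_pdf x).
Proof.
move=> mf fM; split.
  apply/integrableP; split; first exact/measurable_EFinP.
  rewrite integral_std_normal; last exact/measurable_EFinP/measurableT_comp.
  have /integrableP[_] := dominated_std_pdf mf fM.
  congr (_ < _)%E; apply: eq_integral => x _ /=.
  by rewrite normrM (ger0_norm (std_pdf_ge0 _)).
rewrite /Rintegral integral_std_normal; last exact/measurable_EFinP.
by congr fine; apply: eq_integral => x _.
Qed.

(** Stein's identity for [h = id] equates the second moment with the total mass. *)
Lemma std_normal_sqr : (\int[std_normal]_x (x ^+ 2)%:E = 1)%E.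
Proof.
rewrite integral_std_normal; last exact/measurable_EFinP/measurable_funX.
have i2 : lebR.-integrable setT (fun x => (x ^+ 2 * std_pdf x)%:E).
  apply: (@dominated_std_pdf _ 1); first exact: measurable_funX.
  move=> x; rewrite mul1r ger0_norm ?sqr_ge0//; have := sqr_ge0 x; rewrite !expr2; nra.
have := @std_stein id (cst 1) 1.
have -> : \int[lebR]_x ((cst 1 x - x * id x) * std_pdf x) =
    fine (\int[lebR]_x ((std_pdf x)%:E - (x ^+ 2 * std_pdf x)%:E))%E.
  congr fine; apply: eq_integral => x _; rewrite -EFinB; congr EFin => /=; ring.
rewrite integralB//; last exact: integrable_normal_pdf.
rewrite integral_normal_pdf.
under [in X in X -> _]eq_integral do rewrite EFinM.
have f2 := integrable_fin_num measurableT i2.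
under eq_integral do rewrite -EFinM.
move=> h.
have h0 : fine (1 - \int[lebR]_x (x ^+ 2 * std_pdf x)%:E)%E = 0.
  apply: h => //.
  - by move=> x; apply: cvg_cst.
  - by move=> x; rewrite mul1r; have := sqr_ge0 (`|x| - 1); rewrite -(real_normK (num_real x)) !expr2; nra.
  - by move=> x; rewrite normr1 mul1r lerDl sqr_ge0.
rewrite -(fineK f2); congr EFin.
by move: h0; rewrite fineB//= => /eqP; rewrite subr_eq0 => /eqP.
Qed.

Lemma std_normal_mean : \int[std_normal]_x x = 0 /\
  std_normal.-integrable setT (fun x => x%:E).
Proof.
have [|x|h1 ->] := @std_wrap id 1; first exact: measurable_id.
  rewrite mul1r /=; have := sqr_ge0 (`|x| - 1); rewrite -(real_normK (num_real x)).
  have := normr_ge0 x; rewrite !expr2; nra.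
split=> //.
have H : \int[lebR]_x ((0 - x * 1) * std_pdf x) = 0.
  apply: (@std_stein (cst 1) (cst 0) 1) => [x|x|x].
  - exact: cvg_cst.
  - by rewrite /= normr1 mul1r lerDl sqr_ge0.
  - by rewrite /= normr0 mul1r addr_ge0// sqr_ge0.
have i1 : lebR.-integrable setT (fun x => (x * std_pdf x)%:E).
  apply: (@dominated_std_pdf id 1); first exact: measurable_id.
  move=> x; rewrite mul1r /=; have := sqr_ge0 (`|x| - 1); rewrite -(real_normK (num_real x)).
  have := normr_ge0 x; rewrite !expr2; nra.
have E : \int[lebR]_x ((0 - x * 1) * std_pdf x) = \int[lebR]_x (- 1 * (x * std_pdf x)).
  by apply: eq_Rintegral => x _; ring.
by move: H; rewrite E RintegralZl// mulN1r => /eqP; rewrite oppr_eq0 => /eqP.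
Qed.

(** Completing the square turns [expR (t * x) * std_pdf x] into [expR (t ^+ 2 / 2)] times the
    density translated by [t]. *)
Lemma std_normal_expR (t : R) :
  (\int[std_normal]_x (expR (t * x))%:E = (expR (t ^+ 2 / 2))%:E)%E.
Proof.
have mE : measurable_fun setT (fun x : R => expR (t * x)).
  by apply: measurableT_comp => //; exact: measurable_funM.
rewrite integral_std_normal; last exact/measurable_EFinP.
transitivity (\int[lebR]_x ((expR (t ^+ 2 / 2))%:E * (std_pdf (1 * x + - t))%:E))%E.
  apply: eq_integral => x _; rewrite -!EFinM; congr EFin.
  rewrite !std_pdfE mulrCA [RHS]mulrCA; congr (_ * _).
  by rewrite -!expRD; congr expR; field.
rewrite ge0_integralZl//=; last 2 first.
- apply/measurable_EFinP/measurableT_comp; first exact: measurable_std_pdf.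
  by apply: measurable_funD => //; exact: measurable_funM.
- by move=> x _; rewrite lee_fin std_pdf_ge0.
rewrite (@ge0_integral_affine _ 1 (- t) (fun x => (std_pdf x)%:E))//; last 2 first.
- by apply/measurable_EFinP; exact: measurable_std_pdf.
- by move=> x; rewrite lee_fin std_pdf_ge0.
by rewrite integral_normal_pdf invr1 mule1 mule1.
Qed.

(** As a function of [r] the integral [g] satisfies [g' = - r * g]: differentiate under the integral
    and apply Stein's identity to [sin (r * x + c)]. Hence [g r * expR (r ^+ 2 / 2)] is constant.
    The phase [c] carries the real and the imaginary part of the characteristic function in one real
    formula. *)
Lemma std_normal_cos (r c : R) :
  \int[std_normal]_x cos (r * x + c) = cos c * expR (- r ^+ 2 / 2).
Proof.
have mcos s : measurable_fun setT (fun x : R => cos (s * x + c)).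
  apply: continuous_measurable_fun => x; apply: continuous_comp.
    by apply: cvgD; [apply: cvgM; [exact: cvg_cst|exact: cvg_id]|exact: cvg_cst].
  exact: continuous_cos.
have bcos s x : `|cos (s * x + c)| <= 1 * (1 + x ^+ 2) ^+ 2.
  rewrite mul1r; apply: (@le_trans _ _ 1).
    by rewrite ler_norml cos_geN1 cos_le1.
  by rewrite expr_ge1// ?addr_ge0 ?sqr_ge0// lerDl sqr_ge0.
pose g s := \int[lebR]_x (cos (s * x + c) * std_pdf x).
have [_ ->] := std_wrap (mcos r) (bcos r); rewrite -/(g r).
have dcos (s x : R) : is_derive s 1 (fun s => cos (s * x + c) * std_pdf x)
    (- x * sin (s * x + c) * std_pdf x).
  have h1 : is_derive s 1 (fun s => s * x + c) x.
    have -> : (fun s : R => s * x + c) = (x *: id) + cst c.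
      by apply/funext => y; rewrite fctE /GRing.scale/= mulrC.
    by apply: is_derive_eq; rewrite /GRing.scale/=; ring.
  have h2 := is_derive1_comp (is_derive_cos _) h1.
  have -> : (fun s => cos (s * x + c) * std_pdf x) =
     std_pdf x *: (cos \o (fun s => s * x + c)).
    by apply/funext => y; rewrite fctE /GRing.scale/= mulrC.
  by apply: is_derive_eq; rewrite /GRing.scale/=; ring.
have dg (s : R) : is_derive s 1 g (- s * g s).
  pose f (s x : R) := cos (s * x + c) * std_pdf x.
  have sI : [set` `]s - 1, s + 1[] s by rewrite /= in_itv/=; apply/andP; split; lra.
  have intf t : [set` `]s - 1, s + 1[] t -> lebR.-integrable setT (EFin \o f t).
    by move=> _; exact: dominated_std_pdf (mcos t) (bcos t).
  have df t y : [set` `]s - 1, s + 1[] t -> setT y -> derivable (f ^~ y) t 1.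
    by move=> _ _; have [] := dcos t y.
  pose G (y : R) := `|y| * std_pdf y.
  have G0 y : 0 <= G y by rewrite mulr_ge0// std_pdf_ge0.
  have iG : lebR.-integrable setT (EFin \o G).
    apply: (@dominated_std_pdf (fun y => `|y|) 1); first exact: normr_measurable.
    move=> x; rewrite mul1r normr_id -(real_normK (num_real x)).
    have := sqr_ge0 (`|x| - 1); have := normr_ge0 x; rewrite !expr2; nra.
  have Gub t y : [set` `]s - 1, s + 1[] t -> setT y -> `|partial1of2 f t y| <= G y.
    move=> _ _; rewrite partial1of2E; have [_ ->] := dcos t y.
    rewrite !normrM normrN (ger0_norm (std_pdf_ge0 _)) ler_wpM2r ?std_pdf_ge0//.
    by rewrite ler_piMr// ler_norml sin_geN1 sin_le1.
  have d1 := derivable_under_integral measurableT sI intf df G0 iG Gub.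
  have d2 := differentiation_under_integral measurableT sI intf df G0 iG Gub.
  apply: DeriveDef => //; rewrite -derive1E d2.
  have hs x : is_derive (x : R) 1 (fun x => sin (s * x + c)) (s * cos (s * x + c)).
    have h1 : is_derive x 1 (fun x => s * x + c) s.
      have -> : (fun x : R => s * x + c) = (s *: id) + cst c.
        by apply/funext => y; rewrite fctE.
      by apply: is_derive_eq; rewrite /GRing.scale/=; ring.
    have h2 := is_derive1_comp (is_derive_sin _) h1.
    by apply: is_derive_eq; rewrite /GRing.scale/=; ring.
  have := @std_stein (fun x => sin (s * x + c)) (fun x => s * cos (s * x + c)) (1 + `|s|) hs.
  have -> : \int[lebR]_x ((s * cos (s * x + c) - x * sin (s * x + c)) * std_pdf x) =
    s * g s + \int[lebR]_x (partial1of2 f s x).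
    have i1 := intf s sI.
    have i2 : lebR.-integrable setT (EFin \o partial1of2 f s).
      have -> : EFin \o partial1of2 f s = (fun x => ((- x * sin (s * x + c)) * std_pdf x)%:E).
        by apply/funext => x /=; rewrite partial1of2E; have [_ ->] := dcos s x.
      apply: (@dominated_std_pdf _ 1).
        apply: continuous_measurable_fun => x; apply: cvgM.
          by apply: cvgN; exact: cvg_id.
        have [+ _] := hs x.
        by move=> /derivable1_diffP/differentiable_continuous.
      move=> x; rewrite mul1r normrM normrN.
      apply: (@le_trans _ _ `|x|).
        by rewrite ler_piMr// ler_norml sin_geN1 sin_le1.
      rewrite -(real_normK (num_real x)).
      have := sqr_ge0 (`|x| - 1); have := normr_ge0 x; rewrite !expr2; nra.
    rewrite /g -RintegralZl// -RintegralD//; last first.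
      by have := integrableZl measurableT s i1; apply: eq_integrable.
    apply: eq_Rintegral => x _; rewrite partial1of2E; have [_ ->] := dcos s x.
    by ring.
  move=> h; apply/eqP; rewrite mulNr -addr_eq0 addrC; apply/eqP; apply: h.
  - move=> x; apply: cvgM; first exact: cvg_cst.
    apply: continuous_comp; last exact: continuous_cos.
    by apply: cvgD; [apply: cvgM; [exact: cvg_cst|exact: cvg_id]|exact: cvg_cst].
  - move=> x; apply: (@le_trans _ _ 1); first by rewrite ler_norml sin_geN1 sin_le1.
    have := sqr_ge0 x; have := normr_ge0 s; nra.
  - move=> x; rewrite normrM; apply: (@le_trans _ _ `|s|).
      by rewrite ler_piMr// ler_norml cos_geN1 cos_le1.
    have := sqr_ge0 x; have := normr_ge0 s; nra.
have dk (s : R) : is_derive s 1 (fun s => g s * expR (s ^+ 2 / 2)) 0.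
  have h1 : is_derive s 1 (fun x : R => x ^+ 2 / 2) s.
    have -> : (fun x : R => x ^+ 2 / 2) = 2^-1 *: (fun x : R => x ^+ 2).
      by apply/funext => y; rewrite fctE /GRing.scale/=; field.
    by apply: is_derive_eq; rewrite /GRing.scale/=; field.
  have h2 := is_derive1_comp (is_derive_expR _) h1.
  have -> : (fun s => g s * expR (s ^+ 2 / 2)) = g * (expR \o (fun x : R => x ^+ 2 / 2)) by [].
  have := dg s => h3; apply: is_derive_eq; rewrite /GRing.scale/=; ring.
have := is_derive_0_is_cst r 0 dk.
have -> : g 0 = cos c.
  rewrite /g; under eq_Rintegral do rewrite mul0r add0r.
  rewrite RintegralZl//; last exact: integrable_normal_pdf.
  by rewrite /Rintegral integral_normal_pdf/= mulr1.
rewrite expr0n/= mul0r expR0 mulr1 => <-.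
by rewrite -mulrA -expRD mulNr subrr expR0 mulr1.
Qed.

Lemma integral_normal_prob (m s : R) (F : R -> \bar R) : s != 0 ->
  measurable_fun setT F -> (forall x, 0 <= F x)%E ->
  (\int[normal_prob m s]_x F x = \int[std_normal]_x F (m + `|s| * x)%R)%E.
Proof.
move=> s0 mF F0.
have s1 : 0 < `|s| by rewrite normr_gt0.
have mG : measurable_fun setT (fun x => F (m + `|s| * x)%R).
  by apply: measurableT_comp => //; apply: measurable_funD => //; exact: measurable_funM.
rewrite (@ge0_integral_density _ (measurableTypeR R) R lebR (normal_prob m s) (normal_pdf m s))//; last 2 first.
- exact: measurable_normal_pdf.
- exact: normal_pdf_ge0.
rewrite [RHS](integral_std_normal mG).
pose H x := (F x * (`|s| * normal_pdf m s x)%R%:E)%E.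
have H0 x : (0 <= H x)%E by rewrite mule_ge0// lee_fin mulr_ge0// normal_pdf_ge0.
have mH : measurable_fun setT H.
  apply: emeasurable_funM => //; apply/measurable_EFinP/measurable_funM => //.
  exact: measurable_normal_pdf.
transitivity (\int[lebR]_x H (`|s| * x + m)%R)%E.
  rewrite (ge0_integral_affine m s1 mH H0) -ge0_integralZl ?lee_fin ?invr_ge0//.
  apply: eq_integral => x _; rewrite /H muleCA -EFinM mulrA mulVf ?mul1r// gt_eqF//.
apply: eq_integral => x _; rewrite /H addrC; congr (_ * _%:E)%E.
rewrite normal_pdfE//= std_pdfE /normal_fun addrAC subrr add0r mulrA; congr (_ * expR _).
  rewrite /std_peak /normal_peak expr1n mul1r.
  rewrite -mulrnAr sqrtrM ?sqr_ge0// sqrtr_sqr invfM mulrA divff ?mul1r// gt_eqF//.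
rewrite exprMn real_normK ?num_real// -mulr_natr; field.
by rewrite s0.
Qed.

End standard_normal.

(** * Laws determined by trigonometric polynomials *)

Section trigpoly.
Context {R : realType} {n : nat}.
Implicit Types (f g : ('I_n -> R) -> R) (a : 'I_n -> R).

(** These are the functions whose mean is known from the cosine transforms of linear forms. The
    phase includes the sines, and the product-to-sum formulas make the class an algebra. *)
Inductive trigpoly : (('I_n -> R) -> R) -> Prop :=
| trigpoly_cos a c : trigpoly (fun x => cos (\sum_i a i * x i + c))
| trigpoly_add f g : trigpoly f -> trigpoly g -> trigpoly (fun x => f x + g x)
| trigpoly_scale k f : trigpoly f -> trigpoly (fun x => k * f x).

Lemma trigpoly_cst c : trigpoly (fun=> c).
Proof.
have := trigpoly_scale c (trigpoly_cos (fun=> 0) 0).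
congr trigpoly; apply/funext => x.
by rewrite big1 ?addr0 ?cos0 ?mulr1// => i _; rewrite mul0r.
Qed.

Lemma trigpoly_mul f g : trigpoly f -> trigpoly g -> trigpoly (fun x => f x * g x).
Proof.
move=> tf tg; elim: tf g tg => {f} [a c|f1 f2 _ IH1 _ IH2|k f _ IH] g tg.
- elim: tg => {g} [b d|g1 g2 _ IH1 _ IH2|k g _ IH].
  + have := trigpoly_scale 2^-1 (trigpoly_add
      (trigpoly_cos (fun i => a i + b i) (c + d))
      (trigpoly_cos (fun i => a i - b i) (c - d))).
    congr trigpoly; apply/funext => x.
    have -> : \sum_i (a i + b i) * x i + (c + d) =
              (\sum_i a i * x i + c) + (\sum_i b i * x i + d).
      by rewrite addrACA -big_split/=; congr (_ + _); apply: eq_bigr => i _; rewrite mulrDl.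
    have -> : \sum_i (a i - b i) * x i + (c - d) =
              (\sum_i a i * x i + c) - (\sum_i b i * x i + d).
      rewrite opprD addrACA -sumrB; congr (_ + _); apply: eq_bigr => i _.
      by rewrite mulrBl.
    by rewrite cosD cosB; field.
  + have := trigpoly_add IH1 IH2.
    by congr trigpoly; apply/funext => x; rewrite mulrDr.
  + have := trigpoly_scale k IH.
    by congr trigpoly; apply/funext => x; rewrite mulrCA.
- have := trigpoly_add (IH1 _ tg) (IH2 _ tg).
  by congr trigpoly; apply/funext => x; rewrite mulrDl.
- have := trigpoly_scale k (IH _ tg).
  by congr trigpoly; apply/funext => x; rewrite mulrA.
Qed.

Lemma trigpoly_prod (I : Type) (s : seq I) (F : I -> ('I_n -> R) -> R) :
  (forall i, trigpoly (F i)) -> trigpoly (fun x => \prod_(i <- s) F i x).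
Proof.
move=> tF; elim: s => [|i s IH].
  have := trigpoly_cst 1; congr trigpoly; apply/funext => x; by rewrite big_nil.
have := trigpoly_mul (tF i) IH.
by congr trigpoly; apply/funext => x; rewrite big_cons.
Qed.

Lemma trigpoly_sin (l c : R) (j : 'I_n) : trigpoly (fun x => sin (l * x j + c)).
Proof.
have := trigpoly_cos (fun i => l * (i == j)%:R) (c - pi / 2).
congr trigpoly; apply/funext => x.
rewrite (bigD1 j)//= eqxx mulr1 big1 ?addr0; last first.
  by move=> i /negbTE ->; rewrite mulr0 mul0r.
by rewrite addrA cosB cos_pihalf sin_pihalf mulr0 add0r mulr1.
Qed.

End trigpoly.

Section sgr_approx.
Context {R : realType}.

(** An odd polynomial with fixed points -1, 0 and 1, whose iterates converge on [[-1, 1]] to the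
    sign. As trigonometric polynomials are stable under polynomial operations, the sign of a sine
    becomes a bounded pointwise limit of trigonometric polynomials. *)
Definition sgr_step (s : R) := (3 * s - s ^+ 3) / 2.

(** The distance to 1 factors: [1 - sgr_step s = (1 - s) ^+ 2 * (1 + s / 2)]. The iterates increase
    from their starting point [t], so the distance shrinks at least by the factor [1 - t / 2] at
    each step. *)
Let sgr_step_pos (s : R) : 0 < s <= 1 -> s <= sgr_step s <= 1 /\
  1 - sgr_step s <= (1 - s) * (1 - s / 2).
Proof.
move=> /andP[s0 s1]; rewrite /sgr_step.
have h : 0 <= s * (1 - s) by nra.
have h2 : 0 <= s * (s * (1 - s)) by nra.
have h3 : 0 <= (1 - s) * (1 - s) by nra.
have h4 : 0 <= s * ((1 - s) * (1 - s)) by nra.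
split; [apply/andP; split|]; rewrite !exprS expr0; lra.
Qed.

Lemma iter_sgr_step_le1 m (s : R) : -1 <= s <= 1 -> -1 <= iter m sgr_step s <= 1.
Proof.
move=> s1; elim: m => //= m; set t := iter _ _ _ => /andP[t1 t2].
have e (x : R) : 0 <= x <= 1 -> 0 <= sgr_step x <= 1.
  rewrite le_eqVlt => /andP[/predU1P[<- _|x0 x1]].
    by rewrite /sgr_step mulr0 expr0n subrr mul0r lexx ler01.
  have [/andP[h1 h2] _] := @sgr_step_pos x ltac:(by rewrite x0).
  by rewrite h2 (le_trans (ltW x0)).
have o : sgr_step (- t) = - sgr_step t by rewrite /sgr_step !exprS expr0; field.
have [t0|t0] := leP 0 t.
  have /andP[h1 ->] := e t ltac:(by rewrite t0).
  by rewrite andbT (le_trans _ h1)// lerN10.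
have /andP[h1 h2] := e (- t) ltac:(by lra).
rewrite o in h1 h2; lra.
Qed.

Lemma cvg_iter_sgr_step (s : R) : -1 <= s <= 1 ->
  iter m sgr_step s @[m --> \oo] --> Num.sg s.
Proof.
have P (t : R) : 0 < t -> t <= 1 -> iter m sgr_step t @[m --> \oo] --> (1 : R).
  move=> t0 t1.
  have h m : t <= iter m sgr_step t <= 1 /\ 1 - iter m sgr_step t <= (1 - t / 2) ^+ m.
    elim: m => [|m [/andP[h1 h2] h3]] /=; first by rewrite lexx t1 expr0; split=> //; lra.
    have [/andP[h4 h5] h6] := @sgr_step_pos (iter m sgr_step t) ltac:(by rewrite h2 (lt_le_trans t0)).
    rewrite h5 (le_trans h1)//; split => //; apply: le_trans h6 _.
    rewrite exprSr ler_pM//; lra.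
  have c0 : (1 - t / 2) ^+ m @[m --> \oo] --> (0 : R).
    by apply: cvg_expr; rewrite ger0_norm; lra.
  apply: (@squeeze_cvgr _ _ _ _ (fun m => 1 - (1 - t / 2) ^+ m) (cst 1)).
  - by apply: nearW => m; have [/andP[_ h2] h3] := h m; rewrite /= h2 andbT; lra.
  - by rewrite -[X in _ --> X](subr0 1); apply: cvgB => //; exact: cvg_cst.
  - exact: cvg_cst.
move=> /andP[s1 s2].
have [s0|s0|->] := ltgtP s 0.
- rewrite ltr0_sg//.
  have := P (- s) ltac:(lra) ltac:(lra) => /cvgN.
  have o m : iter m sgr_step (- s) = - iter m sgr_step s.
    by elim: m => //= m ->; rewrite /sgr_step !exprS expr0; field.
  by apply: cvg_trans; apply: near_eq_cvg; apply: nearW => m /=; rewrite fctE o opprK.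
- by rewrite gtr0_sg//; exact: P.
- rewrite sgr0; have -> : (fun m => iter m sgr_step 0) = cst (0 : R).
    apply/funext => m; elim: m => //= m ->.
    by rewrite /sgr_step mulr0 expr0n subrr mul0r.
  exact: cvg_cst.
Qed.

(** Once the half period exceeds [x] in absolute value, the sine has exactly the sign of [x]: the
    sequence is eventually constant. *)
Lemma cvg_sgr_sin (x : R) : Num.sg (sin (x / p.+1%:R)) @[p --> \oo] --> Num.sg x.
Proof.
apply: cvg_near_cst; near=> p.
have xp : `|x| < p.+1%:R.
  apply: (@le_lt_trans _ _ p%:R); last by rewrite ltr_nat.
  by near: p; exact: nbhs_infty_ger.
have p0 : 0 < p.+1%:R :> R by [].
have a1 : `|x / p.+1%:R| < 1 by rewrite normf_div (ger0_norm (ltW p0)) ltr_pdivrMr// mul1r.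
have pi1 : 1 < pi :> R by have := pi_ge2 R; lra.
move: a1; rewrite ltr_norml => /andP[b1 b2].
have [x0|x0|->] := ltgtP x 0.
- rewrite !ltr0_sg//.
  rewrite -oppr_gt0 -sinN; apply: sin_gt0_pi.
  have h : x / p.+1%:R < 0 by rewrite ltr_pdivrMr// mul0r.
  by set t := x / _ in b1 b2 h *; apply/andP; split; lra.
- rewrite !gtr0_sg//; apply: sin_gt0_pi.
  by rewrite divr_gt0//=; set t := x / _ in b1 b2 *; lra.
- by rewrite mul0r sin0.
Unshelve. all: by end_near. Qed.

End sgr_approx.

Section bounded_convergence.
Context {d} {T : measurableType d} {R : realType} (P : probability T R).

Lemma cvg_norm_bound (u : nat -> R) (l M : R) :
  u k @[k --> \oo] --> l -> (forall k, `|u k| <= M) -> `|l| <= M.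
Proof.
move=> /cvg_norm h uM; rewrite -(cvg_lim _ h)//; apply: limr_le.
  by apply/cvg_ex; eexists; exact: h.
exact: nearW.
Qed.

Lemma bounded_integrable (f : T -> R) (M : R) : measurable_fun setT f ->
  (forall x, `|f x| <= M) -> P.-integrable setT (EFin \o f).
Proof.
move=> mf fM; apply: measurable_bounded_integrable => //.
  by apply: le_lt_trans (probability_le1 P measurableT) _; exact: ltry.
by exists M; split => [|k Mk x _ /=]; [exact: num_real|exact: le_trans (fM x) (ltW Mk)].
Qed.

Lemma bounded_cvg_Rintegral (f_ : nat -> T -> R) (f : T -> R) (M : R) :
  (forall k, measurable_fun setT (f_ k)) -> measurable_fun setT f ->
  (forall k x, `|f_ k x| <= M) -> (forall x, f_ ^~ x @ \oo --> f x) ->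
  \int[P]_x f_ k x @[k --> \oo] --> \int[P]_x f x.
Proof.
move=> mf_ mf fM cf.
have fM' x : `|f x| <= M.
  exact: cvg_norm_bound (cf x) (fM^~ x).
apply: fine_cvg; rewrite fineK; last first.
  by apply: integrable_fin_num => //; exact: bounded_integrable mf fM'.
apply: (@dominated_cvg _ _ _ P setT measurableT _ _ (cst M%:E)) => //=.
- by move=> k; exact/measurable_EFinP.
- by move=> x _; apply: cvg_EFin; [exact: nearW|exact: cf].
- by apply: (@bounded_integrable (cst M) `|M|).
- by move=> k x _; rewrite lee_fin.
Qed.
End bounded_convergence.

Section equal_laws.
Context {d1 d2} {T1 : measurableType d1} {T2 : measurableType d2} {R : realType}.
Context (P1 : probability T1 R) (P2 : probability T2 R) {n : nat}.
Context (V1 : 'I_n -> T1 -> R) (V2 : 'I_n -> T2 -> R).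
Hypothesis mV1 : forall i, measurable_fun setT (V1 i).
Hypothesis mV2 : forall i, measurable_fun setT (V2 i).

Let ev1 (f : ('I_n -> R) -> R) w := f (fun i => V1 i w).
Let ev2 (f : ('I_n -> R) -> R) w := f (fun i => V2 i w).

(** Test functions with a common bound and equal means under both laws. The common bound makes the
    class stable under pointwise limits, which leads from trigonometric polynomials to indicators of
    orthants. *)
Let same (M : R) (f : ('I_n -> R) -> R) := [/\ measurable_fun setT (ev1 f),
  measurable_fun setT (ev2 f), forall x, `|f x| <= M &
  \int[P1]_w ev1 f w = \int[P2]_w ev2 f w].

Let same_lim (M : R) (f_ : nat -> ('I_n -> R) -> R) f :
  (forall k, same M (f_ k)) -> (forall x, f_ ^~ x @ \oo --> f x) -> same M f.
Proof.
move=> sf cf.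
have m1 : measurable_fun setT (ev1 f).
  apply: (@measurable_fun_cvg _ _ _ setT (fun k => ev1 (f_ k))) => //.
    by move=> k; have [] := sf k.
  by move=> x _; exact: cf.
have m2 : measurable_fun setT (ev2 f).
  apply: (@measurable_fun_cvg _ _ _ setT (fun k => ev2 (f_ k))) => //.
    by move=> k; have [] := sf k.
  by move=> x _; exact: cf.
have b x : `|f x| <= M.
  by apply: cvg_norm_bound (cf x) _ => k; have [] := sf k.
split=> //.
have c1 := @bounded_cvg_Rintegral _ _ _ P1 (fun k => ev1 (f_ k)) (ev1 f) M.
have c2 := @bounded_cvg_Rintegral _ _ _ P2 (fun k => ev2 (f_ k)) (ev2 f) M.
have {}c1 : \int[P1]_w ev1 (f_ k) w @[k --> \oo] --> \int[P1]_w ev1 f w.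
  by apply: c1 => // [k|k x|x]; [have [] := sf k|have [_ _ + _] := sf k; exact|exact: cf].
have {}c2 : \int[P2]_w ev2 (f_ k) w @[k --> \oo] --> \int[P2]_w ev2 f w.
  by apply: c2 => // [k|k x|x]; [have [] := sf k|have [_ _ + _] := sf k; exact|exact: cf].
have E : (fun k => \int[P1]_w ev1 (f_ k) w) = (fun k => \int[P2]_w ev2 (f_ k) w).
  by apply/funext => k; have [] := sf k.
by rewrite E in c1; exact: (cvg_unique _ c1 c2).
Qed.

Hypothesis same_cos : forall a c,
  \int[P1]_w cos (\sum_i a i * V1 i w + c) = \int[P2]_w cos (\sum_i a i * V2 i w + c).

Let same_trig f : trigpoly f -> exists M : R, same M f.
Proof.
have mc d' (T : measurableType d') (V : 'I_n -> T -> R) a c : (forall i, measurable_fun setT (V i)) ->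
    measurable_fun setT (fun w => cos (\sum_i a i * V i w + c)).
  move=> mV; apply: measurableT_comp.
    by apply: continuous_measurable_fun; exact: continuous_cos.
  apply: measurable_funD => //; apply: measurable_sum => i.
  exact: measurable_funM.
elim=> {f} [a c|f g _ [M [m1 m2 b e]] _ [N [k1 k2 h r]]|k f _ [M [m1 m2 b e]]].
- exists 1; split; [exact: mc|exact: mc| |exact: same_cos].
  by move=> x; rewrite ler_norml cos_geN1 cos_le1.
- exists (M + N); split.
  + exact: measurable_funD.
  + exact: measurable_funD.
  + by move=> x; apply: le_trans (ler_normD _ _) _; exact: lerD.
  + have I1 := bounded_integrable P1 m1 (fun x => b _).
    have I2 := bounded_integrable P2 m2 (fun x => b _).
    have J1 := bounded_integrable P1 k1 (fun x => h _).
    have J2 := bounded_integrable P2 k2 (fun x => h _).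
    by rewrite /ev1 /ev2 !RintegralD//; congr (_ + _).
- exists (`|k| * M); split.
  + exact: measurable_funM.
  + exact: measurable_funM.
  + by move=> x; rewrite normrM ler_wpM2l.
  + have I1 := bounded_integrable P1 m1 (fun x => b _).
    have I2 := bounded_integrable P2 m2 (fun x => b _).
    by rewrite /ev1 /ev2 !RintegralZl//; congr (_ * _).
Qed.

(** Two nested limits: the iterates of [sgr_step] give the sign of a sine, then the period of the
    sine tends to infinity. *)
Let same_sgr (y : 'I_n -> R) : same (2 ^+ n) (fun x => \prod_i (1 - Num.sg (x i - y i))).
Proof.
have sb (F : 'I_n -> R) : (forall i, -1 <= F i <= 1) -> `|\prod_i (1 - F i)| <= 2 ^+ n.
  move=> Fb; rewrite normr_prod -[X in 2 ^+ X](card_ord n) -prodr_const.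
  apply: ler_prod => i _; rewrite normr_ge0/=.
  by have := Fb i; rewrite ler_norml => /andP[]; lra.
have cp (F_ : nat -> 'I_n -> R) F : (forall i, F_ k i @[k --> \oo] --> F i) ->
    \prod_i (1 - F_ k i) @[k --> \oo] --> \prod_i (1 - F i).
  move=> cF; apply: cvg_big => [|i _]; first exact: mul_continuous.
  by apply: cvgB => //; exact: cvg_cst.
have sgb (z : R) : -1 <= Num.sg z <= 1.
  by case: sgrP => _; rewrite ?lexx ?lerN10 ?ler01 ?lerN11//= ?andbT; lra.
have sinb (z : R) : -1 <= sin z <= 1 by rewrite sin_geN1 sin_le1.
have same1 p : same (2 ^+ n) (fun x => \prod_i (1 - Num.sg (sin ((x i - y i) / p.+1%:R)))).
  apply: (@same_lim _ (fun m x => \prod_i (1 - iter m sgr_step (sin ((x i - y i) / p.+1%:R))))); last first.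
    by move=> x; apply: cp => i; exact: cvg_iter_sgr_step.
  move=> m.
  have [|M [m1 m2 _ e]] := @same_trig (fun x => \prod_i (1 - iter m sgr_step (sin ((x i - y i) / p.+1%:R)))).
    apply: trigpoly_prod => i.
    have := trigpoly_add (trigpoly_cst 1) (trigpoly_scale (-1) (_ : trigpoly (fun x => iter m sgr_step (sin ((x i - y i) / p.+1%:R))))).
    move=> h; have {h} := h _; rewrite -/(_ -> _) => h.
    have -> : (fun x : 'I_n -> R => 1 - iter m sgr_step (sin ((x i - y i) / p.+1%:R))) =
      (fun x => 1 + -1 * iter m sgr_step (sin ((x i - y i) / p.+1%:R))).
      by apply/funext => x; rewrite mulN1r.
    apply: h; elim: m => [|m IH] /=.
      have := trigpoly_sin (p.+1%:R^-1) (- y i / p.+1%:R) i.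
      by congr trigpoly; apply/funext => x; congr sin; rewrite mulrBl mulNr mulrC.
    have := trigpoly_scale 2^-1 (trigpoly_add (trigpoly_scale 3 IH)
       (trigpoly_scale (-1) (trigpoly_mul IH (trigpoly_mul IH IH)))).
    by congr trigpoly; apply/funext => x; rewrite /sgr_step !exprS expr0; field.
  split => // x; apply: sb => i; exact: iter_sgr_step_le1.
apply: (same_lim same1) => x; apply: cp => i; exact: cvg_sgr_sin.
Qed.

(** The factor [1 - Num.sg (x i - y i)] takes the value 1 at [x i = y i]. Shifting [y i] down by
    [1 / (r + 1)] removes this case in the limit and leaves twice the indicator of a strict
    inequality. *)
Let same_rect (y : 'I_n -> R) : same (2 ^+ n) (fun x => \prod_i ((x i < y i)%R%:R * 2)).
Proof.
apply: (@same_lim _ (fun r x => \prod_i (1 - Num.sg (x i - (y i - r.+1%:R^-1))))).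
  by move=> r; exact: same_sgr.
move=> x; apply: cvg_big => [|i _]; first exact: mul_continuous.
have [xy|yx] := ltP (x i) (y i); apply: cvg_near_cst; near=> r;
  have r0 : 0 < r.+1%:R^-1 :> R by rewrite invr_gt0.
  rewrite mul1r ltr0_sg; first by rewrite opprK.
  suff : r.+1%:R^-1 < y i - x i by set e := r.+1%:R^-1; lra.
  near: r; apply: (cvgr_lt 0); first exact: cvg_harmonic.
  by rewrite subr_gt0.
set e := r.+1%:R^-1 in r0 *.
by rewrite mul0r gtr0_sg ?subrr//; lra.
Unshelve. all: by end_near. Qed.

Let tup1 w : n.-tuple (measurableTypeR R) := [tuple V1 i w | i < n].
Let tup2 w : n.-tuple (measurableTypeR R) := [tuple V2 i w | i < n].

Lemma measurable_mktuple {d} {T : measurableType d} (V : 'I_n -> T -> R) :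
  (forall i, measurable_fun setT (V i)) ->
  measurable_fun setT (fun w => [tuple V i w | i < n] : n.-tuple (measurableTypeR R)).
Proof.
move=> mV; apply/measurable_fun_tnthP => i.
rewrite (_ : _ \o _ = V i); first exact: mV.
by apply/funext => w /=; rewrite tnth_mktuple.
Qed.

(** A Cramér-Wold statement: equal cosine transforms of all linear forms give equal masses of
    orthants, and the orthants form a generating class stable under intersections. *)
Lemma equal_laws (A : set (n.-tuple (measurableTypeR R))) : measurable A ->
  P1 (tup1 @^-1` A) = P2 (tup2 @^-1` A).
Proof.
have mt1 := measurable_mktuple mV1; have mt2 := measurable_mktuple mV2.
pose rect (y : 'I_n -> R) : set (n.-tuple (measurableTypeR R)) := [set t | forall i, tnth t i < y i].
have mrect y : measurable (rect y).
  have -> : rect y = \bigcap_(i in [set: 'I_n]) ((fun t => tnth t i) @^-1` `]-oo, y i[%classic).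
    rewrite predeqE => t; split => [h i _ /=|h i]; first by rewrite in_itv/= h.
    by have := h i I; rewrite /= in_itv.
  apply: fin_bigcap_measurable => // i _.
  by rewrite -[X in measurable X]setTI; apply: measurable_tnth.
have prect y : P1 (tup1 @^-1` rect y) = P2 (tup2 @^-1` rect y).
  have [_ _ _ e] := same_rect y.
  have E d' (T : measurableType d') (P : probability T R) (V : 'I_n -> T -> R) :
      (forall i, measurable_fun setT (V i)) ->
      \int[P]_w \prod_i ((V i w < y i)%R%:R * 2) =
      fine (P ((fun w => [tuple V i w | i < n] : n.-tuple (measurableTypeR R)) @^-1` rect y)) * 2 ^+ n.
    move=> mV.
    have mr : measurable ((fun w => [tuple V i w | i < n] : n.-tuple (measurableTypeR R)) @^-1` rect y).
      by rewrite -[X in measurable X]setTI; apply: (measurable_mktuple mV).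
    transitivity (\int[P]_w (\1_((fun w => [tuple V i w | i < n] : n.-tuple (measurableTypeR R)) @^-1` rect y) w * 2 ^+ n)).
      apply: eq_Rintegral => w _; rewrite big_split/= prodr_const card_ord; congr (_ * _).
      rewrite indicE; have [h|h] := boolP (w \in _).
        by rewrite big1// => i _; move: h => /set_mem /(_ i); rewrite tnth_mktuple => ->.
      have [i hi] : exists i, ~~ (V i w < y i).
        apply/not_existsP => h'; move/negP: h; apply; apply/mem_set => i.
        by rewrite tnth_mktuple; apply/negPn/negP; exact: h'.
      by rewrite (bigD1 i)//= (negbTE hi) mul0r.
    rewrite RintegralZr//; last exact: integrable_indic.
    by rewrite /Rintegral integral_indic// setIT.
  rewrite /ev1 /ev2 !E// in e.
  have {}e := mulIf (expf_neq0 n (_ : 2 != 0 :> R)) e.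
  have f1 := fin_num_measure P1 (tup1 @^-1` rect y).
  have f2 := fin_num_measure P2 (tup2 @^-1` rect y).
  rewrite -[LHS]fineK ?f1//; last by rewrite -[X in measurable X]setTI; apply: mt1.
  rewrite -[RHS]fineK ?f2//; last by rewrite -[X in measurable X]setTI; apply: mt2.
  by rewrite e.
pose G := [set A | exists y, A = rect y].
move=> mA.
(* A half-line in one coordinate is the union over [k] of the orthants with bound [k] on the other
   coordinates, so orthants generate the product sigma-algebra. *)
have sG : <<s G >> A.
  have mid : measurable_fun [set: g_sigma_algebraType G] (fun t : g_sigma_algebraType G => t : n.-tuple (measurableTypeR R)).
    apply/measurable_fun_tnthP => i.
    apply: (measurability _ (@RGenInftyO.measurableE R)) => // _ [_ [x ->] <-].
    rewrite setTI.
    have -> : (((@tnth n (measurableTypeR R))^~ i) \o (fun t : g_sigma_algebraType G => t)) @^-1` `]-oo, x[ =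
        \bigcup_k rect (fun j => if j == i then x else k%:R).
      rewrite predeqE => t; split => /=.
        rewrite in_itv/= => tx; exists (Num.bound (\sum_j `|tnth t j|)) => // j.
        case: eqP => [->//|_]; apply: le_lt_trans (archi_boundP _); last by apply: sumr_ge0.
        apply: le_trans (ler_norm _) _; rewrite (bigD1 j)//= lerDl sumr_ge0//.
      by move=> [k _ /(_ i)]; rewrite eqxx in_itv.
    apply: bigcup_measurable => k _; apply: sub_sigma_algebra.
    by exists (fun j => if j == i then x else k%:R).
  by rewrite -[A]setTI; exact: (mid measurableT).
suff : pushm P1 mt1 A = pushm P2 mt2 A by [].
move: A sG {mA}; apply: (@g_sigma_algebra_measure_unique _ _ _ G _ (fun k => rect (fun=> k%:R))) => //.
- by move=> _ [y ->].
- by move=> k; exists (fun=> k%:R).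
- rewrite predeqE => t; split => // _; exists (Num.bound (\sum_j `|tnth t j|)) => // j.
  apply: le_lt_trans (archi_boundP _); last by apply: sumr_ge0.
  by apply: le_trans (ler_norm _) _; rewrite (bigD1 j)//= lerDl sumr_ge0.
- move=> _ _ [y ->] [z ->]; exists (fun i => Num.min (y i) (z i)).
  rewrite predeqE => t; split => [[h1 h2] i|h]; first by rewrite lt_min h1 h2.
  by split=> i; have := h i; rewrite lt_min => /andP[].
- by move=> _ [y ->]; exact: prect.
- move=> k; rewrite /= /pushforward; apply: (@le_lt_trans _ _ 1%E); last exact: ltry.
  by apply: probability_le1; rewrite -[X in measurable X]setTI; exact: mt1.
Qed.

End equal_laws.

(** * Gaussian spaces *)

Section real_limits.
Context {R : realType}.

Lemma cvg_uniqueR (u : nat -> R) (a b : R) :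
  u k @[k --> \oo] --> a -> u k @[k --> \oo] --> b -> a = b.
Proof. by move=> ua ub; exact: (cvg_unique _ ua ub). Qed.

Lemma cvg_le_bound (u : nat -> R) (l M : R) :
  u k @[k --> \oo] --> l -> (forall k, u k <= M) -> l <= M.
Proof.
move=> h uM; rewrite -(cvg_lim _ h)//; apply: limr_le.
  by apply/cvg_ex; eexists; exact: h.
exact: nearW.
Qed.

End real_limits.

Lemma ge0_integral_pushm {d1 d2} {T1 : measurableType d1} {T2 : measurableType d2}
    {R : realType} (m : {measure set T1 -> \bar R}) (f : T1 -> T2)
    (mf : measurable_fun setT f) (F : T2 -> \bar R) :
  measurable_fun setT F -> (forall x, 0 <= F x)%E ->
  (\int[pushm m mf]_x F x = \int[m]_w F (f w))%E.
Proof. by move=> mF F0; rewrite ge0_integral_pushforward. Qed.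

Section square_integrable.
Context {d} {Omega : measurableType d} {R : realType} (P : probability Omega R).
Implicit Types f g h : Omega -> R.

Definition sqint f := measurable_fun setT f /\
  P.-integrable setT (fun w => (f w ^+ 2)%:E).

(** The inner product of L2. On a Gaussian space the variables are centered ([gs_mean]), and it is
    then the covariance. *)
Definition cov f g : R := \int[P]_w (f w * g w).

Lemma sqint_mul f g : sqint f -> sqint g -> P.-integrable setT (fun w => (f w * g w)%:E).
Proof.
move=> [mf f2] [mg g2].
have := integrableD measurableT f2 g2; apply: le_integrable => //.
  exact/measurable_EFinP/measurable_funM.
move=> w _; rewrite /= lee_fin normrM.
have := sqr_ge0 (`|f w| - `|g w|); rewrite -(real_normK (num_real (f w))) -(real_normK (num_real (g w))).
move=> h; rewrite [leRHS]ger0_norm ?addr_ge0 ?sqr_ge0//.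
have := mulr_ge0 (normr_ge0 (f w)) (normr_ge0 (g w)); rewrite !expr2 in h *; lra.
Qed.

Lemma sqint0 : sqint (fun=> 0).
Proof.
split; first exact: measurable_cst.
by have := integrable0 P setT; apply: eq_integrable => // w _ /=; rewrite expr0n.
Qed.

Lemma sqintDZ a f g : sqint f -> sqint g -> sqint (fun w => a * f w + g w).
Proof.
move=> sf sg; have [mf f2] := sf; have [mg g2] := sg.
split; first by apply: measurable_funD => //; exact: measurable_funM.
have h1 := integrableZl measurableT (a ^+ 2) f2.
have h2 := integrableZl measurableT (2 * a) (sqint_mul sf sg).
have := integrableD measurableT (integrableD measurableT h1 h2) g2.
apply: eq_integrable => // w _ /=; rewrite -!EFinM -!EFinD; congr EFin; ring.
Qed.

Lemma integrable_sqint f : sqint f -> P.-integrable setT (EFin \o f).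
Proof.
move=> [mf f2]; have h1 : P.-integrable setT (EFin \o cst 1).
  by apply: (@bounded_integrable _ _ _ P (cst 1) 1) => // w; rewrite normr1.
have := integrableD measurableT h1 f2; apply: le_integrable => //; first exact/measurable_EFinP.
move=> w _; rewrite /= lee_fin [leRHS]ger0_norm ?addr_ge0 ?sqr_ge0//.
by have := sqr_ge0 (`|f w| - 1); have := normr_ge0 (f w); rewrite -(real_normK (num_real (f w))) !expr2; lra.
Qed.

Lemma covC f g : cov f g = cov g f.
Proof. by apply: eq_Rintegral => w _; rewrite mulrC. Qed.

Lemma cov_ge0 f : 0 <= cov f f.
Proof. by apply: Rintegral_ge0 => w _; rewrite -expr2 sqr_ge0. Qed.

Lemma covDZl a f g h : sqint f -> sqint g -> sqint h ->
  cov (fun w => a * f w + g w) h = a * cov f h + cov g h.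
Proof.
move=> sf sg sh; have fh := sqint_mul sf sh; have gh := sqint_mul sg sh.
rewrite /cov -RintegralZl// -RintegralD//; last by have := integrableZl measurableT a fh; apply: eq_integrable.
by apply: eq_Rintegral => w _; ring.
Qed.

Lemma covDZr a f g h : sqint f -> sqint g -> sqint h ->
  cov h (fun w => a * f w + g w) = a * cov h f + cov h g.
Proof. by move=> sf sg sh; rewrite covC covDZl// !(covC h). Qed.

Lemma cov0l f : cov (fun=> 0) f = 0.
Proof. by rewrite /cov; under eq_Rintegral do rewrite mul0r; rewrite /Rintegral integral0. Qed.

Lemma cov_sqrDZ a f g : sqint f -> sqint g ->
  cov (fun w => a * f w + g w) (fun w => a * f w + g w) =
  a ^+ 2 * cov f f + 2 * a * cov f g + cov g g.
Proof.
move=> sf sg; have sfg := sqintDZ a sf sg.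
by rewrite covDZl// !covDZr// (covC g f); ring.
Qed.

Lemma cauchy_schwarz f g : sqint f -> sqint g -> cov f g ^+ 2 <= cov f f * cov g g.
Proof.
move=> sf sg.
have q a b : 0 <= a ^+ 2 * cov f f + 2 * a * b * cov f g + b ^+ 2 * cov g g.
  have s0 := sqint0; have sbg := sqintDZ b sg s0.
  have := cov_ge0 (fun w => a * f w + (b * g w + 0)).
  by rewrite cov_sqrDZ// cov_sqrDZ// covDZr// !(covC _ (fun=> 0)) !cov0l; lra.
have g0 := cov_ge0 g; have f0 := cov_ge0 f.
have [g1|g1] := eqVneq (cov g g) 0.
  (* When [cov g g = 0] the form at [a = - cov f g], [b = (cov f f + 1) / 2] reduces to
     [- cov f g ^+ 2], which must be nonnegative. *)
  have := q (- cov f g) ((cov f f + 1) / 2); have := q (cov f g) (- (cov f f + 1) / 2).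
  rewrite g1 !mulr0 !addr0.
  set x := cov f g; set F := cov f f in f0 *; nra.
have g2 : 0 < cov g g by rewrite lt_neqAle eq_sym g1.
have := q (cov g g) (- cov f g).
have -> : cov g g ^+ 2 * cov f f + 2 * cov g g * - cov f g * cov f g + (- cov f g) ^+ 2 * cov g g
   = cov g g * (cov f f * cov g g - cov f g ^+ 2) by ring.
by rewrite pmulr_rge0// subr_ge0.
Qed.

Definition nrm2 f := Num.sqrt (cov f f).

Lemma nrm2_ge0 f : 0 <= nrm2 f. Proof. exact: sqrtr_ge0. Qed.

Lemma sqr_nrm2 f : nrm2 f ^+ 2 = cov f f.
Proof. by rewrite sqr_sqrtr// cov_ge0. Qed.

Lemma cov_le f g : sqint f -> sqint g -> `|cov f g| <= nrm2 f * nrm2 g.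
Proof.
move=> sf sg; rewrite -(@ler_pXn2r _ 2)// ?nnegrE ?mulr_ge0 ?nrm2_ge0//.
by rewrite real_normK ?num_real// exprMn !sqr_nrm2 cauchy_schwarz.
Qed.

Lemma nrm2D f g : sqint f -> sqint g -> nrm2 (fun w => f w + g w) <= nrm2 f + nrm2 g.
Proof.
move=> sf sg; rewrite -(@ler_pXn2r _ 2)// ?nnegrE ?addr_ge0 ?nrm2_ge0//.
have -> : (fun w => f w + g w) = (fun w => 1 * f w + g w) by apply/funext => w; rewrite mul1r.
rewrite sqr_nrm2 cov_sqrDZ// sqrrD !sqr_nrm2 expr1n mul1r mulr1 lerD2r lerD2l.
rewrite -[leRHS]mulr_natl ler_wpM2l//; apply: le_trans (ler_norm _) _; exact: cov_le.
Qed.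

Lemma nrm2Z a f : sqint f -> nrm2 (fun w => a * f w) = `|a| * nrm2 f.
Proof.
move=> sf; have s0 := sqint0.
have -> : (fun w => a * f w) = (fun w => a * f w + 0) by apply/funext => w; rewrite addr0.
by rewrite /nrm2 cov_sqrDZ// (covC f) !cov0l mulr0 !addr0 sqrtrM ?sqr_ge0// sqrtr_sqr.
Qed.

Lemma sqint_sum (I : Type) (r : seq I) (a : I -> R) (F : I -> Omega -> R) :
  (forall i, sqint (F i)) -> sqint (fun w => \sum_(i <- r) a i * F i w).
Proof.
move=> sF; elim: r => [|i r IH].
  by have := sqint0; congr sqint; apply/funext => w; rewrite big_nil.
by have := sqintDZ (a i) (sF i) IH; congr sqint; apply/funext => w; rewrite big_cons.
Qed.

Lemma cov_suml (I : Type) (r : seq I) (a : I -> R) (F : I -> Omega -> R) g :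
  (forall i, sqint (F i)) -> sqint g ->
  cov (fun w => \sum_(i <- r) a i * F i w) g = \sum_(i <- r) a i * cov (F i) g.
Proof.
move=> sF sg; elim: r => [|i r IH].
  transitivity (cov (fun=> 0) g); last by rewrite cov0l big_nil.
  by congr cov; apply/funext => w; rewrite big_nil.
rewrite big_cons -IH -covDZl//; last exact: sqint_sum.
by congr cov; apply/funext => w; rewrite big_cons.
Qed.

Lemma cov_sumr (I : Type) (r : seq I) (a : I -> R) (F : I -> Omega -> R) g :
  (forall i, sqint (F i)) -> sqint g ->
  cov g (fun w => \sum_(i <- r) a i * F i w) = \sum_(i <- r) a i * cov g (F i).
Proof.
by move=> sF sg; rewrite covC cov_suml//; apply: eq_bigr => i _; rewrite covC.
Qed.

Lemma cov_sqr_integral f : sqint f -> (\int[P]_w (f w ^+ 2)%:E = (cov f f)%:E)%E.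
Proof.
move=> [mf f2]; rewrite /cov /Rintegral fineK; last exact: integrable_fin_num f2.
by apply: eq_integral => w _.
Qed.

End square_integrable.

Section gaussian_space.
Context {d} {Omega : measurableType d} {R : realType} (P : probability Omega R).
Implicit Types f g h : Omega -> R.

(** Each law is prescribed by its cosine transform with phase: this form passes to L2 limits and is
    what [equal_laws] consumes. Since the space is linear, all joint laws are fixed by [cov], and
    degenerate elements are included. *)
Record gaussian_space (H : set (Omega -> R)) := GaussianSpace {
  gs_sqint : forall f, H f -> sqint P f ;
  gs0 : H (fun=> 0) ;
  gsDZ : forall a f g, H f -> H g -> H (fun w => a * f w + g w) ;
  gs_cos : forall f c, H f ->
    \int[P]_w cos (f w + c) = cos c * expR (- cov P f f / 2) }.

Definition l2_closed (H : set (Omega -> R)) := forall f, measurable_fun setT f ->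
  (forall e : R, 0 < e -> exists2 g, H g & (\int[P]_w ((f w - g w) ^+ 2)%:E <= e%:E)%E) -> H f.

Definition l2_closure (H : set (Omega -> R)) : set (Omega -> R) :=
  [set f : Omega -> R | measurable_fun setT f /\
  (forall e : R, 0 < e -> exists2 g, H g & (\int[P]_w ((f w - g w) ^+ 2)%:E <= e%:E)%E)].

Lemma gsD H f g : gaussian_space H -> H f -> H g -> H (fun w => f w + g w).
Proof.
move=> gH Hf Hg; have := gsDZ gH 1 Hf Hg; congr H; apply/funext => w.
by rewrite mul1r.
Qed.

Lemma gsZ H a f : gaussian_space H -> H f -> H (fun w => a * f w).
Proof.
move=> gH Hf; have := gsDZ gH a Hf (gs0 gH); congr H; apply/funext => w.
by rewrite addr0.
Qed.

Lemma gsB H f g : gaussian_space H -> H f -> H g -> H (fun w => f w - g w).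
Proof.
move=> gH Hf Hg; have := gsDZ gH (-1) Hg Hf; congr H; apply/funext => w.
by rewrite mulN1r addrC.
Qed.

Lemma gs_sum H (I : Type) (r : seq I) (F : I -> Omega -> R) : gaussian_space H ->
  (forall i, H (F i)) -> H (fun w => \sum_(i <- r) F i w).
Proof.
move=> gH HF; elim: r => [|i r IH].
  by have := gs0 gH; congr H; apply/funext => w; rewrite big_nil.
have := gsD gH (HF i) IH; congr H; apply/funext => w; by rewrite big_cons.
Qed.

Lemma sub_l2_closure H : gaussian_space H -> H `<=` l2_closure H.
Proof.
move=> gH f Hf; split; first by case: (gs_sqint gH Hf).
move=> e e0; exists f => //.
under eq_integral do rewrite subrr expr0n/=.
by rewrite integral0 lee_fin ltW.
Qed.

Lemma sqint_close f g (e : R) : measurable_fun setT f -> sqint P g ->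
  (\int[P]_w ((f w - g w) ^+ 2)%:E <= e%:E)%E ->
  sqint P f /\ cov P (fun w => f w - g w) (fun w => f w - g w) <= e.
Proof.
move=> mf sg he; have [mg g2] := sg.
have sfg : sqint P (fun w => f w - g w).
  split; first exact: measurable_funB.
  apply/integrableP; split; first exact/measurable_EFinP/measurable_funX/measurable_funB.
  apply: le_lt_trans (ltry e); apply: le_trans he; rewrite le_eqVlt; apply/orP; left.
  by apply/eqP; apply: eq_integral => w _ /=; rewrite ger0_norm ?sqr_ge0.
split; last by rewrite -lee_fin -cov_sqr_integral.
have := sqintDZ 1 sfg sg; congr (sqint P); apply/funext => w.
by rewrite mul1r subrK.
Qed.

Lemma l2_closure_sqint H f : gaussian_space H -> l2_closure H f -> sqint P f.
Proof.
move=> gH [mf /(_ 1 ltr01)[g Hg he]].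
by have [] := sqint_close mf (gs_sqint gH Hg) he.
Qed.

Lemma nrm2B_close f g : sqint P f -> sqint P g ->
  `|nrm2 P f - nrm2 P g| <= nrm2 P (fun w => f w - g w).
Proof.
move=> sf sg.
have D a b : sqint P a -> sqint P b -> sqint P (fun w => a w - b w).
  move=> sa sb; have := sqintDZ (-1) sb sa; congr (sqint P); apply/funext => w.
  by rewrite mulN1r addrC.
have sy : nrm2 P (fun w => g w - f w) = nrm2 P (fun w => f w - g w).
  have -> : (fun w => g w - f w) = (fun w => -1 * (f w - g w)).
    by apply/funext => w; rewrite mulN1r opprB.
  by rewrite nrm2Z ?normrN1 ?mul1r//; exact: D.
have h1 := nrm2D (D f g sf sg) sg; have h2 := nrm2D (D g f sg sf) sf.
rewrite sy in h2.
rewrite (_ : (fun w => _) = f) in h1; last by apply/funext => w; rewrite subrK.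
rewrite (_ : (fun w => _) = g) in h2; last by apply/funext => w; rewrite subrK.
by rewrite ler_norml; apply/andP; split; lra.
Qed.

Lemma cos_lip (x y : R) : `|cos x - cos y| <= `|x - y|.
Proof.
wlog xy : x y / x < y.
  move=> h; have [|yx|->] := ltgtP x y; [exact: h| |by rewrite !subrr].
  by rewrite distrC (distrC x); exact: h.
have [|c _ e] := @MVT R cos (fun z => - sin z) x y xy.
- by apply: continuous_subspaceT; exact: continuous_cos.
rewrite distrC e normrM normrN (distrC x) ler_piMl//.
by rewrite ler_norml sin_geN1 sin_le1.
Qed.

(** The cosine is 1-Lipschitz, and the first moment of the difference is bounded by its L2 norm
    through Cauchy-Schwarz against the constant 1. *)
Lemma Ecos_lip f g c : sqint P f -> sqint P g ->
  `|\int[P]_w cos (f w + c) - \int[P]_w cos (g w + c)| <= nrm2 P (fun w => f w - g w).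
Proof.
move=> sf sg; have [mf _] := sf; have [mg _] := sg.
have ic h : measurable_fun setT h -> P.-integrable setT (EFin \o (fun w => cos (h w + c))).
  move=> mh; apply: (@bounded_integrable _ _ _ _ _ 1).
    apply: measurableT_comp; first by apply: continuous_measurable_fun; exact: continuous_cos.
    exact: measurable_funD.
  by move=> w; rewrite ler_norml cos_geN1 cos_le1.
have sfg : sqint P (fun w => f w - g w).
  have := sqintDZ (-1) sg sf; congr (sqint P); apply/funext => w.
  by rewrite mulN1r addrC.
rewrite -RintegralB//; [|exact: ic|exact: ic].
have iB : P.-integrable setT (EFin \o (fun w => cos (f w + c) - cos (g w + c))).
  by have := integrableB measurableT (ic f mf) (ic g mg); apply: eq_integrable.
have ia := integrable_sqint sfg.
have s1 : sqint P (cst 1).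
  split => //; apply: (@bounded_integrable _ _ _ P (cst 1 ^+ 2) 1) => // w.
  by rewrite /= expr1n normr1.
have sa : sqint P (fun w => `|f w - g w|).
  split; first by apply: measurableT_comp => //; exact: measurable_funB.
  by have [_] := sfg; apply: eq_integrable => // w _; rewrite real_normK ?num_real.
apply: (@le_trans _ _ (\int[P]_w `|cos (f w + c) - cos (g w + c)|)).
  by apply: le_normr_Rintegral.
apply: (@le_trans _ _ (cov P (fun w => `|f w - g w|) (cst 1))).
  apply: le_Rintegral => //.
  - exact: integrable_norm.
  - exact: sqint_mul.
  - move=> w _ /=; rewrite mulr1; apply: le_trans (cos_lip _ _) _.
    by rewrite opprD addrACA subrr addr0.
apply: le_trans (ler_norm _) _; apply: le_trans (cov_le sa s1) _.
have -> : nrm2 P (cst 1) = 1.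
  rewrite /nrm2 /cov (_ : \int[P]_w _ = 1) ?sqrtr1//.
  transitivity (\int[P]_(w in setT) (1 : R)); first by apply: eq_Rintegral => w _; rewrite mulr1.
  by rewrite Rintegral_cst// mul1r; exact: (congr1 fine (probability_setT P)).
rewrite mulr1 /nrm2 /cov le_eqVlt; apply/orP; left; apply/eqP; congr Num.sqrt.
by apply: eq_Rintegral => w _; rewrite -!expr2 real_normK ?num_real.
Qed.

Lemma l2_closure_gaussian H : gaussian_space H -> gaussian_space (l2_closure H).
Proof.
move=> gH; split.
- by move=> f; exact: l2_closure_sqint.
- exact: (sub_l2_closure gH (gs0 gH)).
- move=> a f g Hf Hg; have [mf cf] := Hf; have [mg cg] := Hg.
  have sf := l2_closure_sqint gH Hf; have sg := l2_closure_sqint gH Hg.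
  split; first by case: (sqintDZ a sf sg).
  move=> e e0.
  have [f' Hf' ef] := cf (e / (4 * (a ^+ 2 + 1))) ltac:(by rewrite divr_gt0// mulr_gt0// ltr_wpDl// sqr_ge0).
  have [g' Hg' eg] := cg (e / 4) ltac:(by rewrite divr_gt0).
  exists (fun w => a * f' w + g' w); first exact: gsDZ.
  have sf' := gs_sqint gH Hf'; have sg' := gs_sqint gH Hg'.
  have [_ df] := sqint_close mf sf' ef; have [_ dg] := sqint_close mg sg' eg.
  have B a0 b0 : sqint P a0 -> sqint P b0 -> sqint P (fun w => a0 w - b0 w).
    move=> sa sb; have := sqintDZ (-1) sb sa; congr (sqint P); apply/funext => w.
    by rewrite mulN1r addrC.
  have sF := B _ _ sf sf'; have sG := B _ _ sg sg'.
  rewrite (eq_integral (fun w => ((a * (f w - f' w) + (g w - g' w)) ^+ 2)%:E)); last first.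
    by move=> w _; congr (_%:E); ring.
  rewrite (cov_sqr_integral (sqintDZ a sF sG)) lee_fin cov_sqrDZ//.
  set F := fun w => f w - f' w in sF df *; set G := fun w => g w - g' w in sG dg *.
  (* The variance of [a * F - G] is nonnegative, which bounds the cross term [2 * a * cov F G] by
     the two squares. *)
  have := cov_ge0 P (fun w => a * F w + (-1 * G w + 0)).
  have s0 := sqint0 P; have snG := sqintDZ (-1) sG s0.
  rewrite !cov_sqrDZ// covDZr// !(covC _ _ (fun=> 0)) !cov0l.
  have : a ^+ 2 * cov P F F <= e / 4.
    apply: (@le_trans _ _ (a ^+ 2 * (e / (4 * (a ^+ 2 + 1))))).
      by rewrite ler_wpM2l ?sqr_ge0.
    have a2 := sqr_ge0 a.
    rewrite mulrA ler_pdivrMr ?mulr_gt0 ?ltr_wpDl//; nra.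
  by lra.
- move=> f c Hf; have [mf cf] := Hf; have sf := l2_closure_sqint gH Hf.
  have /choice[g_ hg] : forall n : nat, exists g, H g /\
      nrm2 P (fun w => f w - g w) <= n.+1%:R^-1.
    move=> n.
    have [g Hg eg] := cf (n.+1%:R ^- 2) ltac:(by rewrite invr_gt0 exprn_gt0).
    exists g; split=> //; have [_] := sqint_close mf (gs_sqint gH Hg) eg.
    by move=> h; rewrite -(@ler_pXn2r _ 2)// ?nnegrE ?nrm2_ge0 ?invr_ge0// sqr_nrm2 exprVn.
  have c0 : nrm2 P (fun w => f w - g_ n w) @[n --> \oo] --> (0 : R).
    apply: (@squeeze_cvgr _ _ _ _ (cst 0) harmonic).
    - by apply: nearW => n; rewrite nrm2_ge0; have [] := hg n.
    - exact: cvg_cst.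
    - exact: cvg_harmonic.
  have c1 : \int[P]_w cos (g_ n w + c) @[n --> \oo] --> \int[P]_w cos (f w + c).
    apply/cvgrPdist_le => e e0; near=> n.
    apply: le_trans (Ecos_lip c sf (gs_sqint gH (hg n).1)) _.
    rewrite -[leLHS]ger0_norm ?nrm2_ge0//.
    by near: n; apply: cvgr0_norm_le.
  have c2 : nrm2 P (g_ n) @[n --> \oo] --> nrm2 P f.
    apply/cvgrPdist_le => e e0; near=> n.
    apply: le_trans (nrm2B_close sf (gs_sqint gH (hg n).1)) _.
    rewrite -[leLHS]ger0_norm ?nrm2_ge0//.
    by near: n; apply: cvgr0_norm_le.
  apply: (cvg_uniqueR c1) => {c1}.
  have -> : (fun n => \int[P]_w cos (g_ n w + c)) =
            (fun n => cos c * expR (- nrm2 P (g_ n) ^+ 2 / 2)).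
    by apply/funext => n; rewrite (gs_cos gH)//; [rewrite sqr_nrm2|exact: (hg n).1].
  rewrite -sqr_nrm2; apply: cvgM; first exact: cvg_cst.
  apply: continuous_cvg; first exact: continuous_expR.
  by apply: cvgM; [apply: cvgN; apply: cvgM|exact: cvg_cst].
Unshelve. all: by end_near. Qed.

Lemma l2_closure_closed H : gaussian_space H -> l2_closed (l2_closure H).
Proof.
move=> gH f mf hf; split=> // e e0.
have [g [mg hg] eg] := hf (e / 4) ltac:(by rewrite divr_gt0).
have [h Hh eh] := hg (e / 4) ltac:(by rewrite divr_gt0).
exists h => //; have [mh _] := gs_sqint gH Hh.
have m1 : measurable_fun setT (fun w => ((f w - g w) ^+ 2)%:E).
  exact/measurable_EFinP/measurable_funX/measurable_funB.
have m2 : measurable_fun setT (fun w => ((g w - h w) ^+ 2)%:E).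
  exact/measurable_EFinP/measurable_funX/measurable_funB.
apply: (@le_trans _ _ (\int[P]_w (2%:E * ((f w - g w) ^+ 2)%:E + 2%:E * ((g w - h w) ^+ 2)%:E)))%E.
  apply: ge0_le_integral => //.
  - by move=> w _; rewrite lee_fin sqr_ge0.
  - exact/measurable_EFinP/measurable_funX/measurable_funB.
  - by apply: emeasurable_funD; exact: measurable_funeM.
  - move=> w _; rewrite -!EFinM -EFinD lee_fin.
    by have := sqr_ge0 ((f w - g w) - (g w - h w)); rewrite !expr2; lra.
rewrite ge0_integralD//; last 4 first.
- by move=> w _; rewrite mule_ge0// lee_fin sqr_ge0.
- exact: measurable_funeM.
- by move=> w _; rewrite mule_ge0// lee_fin sqr_ge0.
- exact: measurable_funeM.
rewrite !ge0_integralZl_EFin//; last 2 first.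
- by move=> w _; rewrite lee_fin sqr_ge0.
- by move=> w _; rewrite lee_fin sqr_ge0.
apply: (@le_trans _ _ (2%:E * (e / 4)%:E + 2%:E * (e / 4)%:E))%E.
  by apply: leeD; apply: lee_wpmul2l.
by rewrite -!EFinM -EFinD lee_fin; lra.
Qed.

End gaussian_space.

Section gaussian_limit.
Context {d} {Omega : measurableType d} {R : realType} (P : probability Omega R).
Implicit Types f g h : Omega -> R.

(* Bounded convergence applied to the characteristic functions shows that a pointwise convergent
   sequence of Gaussian variables is Cauchy in mean square. *)
Lemma gaussian_cauchy (H : set (Omega -> R)) (f_ : nat -> Omega -> R) f :
  gaussian_space P H -> (forall n, H (f_ n)) -> (forall w, f_ ^~ w @ \oo --> f w) ->
  forall e : R, 0 < e -> exists N, forall n m, (N <= n)%N -> (N <= m)%N ->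
    cov P (fun w => f_ n w - f_ m w) (fun w => f_ n w - f_ m w) <= e.
Proof.
move=> gH Hf cf e e0; apply: contrapT => nE.
have /choice[k hk] : forall N : nat, exists nm : nat * nat, [/\ (N <= nm.1)%N, (N <= nm.2)%N &
    e < cov P (fun w => f_ nm.1 w - f_ nm.2 w) (fun w => f_ nm.1 w - f_ nm.2 w)].
  move=> N; apply: contrapT => nN; apply: nE; exists N => n m nN' mN.
  by rewrite leNgt; apply/negP => h; apply: nN; exists (n, m).
pose g N w := f_ (k N).1 w - f_ (k N).2 w.
have Hg N : H (g N) by apply: (gsB gH).
have cg w : g ^~ w @ \oo --> (0 : R).
  rewrite -(subrr (f w)); apply: cvgB.
  - apply: (cvg_comp (fun N => (k N).1) (f_ ^~ w) _ (cf w)).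
    move=> A [M _ MA]; exists M => // N /= MN; apply: MA; have [h _ _] := hk N.
    exact: leq_trans MN h.
  - apply: (cvg_comp (fun N => (k N).2) (f_ ^~ w) _ (cf w)).
    move=> A [M _ MA]; exists M => // N /= MN; apply: MA; have [_ h _] := hk N.
    exact: leq_trans MN h.
have mcos (h : Omega -> R) : measurable_fun setT h -> measurable_fun setT (fun w => cos (h w + 0)).
  move=> mh; apply: measurableT_comp; first by apply: continuous_measurable_fun; exact: continuous_cos.
  exact: measurable_funD.
have c1 : \int[P]_w cos (g N w + 0) @[N --> \oo] --> \int[P]_(w in setT) cos (0 + 0 : R).
  apply: (@bounded_cvg_Rintegral _ _ _ P (fun N w => cos (g N w + 0)) (fun=> cos (0 + 0)) 1).
  - by move=> N; apply: mcos; have [] := gs_sqint gH (Hg N).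
  - exact: measurable_cst.
  - by move=> N w; rewrite ler_norml cos_geN1 cos_le1.
  - move=> w; apply: continuous_cvg; first exact: continuous_cos.
    by apply: cvgD => //; exact: cvg_cst.
have : (1 : R) <= expR (- e / 2).
  have e1 : \int[P]_(w in setT) cos (0 + 0 : R) = 1.
    rewrite addr0 cos0 Rintegral_cst// mul1r; exact: (congr1 fine (probability_setT P)).
  rewrite e1 in c1; apply: (cvg_le_bound c1) => N.
  rewrite (gs_cos gH)// cos0 mul1r ler_expR; have [_ _] := hk N.
  by rewrite -/(g N); lra.
by rewrite leNgt expR_lt1; have -> : - e / 2 < 0 by lra.
Qed.

(** Fatou's lemma carries the Cauchy estimate to the pointwise limit, and closedness puts the limit
    in [H]. This is how the derivatives of the field, as pointwise limits of difference quotients,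
    enter the Gaussian space. *)
Lemma gaussian_limit (H : set (Omega -> R)) (f_ : nat -> Omega -> R) f :
  gaussian_space P H -> l2_closed P H ->
  (forall n, H (f_ n)) -> (forall w, f_ ^~ w @ \oo --> f w) ->
  H f /\ cov P (fun w => f_ n w - f w) (fun w => f_ n w - f w) @[n --> \oo] --> (0 : R).
Proof.
move=> gH cH Hf cf.
have mf : measurable_fun setT f.
  by apply: (@measurable_fun_cvg _ _ _ setT f_) => // n; have [] := gs_sqint gH (Hf n).
have close e : 0 < e -> exists N, forall n, (N <= n)%N -> (\int[P]_w ((f w - f_ n w) ^+ 2)%:E <= e%:E)%E.
  move=> e0; have [N hN] := gaussian_cauchy gH Hf cf e0; exists N => n Nn.
  have mn m : measurable_fun setT (fun w => ((f_ (m + N)%N w - f_ n w) ^+ 2)%:E).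
    have [m1 _] := gs_sqint gH (Hf (m + N)%N); have [m2 _] := gs_sqint gH (Hf n).
    exact/measurable_EFinP/measurable_funX/measurable_funB.
  have := @fatou _ _ _ P setT measurableT (fun m w => ((f_ (m + N)%N w - f_ n w) ^+ 2)%:E) mn.
  rewrite [X in (_ -> (X <= _)%E) -> _](_ : _ = \int[P]_w ((f w - f_ n w) ^+ 2)%:E)%E; last first.
    apply: eq_integral => w _; apply: (cvg_limn_einf_sup _).1; apply: cvg_EFin; first exact: nearW.
    have h1 : f_ (m + N)%N w - f_ n w @[m --> \oo] --> f w - f_ n w.
      apply: cvgB; last exact: cvg_cst.
      by have := cf w; rewrite -(cvg_shiftn N).
    by rewrite expr2; apply: cvg_trans (cvgM h1 h1).
  move=> h; apply: le_trans (h _) _ => {h}.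
    by move=> m w _; rewrite lee_fin sqr_ge0.
  rewrite limn_einf_lim; apply: lime_le; first exact: is_cvg_einfs.
  apply: nearW => m; apply: (@le_trans _ _ (\int[P]_w ((f_ (m + N)%N w - f_ n w) ^+ 2)%:E)%E).
    by apply: ereal_inf_lbound; exists m => /=.
  have sB := gs_sqint gH (gsB gH (Hf (m + N)%N) (Hf n)).
  by rewrite (cov_sqr_integral sB) lee_fin; apply: hN => //; exact: leq_addl.
have Hfl : H f.
  apply: cH => // e e0; have [N hN] := close e e0.
  by exists (f_ N) => //; exact: hN.
split=> //; apply/cvgrPdist_le => e e0; have [N hN] := close e e0.
exists N => // n /= Nn; rewrite sub0r normrN ger0_norm ?cov_ge0//.
have := hN n Nn; have sB := gs_sqint gH (gsB gH Hfl (Hf n)).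
rewrite (cov_sqr_integral sB) lee_fin; congr (_ <= _).
by apply: eq_Rintegral => w _; ring.
Qed.

End gaussian_limit.

(** * Independence of uncorrelated Gaussian families *)

Section product_probability.
Context {d1 d2} {T1 : measurableType d1} {T2 : measurableType d2} {R : realType}.
Context (P1 : probability T1 R) (P2 : probability T2 R).
Local Open Scope ereal_scope.

Definition prod_prob : set (T1 * T2) -> \bar R := P1 \x P2.

HB.instance Definition _ := Measure.on prod_prob.

Let prod_probT : prod_prob setT = 1.
Proof.
rewrite /prod_prob -setXTT product_measure1E//.
rewrite -[RHS]mule1; congr (_ * _); exact: probability_setT.
Qed.

HB.instance Definition _ := @Measure_isProbability.Build _ _ R prod_prob prod_probT.

Lemma Rintegral_prod_prob (f : T1 * T2 -> R) (M : R) : measurable_fun setT f ->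
  (forall z, `|f z| <= M)%R ->
  (\int[prod_prob]_z f z = \int[P1]_x \int[P2]_y f (x, y))%R.
Proof.
move=> mf fM; have intf := @bounded_integrable _ _ _ prod_prob _ _ mf fM.
rewrite /Rintegral -(integral12_prod_meas1 intf); congr fine.
apply: eq_integral => x _; rewrite fineK//; apply: integrable_fin_num => //.
apply: (@bounded_integrable _ _ _ P2 (fun y => f (x, y)) M) => [|y]; last exact: fM.
exact: (measurableT_comp mf (pair1_measurable x)).
Qed.

End product_probability.

Section gaussian_independence.
Context {d} {Omega : measurableType d} {R : realType} (P : probability Omega R).
Context (H : set (Omega -> R)) (gH : gaussian_space P H).
Local Notation tup m := (m.-tuple (measurableTypeR R)).

Lemma gs_measurable f : H f -> measurable_fun setT f.
Proof. by move=> Hf; have [] := gs_sqint gH Hf. Qed.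

Lemma gs_law1 (f : Omega -> R) (F : R -> \bar R) : H f -> measurable_fun setT F ->
  (forall x, 0 <= F x)%E ->
  (\int[P]_w F (f w) = \int[std_normal]_x F (nrm2 P f * x)%R)%E.
Proof.
move=> Hf mF F0; have mf := gs_measurable Hf.
pose V1 (i : 'I_1) := f; pose V2 (i : 'I_1) (x : measurableTypeR R) : R := nrm2 P f * x.
have mV2 i : measurable_fun setT (V2 i) by exact: measurable_funM.
have mV1 i : measurable_fun setT (V1 i) by [].
have e A : measurable A -> P ((fun w => [tuple V1 i w | i < 1] : tup 1) @^-1` A) =
   (@std_normal R) ((fun w => [tuple V2 i w | i < 1] : tup 1) @^-1` A).
  apply: (@equal_laws _ _ _ _ _ P std_normal) => // a c.
  rewrite (@eq_Rintegral _ _ _ _ _ (fun w => cos (a ord0 * f w + c))); last first.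
    by move=> w _; rewrite big_ord_recl big_ord0 addr0.
  rewrite (gs_cos gH)//; last exact: (gsZ _ gH Hf).
  transitivity (\int[std_normal]_x cos ((a ord0 * nrm2 P f) * x + c)); last first.
    by apply: eq_Rintegral => w _; rewrite big_ord_recl big_ord0 addr0 /V2 mulrA.
  rewrite (_ : cov P _ _ = (a ord0 * nrm2 P f) ^+ 2); first exact/esym/std_normal_cos.
  by rewrite -sqr_nrm2 (nrm2Z _ (gs_sqint gH Hf)) !exprMn real_normK ?num_real.
pose m1 := pushm P (measurable_mktuple mV1); pose m2 := pushm std_normal (measurable_mktuple mV2).
have mF' : measurable_fun setT (fun t : tup 1 => F (tnth t ord0)).
  by apply: measurableT_comp => //; exact: measurable_tnth.
transitivity (\int[m1]_t F (tnth t ord0))%E.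
  by rewrite ge0_integral_pushm//; apply: eq_integral => w _; rewrite tnth_mktuple.
transitivity (\int[m2]_t F (tnth t ord0))%E.
  by apply: eq_measure_integral => A mA _; exact: e.
by rewrite ge0_integral_pushm//; apply: eq_integral => w _; rewrite tnth_mktuple.
Qed.

Lemma gs_expR f : H f -> (\int[P]_w (expR (f w))%:E = (expR (cov P f f / 2))%:E)%E.
Proof.
move=> Hf; rewrite (gs_law1 (F := fun x => (expR x)%:E) Hf).
- by rewrite std_normal_expR sqr_nrm2.
- exact/measurable_EFinP.
- by move=> x; rewrite lee_fin expR_ge0.
Qed.

(** The joint law of [(U, V)] is compared with its law on [P x P] when [U] reads the first
    coordinate and [V] the second. As the cross covariances vanish, the variances of linear forms
    add up and both cosine transforms are the same. *)
Lemma gaussian_independence m n (U : 'I_m -> Omega -> R) (V : 'I_n -> Omega -> R)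
    (F : tup m * tup n -> \bar R) :
  (forall i, H (U i)) -> (forall j, H (V j)) -> (forall i j, cov P (U i) (V j) = 0) ->
  measurable_fun setT F -> (forall z, 0 <= F z)%E ->
  (\int[P]_w F ([tuple U i w | i < m], [tuple V j w | j < n]) =
   \int[P]_w \int[P]_w' F ([tuple U i w | i < m], [tuple V j w' | j < n]))%E.
Proof.
move=> HU HV UV mF F0.
have mU i := gs_measurable (HU i); have mV j := gs_measurable (HV j).
pose V1 (i : 'I_(m + n)%N) : Omega -> R := match fintype.split i with inl j => U j | inr j => V j end.
pose V2 (i : 'I_(m + n)%N) : Omega * Omega -> R :=
  match fintype.split i with inl j => fun z => U j z.1 | inr j => fun z => V j z.2 end.
have mV1 i : measurable_fun setT (V1 i) by rewrite /V1; case: fintype.split.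
have mV2 i : measurable_fun setT (V2 i).
  by rewrite /V2; case: fintype.split => j; apply: measurableT_comp.
have HUs a : H (fun w => \sum_i a i * U i w) by apply: (gs_sum _ gH) => i; exact: (gsZ _ gH).
have HVs a : H (fun w => \sum_j a j * V j w) by apply: (gs_sum _ gH) => i; exact: (gsZ _ gH).
have mc (c : R) : measurable_fun setT (fun x : R => cos (x + c)).
  apply: measurableT_comp; first by apply: continuous_measurable_fun; exact: continuous_cos.
  exact: measurable_funD.
have bc (x : R) : `|cos x| <= 1 by rewrite ler_norml cos_geN1 cos_le1.
have e A : measurable A -> P ((fun w => [tuple V1 i w | i < (m + n)%N] : tup (m + n)%N) @^-1` A) =
   prod_prob P P ((fun w => [tuple V2 i w | i < (m + n)%N] : tup (m + n)%N) @^-1` A).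
  apply: (@equal_laws _ _ _ _ _ P (prod_prob P P)) => // a c.
  pose f w := \sum_i a (lshift n i) * U i w; pose g w := \sum_j a (rshift m j) * V j w.
  have Hf : H f by exact: HUs.
  have Hg : H g by exact: HVs.
  have sU i := gs_sqint gH (HU i); have sV j := gs_sqint gH (HV j).
  have fg : cov P f g = 0.
    rewrite cov_suml//; last exact: sqint_sum.
    by rewrite big1// => i _; rewrite cov_sumr// big1 ?mulr0// => j _; rewrite UV mulr0.
  have mf := gs_measurable Hf; have mg := gs_measurable Hg.
  have E1 w : \sum_i a i * V1 i w = g w + f w.
    rewrite big_split_ord/= addrC; congr (_ + _); apply: eq_bigr => i _; rewrite /V1.
      by case: split_ordP => k => [/eqP|/rshift_inj ->//]; rewrite eq_rlshift.
    by case: split_ordP => k => [/lshift_inj ->//|/eqP]; rewrite eq_lrshift.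
  have E2 z : \sum_i a i * V2 i z = g z.2 + f z.1.
    rewrite big_split_ord/= addrC; congr (_ + _); apply: eq_bigr => i _; rewrite /V2.
      by case: split_ordP => k => [/eqP|/rshift_inj ->//]; rewrite eq_rlshift.
    by case: split_ordP => k => [/lshift_inj ->//|/eqP]; rewrite eq_lrshift.
  under eq_Rintegral do rewrite E1.
  rewrite (gs_cos gH c (gsD gH Hg Hf)).
  under [RHS]eq_Rintegral do rewrite E2.
  rewrite (@Rintegral_prod_prob _ _ _ _ _ P P (fun z => cos (g z.2 + f z.1 + c)) 1)//; last first.
    apply: (measurableT_comp (mc c) (_ : measurable_fun setT (fun z => g z.2 + f z.1))).
    by apply: measurable_funD; apply: measurableT_comp.
  under [RHS]eq_Rintegral => w _.
    under eq_Rintegral do rewrite /= -addrA.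
    rewrite (gs_cos gH _ Hg). over.
  rewrite RintegralZr//; last first.
    apply: (@bounded_integrable _ _ _ P (fun w => cos (f w + c)) 1) => //.
    exact: (measurableT_comp (mc c) mf).
  rewrite (gs_cos gH _ Hf) -mulrA -expRD; congr (_ * expR _).
  have -> : (fun w => g w + f w) = (fun w => 1 * g w + f w) by apply/funext => w; rewrite mul1r.
  by rewrite (cov_sqrDZ 1 (gs_sqint gH Hg) (gs_sqint gH Hf)) (covC P g f) fg; field.
pose m1 := pushm P (measurable_mktuple mV1); pose m2 := pushm (prod_prob P P) (measurable_mktuple mV2).
pose G (t : tup (m + n)%N) := F ([tuple tnth t (lshift n i) | i < m], [tuple tnth t (rshift m j) | j < n]).
have mG : measurable_fun setT G.
  apply: measurableT_comp => //; apply: measurable_fun_pair; apply: measurable_mktuple => i;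
  exact: measurable_tnth.
have G0 t : (0 <= G t)%E by exact: F0.
transitivity (\int[m1]_t G t)%E.
  rewrite ge0_integral_pushm//; apply: eq_integral => w _; rewrite /G; congr (F (_, _)).
    by apply: eq_from_tnth => i; rewrite !tnth_mktuple /V1 (unsplitK (inl i)).
  by apply: eq_from_tnth => i; rewrite !tnth_mktuple /V1 (unsplitK (inr i)).
transitivity (\int[m2]_t G t)%E.
  by apply: eq_measure_integral => A mA _; exact: e.
rewrite ge0_integral_pushm// fubini_tonelli1//; last first.
  by apply: measurableT_comp => //; exact: measurable_mktuple.
apply: eq_integral => w _; apply: eq_integral => w' _ /=; rewrite /G; congr (F (_, _)).
  by apply: eq_from_tnth => i; rewrite !tnth_mktuple /V2 (unsplitK (inl i)).
by apply: eq_from_tnth => i; rewrite !tnth_mktuple /V2 (unsplitK (inr i)).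
Qed.

End gaussian_independence.

Lemma cvg_sumr {R : realType} {T : Type} (F : set_system T) {FF : Filter F} (I : Type)
    (r : seq I) (f : I -> T -> R) (l : I -> R) : (forall i, f i t @[t --> F] --> l i) ->
  \sum_(i <- r) f i t @[t --> F] --> \sum_(i <- r) l i.
Proof.
move=> fl; elim: r => [|i r IH].
  by rewrite big_nil; under eq_fun do rewrite big_nil; exact: cvg_cst.
by rewrite big_cons; under eq_fun do rewrite big_cons; exact: cvgD.
Qed.

(** * Sequential topology and measurability on row vectors *)

Section row_topology.
Context {R : realType} {k : nat}.
Local Notation tup := (k.-tuple (measurableTypeR R)).

Lemma nbhs_rowP (x : 'rV[R]_k) (A : set 'rV[R]_k) :
  nbhs x A <-> exists2 e : R, 0 < e & forall y : 'rV[R]_k,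
    (forall i, `|x ord0 i - y ord0 i| < e) -> A y.
Proof.
split=> [/nbhs_ballP[e /= e0 xe]|[e e0 xe]].
  exists e => // y xy; apply: xe; rewrite mx_norm_ball /ball_/=.
  rewrite /Num.norm/= mx_normrE; apply/bigmax_ltP; split => // -[i j] _ /=.
  by rewrite !mxE (ord1 i); exact: xy.
apply/nbhs_ballP; exists e => // y; rewrite mx_norm_ball /ball_/= => xy.
apply: xe => i; apply: le_lt_trans xy.
rewrite /Num.norm/= mx_normrE; apply: le_trans (le_bigmax _ _ (ord0, i)) => /=.
by rewrite !mxE.
Qed.

Lemma cvg_row (T : Type) (F : set_system T) {FF : Filter F} (u : T -> 'rV[R]_k) (x : 'rV[R]_k) :
  (forall i, u t ord0 i @[t --> F] --> x ord0 i) -> u @ F --> x.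
Proof.
move=> ux A /nbhs_rowP[e e0 xe].
have : \forall t \near F, forall i, `|x ord0 i - u t ord0 i| < e.
  by apply: filter_forall => i; have /cvgrPdist_lt := ux i; exact.
by apply: filterS => t h; exact: xe.
Qed.

Lemma continuous_row_seq (f : 'rV[R]_k -> R) (x : 'rV[R]_k) :
  (forall u : nat -> 'rV[R]_k, (forall i, u n ord0 i @[n --> \oo] --> x ord0 i) ->
    f (u n) @[n --> \oo] --> f x) -> {for x, continuous f}.
Proof.
move=> hf A /nbhs_ballP[e /= e0 fA]; apply: contrapT => ne.
have /choice[u hu] : forall n : nat, exists y : 'rV[R]_k,
    (forall i, `|x ord0 i - y ord0 i| < n.+1%:R^-1) /\ e <= `|f x - f y|.
  move=> n; apply: contrapT => nn; apply: ne; apply/nbhs_rowP; exists n.+1%:R^-1.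
    by rewrite invr_gt0.
  move=> y xy; apply: fA; rewrite /ball/= ltNge; apply/negP => h; apply: nn; by exists y.
have ux i : u n ord0 i @[n --> \oo] --> x ord0 i.
  apply/cvgrPdist_lt => d d0; near=> n.
  apply: lt_trans ((hu n).1 i) _; near: n.
  have := @cvg_harmonic R => /cvgr_lt; exact.
have /cvgrPdist_lt/(_ e e0)[n _ /(_ n)/=] := hf u ux.
by rewrite leqnn => /(_ isT); rewrite ltNge (hu n).2.
Unshelve. all: by end_near. Qed.

Lemma continuous_row_cvg (f : 'rV[R]_k -> R) (x : 'rV[R]_k) (u : nat -> 'rV[R]_k) :
  {for x, continuous f} -> (forall i, u n ord0 i @[n --> \oo] --> x ord0 i) ->
  f (u n) @[n --> \oo] --> f x.
Proof. by move=> cf ux; apply: (cvg_comp u f _ cf); exact: cvg_row. Qed.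

(** Rounding down to a grid of mesh [1 / (n + 1)]. A continuous function is the limit of its
    roundings, which have countably many pieces; this links the topology of row vectors to the
    product sigma-algebra of tuples. *)
Definition rnd (n : nat) (x : R) : R := (Num.floor (n.+1%:R * x))%:~R / n.+1%:R.

Lemma rnd_le n (x : R) : `|x - rnd n x| <= n.+1%:R^-1.
Proof.
have n0 : 0 < n.+1%:R :> R by [].
have /andP[h1 h2] := floor_itv (n.+1%:R * x).
rewrite /rnd -(@ler_pM2l _ n.+1%:R)// divff ?gt_eqF// -[X in X * _]ger0_norm// -normrM.
rewrite mulrBr mulrCA divff ?gt_eqF// mulr1 ger0_norm ?subr_ge0//.
rewrite intrD in h2; lra.
Qed.

Lemma cvg_rnd (x : R) : rnd n x @[n --> \oo] --> x.
Proof.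
apply/cvgrPdist_lt => d d0; near=> n.
apply: le_lt_trans (rnd_le n x) _; near: n.
have := @cvg_harmonic R => /cvgr_lt; exact.
Unshelve. all: by end_near. Qed.

Definition rnd_tuple n (v : tup) : tup := [tuple rnd n (tnth v i) | i < k].

(** [D] is an arbitrary set: [rnd_tuple n] takes countably many values, each of them on a product of
    intervals. *)
Lemma measurable_rnd_tuple n (D : set tup) : measurable [set v | D (rnd_tuple n v)].
Proof.
pose G (z : k.-tuple int) : set tup := \bigcap_(i in [set: 'I_k])
  ((fun v => tnth v i) @^-1` [set x | Num.floor (n.+1%:R * x) = tnth z i]).
pose F (z : k.-tuple int) := if `[< D [tuple (tnth z i)%:~R / n.+1%:R | i < k] >] then G z else set0.
have n0 : 0 < n.+1%:R :> R by [].
have mG z : measurable (G z).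
  apply: fin_bigcap_measurable => // i _.
  rewrite -[X in measurable X]setTI; apply: measurable_tnth => //.
  rewrite [X in measurable X](_ : _ = `[((tnth z i)%:~R / n.+1%:R : R), ((tnth z i + 1)%:~R / n.+1%:R)[%classic).
    exact: measurable_itv.
  rewrite predeqE => x /=; rewrite in_itv/= ler_pdivrMr// ltr_pdivlMr// (mulrC x); split.
    by move=> <-; exact: floor_itv.
  by move=> h; exact: floor_def.
have -> : [set v | D (rnd_tuple n v)] = \bigcup_z F z.
  rewrite predeqE => v; split => [Dv|[z _]].
    exists [tuple Num.floor (n.+1%:R * tnth v i) | i < k] => //; rewrite /F.
    have -> : [tuple (tnth [tuple Num.floor (n.+1%:R * tnth v i0) | i0 < k] i)%:~R / n.+1%:R | i < k] = rnd_tuple n v.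
      by apply: eq_from_tnth => i; rewrite !tnth_mktuple.
    by rewrite asboolT// => i _ /=; rewrite tnth_mktuple.
  rewrite /F; case: asboolP => // Dz Gv /=.
  suff -> : rnd_tuple n v = [tuple (tnth z i)%:~R / n.+1%:R | i < k] by [].
  by apply: eq_from_tnth => i; rewrite !tnth_mktuple /rnd; have := Gv i I => /= ->.
apply: countable_bigcupT_measurable => [|z]; first exact: countableP.
by rewrite /F; case: ifP.
Qed.

Lemma row_of_rnd_tuple n (v : tup) i :
  row_of_tuple (rnd_tuple n v) ord0 i = rnd n (row_of_tuple v ord0 i).
Proof. by rewrite !mxE tnth_mktuple. Qed.

Lemma measurable_row_of_tuple_open (U : set 'rV[R]_k) : open U ->
  measurable ((row_of_tuple : tup -> _) @^-1` U).
Proof.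
move=> oU.
(* [D n] asks that the closed ball of radius [1 / (n + 1)] around the rounded point lie in [U]. The
   ball contains the unrounded point, and for a point of the open set [U] the condition holds for
   large [n]. *)
pose D n : set tup := [set q | forall r : 'rV[R]_k,
  (forall i, `|r ord0 i - row_of_tuple q ord0 i| <= n.+1%:R^-1) -> U r].
have -> : (row_of_tuple : tup -> _) @^-1` U = \bigcup_n [set v | D n (rnd_tuple n v)].
  rewrite predeqE => v; split => [Uv|[n _ /= Dv]]; last first.
    by apply: Dv => i; rewrite row_of_rnd_tuple; exact: rnd_le.
  have /nbhs_rowP[e e0 h] : nbhs (row_of_tuple v) U by move: oU; rewrite openE; exact.
  have [n _ hn] : \forall n \near \oo, n.+1%:R^-1 < e / 2.
    have := @cvg_harmonic R => /cvgr_lt; apply; lra.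
  exists n => //= r hr; apply: h => i.
  have := hr i; rewrite row_of_rnd_tuple => h1; have := rnd_le n (row_of_tuple v ord0 i) => h2.
  have := hn n (leqnn n) => /= h3.
  set q := n.+1%:R^-1 in h1 h2 h3.
  rewrite (_ : _ - _ = (row_of_tuple v ord0 i - rnd n (row_of_tuple v ord0 i)) -
     (r ord0 i - rnd n (row_of_tuple v ord0 i))); last by ring.
  apply: le_lt_trans (ler_normB _ _) _; lra.
by apply: bigcupT_measurable => n; exact: measurable_rnd_tuple.
Qed.

Lemma measurable_row_of_tuple_borel (B : set 'rV[R]_k) : borel B ->
  measurable ((row_of_tuple : tup -> _) @^-1` B).
Proof.
have : @borel R k `<=` [set B : set 'rV[R]_k | measurable ((row_of_tuple : tup -> _) @^-1` B)].
  apply: smallest_sub; last by move=> U /=; exact: measurable_row_of_tuple_open.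
  split => /= [|A mA|F mF].
  - by rewrite preimage_set0.
  - by rewrite setTD preimage_setC; exact: measurableC.
  - by rewrite preimage_bigcup; exact: bigcupT_measurable.
exact.
Qed.

Lemma measurable_continuous_row (f : 'rV[R]_k -> R) : continuous f ->
  measurable_fun setT (fun v : tup => f (row_of_tuple v)).
Proof.
move=> cf; apply: (@measurable_fun_cvg _ _ _ setT (fun n (v : tup) => f (row_of_tuple (rnd_tuple n v)))).
- move=> n _ Y mY; rewrite setTI.
  exact: (measurable_rnd_tuple n (fun q => Y (f (row_of_tuple q)))).
- move=> v _; apply: continuous_row_cvg => [|i]; first exact: cf.
  under eq_fun do rewrite row_of_rnd_tuple; exact: cvg_rnd.
Qed.

(* A function that is measurable in one variable and continuous in the other is the pointwise
   limit of its roundings in the continuous variable. *)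
Lemma measurable_caratheodory {d} {T : measurableType d} (F : tup -> T -> R) :
  (forall v, measurable_fun setT (F v)) ->
  (forall v w, F (rnd_tuple n v) w @[n --> \oo] --> F v w) ->
  measurable_fun setT (fun z : tup * T => F z.1 z.2).
Proof.
move=> mF cF; apply: (@measurable_fun_cvg _ _ _ setT (fun n (z : tup * T) => F (rnd_tuple n z.1) z.2)).
- move=> n _ Y mY; rewrite setTI.
  pose q (z : k.-tuple int) : tup := [tuple (tnth z i)%:~R / n.+1%:R | i < k].
  have -> : (fun z : tup * T => F (rnd_tuple n z.1) z.2) @^-1` Y =
    \bigcup_z ([set v | rnd_tuple n v = q z] `*` (F (q z) @^-1` Y)).
    rewrite predeqE => -[v w]; split => /= [h|[z _ [/= -> //]]].
    exists [tuple Num.floor (n.+1%:R * tnth v i) | i < k] => //.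
    have e : rnd_tuple n v = q [tuple Num.floor (n.+1%:R * tnth v i) | i < k].
      by apply: eq_from_tnth => i; rewrite !tnth_mktuple.
    by split => //=; rewrite -e.
  apply: countable_bigcupT_measurable => [|z]; first exact: countableP.
  apply: measurableX; first exact: (measurable_rnd_tuple n (fun v => v = q z)).
  by rewrite -[X in measurable X]setTI; exact: mF.
- by move=> [v w] _; exact: cF.
Qed.

End row_topology.

(** * Gaussian densities and regressions *)

Section gaussian_density.
Context {d} {Omega : measurableType d} {R : realType} (P : probability Omega R).
Context (H : set (Omega -> R)) (gH : gaussian_space P H).
Local Notation tup m := (m.-tuple (measurableTypeR R)).
Local Notation lebR := (@lebesgue_measure R).

(** Linear independence with an explicit constant, so that one [lambda] can serve all points of the
    box and bound all the densities uniformly. *)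
Definition posdef k (lambda : R) (Z : 'I_k -> Omega -> R) := forall c : 'I_k -> R,
  lambda * \sum_i c i ^+ 2 <=
  cov P (fun w => \sum_i c i * Z i w) (fun w => \sum_i c i * Z i w).

Lemma gs_lincomb k (c : 'I_k -> R) (Z : 'I_k -> Omega -> R) : (forall i, H (Z i)) ->
  H (fun w => \sum_i c i * Z i w).
Proof. by move=> HZ; apply: (gs_sum _ gH) => i; exact: (gsZ _ gH). Qed.

(** The coefficients solve the normal equations. A vector in the kernel of the Gram matrix would
    give a combination of zero variance, which [posdef] forbids. *)
Lemma gaussian_projection k lambda (Z : 'I_k -> Omega -> R) f : 0 < lambda ->
  (forall i, H (Z i)) -> H f -> posdef lambda Z ->
  exists b : 'I_k -> R, forall j, cov P (fun w => f w - \sum_i b i * Z i w) (Z j) = 0.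
Proof.
move=> l0 HZ Hf pd; pose M : 'M[R]_k := \matrix_(i, j) cov P (Z i) (Z j).
have sZ i := gs_sqint gH (HZ i); have sf := gs_sqint gH Hf.
have Mu : M \in unitmx.
  rewrite unitmxE unitfE; apply/negP => /det0P[v v0 vM]; case/negP: v0.
  have : lambda * \sum_i v ord0 i ^+ 2 <= 0.
    apply: le_trans (pd _) _; rewrite cov_sumr ?big1//; last exact: sqint_sum.
    move=> j _; rewrite cov_suml//.
    have := congr1 (fun B : 'rV_k => B ord0 j) vM; rewrite !mxE.
    under eq_bigr do rewrite mxE.
    by move=> ->; rewrite mulr0.
  rewrite pmulr_rle0// => h.
  have /eqP : \sum_i v ord0 i ^+ 2 = 0.
    by apply/eqP; rewrite eq_le h sumr_ge0// => i _; exact: sqr_ge0.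
  rewrite psumr_eq0 => [/allP vz|i _]; last exact: sqr_ge0.
  apply/eqP/rowP => i; rewrite mxE; apply/eqP; have := vz i (mem_index_enum _).
  by rewrite sqrf_eq0.
pose r : 'rV[R]_k := \row_j cov P f (Z j).
exists (fun i => (r *m invmx M) ord0 i) => j.
have -> : (fun w => f w - \sum_i (r *m invmx M) ord0 i * Z i w) =
    (fun w => (-1) * (\sum_i (r *m invmx M) ord0 i * Z i w) + f w).
  by apply/funext => w; rewrite mulN1r addrC.
rewrite covDZl//; last exact: sqint_sum.
rewrite cov_suml//; have := congr1 (fun B : 'rV_k => B ord0 j) (mulmxKV Mu r).
rewrite !mxE; under eq_bigr do rewrite [in X in _ * X]mxE.
by move=> ->; rewrite mulN1r addNr.
Qed.

Lemma posdef_lift k lambda (Z : 'I_k.+1 -> Omega -> R) : posdef lambda Z ->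
  posdef lambda (fun i => Z (lift ord0 i)).
Proof.
move=> pd c; pose c' i := if unlift ord0 i is Some j then c j else 0.
have := pd c'; rewrite big_ord_recl /c' unlift_none expr0n add0r.
under eq_bigr do rewrite liftK.
have -> // : (fun w => \sum_(i < k.+1) match unlift ord0 i with Some j => c j | None => 0 end * Z i w)
  = (fun w => \sum_i c i * Z (lift ord0 i) w).
apply/funext => w; rewrite big_ord_recl unlift_none mul0r add0r.
by apply: eq_bigr => i _; rewrite liftK.
Qed.

Lemma posdef_residual k lambda (Z : 'I_k.+1 -> Omega -> R) (b : 'I_k -> R) : 0 < lambda ->
  posdef lambda Z -> let r := fun w => Z ord0 w - \sum_i b i * Z (lift ord0 i) w in
  lambda <= cov P r r.
Proof.
move=> l0 pd; set r := fun w => _; move=> /=; pose c' i := if unlift ord0 i is Some j then - b j else 1.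
have := pd c'; rewrite big_ord_recl /c' unlift_none expr1n => h.
apply: le_trans (le_trans _ h) _.
  by rewrite ler_peMr ?(ltW l0)// lerDl sumr_ge0// => i _; exact: sqr_ge0.
rewrite le_eqVlt; apply/orP; left; apply/eqP; congr cov; apply/funext => w;
rewrite big_ord_recl unlift_none mul1r /r -sumrN; congr (_ + _);
by apply: eq_bigr => i _; rewrite liftK mulNr.
Qed.

(* The first variable is split into its projection on the other ones and an independent residual;
   a change of variable then reduces the number of variables by one. *)
Lemma gaussian_density k (Z : 'I_k -> Omega -> R) (Y : Omega -> R) lambda : 0 < lambda ->
  (forall i, H (Z i)) -> H Y -> posdef lambda Z ->
  exists p : 'rV[R]_k -> R, [/\ continuous p,
    forall v, 0 <= p v <= (std_peak / Num.sqrt lambda) ^+ k * expR (cov P Y Y / 2) &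
    forall F : tup k -> \bar R, measurable_fun setT F -> (forall v, 0 <= F v)%E ->
      (\int[P]_w ((expR (Y w))%:E * F [tuple Z i w | i < k]) =
       \int[lebesgue_tuple R k]_v (F v * (p (row_of_tuple v))%:E))%E].
Proof.
move=> l0; elim: k Z Y => [|k IH] Z Y HZ HY pd.
  exists (fun=> expR (cov P Y Y / 2)); split.
  - exact: cst_continuous.
  - by move=> v; rewrite expr0 mul1r /= expR_ge0 lexx.
  - move=> F mF F0; rewrite ge0_integral_lebesgue_tuple0; last first.
      by apply: emeasurable_funM.
    rewrite -(gs_expR gH HY) muleC -ge0_integralZr//; last first.
      by apply/measurable_EFinP; apply: measurableT_comp => //; exact: (gs_measurable gH).
    by apply: eq_integral => w _; congr (_ * F _)%E; rewrite (tuple0 [tuple Z i w | i < 0]).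
pose Z' i := Z (lift ord0 i).
have HZ' i : H (Z' i) by exact: HZ.
have pd' : posdef lambda Z' by exact: posdef_lift.
have [b hb] := gaussian_projection l0 HZ' (HZ ord0) pd'.
pose r w := Z ord0 w - \sum_i b i * Z' i w.
have Hr : H r by apply: (gsB gH) => //; exact: gs_lincomb.
have nr : lambda <= cov P r r by exact: (posdef_residual b l0 pd).
pose l := nrm2 P r.
have sl : Num.sqrt lambda <= l by rewrite /l /nrm2 ler_wsqrtr.
have lp : 0 < l by apply: lt_le_trans sl; rewrite sqrtr_gt0.
have sr := gs_sqint gH Hr.
pose z w := l^-1 * r w.
have Hz : H z by exact: (gsZ _ gH).
have sz := gs_sqint gH Hz.
have nz : nrm2 P z = 1.
  by rewrite nrm2Z// ger0_norm ?invr_ge0 ?(ltW lp)// mulVf// gt_eqF.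
have zZ i : cov P z (Z' i) = 0.
  have -> : z = (fun w => l^-1 * r w + 0) by apply/funext => w; rewrite addr0.
  rewrite covDZl//; first by rewrite hb mulr0 cov0l addr0.
  - exact: sqint0.
  - exact: (gs_sqint gH).
(* The tilt is split as well: its component [y * z] stays in the one-dimensional integral, where
   [expR (y * x) * std_pdf x] is at most [std_peak * expR (y ^+ 2 / 2)], and the rest [Y'] is the
   tilt of the induction. The two variances add up to that of [Y], whence the form of the bound. *)
pose y := cov P Y z.
pose Y' w := - y * z w + Y w.
have HY' : H Y' by exact: (gsDZ gH).
have sY := gs_sqint gH HY.
have Y'z : cov P Y' z = 0.
  by rewrite covDZl// -sqr_nrm2 nz expr1n mulr1 -/y addNr.
have covY : cov P Y Y = y ^+ 2 + cov P Y' Y'.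
  by rewrite cov_sqrDZ// -(sqr_nrm2 P z) nz (covC P z) -/y; ring.
have [p' [cp' bp' hp']] := IH Z' Y' HZ' HY' pd'.
pose tail (v : 'rV[R]_k.+1) : 'rV[R]_k := \row_i v ord0 (lift ord0 i).
pose s (v : 'rV[R]_k.+1) := (v ord0 ord0 - \sum_i b i * v ord0 (lift ord0 i)) / l.
pose g (x : R) := expR (y * x) * std_pdf x.
have g0 x : 0 <= g x by rewrite mulr_ge0 ?expR_ge0 ?std_pdf_ge0.
have gM x : g x <= std_peak * expR (y ^+ 2 / 2).
  rewrite /g std_pdfE mulrCA ler_wpM2l ?(ltW std_peak_gt0)// -expRD ler_expR.
  by have := sqr_ge0 (x - y); rewrite !expr2; lra.
have cg : continuous g.
  move=> x; apply: cvgM; last exact: continuous_std_pdf.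
  apply: continuous_cvg; first exact: continuous_expR.
  by apply: cvgM; [exact: cvg_cst|exact: cvg_id].
have mg : measurable_fun setT g by exact: continuous_measurable_fun.
have cs (v : 'rV[R]_k.+1) (u : nat -> 'rV[R]_k.+1) :
    (forall i, u n ord0 i @[n --> \oo] --> v ord0 i) -> s (u n) @[n --> \oo] --> s v.
  move=> uv; apply: cvgM; last exact: cvg_cst.
  apply: cvgB; first exact: uv.
  apply: cvg_sumr => i; apply: cvgM; [exact: cvg_cst|exact: uv].
exists (fun v => l^-1 * g (s v) * p' (tail v)); split.
- move=> v; apply: continuous_row_seq => u uv.
  apply: cvgM; first apply: cvgM; first exact: cvg_cst.
    by apply: continuous_cvg; [exact: cg|exact: cs].
  apply: continuous_row_cvg; first exact: cp'.
  by move=> i; under eq_fun do rewrite mxE; rewrite mxE; exact: uv.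
- move=> v; have /andP[p0 p1] := bp' (tail v).
  rewrite !(mulr_ge0 (mulr_ge0 _ (g0 _)))//= ?invr_ge0 ?(ltW lp)//.
  rewrite covY mulrDl expRD exprS.
  rewrite [leRHS](_ : _ = (Num.sqrt lambda)^-1 * (std_peak * expR (y ^+ 2 / 2)) *
     ((std_peak / Num.sqrt lambda) ^+ k * expR (cov P Y' Y' / 2))); last by ring.
  apply: ler_pM => //; first by rewrite mulr_ge0// invr_ge0 ltW.
  by apply: ler_pM => //; rewrite ?invr_ge0 ?(ltW lp)// lef_pV2 ?posrE// sqrtr_gt0.
move=> F mF F0.
(* Index 0 carries the tilt [Y'], because [z] has to be independent of [Y'] and [Z'] jointly. *)
pose U (i : 'I_k.+1) : Omega -> R := if unlift ord0 i is Some j then Z' j else Y'.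
pose V (i : 'I_1) : Omega -> R := z.
have HU i : H (U i) by rewrite /U; case: unliftP.
pose B (v : tup k) := \sum_i b i * tnth v i.
have mB : measurable_fun setT B.
  by apply: measurable_sum => i; apply: measurable_funM => //; exact: measurable_tnth.
pose K (q : R * tup k) : \bar R := ((expR (y * q.1))%:E * F [the tup k.+1 of (l * q.1 + B q.2)%R :: q.2])%E.
have mcons (h : R * tup k -> R) : measurable_fun setT h ->
    measurable_fun setT (fun q : R * tup k => F [the tup k.+1 of h q :: q.2]).
  move=> mh; apply: (measurableT_comp mF).
  apply: (measurableT_comp (@measurable_cons_pair _ (measurableTypeR R) k)
    (_ : measurable_fun setT (fun q : R * tup k => (h q : measurableTypeR R, q.2)))).
  by apply: measurable_fun_pair => //; exact: measurable_snd.
have mK : measurable_fun setT K.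
  apply: emeasurable_funM.
    by apply/measurable_EFinP; apply: measurableT_comp => //; exact: measurable_funM.
  apply: mcons; apply: measurable_funD; first exact: measurable_funM.
  by apply: measurableT_comp => //; exact: measurable_snd.
have K0 q : (0 <= K q)%E by rewrite mule_ge0// lee_fin expR_ge0.
pose G (q : tup k.+1 * tup 1) : \bar R :=
  ((expR (tnth q.1 ord0))%:E * K (tnth q.2 ord0, [tuple tnth q.1 (lift ord0 i) | i < k]))%E.
have mG : measurable_fun setT G.
  apply: emeasurable_funM.
    apply/measurable_EFinP; apply: measurableT_comp => //.
    by apply: (measurableT_comp (@measurable_tnth _ _ _ _)); exact: measurable_fst.
  apply: (measurableT_comp mK); apply: measurable_fun_pair.
    by apply: (measurableT_comp (@measurable_tnth _ _ _ _)); exact: measurable_snd.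
  apply: measurable_mktuple => i.
  by apply: (measurableT_comp (@measurable_tnth _ _ _ _)); exact: measurable_fst.
have UV i j : cov P (U i) (V j) = 0.
  by rewrite /U /V; case: unliftP => [i' _|_] //; rewrite covC.
transitivity (\int[P]_w G ([tuple U i w | i < k.+1], [tuple V i w | i < 1]))%E.
  apply: eq_integral => w _; rewrite /G /K /= !tnth_mktuple /U unlift_none muleA -EFinM -expRD.
  congr ((expR _)%:E * F _)%E; first by rewrite /Y' /V; ring.
  apply: eq_from_tnth => i; rewrite tnth_mktuple; case: (unliftP ord0 i) => [j ->|->].
    by rewrite tnthS !tnth_mktuple liftK.
  rewrite tnth0 /z /r /V mulrA divff ?gt_eqF// mul1r; rewrite -[LHS](subrK (\sum_i b i * Z' i w)).
  by congr (_ + _); apply: eq_bigr => i' _; rewrite !tnth_mktuple liftK.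
rewrite (gaussian_independence gH HU (fun=> Hz) UV mG); last first.
  by move=> q; rewrite mule_ge0// lee_fin expR_ge0.
pose L (v : tup k) : \bar R := (\int[lebR]_x (F [the tup k.+1 of x :: v] *
   (l^-1 * g ((x - B v) / l))%:E))%E.
pose KL (q : R * tup k) : \bar R := (F [the tup k.+1 of q.1 :: q.2] * (l^-1 * g ((q.1 - B q.2) / l))%:E)%E.
have mKL : measurable_fun setT KL.
  apply: emeasurable_funM; first by apply: mcons; exact: measurable_fst.
  apply/measurable_EFinP; apply: measurable_funM => //.
  apply: (measurableT_comp mg); apply: measurable_funM => //; apply: measurable_funB => //.
  by apply: measurableT_comp => //; exact: measurable_snd.
have KL0 q : (0 <= KL q)%E by rewrite mule_ge0// lee_fin mulr_ge0// invr_ge0 ltW.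
have mL : measurable_fun setT L.
  exact: (@measurable_fun_fubini_tonelli_G _ _ _ _ _ lebR KL mKL KL0).
have inner v : (\int[P]_w K (z w, v) = L v)%E.
  have mKv : measurable_fun setT (fun x : R => K (x, v)).
    by apply: (measurableT_comp mK); exact: measurable_pair2.
  have -> : (\int[P]_w K (z w, v) = \int[std_normal]_x K (x, v))%E.
    rewrite (gs_law1 gH Hz mKv); last by move=> x; exact: K0.
    by apply: eq_integral => x _; rewrite nz mul1r.
  rewrite integral_std_normal//.
  have mKLv : measurable_fun setT (fun x : R => KL (x, v)).
    by apply: (measurableT_comp mKL); exact: measurable_pair2.
  transitivity (l%:E * \int[lebR]_x KL ((l * x + B v)%R, v))%E.
    rewrite -ge0_integralZl_EFin//; last 2 first.
    + apply: (measurableT_comp mKLv (_ : measurable_fun setT (fun x : R => l * x + B v)%R)).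
      by apply: measurable_funD => //; exact: measurable_funM.
    + by rewrite ltW.
    apply: eq_integral => x _; rewrite /KL /K /= addrK mulrAC divff ?gt_eqF// mul1r.
    rewrite [RHS]muleCA -EFinM mulrA divff ?gt_eqF// mul1r /g EFinM.
    by rewrite [RHS]muleA (muleC (F _)).
  rewrite (ge0_integral_affine (B v) lp mKLv); last by move=> x; exact: KL0.
  by rewrite muleA -EFinM divff ?gt_eqF// mul1e.
transitivity (\int[P]_w ((expR (Y' w))%:E * L [tuple Z' i w | i < k]))%E.
  apply: eq_integral => w _.
  pose f w' := K (z w', [tuple Z' i w | i < k]).
  have mf : measurable_fun setT f.
    apply: (measurableT_comp mK (_ : measurable_fun setT (fun w' => (z w', [tuple Z' i w | i < k])))).
    by apply: measurable_fun_pair => //; exact: (gs_measurable gH).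
  have f0 w' : setT w' -> (0 <= f w')%E by move=> _; exact: K0.
  transitivity ((expR (Y' w))%:E * \int[P]_w' f w')%E; last by rewrite /f inner.
  rewrite -(ge0_integralZl_EFin P measurableT f0 mf (expR_ge0 (Y' w))).
  apply: eq_integral => w' _; rewrite /G /= !tnth_mktuple /U unlift_none.
  congr (_ * K (_, _))%E.
  by apply: eq_from_tnth => i; rewrite !tnth_mktuple liftK.
rewrite hp'//; last by move=> v; apply: integral_ge0 => x _; exact: KL0 (x, v).
have mrow : measurable_fun setT (fun v : tup k => p' (row_of_tuple v)) by exact: measurable_continuous_row.
have p'0 v : 0 <= p' v by case/andP: (bp' v).
pose Q (q : R * tup k) : \bar R := (KL q * (p' (row_of_tuple q.2))%:E)%E.
have mQ : measurable_fun setT Q.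
  apply: emeasurable_funM => //; apply/measurable_EFinP.
  by apply: (measurableT_comp mrow); exact: measurable_snd.
have Q0 q : (0 <= Q q)%E by rewrite mule_ge0// lee_fin.
transitivity (\int[lebesgue_tuple R k]_v \int[lebR]_x Q (x, v))%E.
  apply: eq_integral => v _.
  have mv : measurable_fun setT (fun x : measurableTypeR R => KL (x, v)).
    by apply: (measurableT_comp mKL); exact: measurable_pair2.
  have v0 (x : measurableTypeR R) : setT x -> (0 <= KL (x, v))%E by move=> _; exact: KL0.
  by symmetry; rewrite /Q /=; apply: (ge0_integralZr lebR measurableT mv v0); rewrite lee_fin.
rewrite -(lebesgue_tuple_fubini mQ Q0) [RHS]ge0_integral_lebesgue_tupleS//.
- apply: eq_integral => x _; apply: eq_integral => v _.
  rewrite /Q /KL /= -muleA -EFinM; congr (F _ * (l^-1 * g (_ / l) * p' _)%:E)%E.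
    rewrite !mxE tnth0; congr (_ - _); apply: eq_bigr => i _; rewrite !mxE tnthS//.
  by apply/rowP => i; rewrite !mxE tnthS.
- apply: emeasurable_funM => //; apply/measurable_EFinP; apply: measurable_funM.
    apply: measurable_funM => //; apply: (measurableT_comp mg).
    apply: measurable_funM => //; apply: measurable_funB.
      by under eq_fun do rewrite mxE; exact: measurable_tnth.
    apply: measurable_sum => i; apply: measurable_funM => //.
    by under eq_fun do rewrite mxE; exact: measurable_tnth.
  have -> : (fun v : tup k.+1 => p' (tail (row_of_tuple v))) =
      (fun v : tup k => p' (row_of_tuple v)) \o (fun v : tup k.+1 => [tuple tnth v (lift ord0 i) | i < k]).
    by apply/funext => v /=; congr p'; apply/rowP => i; rewrite !mxE tnth_mktuple.
  by apply: measurableT_comp => //; apply: measurable_mktuple => i; exact: measurable_tnth.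
- move=> v; rewrite mule_ge0// lee_fin mulr_ge0//.
  by apply: mulr_ge0 (g0 _); rewrite invr_ge0 ltW.
Qed.

End gaussian_density.

Section gaussian_exponential.
Context {d} {Omega : measurableType d} {R : realType} (P : probability Omega R).
Context (H : set (Omega -> R)) (gH : gaussian_space P H).

(** The term whose signs are those of the [x i] already suffices. The bound turns exponentials of
    absolute values into exponentials of linear combinations, whose Gaussian means are explicit. *)
Lemma expR_sum_norm_le n (x : 'I_n -> R) :
  expR (\sum_i `|x i|) <= \sum_(s : {ffun 'I_n -> bool}) expR (\sum_i (-1) ^+ s i * x i).
Proof.
pose s0 : {ffun 'I_n -> bool} := [ffun i => x i < 0].
rewrite (bigD1 s0)//= -[leLHS]addr0 lerD//; last first.
  by apply: sumr_ge0 => s _; exact: expR_ge0.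
rewrite ler_expR ler_sum// => i _; rewrite ffunE; case: ltP => h.
  by rewrite ltr0_norm// expr1 mulN1r.
by rewrite ger0_norm// expr0 mul1r.
Qed.

Lemma integrable_expR_sum_norm n (W : 'I_n -> Omega -> R) : (forall i, H (W i)) ->
  P.-integrable setT (fun w => (expR (\sum_i `|W i w|))%:E).
Proof.
move=> HW; have mW i := gs_measurable gH (HW i).
have mS : measurable_fun setT (fun w => expR (\sum_i `|W i w|)).
  apply: measurableT_comp => //; apply: measurable_sum => i.
  exact: measurableT_comp.
apply: (@le_integrable _ _ _ P setT measurableT _
  (fun w => \sum_(s : {ffun 'I_n -> bool}) (expR (\sum_i (-1) ^+ s i * W i w))%:E)%E).
- exact/measurable_EFinP.
- move=> w _; rewrite sumEFin /= lee_fin ger0_norm ?expR_ge0// ger0_norm; last first.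
    by apply: sumr_ge0 => s _; exact: expR_ge0.
  exact: expR_sum_norm_le.
- apply: integrable_sum => // s _; have HS := gs_lincomb gH (fun i => (-1) ^+ s i) HW.
  apply/integrableP; split.
    by apply/measurable_EFinP; apply: measurableT_comp => //; exact: (gs_measurable gH).
  under eq_integral do rewrite /= ger0_norm ?expR_ge0//.
  by rewrite (gs_expR gH HS) ltry.
Qed.

Lemma gs_prob f (A : set (measurableTypeR R)) : H f -> measurable A ->
  (P (f @^-1` A) = std_normal ((fun x : measurableTypeR R => (nrm2 P f * x)%R : measurableTypeR R) @^-1` A))%E.
Proof.
move=> Hf mA; have mf := gs_measurable gH Hf.
have m1 : measurable_fun setT (fun x : measurableTypeR R => (\1_A x : R)%:E).
  by apply/measurable_EFinP; exact: measurable_indic.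
have mg : measurable_fun setT (fun x : measurableTypeR R => (nrm2 P f * x)%R : measurableTypeR R).
  exact: measurable_funM.
have := gs_law1 gH Hf m1 (fun x => _).
have -> : (\int[P]_w (\1_A (f w))%:E = P (f @^-1` A))%E.
  by rewrite (@integral_indic _ _ _ P setT measurableT (f @^-1` A))// ?setIT// -[X in measurable X]setTI; exact: mf.
have -> : (\int[std_normal]_x (\1_A (nrm2 P f * x)%R)%:E =
   std_normal ((fun x : measurableTypeR R => (nrm2 P f * x)%R : measurableTypeR R) @^-1` A))%E.
  pose g (x : measurableTypeR R) : measurableTypeR R := (nrm2 P f * x)%R.
  by rewrite (@integral_indic _ _ _ std_normal setT measurableT (g @^-1` A))// ?setIT// -[X in measurable X]setTI; exact: mg.
by apply=> x; rewrite lee_fin.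
Qed.

(** Needed for thresholds: the indicator of [u <= f] is discontinuous only where [f] equals [u]. *)
Lemma gs_noatom f (c : R) : H f -> nrm2 P f != 0 -> {ae P, forall w, f w != c}.
Proof.
move=> Hf n0; have mf := gs_measurable gH Hf.
have mA : measurable (f @^-1` [set c]) by rewrite -[X in measurable X]setTI; exact: mf.
apply: (@negligibleS _ _ _ P (f @^-1` [set c])).
  by move=> w /= /negP; rewrite negbK => /eqP.
apply/negligibleP => //; apply: (eq_trans (gs_prob Hf (measurable_set1 c))).
have -> : (fun x : measurableTypeR R => (nrm2 P f * x)%R : measurableTypeR R) @^-1` [set c] =
   [set c / nrm2 P f].
  by rewrite predeqE => x /=; split => [<-|->]; field.
have /null_content_dominatesP := @normal_prob_dominates R 0 1; apply => //.
exact: lebesgue_measure_set1.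
Qed.

End gaussian_exponential.

Section gaussian_regression.
Context {d} {Omega : measurableType d} {R : realType} (P : probability Omega R).
Context (H : set (Omega -> R)) (gH : gaussian_space P H).
Local Notation tup m := (m.-tuple (measurableTypeR R)).
Context {n k : nat} (V : 'I_n.+1 -> Omega -> R) (Z : 'I_k -> Omega -> R) (lambda C u : R).
Context (D : tup n.+1 -> R).
Hypotheses (l0 : 0 < lambda) (HV : forall i, H (V i)) (HZ : forall i, H (Z i)).
Hypothesis pd : posdef P lambda (fun i : 'I_k.+1 => if unlift ord0 i is Some j then Z j else V ord0).
Hypothesis mD : measurable_fun setT D.
Hypothesis DC : forall v, `|D v| <= C * expR (\sum_i `|tnth v i|).
Hypothesis cD : forall (v_ : nat -> tup n.+1) v,
  (forall i, tnth (v_ m) i @[m --> \oo] --> tnth v i) -> D (v_ m) @[m --> \oo] --> D v.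

Let Psi (v : tup n.+1) : R := D v * (u <= tnth v ord0)%R%:R.
Let Zr w : 'rV[R]_k := \row_i Z i w.

Let mPsi : measurable_fun setT Psi.
Proof.
apply: measurable_funM => //.
have -> : (fun v : tup n.+1 => (u <= tnth v ord0)%R%:R : R) = \1_([set v | u <= tnth v ord0]).
  by apply/funext => v; rewrite indicE; case: (boolP (u <= tnth v ord0)%R) => h;
    [rewrite mem_set|rewrite memNset//=; exact/negP].
apply: measurable_indic; rewrite -[X in measurable X]setTI.
rewrite (_ : [set v | _] = (fun v : tup n.+1 => tnth v ord0) @^-1` `[u, +oo[%classic); last first.
  by rewrite predeqE => v /=; rewrite in_itv/= andbT.
exact: measurable_tnth.
Qed.

Let PsiC v : `|Psi v| <= C * expR (\sum_i `|tnth v i|).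
Proof.
apply: le_trans (DC v); rewrite normrM ler_piMr// ger0_norm//.
by case: (u <= tnth v ord0)%R; rewrite ?lexx ?ler01.
Qed.

(* Conditioning on [Z] amounts to integrating over the residuals of the projections on [Z], which
   are independent of [Z]. *)
Lemma gaussian_regression : exists phi : 'rV[R]_k -> R,
  [/\ continuous phi, P.-integrable setT (fun w => (Psi [tuple V i w | i < n.+1])%:E) &
  forall B, borel B ->
    (\int[P]_(w in Zr @^-1` B) (Psi [tuple V i w | i < n.+1])%:E =
     \int[P]_(w in Zr @^-1` B) (phi (Zr w))%:E)%E].
Proof.
have pdZ : posdef P lambda Z.
  have := posdef_lift pd; rewrite /=; congr posdef; apply/funext => i.
  by rewrite liftK.
have /choice[A hA] : forall j : 'I_n.+1, exists a : 'I_k -> R,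
    forall i, cov P (fun w => V j w - \sum_i a i * Z i w) (Z i) = 0.
  by move=> j; exact: (gaussian_projection gH l0 HZ (HV j) pdZ).
pose W j w := V j w - \sum_i A j i * Z i w.
have HW j : H (W j) by apply: (gsB gH) => //; exact: (gs_lincomb gH).
have mW j := gs_measurable gH (HW j); have mZ i := gs_measurable gH (HZ i).
(* Joint nondegeneracy of [V ord0] and [Z] leaves a nonzero residual of [V ord0]. It has no atom, so
   the indicator of the level varies continuously in the conditioning value for almost every
   residual. *)
have W0 : nrm2 P (W ord0) != 0.
  have := posdef_residual (A ord0) l0 pd; rewrite /= unlift_none.
  under eq_fun do under eq_bigr do rewrite liftK.
  rewrite -/(W ord0) => h; rewrite /nrm2 gt_eqF// sqrtr_gt0; exact: lt_le_trans h.
(* [q] rebuilds [V] from a value of [Z] and the residuals; averaging over the residuals with the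
   value frozen at [z] defines the regression [phi z]. *)
pose q (z : tup k) (t : tup n.+1) : tup n.+1 :=
  [tuple tnth t j + \sum_i A j i * tnth z i | j < n.+1].
pose S (w : Omega) : tup n.+1 := [tuple W j w | j < n.+1].
pose T (w : Omega) : tup k := [tuple Z i w | i < k].
have mS : measurable_fun setT S by exact: measurable_mktuple.
have mT : measurable_fun setT T by exact: measurable_mktuple.
have qV w : q (T w) (S w) = [tuple V i w | i < n.+1].
  apply: eq_from_tnth => j; rewrite !tnth_mktuple /W -[RHS](subrK (\sum_i A j i * Z i w)).
  by congr (_ + _); apply: eq_bigr => i _; rewrite tnth_mktuple.
have mq : measurable_fun setT (fun zt : tup k * tup n.+1 => q zt.1 zt.2).
  apply: measurable_mktuple => j; apply: measurable_funD.
    by apply: (measurableT_comp (@measurable_tnth _ _ _ _)); exact: measurable_snd.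
  apply: measurable_sum => i; apply: measurable_funM => //.
  by apply: (measurableT_comp (@measurable_tnth _ _ _ _)); exact: measurable_fst.
pose a (z : 'rV[R]_k) := \sum_j `|\sum_i A j i * z ord0 i|.
pose E w := expR (\sum_j `|W j w|).
have mE : measurable_fun setT E.
  by apply: measurableT_comp => //; apply: measurable_sum => j; exact: measurableT_comp.
have iE : P.-integrable setT (EFin \o E) by exact: (integrable_expR_sum_norm gH HW).
pose tz (z : 'rV[R]_k) : tup k := [tuple z ord0 i | i < k].
have C0 : 0 <= C.
  have := le_trans (normr_ge0 _) (DC [tuple 0 | i < n.+1]).
  by rewrite pmulr_lge0// expR_gt0.
have bq z w : `|Psi (q (tz z) (S w))| <= C * expR (a z) * E w.
  apply: le_trans (PsiC _) _; rewrite -mulrA ler_wpM2l// -expRD ler_expR -big_split/=.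
  apply: ler_sum => j _; rewrite !tnth_mktuple addrC; apply: le_trans (ler_normD _ _) _.
  rewrite lerD2l le_eqVlt; apply/orP; left; apply/eqP; congr `|_|.
  by apply: eq_bigr => i _; rewrite tnth_mktuple.
have mPz z : measurable_fun setT (fun w => Psi (q z (S w))).
  apply: (measurableT_comp mPsi); apply: (measurableT_comp mq (_ : measurable_fun setT (fun w => (z, S w)))).
  exact: measurable_fun_pair.
have iPz z : P.-integrable setT (fun w => (Psi (q (tz z) (S w)))%:E).
  have := integrableZl measurableT (C * expR (a z)) iE; apply: le_integrable => //.
    exact/measurable_EFinP.
  move=> w _; rewrite /= lee_fin; apply: le_trans (bq z w) _; exact: ler_norm.
pose phi z := \int[P]_w Psi (q (tz z) (S w)).
have iV : P.-integrable setT (fun w => (Psi [tuple V i w | i < n.+1])%:E).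
  have := integrableZl measurableT C (integrable_expR_sum_norm gH HV).
  apply: le_integrable => //; first by apply/measurable_EFinP; exact: (measurableT_comp mPsi (measurable_mktuple (fun i => gs_measurable gH (HV i)))).
  move=> w _; rewrite /= lee_fin; apply: le_trans (PsiC _) _; apply: le_trans (ler_norm _).
  suff -> : \sum_i `|tnth [tuple V i w | i < n.+1] i| = \sum_i `|V i w| by [].
  by apply: eq_bigr => i _; rewrite tnth_mktuple.
exists phi; split => //.
  move=> z; apply: continuous_row_seq => z_ zz.
  have ca : a (z_ m) @[m --> \oo] --> a z.
    apply: cvg_sumr => j; apply: cvg_norm; apply: cvg_sumr => i.
    by apply: cvgM; [exact: cvg_cst|exact: zz].
  have [M hM] : exists M, forall m, a (z_ m) <= M.
    have /cvg_seq_bounded[M [_ hM]] : cvgn (a \o z_) by apply/cvg_ex; exists (a z).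
    exists (M + 1) => m; apply: le_trans (ler_norm _) _; apply: (hM (M + 1)) => //.
    by rewrite ltrDl.
  rewrite /phi /Rintegral; apply: fine_cvg; rewrite fineK; last exact: integrable_fin_num.
  have [] := @dominated_convergence _ _ _ P setT measurableT
    (fun m w => (Psi (q (tz (z_ m)) (S w)))%:E) (fun w => (Psi (q (tz z) (S w)))%:E)
    (fun w => (C * expR M * E w)%:E) => //.
  - by move=> m; exact/measurable_EFinP.
  - exact/measurable_EFinP.
  - have := gs_noatom gH (u - \sum_i A ord0 i * z ord0 i) (HW ord0) W0.
    apply: filterS => w hw _; apply: cvg_EFin; first exact: nearW.
    have cq j : tnth (q (tz (z_ m)) (S w)) j @[m --> \oo] --> tnth (q (tz z) (S w)) j.
      rewrite tnth_mktuple; under eq_fun do rewrite tnth_mktuple; apply: cvgD; first exact: cvg_cst.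
      apply: cvg_sumr => i; rewrite tnth_mktuple; under eq_fun do rewrite tnth_mktuple.
      by apply: cvgM; [exact: cvg_cst|exact: zz].
    apply: cvgM; first exact: cD.
    have ne : tnth (q (tz z) (S w)) ord0 != u.
      rewrite !tnth_mktuple; apply: contra hw => /eqP <-.
      by under [X in _ + X - _]eq_bigr do rewrite tnth_mktuple; rewrite addrK.
    have := cq ord0; set x := tnth _ ord0 in ne *; move=> cx.
    apply: cvg_near_cst; case: (ltgtP x u) ne => // h _.
    + have /cvgr_lt/(_ u h) := cx; by apply: filterS => m; rewrite ltNge => /negbTE ->.
    + have /cvgr_gt/(_ u h) := cx; by apply: filterS => m /ltW ->.
  - have := integrableZl measurableT (C * expR M) iE; exact.
  - apply: aeW => w m _; rewrite /= lee_fin; apply: le_trans (bq _ _) _.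
    rewrite ler_wpM2r ?expR_ge0// ler_wpM2l// ler_expR//.
(* Independence is available for nonnegative integrands, so the positive and the negative part of
   [Psi] are treated apart, with [s = 1] and [s = -1]. *)
pose G (s : R) (z : tup k) : \bar R := (\int[P]_w' (Num.max 0 (s * Psi (q z (S w'))))%:E)%E.
move=> B bB; have mB := measurable_row_of_tuple_borel bB.
have ZB : Zr @^-1` B = T @^-1` (row_of_tuple @^-1` B).
  by rewrite predeqE => w /=; have -> : Zr w = row_of_tuple (T w)
    by apply/rowP => i; rewrite !mxE tnth_mktuple.
have mZB : measurable (Zr @^-1` B) by rewrite ZB -[X in measurable X]setTI; exact: mT.
have mPs (s : R) : measurable_fun setT (fun v => Num.max 0 (s * Psi v)).
  by apply: measurable_maxr => //; exact: measurable_funM.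
have key (s : R) : (\int[P]_(w in Zr @^-1` B) (Num.max 0 (s * Psi [tuple V i w | i < n.+1]))%:E =
    \int[P]_(w in Zr @^-1` B) G s (T w))%E.
  pose F (zt : tup k * tup n.+1) : \bar R :=
    ((\1_(row_of_tuple @^-1` B) zt.1 : R) * Num.max 0 (s * Psi (q zt.1 zt.2)))%:E.
  have mF : measurable_fun setT F.
    apply/measurable_EFinP; apply: measurable_funM.
      by apply: measurableT_comp; [exact: measurable_indic|exact: measurable_fst].
    exact: (measurableT_comp (mPs s) mq).
  have F0 zt : (0 <= F zt)%E by rewrite lee_fin mulr_ge0// le_max lexx.
  have cZW i j : cov P (Z i) (W j) = 0 by rewrite covC hA.
  rewrite [LHS]integral_mkcond [RHS]integral_mkcond.
  apply: (eq_trans (eq_trans _ (gaussian_independence gH HZ HW cZW mF F0))).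
    apply: eq_integral => w _; rewrite /F /patch -/(T w) -/(S w) qV indicE.
    have -> : (w \in Zr @^-1` B) = (T w \in (row_of_tuple : tup k -> _) @^-1` B).
      by rewrite ZB; apply/idP/idP; rewrite !inE.
    by case: ifPn => h; rewrite ?mul1r ?mul0r.
  apply: eq_integral => w _; rewrite /F /patch -/(T w) /=.
  have -> : (w \in Zr @^-1` B) = (T w \in (row_of_tuple : tup k -> _) @^-1` B).
    by rewrite ZB; apply/idP/idP; rewrite !inE.
  case: ifPn => h; first by apply: eq_integral => w' _; rewrite indicE h mul1r.
  under eq_integral do rewrite indicE (negbTE h) mul0r.
  by rewrite integral0.
have Gfin s z : P.-integrable setT (fun w => (Num.max 0 (s * Psi (q (tz z) (S w))))%:E).
  have := integrableZl measurableT s (iPz z); apply: le_integrable => //.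
    by apply/measurable_EFinP; apply: measurable_maxr => //; exact: measurable_funM.
  move=> w _; rewrite -EFinM !abse_EFin lee_fin [leLHS]ger0_norm ?le_max ?lexx//.
  by rewrite ge_max normr_ge0 ler_norm.
have mPsq (s : R) : measurable_fun setT (fun w => Num.max 0 (s * Psi [tuple V i w | i < n.+1])).
  exact: (measurableT_comp (mPs s) (measurable_mktuple (fun i => gs_measurable gH (HV i)))).
have iPs (s : R) : P.-integrable setT (fun w => (Num.max 0 (s * Psi [tuple V i w | i < n.+1]))%:E).
  have := integrableZl measurableT s iV; apply: le_integrable => //; first exact/measurable_EFinP.
  move=> w _; rewrite -EFinM !abse_EFin lee_fin [leLHS]ger0_norm ?le_max ?lexx//.
  by rewrite ge_max normr_ge0 ler_norm.
have mG s : measurable_fun setT (G s).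
  pose F (zt : tup k * tup n.+1) : \bar R := (Num.max 0 (s * Psi (q zt.1 zt.2)))%:E.
  have mF : measurable_fun setT (fun zw : tup k * Omega => (Num.max 0 (s * Psi (q zw.1 (S zw.2))))%:E).
    apply/measurable_EFinP; apply: (measurableT_comp (mPs s)).
    apply: (measurableT_comp mq (_ : measurable_fun setT (fun zw : tup k * Omega => (zw.1, S zw.2)))).
    apply: measurable_fun_pair; first exact: measurable_fst.
    by apply: (measurableT_comp mS); exact: measurable_snd.
  apply: (@measurable_fun_fubini_tonelli_F _ _ _ _ _ P _ mF) => zw.
  by rewrite lee_fin le_max lexx.
have G0 s z : (0 <= G s z)%E by apply: integral_ge0 => w _; rewrite lee_fin le_max lexx.
have iG s : P.-integrable (Zr @^-1` B) (fun w => G s (T w)).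
  apply/integrableP; split.
    by apply: measurable_funTS; exact: (measurableT_comp (mG s) mT).
  under eq_integral do rewrite gee0_abs//.
  rewrite -key; have /integrableP[_] := integrableS measurableT mZB (@subsetT _ _) (iPs s).
  apply: le_lt_trans; apply: ge0_le_integral => //.
  - by move=> w _; rewrite lee_fin le_max lexx.
  - by apply: measurable_funTS; exact/measurable_EFinP.
  - by apply: measurable_funTS; apply: measurableT_comp => //; exact/measurable_EFinP.
  - by move=> w _; exact: lee_abs.
have dec (x : R) : x = Num.max 0 (1 * x) - Num.max 0 (-1 * x).
  by rewrite mul1r mulN1r; case: (leP 0 x) => h; [rewrite max_l ?subr0|rewrite max_r ?opprK ?sub0r//]; lra.
transitivity (\int[P]_(w in Zr @^-1` B) (Num.max 0 (1 * Psi [tuple V i w | i < n.+1]))%:E -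
   \int[P]_(w in Zr @^-1` B) (Num.max 0 (-1 * Psi [tuple V i w | i < n.+1]))%:E)%E.
  rewrite -integralB//; last 2 first.
  - exact: (integrableS measurableT mZB (@subsetT _ _) (iPs 1)).
  - exact: (integrableS measurableT mZB (@subsetT _ _) (iPs (-1))).
  by apply: eq_integral => w _; rewrite [in LHS](dec (Psi _)).
rewrite !key -integralB//; apply: eq_integral => w _.
have tzw : tz (Zr w) = T w by apply: eq_from_tnth => i; rewrite !tnth_mktuple mxE.
rewrite /phi tzw /Rintegral fineK; last by rewrite -tzw; exact: integrable_fin_num.
rewrite /G -integralB//; [|by rewrite -tzw..].
by apply: eq_integral => w' _; rewrite [in RHS](dec (Psi _)).
Qed.

End gaussian_regression.

(** * Rare events *)

Section mass.
Context {d} {Omega : measurableType d} {R : realType} (P : probability Omega R).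
Implicit Types (q : Omega -> R) (A B : set Omega).

Definition weight q := measurable_fun setT q /\ forall w, 0 <= q w.

Definition above (f : Omega -> R) x : set Omega := [set w | x <= f w].

Definition mass q A : \bar R := (\int[P]_(w in A) (q w)%:E)%E.

Lemma mass_ge0 q A : weight q -> (0 <= mass q A)%E.
Proof. by move=> [_ q0]; apply: integral_ge0 => w _; rewrite lee_fin. Qed.

Lemma mass_indic q A : mass q A = (\int[P]_w (q w * \1_A w)%:E)%E.
Proof.
rewrite /mass integral_mkcond; apply: eq_integral => w _.
by rewrite /patch indicE; case: ifPn => _; rewrite ?mulr1 ?mulr0.
Qed.

Lemma weight_indic q A : weight q -> measurable A -> weight (fun w => q w * \1_A w).
Proof.
move=> [mq q0] mA; split=> [|w]; last by rewrite mulr_ge0.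
by apply: measurable_funM => //; exact: measurable_indic.
Qed.

Lemma mass_le q A B : weight q -> measurable A -> measurable B -> A `<=` B ->
  (mass q A <= mass q B)%E.
Proof.
move=> [mq q0] mA mB AB; apply: ge0_subset_integral => //.
  by apply: measurable_funTS; exact/measurable_EFinP.
by move=> w _; rewrite lee_fin.
Qed.

Lemma le_indic_exists (I : Type) (A : I -> set Omega) i w : A i w ->
  \1_(\bigcup_i A i) w = \1_(A i) w :> R.
Proof. by move=> Aw; rewrite !indicE !mem_set//; exists i. Qed.

Lemma mass_bigcup q (A : nat -> set Omega) : weight q -> (forall n, measurable (A n)) ->
  (mass q (\bigcup_n A n) <= \sum_(0 <= n <oo) mass q (A n))%E.
Proof.
move=> wq mA; have [mq q0] := wq; rewrite mass_indic.
under eq_eseriesr do rewrite mass_indic.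
have w0 n w : (0 <= (q w * \1_(A n) w)%:E)%E by rewrite lee_fin mulr_ge0.
rewrite -integral_nneseries//; last first.
  by move=> n; apply/measurable_EFinP; case: (weight_indic wq (mA n)).
apply: ge0_le_integral => //.
- by move=> w _; rewrite lee_fin mulr_ge0.
- have mU : measurable (\bigcup_n A n) by exact: bigcupT_measurable.
  by apply/measurable_EFinP; case: (weight_indic wq mU).
- apply: ge0_emeasurable_sum => // n _.
  by apply/measurable_EFinP; case: (weight_indic wq (mA n)).
move=> w _; have [[n _ Aw]|nA] := pselect ((\bigcup_n A n) w).
  rewrite (le_indic_exists Aw); apply: le_trans (nneseries_lim_ge n.+1 _); last by [].
  by rewrite big_nat_recr//= leeDr// sume_ge0.
by rewrite [X in (X%:E <= _)%E](_ : _ = 0) ?nneseries_ge0// indicE memNset ?mulr0.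
Qed.

Lemma mass_fin_bigcup q (I : finType) (A : I -> set Omega) : weight q ->
  (forall i, measurable (A i)) ->
  (mass q (\bigcup_i A i) <= \sum_i mass q (A i))%E.
Proof.
move=> wq mA; have [mq q0] := wq; rewrite mass_indic.
under eq_bigr do rewrite mass_indic.
have w0 i w : (0 <= (q w * \1_(A i) w)%:E)%E by rewrite lee_fin mulr_ge0.
have mU : measurable (\bigcup_i A i) by apply: fin_bigcup_measurable => //; exact: finite_finset.
rewrite -ge0_integral_sum//; last first.
  by move=> i; apply/measurable_EFinP; case: (weight_indic wq (mA i)).
apply: ge0_le_integral => //.
- by move=> w _; rewrite lee_fin mulr_ge0.
- by apply/measurable_EFinP; case: (weight_indic wq mU).
- apply: emeasurable_sum => i.
  by apply/measurable_EFinP; case: (weight_indic wq (mA i)).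
move=> w _; have [[i _ Aw]|nA] := pselect ((\bigcup_i A i) w).
  by rewrite (le_indic_exists Aw) (bigD1 i)//= leeDl// sume_ge0.
by rewrite [X in (X%:E <= _)%E](_ : _ = 0) ?sume_ge0// indicE memNset ?mulr0.
Qed.

Lemma massU q A B : weight q -> measurable A -> measurable B ->
  (mass q (A `|` B) <= mass q A + mass q B)%E.
Proof.
move=> wq mA mB; have mI (b : bool) : measurable (if b then A else B) by case: b.
have := mass_fin_bigcup wq mI; rewrite big_bool; apply: le_trans.
apply: mass_le => //; first exact: measurableU.
- by apply: fin_bigcup_measurable => //; exact: finite_finset.
- by move=> w [h|h]; [exists true|exists false].
Qed.

End mass.

Section rare.
Context {d} {Omega : measurableType d} {R : realType} (P : probability Omega R).
Context (H : set (Omega -> R)) (gH : gaussian_space P H).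

(** Against the weight, [expR Y] may cost as much as if the standard deviation of [Y] were larger by
    [c]. The constant weight has [C = 1] and [c = 0]; the smoothed counts of critical points have
    constants that depend neither on [eps] nor on the point. *)
Definition subgaussian (C c : R) (q : Omega -> R) := weight q /\ forall Y, H Y ->
  (\int[P]_w (expR (Y w) * q w)%:E <= (C * expR ((nrm2 P Y + c) ^+ 2 / 2))%:E)%E.

Lemma measurable_above (f : Omega -> R) x : measurable_fun setT f ->
  measurable (above f x).
Proof.
move=> mf; rewrite -[X in measurable X]setTI.
rewrite (_ : above f x = f @^-1` `[x, +oo[%classic); first exact: mf.
by rewrite predeqE => w /=; rewrite in_itv/= andbT.
Qed.

(** Chernoff's bound with the parameter [x / s ^+ 2], the optimal one for a Gaussian variable of
    standard deviation [s]. The shift [c] only adds terms of lower order in [x / s]. *)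
Lemma subgaussian_tail C c q f s x : subgaussian C c q -> H f -> 0 <= C -> 0 <= c -> 0 <= x ->
  0 < s -> nrm2 P f <= s ->
  (mass P q (above f x) <=
   (C * expR (- (x / s) ^+ 2 / 2 + c * (x / s) + c ^+ 2 / 2))%:E)%E.
Proof.
move=> [[mq q0] sq] Hf C0 c0 x0 s0 fs; have mf := gs_measurable gH Hf.
pose l := x / s ^+ 2; have l0 : 0 <= l by rewrite divr_ge0// sqr_ge0.
rewrite mass_indic.
have mE : measurable_fun setT (fun w => expR (l * f w) * q w).
  apply: measurable_funM => //; apply: measurableT_comp => //; exact: measurable_funM.
apply: (@le_trans _ _ (\int[P]_w ((expR (- (l * x)))%:E * (expR (l * f w) * q w)%:E))%E).
  apply: ge0_le_integral => //.
  - by move=> w _; rewrite lee_fin mulr_ge0.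
  - apply/measurable_EFinP; apply: measurable_funM => //; apply: measurable_indic.
    exact: measurable_above.
  - by apply: emeasurable_funM => //; exact/measurable_EFinP.
  move=> w _; rewrite -EFinM lee_fin mulrA -expRD mulrC.
  rewrite indicE; case: (boolP (w \in _)); rewrite ?mul0r ?mul1r; last first.
    by move=> _; rewrite mulr_ge0// expR_ge0.
  rewrite inE /= => xf; rewrite ler_peMl// -[leLHS]expR0 ler_expR.
  by rewrite addrC subr_ge0 ler_wpM2l.
rewrite ge0_integralZl_EFin ?expR_ge0//; last 2 first.
- by move=> w _; rewrite lee_fin mulr_ge0// expR_ge0.
- exact/measurable_EFinP.
have := sq _ (gsZ l gH Hf); rewrite (nrm2Z _ (gs_sqint gH Hf)) ger0_norm// => h.
apply: (@le_trans _ _ ((expR (- (l * x)))%:E * (C * expR ((l * nrm2 P f + c) ^+ 2 / 2))%:E)%E).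
  by apply: lee_wpmul2l => //; rewrite lee_fin expR_ge0.
rewrite -EFinM lee_fin mulrCA ler_wpM2l// -expRD ler_expR.
have h1 : l * nrm2 P f <= x / s.
  by rewrite /l expr2 invfM mulrA -mulrA ler_piMr ?divr_ge0 ?(ltW s0)// mulrC ler_pdivrMr// mul1r.
have h2 : (l * nrm2 P f + c) ^+ 2 <= (x / s + c) ^+ 2.
  have y0 : 0 <= x / s by rewrite divr_ge0// ltW.
  have z0 : 0 <= l * nrm2 P f by rewrite mulr_ge0 ?nrm2_ge0.
  by rewrite ler_pXn2r ?nnegrE ?addr_ge0// lerD2r.
have -> : l * x = (x / s) ^+ 2 by rewrite /l expr_div_n; field; exact: lt0r_neq0.
by set y := x / s in h2 *; rewrite sqrrD in h2; lra.
Qed.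

Lemma subgaussian1 : subgaussian 1 0 (cst 1).
Proof.
split; first by split.
move=> Y HY; under eq_integral do rewrite mulr1.
by rewrite (gs_expR gH HY) addr0 mul1r sqr_nrm2.
Qed.

(* Uniformity over the weights is what allows a bound on the mean of the approximate number of
   critical points on such an event. *)
Definition rare (s2 : R) (B : R -> set Omega) := (forall u, measurable (B u)) /\
  exists2 alpha : R, 0 < alpha & forall C c : R, 0 <= C -> 0 <= c -> exists2 A : R, 0 <= A &
    forall q, subgaussian C c q -> forall u, 1 <= u ->
      (mass P q (B u) <= (A * expR (- u ^+ 2 / (2 * s2) - alpha * u ^+ 2))%:E)%E.

Lemma rare_tail s2 f : 0 < s2 -> H f -> cov P f f < s2 -> rare s2 (above f).
Proof.
move=> s20 Hf fs; have mf := gs_measurable gH Hf.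
split; first by move=> u; exact: measurable_above.
pose v := (cov P f f + s2) / 2; have cf := cov_ge0 P f.
have v0 : 0 < v by rewrite /v; lra.
have fv : cov P f f < v by rewrite /v; lra.
have vs : v < s2 by rewrite /v; lra.
pose s := Num.sqrt v; have s0 : 0 < s by rewrite sqrtr_gt0.
have s2v : s ^+ 2 = v by rewrite sqr_sqrtr// ltW.
(* The gap between [u ^+ 2 / (2 * v)] and [u ^+ 2 / (2 * s2)] is [2 * alpha * u ^+ 2]. One half is
   kept as the gain, the other absorbs the linear term [c * (u / s)] of the tail bound. *)
pose alpha := (v^-1 - s2^-1) / 4.
have a0 : 0 < alpha by rewrite divr_gt0// subr_gt0 ltf_pV2.
exists alpha => // C c C0 c0; exists (C * expR (c ^+ 2 / (4 * alpha * v) + c ^+ 2 / 2)).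
  by rewrite mulr_ge0 ?expR_ge0.
move=> q sq u u1; have u0 : 0 <= u by lra.
have fs' : nrm2 P f <= s by rewrite /nrm2 ler_wsqrtr// ltW.
apply: le_trans (subgaussian_tail sq Hf C0 c0 u0 s0 fs') _.
rewrite lee_fin -mulrA ler_wpM2l// -expRD ler_expR expr_div_n s2v.
have -> : - u ^+ 2 / (2 * s2) - alpha * u ^+ 2 = - (u ^+ 2 / v) / 2 + alpha * u ^+ 2.
  by rewrite /alpha; field; rewrite ?gt_eqF.
have h : c * (u / s) <= alpha * u ^+ 2 + c ^+ 2 / (4 * alpha * v).
  have -> : c ^+ 2 / (4 * alpha * v) = (c / s) ^+ 2 / (4 * alpha).
    by rewrite expr_div_n s2v; field; rewrite ?gt_eqF.
  set y := c / s; have -> : c * (u / s) = y * u by rewrite /y; ring.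
  rewrite -subr_ge0; have -> : alpha * u ^+ 2 + y ^+ 2 / (4 * alpha) - y * u =
     alpha * (u - y / (2 * alpha)) ^+ 2 by field; rewrite gt_eqF.
  by rewrite mulr_ge0 ?sqr_ge0// ltW.
lra.
Qed.

Lemma rare_subset s2 (A B : R -> set Omega) : rare s2 B -> (forall u, measurable (A u)) ->
  (forall u, A u `<=` B u) -> rare s2 A.
Proof.
move=> [mB [al al0 h]] mA AB; split=> //; exists al => // C c C0 c0.
have [K K0 hK] := h C c C0 c0; exists K => // q sq u u1.
by apply: le_trans (hK q sq u u1); apply: mass_le => //; case: sq.
Qed.

Lemma rare_fin_bigcup s2 (I : finType) (B : I -> R -> set Omega) :
  (forall i, rare s2 (B i)) -> rare s2 (fun u => \bigcup_i B i u).
Proof.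
move=> rB; split.
  move=> u; apply: fin_bigcup_measurable; first exact: finite_finset.
  by move=> i _; have [mB _] := rB i.
have /choice[al hal] : forall i, exists al : R, 0 < al /\ forall C c : R, 0 <= C -> 0 <= c ->
    exists2 A : R, 0 <= A & forall q, subgaussian C c q -> forall u, 1 <= u ->
      (mass P q (B i u) <= (A * expR (- u ^+ 2 / (2 * s2) - al * u ^+ 2))%:E)%E.
  by move=> i; have [_ [al al0 h]] := rB i; exists al.
exists (\big[Num.min/1]_i al i).
  by apply: lt_bigmin => // i _; exact: (hal i).1.
move=> C c C0 c0; have /choice[K hK] : forall i, exists A : R, 0 <= A /\
    forall q, subgaussian C c q -> forall u, 1 <= u ->
      (mass P q (B i u) <= (A * expR (- u ^+ 2 / (2 * s2) - al i * u ^+ 2))%:E)%E.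
  by move=> i; have [A A0 h] := (hal i).2 C c C0 c0; exists A.
exists (\sum_i K i) => [|q sq u u1]; first by apply: sumr_ge0 => i _; exact: (hK i).1.
apply: le_trans (mass_fin_bigcup P sq.1 _) _ => [i|]; first by have [mB _] := rB i.
rewrite mulr_suml -sumEFin; apply: lee_sum => i _.
apply: le_trans ((hK i).2 q sq u u1) _; rewrite lee_fin ler_wpM2l//; first exact: (hK i).1.
rewrite ler_expR lerD2l lerN2 ler_wpM2r ?sqr_ge0//.
exact: bigmin_le_cond.
Qed.

Lemma rareU s2 (A B : R -> set Omega) : rare s2 A -> rare s2 B -> rare s2 (fun u => A u `|` B u).
Proof.
move=> rA rB; apply: (@rare_subset _ _ (fun u => \bigcup_(b : bool) (if b then A u else B u))).
- by apply: (@rare_fin_bigcup s2 bool (fun b u => if b then A u else B u)); case.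
- by move=> u; apply: measurableU; [exact: rA.1|exact: rB.1].
- by move=> u w [Aw|Bw]; [exists true|exists false].
Qed.

End rare.

(** * Oscillation of a Hölder Gaussian family by chaining *)

Section oscillation.
Context {d} {Omega : measurableType d} {R : realType} (P : probability Omega R).
Context (H : set (Omega -> R)) (gH : gaussian_space P H).
Context {N : nat} (a b : 'rV[R]_N) (hab : forall i, a ord0 i < b ord0 i).
Local Notation T := (box a b).

Definition close (r : R) (s t : 'rV[R]_N) := forall i, `|s ord0 i - t ord0 i| <= r.

Lemma close_trans r r' s t v : close r s t -> close r' t v -> close (r + r') s v.
Proof.
move=> st tv i; rewrite -(subrKA (t ord0 i)); apply: le_trans (ler_normD _ _) _.
by rewrite lerD.
Qed.

Lemma close_sym r s t : close r s t -> close r t s.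
Proof. by move=> st i; rewrite distrC. Qed.

(** The sum dominates every side of the box, and the added 1 keeps the width positive when
    [N = 0]. *)
Definition width : R := \sum_i (b ord0 i - a ord0 i) + 1.

Lemma width_gt0 : 0 < width.
Proof.
rewrite /width addrC ltr_wpDr// sumr_ge0// => i _; by rewrite subr_ge0 ltW.
Qed.

Lemma le_width i : b ord0 i - a ord0 i <= width.
Proof.
rewrite /width (bigD1 i)//= -addrA lerDl addr_ge0// sumr_ge0// => j _.
by rewrite subr_ge0 ltW.
Qed.

Definition grid_point (M : nat) (z : {ffun 'I_N -> 'I_M.+1}) : 'rV[R]_N :=
  \row_i (a ord0 i + (b ord0 i - a ord0 i) * (z i)%:R / M%:R).

Lemma box_grid_point M z : (0 < M)%N -> T (@grid_point M z).
Proof.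
move=> M0 i; rewrite mxE; have ab := hab i.
have m0 : 0 < M%:R :> R by rewrite ltr0n.
have h0 : 0 <= (z i)%:R / M%:R :> R by rewrite divr_ge0.
have h1 : (z i)%:R / M%:R <= 1 :> R by rewrite ler_pdivrMr// mul1r ler_nat -ltnS.
rewrite -mulrA; set x := _ / _ in h0 h1 *.
by apply/andP; split; nra.
Qed.

Lemma grid_approx M t : (0 < M)%N -> T t ->
  exists z, close (width / M%:R) (@grid_point M z) t.
Proof.
move=> M0 Tt; have m0 : 0 < M%:R :> R by rewrite ltr0n.
pose y i := (t ord0 i - a ord0 i) / (b ord0 i - a ord0 i) * M%:R.
have w0 i : 0 < b ord0 i - a ord0 i by rewrite subr_gt0.
have y0 i : 0 <= y i.
  by rewrite /y mulr_ge0// divr_ge0 ?(ltW (w0 i))// subr_ge0; case/andP: (Tt i).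
have yM i : y i <= M%:R.
  rewrite /y -[leRHS]mul1r ler_wpM2r// ler_pdivrMr// mul1r lerD2r.
  by case/andP: (Tt i).
have tM i : (Num.truncn (y i) < M.+1)%N.
  by rewrite ltnS -(ler_nat R); apply: le_trans (yM i); rewrite truncn_le.
exists [ffun i => Ordinal (tM i)] => i; rewrite !mxE ffunE /=.
have /andP[h1 h2] : (Num.truncn (y i))%:R <= y i < (Num.truncn (y i)).+1%:R.
  by rewrite truncn_le ?y0//= truncnS_gt.
have -> : t ord0 i = a ord0 i + (b ord0 i - a ord0 i) * y i / M%:R.
  by rewrite /y; field; rewrite ?gt_eqF.
have -> : a ord0 i + (b ord0 i - a ord0 i) * (Num.truncn (y i))%:R / M%:R -
  (a ord0 i + (b ord0 i - a ord0 i) * y i / M%:R) =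
  (b ord0 i - a ord0 i) * (((Num.truncn (y i))%:R - y i) / M%:R) by field; rewrite gt_eqF.
rewrite normrM ger0_norm ?(ltW (w0 i))// ler_pM ?(ltW (w0 i)) ?le_width//.
rewrite normrM (@ger0_norm _ M%:R^-1) ?invr_ge0// ler_piMl ?invr_ge0//.
rewrite -natr1 in h2; rewrite ler_norml; apply/andP; split; lra.
Qed.

Lemma exp4_ge n : n.+1%:R <= 4 ^+ n :> R.
Proof.
elim: n => [|n IH]; first by rewrite expr0.
rewrite exprS -[n.+2%:R]natr1; have : 1 <= n.+1%:R :> R by rewrite ler1n.
by set y := 4 ^+ n in IH *; lra.
Qed.

Lemma sum_half_le (x : R) n : 0 <= x -> \sum_(0 <= k < n) x / 2 ^+ k <= 2 * x.
Proof.
move=> x0; have -> : \sum_(0 <= k < n) x / 2 ^+ k = 2 * x - 2 * x / 2 ^+ n.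
  elim: n => [|n IH]; first by rewrite big_nil expr0 divr1 subrr.
  by rewrite big_nat_recr//= IH exprS; field; rewrite expf_neq0.
by rewrite gerBl divr_ge0 ?mulr_ge0// exprn_ge0.
Qed.

(* Chaining: along grids refined by a factor [L] with [4 <= L ^ delta], the increments have
   standard deviation of order [4 ^- n] and are compared with the thresholds [kappa * u / 2 ^ n]. *)
Lemma rare_oscillation (s2 K delta kappa : R) (G : 'rV[R]_N -> Omega -> R) :
  0 < s2 -> 0 < K -> 0 < delta -> 0 < kappa -> (forall t, T t -> H (G t)) ->
  (forall r s t, 0 <= r -> T s -> T t -> close r s t ->
     nrm2 P (fun w => G s w - G t w) <= K * r `^ delta) ->
  (forall w (t_ : nat -> 'rV[R]_N) t, (forall n, T (t_ n)) -> T t ->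
     (forall i, t_ n ord0 i @[n --> \oo] --> t ord0 i) -> G (t_ n) w @[n --> \oo] --> G t w) ->
  exists2 r : R, 0 < r & exists2 B, rare P H s2 B &
    forall u w s t, 0 < u -> ~ B u w -> T s -> T t -> close r s t ->
      `|G s w - G t w| <= 4 * kappa * u.
Proof.
move=> s20 K0 d0 k0 HG nG cG.
have D0 := width_gt0; set D := width in D0.
pose L := (Num.truncn ((4 : R) `^ delta^-1)).+2.
have L0 : 0 < L%:R :> R by rewrite ltr0n.
have L4 : 4 <= L%:R `^ delta.
  have -> : (4 : R) = (4 `^ delta^-1) `^ delta by rewrite -powRrM mulVf ?gt_eqF// powRr1.
  by rewrite ge0_ler_powR ?nnegrE ?powR_ge0 ?(ltW d0)// ltW// (lt_trans (truncnS_gt _))// ltr_nat.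
(* The first two terms pay for the target exponent with [alpha = 1]. The last one makes
   [expR (- Q) * L ^+ (2 * N)] at most 1/2, which beats the growth of the number of grid pairs from
   one level to the next. *)
pose Q := 1 + (2 * s2)^-1 + 2 * L%:R ^+ (2 * N).
have Q0 : 0 < Q.
  by rewrite /Q !addr_gt0// ?invr_gt0 ?mulr_gt0// exprn_gt0.
(* With standard deviation [e / 4 ^+ n] and threshold [kappa * u / 2 ^+ n], the squared ratio is
   [4 * Q * u ^+ 2 * 4 ^+ n]. The first grid size [m] is then taken large enough for level 0. *)
pose e := kappa / Num.sqrt (4 * Q).
have sQ0 : 0 < Num.sqrt (4 * Q) by rewrite sqrtr_gt0 mulr_gt0.
have e0 : 0 < e by rewrite divr_gt0.
pose m := (Num.truncn (3 * D / (e / K) `^ delta^-1)).+1.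
have m0 : 0 < m%:R :> R by rewrite ltr0n.
have eK0 : 0 < (e / K) `^ delta^-1 by rewrite powR_gt0// divr_gt0.
have me : K * (3 * D / m%:R) `^ delta <= e.
  rewrite mulrC -ler_pdivlMr//.
  have h : e / K = ((e / K) `^ delta^-1) `^ delta.
    by rewrite -powRrM mulVf ?gt_eqF// powRr1// ltW// divr_gt0.
  rewrite [leRHS]h.
  rewrite ge0_ler_powR ?nnegrE ?powR_ge0 ?(ltW d0)// ?divr_ge0 ?mulr_ge0 ?(ltW D0)//.
  rewrite ler_pdivrMr// [leRHS]mulrC -ler_pdivrMr// ltW// truncnS_gt//.
pose M n := (m * L ^ n)%N.
have M0 n : (0 < M n)%N by rewrite muln_gt0/= expn_gt0.
have MR n : 0 < (M n)%:R :> R by rewrite ltr0n.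
have MS n : (M n)%:R <= (M n.+1)%:R :> R.
  by rewrite ler_nat /M leq_mul2l expnS leq_pmull ?orbT.
have sd n s t : T s -> T t -> close (3 * D / (M n)%:R) s t ->
    nrm2 P (fun w => G s w - G t w) <= e / 4 ^+ n.
  move=> Ts Tt st; have r0 : 0 <= 3 * D / (M n)%:R by rewrite divr_ge0// mulr_ge0// ltW.
  apply: le_trans (nG _ _ _ r0 Ts Tt st) _.
  have -> : 3 * D / (M n)%:R = 3 * D / m%:R * (L%:R ^+ n)^-1.
    by rewrite /M natrM natrX invfM mulrA.
  rewrite powRM ?invr_ge0 ?exprn_ge0 ?divr_ge0 ?mulr_ge0 ?(ltW D0)// mulrA ler_pM//.
  - by rewrite mulr_ge0 ?powR_ge0// ltW.
  - rewrite -powR_inv1 ?exprn_ge0// -powRrM mulN1r powRN lef_pV2 ?posrE ?powR_gt0 ?exprn_gt0//.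
    by rewrite -(powR_mulrn n (ltW L0)) powRAC powR_mulrn ?powR_ge0// lerXn2r ?nnegrE ?powR_ge0.
pose I n : finType := ({ffun 'I_N -> 'I_(M n).+1} * {ffun 'I_N -> 'I_(M n.+1).+1})%type.
pose dlt n (z : I n) w := G (grid_point z.1) w - G (grid_point z.2) w.
pose near_ n (z : I n) := `[< close (3 * D / (M n)%:R) (grid_point z.1) (grid_point z.2) >].
have Hd n z : H (@dlt n z) by apply: (gsB gH); apply: HG; exact: box_grid_point.
pose E n (z : I n) u : set Omega := if near_ n z then
  above (@dlt n z) (kappa * u / 2 ^+ n) `|` above (fun w => -1 * @dlt n z w) (kappa * u / 2 ^+ n) else set0.
have mE n z u : measurable (@E n z u).
  rewrite /E; case: ifP => // _; apply: measurableU; apply: measurable_above.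
    exact: (gs_measurable gH).
  exact/(gs_measurable gH)/(gsZ _ gH).
pose B u := \bigcup_n \bigcup_(z : I n) E n z u.
have mB u : measurable (B u).
  apply: bigcupT_measurable => n; apply: fin_bigcup_measurable => //; exact: finite_finset.
exists (D / (M 0)%:R); first by rewrite divr_gt0.
exists B; first split => //.
  exists 1 => // C c C0 c0.
  pose A0 := 2 * C * expR (c ^+ 2 * 3 / 2) * (2 * m%:R * L%:R) ^+ (2 * N).
  exists (2 * A0); first by rewrite !mulr_ge0// ?expR_ge0// exprn_ge0 ?mulr_ge0.
  move=> q sq u u1; have [wq _] := sq.
  have card n : #|I n|%:R <= (2 * m%:R * L%:R) ^+ (2 * N) * (L%:R ^+ (2 * N)) ^+ n :> R.
    have e2 (X Y : R) : X ^+ (2 * N) * (Y ^+ (2 * N)) ^+ n = (X * Y ^+ n) ^+ N * (X * Y ^+ n) ^+ N.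
      by rewrite -exprD addnn -mul2n exprMn -!exprM (mulnC n).
    rewrite card_prod !card_ffun !card_ord natrM !natrX e2.
    have h : (M n.+1).+1%:R <= 2 * m%:R * L%:R * L%:R ^+ n :> R.
      have -> : 2 * m%:R * L%:R * L%:R ^+ n = (M n.+1)%:R + (M n.+1)%:R :> R.
        by rewrite /M natrM natrX exprS; ring.
      by rewrite -[leLHS]natr1 lerD2l ler1n.
    apply: ler_pM => //; rewrite lerXn2r ?nnegrE ?mulr_ge0 ?exprn_ge0//.
    apply: le_trans h.
    by rewrite ler_nat ltnS -(ler_nat R).
  have tail n z : (mass P q (@E n z u) <=
     (2 * (C * expR (c ^+ 2 * 3 / 2) * (expR (- (Q * u ^+ 2)) * expR (- Q) ^+ n)))%:E)%E.
    rewrite /E; case: ifPn => [/asboolP zn|_]; last first.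
      rewrite /mass integral_set0 lee_fin !mulr_ge0 ?expR_ge0// exprn_ge0// expR_ge0//.
    have T1 : T (grid_point z.1) by exact: box_grid_point.
    have T2 : T (grid_point z.2) by exact: box_grid_point.
    have s1 := sd n _ _ T1 T2 zn.
    have Hz := Hd n z; have Hz' := gsZ (-1) gH Hz.
    have s2' : nrm2 P (fun w => -1 * dlt n z w) <= e / 4 ^+ n.
      by rewrite (nrm2Z _ (gs_sqint gH Hz)) normrN1 mul1r.
    have x0 : 0 <= kappa * u / 2 ^+ n by rewrite divr_ge0 ?exprn_ge0// mulr_ge0 ?ltW//; lra.
    have en : 0 < e / 4 ^+ n by rewrite divr_gt0// exprn_gt0.
    have bnd : C * expR (- (kappa * u / 2 ^+ n / (e / 4 ^+ n)) ^+ 2 / 2 +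
          c * (kappa * u / 2 ^+ n / (e / 4 ^+ n)) + c ^+ 2 / 2) <=
        C * expR (c ^+ 2 * 3 / 2) * (expR (- (Q * u ^+ 2)) * expR (- Q) ^+ n).
      rewrite -[leRHS]mulrA; apply: ler_wpM2l => //; rewrite -expRM_natl -!expRD ler_expR.
      set y := kappa * u / 2 ^+ n / (e / 4 ^+ n).
      have yE : y ^+ 2 = 4 * Q * u ^+ 2 * 4 ^+ n.
        have -> : y = kappa / e * (u * (4 ^+ n / 2 ^+ n)).
          by rewrite /y; field; rewrite ?gt_eqF ?exprn_gt0.
        rewrite -expr_div_n (_ : 4 / 2 = 2 :> R); last by field.
        have -> : kappa / e = Num.sqrt (4 * Q).
          by rewrite /e; field; rewrite ?gt_eqF.
        rewrite !exprMn sqr_sqrtr ?mulr_ge0 ?(ltW Q0)// -exprM mulnC exprM.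
        by rewrite (_ : 2 ^+ 2 = 4 :> R) ?mulrA// expr2; ring.
      have h1 := exp4_ge n; rewrite -natr1 in h1.
      have h2 : Q * u ^+ 2 * (n%:R + 1) <= y ^+ 2 / 4.
        rewrite yE; have -> : 4 * Q * u ^+ 2 * 4 ^+ n / 4 = Q * u ^+ 2 * 4 ^+ n by field.
        by rewrite ler_wpM2l// mulr_ge0 ?sqr_ge0// ltW.
      have h3 : Q * u ^+ 2 + Q * n%:R <= Q * u ^+ 2 * (n%:R + 1).
        rewrite mulrDr mulr1 addrC lerD2r -mulrA ler_wpM2l ?(ltW Q0)// ler_peMl//.
        by rewrite expr2; nra.
      have h4 := sqr_ge0 (y / 2 - c).
      rewrite !expr2 in h2 h3 h4 *; lra.
    have mf := gs_measurable gH Hz; have mf' := gs_measurable gH Hz'.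
    apply: le_trans (massU P wq (measurable_above _ mf) (measurable_above _ mf')) _.
    rewrite mulr_natl mulr2n EFinD; apply: leeD.
      by apply: le_trans (subgaussian_tail gH sq Hz C0 c0 x0 en s1) _; rewrite lee_fin.
    by apply: le_trans (subgaussian_tail gH sq Hz' C0 c0 x0 en s2') _; rewrite lee_fin.
  apply: le_trans (mass_bigcup P wq _) _ => [n|].
    by apply: fin_bigcup_measurable => //; exact: finite_finset.
  have lvl n : (mass P q (\bigcup_(z : I n) E n z u) <=
      (A0 * expR (- u ^+ 2 / (2 * s2) - 1 * u ^+ 2) / 2 ^+ n)%:E)%E.
    apply: le_trans (mass_fin_bigcup P wq (fun z => mE n z u)) _.
    apply: (@le_trans _ _ (\sum_(z : I n) (2 * (C * expR (c ^+ 2 * 3 / 2) * (expR (- (Q * u ^+ 2)) * expR (- Q) ^+ n)))%:E)%E).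
      by apply: lee_sum => z _; exact: tail.
    rewrite sumEFin sumr_const -[X in (X%:E <= _)%E]mulr_natr lee_fin.
    set X := C * _; set J := (2 * m%:R * L%:R) ^+ _ in card.
    apply: le_trans (ler_wpM2l _ (card n)) _.
      by rewrite !mulr_ge0 ?exprn_ge0 ?expR_ge0.
    have -> : A0 = 2 * X * J by rewrite /A0 /X /J mulrA.
    have -> : 2 * (X * (expR (- (Q * u ^+ 2)) * expR (- Q) ^+ n)) * (J * (L%:R ^+ (2 * N)) ^+ n) =
      2 * X * J * (expR (- (Q * u ^+ 2)) * (expR (- Q) * L%:R ^+ (2 * N)) ^+ n).
      by rewrite exprMn; ring.
    have XJ : 0 <= 2 * X * J by rewrite !mulr_ge0 ?expR_ge0// exprn_ge0 ?mulr_ge0.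
    rewrite -[leRHS]mulrA ler_wpM2l// ler_pM ?expR_ge0 ?exprn_ge0 ?mulr_ge0 ?expR_ge0 ?exprn_ge0//.
      rewrite ler_expR mul1r.
      have -> : - u ^+ 2 / (2 * s2) - u ^+ 2 = - ((1 + (2 * s2)^-1) * u ^+ 2) by ring.
      rewrite lerN2 ler_wpM2r ?sqr_ge0// /Q lerDl mulr_ge0// exprn_ge0//.
    rewrite -exprVn lerXn2r ?nnegrE ?mulr_ge0 ?expR_ge0 ?exprn_ge0//.
    rewrite expRN mulrC ler_pdivrMr ?expR_gt0//.
    have := @expR_ge1Dx R Q; have : 0 < (2 * s2)^-1 by rewrite invr_gt0 mulr_gt0.
    by rewrite {1}/Q; lra.
  apply: le_trans (lee_nneseries _ (fun n _ => lvl n)) _.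
    by move=> n _ _; exact: mass_ge0.
  apply: lime_le; first by apply: is_cvg_nneseries => n _ _; rewrite lee_fin divr_ge0 ?exprn_ge0// mulr_ge0 ?expR_ge0// /A0 !mulr_ge0 ?expR_ge0 ?exprn_ge0 ?mulr_ge0.
  apply: nearW => n; rewrite sumEFin lee_fin -mulrA; apply: sum_half_le.
  by rewrite mulr_ge0 ?expR_ge0// /A0 !mulr_ge0 ?expR_ge0 ?exprn_ge0 ?mulr_ge0.
move=> u w s t u0 nB Ts Tt st.
have small n s' t' : T s' -> T t' -> (exists z, s' = @grid_point (M n) z) ->
    (exists z, t' = @grid_point (M n.+1) z) -> close (3 * D / (M n)%:R) s' t' ->
    `|G s' w - G t' w| <= kappa * u / 2 ^+ n.
  move=> Ts' Tt' [z ->] [z' ->] zz; rewrite ler_norml -lerNl !leNgt.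
  apply/andP; split; apply/negP => h; apply: nB; exists n => //; exists (z, z') => //; rewrite /E /near_ asboolT//.
    by right; rewrite /above/= mulN1r /dlt/= ltW.
  by left; rewrite /above/= /dlt/= ltW.
have /choice[gr hgr] : forall nv : nat * 'rV[R]_N, exists z : 'rV[R]_N, T nv.2 ->
    [/\ T z, close (D / (M nv.1)%:R) z nv.2 & exists y, z = @grid_point (M nv.1) y].
  move=> [n v]; have [Tv|nTv] := pselect (T v); last by exists 0.
  have [z hz] := grid_approx (M0 n) Tv; exists (grid_point z) => _; split => //.
    exact: box_grid_point.
  by exists z.
have DM n : D / (M n.+1)%:R <= D / (M n)%:R.
  by rewrite ler_wpM2l ?(ltW D0)// lef_pV2 ?posrE.
(* The radius [3 * D / M n] adds up a rounding at level [n], the distance of the two points and a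
   rounding at level [n + 1], each at most [D / M n]. *)
have near3 n v v' : T v -> T v' -> close (D / (M n)%:R) v v' ->
    `|G (gr (n, v)) w - G (gr (n.+1, v')) w| <= kappa * u / 2 ^+ n.
  move=> Tv Tv' vv; have [T1 c1 e1] := hgr (n, v) Tv; have [T2 c2 e2] := hgr (n.+1, v') Tv'.
  apply: small => // i; apply: le_trans (close_trans (close_trans c1 vv) (close_sym c2) i) _.
  by rewrite /=; have := DM n; set x := D / _; set y := D / _; have -> : 3 * D / (M n)%:R = 3 * y; [rewrite /y mulrA|lra].
have near1 n v : T v -> `|G (gr (n, v)) w - G (gr (n.+1, v)) w| <= kappa * u / 2 ^+ n.
  move=> Tv; apply: near3 => // i; rewrite subrr normr0 divr_ge0// ltW//.
have ku0 : 0 <= kappa * u by rewrite mulr_ge0// ltW.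
have chain n k v : T v -> `|G (gr (n, v)) w - G (gr ((n + k)%N, v)) w| <= \sum_(0 <= j < k) (kappa * u / 2 ^+ n) / 2 ^+ j.
  move=> Tv; elim: k => [|k IH]; first by rewrite addn0 subrr normr0 big_nil.
  rewrite big_nat_recr//= addnS -(subrKA (G (gr ((n + k)%N, v)) w)).
  apply: le_trans (ler_normD _ _) _; apply: lerD => //; apply: le_trans (near1 _ _ Tv) _.
  by rewrite exprD invfM mulrA.
have lim_ n v : T v -> `|G (gr (n, v)) w - G v w| <= 2 * (kappa * u / 2 ^+ n).
  move=> Tv.
  have cv : G (gr ((n + k)%N, v)) w @[k --> \oo] --> G v w.
    apply: cG => // [k|i]; first by have [] := hgr ((n + k)%N, v) Tv.
    apply/cvgrPdist_le => x x0; near=> k.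
    have [_ /(_ i) h _] := hgr ((n + k)%N, v) Tv; rewrite distrC; apply: le_trans h _ => /=.
    rewrite ler_pdivrMr// mulrC -ler_pdivrMr//.
    have hk : (k%:R : R) <= (M (n + k)%N)%:R.
      rewrite ler_nat /M; apply: leq_trans (leq_addl n k) _.
      by apply: leq_trans (leq_pmull _ _) => //; apply: ltnW; apply: ltn_expl.
    by apply: le_trans hk; near: k; exact: nbhs_infty_ger.
  have cn : `|G (gr (n, v)) w - G (gr ((n + k)%N, v)) w| @[k --> \oo] --> `|G (gr (n, v)) w - G v w|.
    by apply: cvg_norm; apply: cvgB => //; exact: cvg_cst.
  apply: (cvg_le_bound cn) => k; apply: le_trans (chain n k v Tv) _; apply: sum_half_le.
  by rewrite divr_ge0// exprn_ge0.
(* [t] is approximated from level 0 and [s] from level 1, and one link joins the two chains: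
   [2 + 1 + 1] times [kappa * u]. *)
have h1 := lim_ 0%N _ Tt; have h2 := lim_ 1%N _ Ts; have h3 := near3 0%N _ _ Tt Ts (close_sym st).
rewrite expr0 expr1 divr1 in h1 h2 h3.
have -> : G s w - G t w = - (G (gr (1%N, s)) w - G s w) - (G (gr (0%N, t)) w - G (gr (1%N, s)) w) +
  (G (gr (0%N, t)) w - G t w) by ring.
apply: le_trans (ler_normD _ _) _; apply: le_trans (lerD (ler_normB _ _) (lexx _)) _.
rewrite normrN; lra.
Unshelve. all: by end_near. Qed.

End oscillation.

(** * Smooth paths *)

Section directional.
Context {R : realType}.

Lemma is_derive_increments (V1 V2 : normedModType R) (f1 : V1 -> R) (f2 : V2 -> R)
    (x1 v1 : V1) (x2 v2 : V2) (df : R) :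
  (forall h : R, f1 (h *: v1 + x1) - f1 x1 = f2 (h *: v2 + x2) - f2 x2) ->
  is_derive x2 v2 f2 df -> is_derive x1 v1 f1 df.
Proof.
move=> e [d2 e2].
have E : (fun h : R => h^-1 *: ((f1 \o shift x1) (h *: v1) - f1 x1)) =
         (fun h : R => h^-1 *: ((f2 \o shift x2) (h *: v2) - f2 x2)).
  by apply/funext => h; congr (_ *: _); exact: e.
by apply: DeriveDef; rewrite /derivable /derive E.
Qed.

Lemma is_derive_translate (V : normedModType R) (f : V -> R) (x c v : V) (df : R) :
  is_derive (x + c) v f df -> is_derive x v (fun y => f (y + c)) df.
Proof. by apply: is_derive_increments => h; rewrite addrA. Qed.

Lemma is_derive_line (V : normedModType R) (f : V -> R) (x v : V) (h df : R) :
  is_derive (h *: v + x) v f df -> is_derive h 1 (fun k : R => f (k *: v + x)) df.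
Proof.
apply: is_derive_increments => k.
by rewrite /= [k *: 1]mulr1 scalerDl addrA.
Qed.

Lemma mvt1 (g dg : R -> R) (x y : R) : (forall h : R, is_derive h 1 g (dg h)) ->
  exists c : R, [/\ Num.min x y <= c <= Num.max x y & g y - g x = dg c * (y - x)].
Proof.
move=> hg.
have cg : continuous g.
  move=> h; apply: differentiable_continuous; apply/derivable1_diffP.
  exact: (@ex_derive _ _ _ _ _ _ _ (hg h)).
have W p q : p <= q -> exists c : R, p <= c <= q /\ g q - g p = dg c * (q - p).
  move=> pq; have [c] := MVT_segment pq (fun h _ => hg h) (continuous_subspaceT cg).
  by rewrite in_itv/= => ci e; exists c.
case: (leP x y) => [/W|/ltW/W] [c [ci e]]; exists c; split => //.
by rewrite -opprB e; ring.
Qed.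

End directional.

Section coordinates.
Context {R : realType} {N : nat}.
Implicit Types (f : 'rV[R]_N -> R) (x y z v : 'rV[R]_N).

Definition between x y z := forall i,
  Num.min (x ord0 i) (y ord0 i) <= z ord0 i <= Num.max (x ord0 i) (y ord0 i).

Lemma e_E (i j : 'I_N) : (e_ i : 'rV[R]_N) ord0 j = (i == j)%:R.
Proof. by rewrite mxE eqxx /= eq_sym. Qed.

(* The coordinates are changed one at a time, which avoids differentiating along a segment. *)
Lemma mvt_coord f (df : 'I_N -> 'rV[R]_N -> R) x y :
  (forall i t, is_derive t (e_ i) f (df i t)) ->
  exists xi : 'I_N -> 'rV[R]_N, (forall i, between x y (xi i)) /\
    f y - f x = \sum_i (y ord0 i - x ord0 i) * df i (xi i).
Proof.
move=> hf; pose p (k : nat) : 'rV[R]_N := \row_i if (i < k)%N then y ord0 i else x ord0 i.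
have pS (i : 'I_N) : p i.+1 = (y ord0 i - x ord0 i) *: e_ i + p i.
  apply/rowP => j; rewrite !mxE eqxx /= ltnS; case: (ltngtP j i) => h.
  - by rewrite -val_eqE /= (ltn_eqF h) mulr0 add0r.
  - by rewrite -val_eqE /= (gtn_eqF h) mulr0 add0r.
  - by rewrite (val_inj h) eqxx mulr1 subrK.
have step (i : 'I_N) : exists xi, between x y xi /\
    f (p i.+1) - f (p i) = (y ord0 i - x ord0 i) * df i xi.
  pose g (h : R) := f (h *: e_ i + p i).
  have hg (h : R) : is_derive h 1 g (df i (h *: e_ i + p i)) by apply: is_derive_line; exact: hf.
  have [c [ci e]] := mvt1 0 (y ord0 i - x ord0 i) hg.
  exists (c *: e_ i + p i); split.
    move=> j; rewrite !mxE eqxx /=; case: (altP (j =P i)) => [->|ji].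
      rewrite ltnn mulr1; move: ci; set u := x ord0 i; set v := y ord0 i.
      rewrite /Num.min /Num.max; case: ltP => h1; case: ltP => h2 /andP[h3 h4]; apply/andP; split; lra.
    by rewrite mulr0 add0r; case: ifP => _; rewrite ge_min le_max !lexx ?orbT.
  by move: e; rewrite /g scale0r add0r subr0 -pS mulrC.
have /choice[xi hxi] := step; exists xi; split=> [i|]; first exact: (hxi i).1.
rewrite -(eq_bigr _ (fun i _ => (hxi i).2)).
have -> : \sum_(i < N) (f (p i.+1) - f (p i)) = f (p N) - f (p 0%N).
  by rewrite -(big_mkord xpredT (fun i => f (p i.+1) - f (p i))) telescope_sumr.
by congr (f _ - f _); apply/rowP => i; rewrite !mxE ?ltn_ord.
Qed.

Lemma C1_derive f i t : C1 f -> is_derive t (e_ i) f (partial i f t).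
Proof. by move=> [_ /(_ i)[d _]]; apply: DeriveDef. Qed.

Lemma C1_continuous f : C1 f -> continuous f. Proof. by case. Qed.

Lemma C1_partial f i : C1 f -> continuous (partial i f).
Proof. by move=> [_ /(_ i)[_ c]]. Qed.

Lemma C1_mvt f x y : C1 f ->
  exists xi : 'I_N -> 'rV[R]_N, (forall i, between x y (xi i)) /\
    f y - f x = \sum_i (y ord0 i - x ord0 i) * partial i f (xi i).
Proof. by move=> cf; apply: (@mvt_coord f (fun i => partial i f)) => i t; exact: C1_derive. Qed.

Lemma between_close x y z (r : R) : close r x y -> between x y z -> close r x z.
Proof.
move=> xy xyz i; have := xyz i; have := xy i; rewrite !ler_norml.
by rewrite /Num.min /Num.max; case: ltP => h /andP[? ?] /andP[? ?]; apply/andP; split; lra.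
Qed.

Lemma between_box (a b : 'rV[R]_N) x y z : box a b x -> box a b y -> between x y z -> box a b z.
Proof.
move=> Tx Ty xyz i; have := xyz i; have /andP[? ?] := Tx i; have /andP[? ?] := Ty i.
by rewrite /Num.min /Num.max; case: ltP => h /andP[? ?]; apply/andP; split; lra.
Qed.

Lemma C1_lipschitz (a b : 'rV[R]_N) f x y (L r : R) : C1 f -> box a b x -> box a b y ->
  (forall i z, box a b z -> `|partial i f z| <= L) -> close r x y -> `|f x - f y| <= N%:R * (L * r).
Proof.
move=> cf Tx Ty fL xy; have [xi [hxi e]] := C1_mvt y x cf.
rewrite e; apply: le_trans (ler_norm_sum _ _ _) _.
apply: (@le_trans _ _ (\sum_(i < N) L * r)); last by rewrite sumr_const card_ord -(mulr_natl (L * r) N).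
apply: ler_sum => i _; rewrite normrM mulrC ler_pM//.
by apply: fL; apply: (between_box Ty Tx).
Qed.

Lemma cvg_row_close (u : nat -> 'rV[R]_N) x (r : nat -> R) :
  (forall n, close (r n) x (u n)) -> r n @[n --> \oo] --> (0 : R) ->
  forall i, u n ord0 i @[n --> \oo] --> x ord0 i.
Proof.
move=> hu r0 i; apply/cvgrPdist_le => e e0; near=> n.
apply: le_trans (hu n i) _; apply: le_trans (ler_norm _) _.
by near: n; apply: cvgr0_norm_le.
Unshelve. all: by end_near. Qed.

Lemma cvg_harmonicZ (c : R) : c / n.+1%:R @[n --> \oo] --> (0 : R).
Proof. by rewrite -[X in _ --> X](mulr0 c); apply: cvgM; [exact: cvg_cst|exact: cvg_harmonic]. Qed.

Definition vnorm (v : 'rV[R]_N) : R := \sum_i `|v ord0 i|.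

Lemma le_vnorm (v : 'rV[R]_N) i : `|v ord0 i| <= vnorm v.
Proof. by rewrite /vnorm (bigD1 i)//= lerDl sumr_ge0. Qed.

(** The coordinate mean value theorem gives partial derivatives at points that tend to [x]; their
    continuity yields the whole directional derivative. *)
Lemma cvg_difference_quotient f x v (h : nat -> R) : C1 f -> (forall n, h n != 0) ->
  h n @[n --> \oo] --> (0 : R) ->
  (h n)^-1 * (f (h n *: v + x) - f x) @[n --> \oo] --> \sum_i v ord0 i * partial i f x.
Proof.
move=> cf h0 ch; have /choice[xi hxi] := fun n : nat => C1_mvt x (h n *: v + x) cf.
have -> : (fun n : nat => (h n)^-1 * (f (h n *: v + x) - f x)) =
    (fun n : nat => \sum_i v ord0 i * partial i f (xi n i)).
  apply/funext => n; rewrite (hxi n).2 mulr_sumr; apply: eq_bigr => i _.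
  by rewrite !mxE addrK !mulrA mulVf ?mul1r.
apply: cvg_sumr => i; apply: cvgM; first exact: cvg_cst.
apply: continuous_row_cvg; first exact: C1_partial.
apply: (@cvg_row_close _ _ (fun n => vnorm v * `|h n|)).
  move=> n; apply: between_close ((hxi n).1 i) => j.
  rewrite !mxE opprD addrCA subrr addr0 normrN normrM mulrC.
  by rewrite ler_wpM2r// le_vnorm.
by rewrite -(mulr0 (vnorm v)) -(@normr0 _ R); apply: cvgM; [exact: cvg_cst|exact: cvg_norm].
Qed.

Lemma cvg_first_difference f x v : C1 f ->
  n.+1%:R * (f (n.+1%:R^-1 *: v + x) - f x) @[n --> \oo] --> \sum_i v ord0 i * partial i f x.
Proof.
move=> cf.
have -> : (fun n : nat => n.+1%:R * (f (n.+1%:R^-1 *: v + x) - f x)) =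
    (fun n : nat => (n.+1%:R^-1)^-1 * (f (n.+1%:R^-1 *: v + x) - f x)).
  by apply/funext => n; rewrite invrK.
apply: (@cvg_difference_quotient f x v (fun n => n.+1%:R^-1) cf) => [n|].
  by rewrite invr_eq0 gt_eqF.
exact: cvg_harmonic.
Qed.

(** The second difference is the increment of [F n = f (. + h v) - f] between [x - h v] and [x]. The
    coordinate mean value theorem, once for [F n] and once for each partial derivative, leaves
    second partial derivatives at points that tend to [x]. *)
Lemma cvg_second_difference f x v : C2 f ->
  n.+1%:R ^+ 2 * (f (n.+1%:R^-1 *: v + x) + f (x - n.+1%:R^-1 *: v) - 2 * f x) @[n --> \oo] -->
  \sum_i \sum_j v ord0 i * v ord0 j * partial i (partial j f) x.
Proof.
move=> [cf cpf].
pose h (n : nat) : R := n.+1%:R^-1.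
pose F n y := f (y + h n *: v) - f y.
have dF n i t : is_derive t (e_ i) (F n) (partial i f (t + h n *: v) - partial i f t).
  apply: is_deriveB; last exact: C1_derive.
  by apply: is_derive_translate; exact: C1_derive.
have /choice[xi hxi] := fun n : nat => mvt_coord (x - h n *: v) x (dF n).
have /choice[zt hzt] : forall n : nat, exists zt : 'I_N -> 'I_N -> 'rV[R]_N, forall j,
    (forall i, between (xi n j) (xi n j + h n *: v) (zt j i)) /\
    partial j f (xi n j + h n *: v) - partial j f (xi n j) =
      \sum_i h n * v ord0 i * partial i (partial j f) (zt j i).
  move=> n; suff /choice[z hz] : forall j : 'I_N, exists z : 'I_N -> 'rV[R]_N,
      (forall i, between (xi n j) (xi n j + h n *: v) (z i)) /\
      partial j f (xi n j + h n *: v) - partial j f (xi n j) =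
      \sum_i h n * v ord0 i * partial i (partial j f) (z i) by exists z.
  move=> j.
  have [z [hz e]] := C1_mvt (xi n j) (xi n j + h n *: v) (cpf j).
  exists z; split => //; rewrite e; apply: eq_bigr => i _.
  by rewrite !mxE [X in X - _]addrC addrK.
have -> : (fun n : nat => n.+1%:R ^+ 2 * (f (n.+1%:R^-1 *: v + x) + f (x - n.+1%:R^-1 *: v) - 2 * f x)) =
    (fun n : nat => \sum_j \sum_i v ord0 i * v ord0 j * partial i (partial j f) (zt n j i)).
  apply/funext => n; have n0 : n.+1%:R != 0 :> R by rewrite gt_eqF.
  have -> : f (n.+1%:R^-1 *: v + x) + f (x - n.+1%:R^-1 *: v) - 2 * f x = F n x - F n (x - h n *: v).
    by rewrite /F subrK -/(h n) (addrC (h n *: v)); ring.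
  rewrite (hxi n).2 mulr_sumr; apply: eq_bigr => j _; rewrite (hzt n j).2 !mulr_sumr.
  apply: eq_bigr => i _; rewrite !mxE opprB addrCA subrr addr0 /h.
  by field.
rewrite [X in _ --> X]exchange_big /=; apply: cvg_sumr => j; apply: cvg_sumr => i.
apply: cvgM; first exact: cvg_cst.
apply: continuous_row_cvg; first exact: C1_partial.
apply: (@cvg_row_close _ _ (fun n => 2 * vnorm v / n.+1%:R)); last exact: cvg_harmonicZ.
move=> n; have c1 : close (vnorm v / n.+1%:R) x (x - h n *: v).
  move=> k; rewrite !mxE opprB addrCA subrr addr0 normrM ger0_norm ?invr_ge0// mulrC.
  by rewrite ler_wpM2r ?invr_ge0// le_vnorm.
have c2 y : close (vnorm v / n.+1%:R) y (y + h n *: v).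
  move=> k; rewrite !mxE opprD addrA subrr sub0r normrN normrM ger0_norm ?invr_ge0// mulrC.
  by rewrite ler_wpM2r ?invr_ge0// le_vnorm.
have c3 : close (vnorm v / n.+1%:R) x (xi n j).
  apply: between_close c1 _ => k; have := (hxi n).1 j k.
  by rewrite minC maxC.
have c4 := between_close (c2 (xi n j)) ((hzt n j).1 i).
by rewrite -mulrA mulr_natl mulr2n; exact: close_trans c3 c4.
Qed.

End coordinates.

(** * Integrals of functions that agree off a null set *)

Section integral_negligible.
Import HBNNSimple.
Context {d} {T : measurableType d} {R : realType} (mu : {measure set T -> \bar R}).
Local Open Scope ereal_scope.

(** [f], [g] and [D] are arbitrary, since on the null set the derivatives of the original field are
    uncontrolled and its events may fail to be measurable. The integral of a nonnegative function is
    a supremum over simple functions, and these may be cut to 0 on [A]. *)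
Lemma eq_integral_off (A D : set T) (f g : T -> \bar R) : measurable A -> mu A = 0 ->
  (forall x, ~ A x -> f x = g x) -> \int[mu]_(x in D) f x = \int[mu]_(x in D) g x.
Proof.
move=> mA A0.
have main (f1 g1 : T -> \bar R) : (forall x, 0 <= f1 x) -> (forall x, 0 <= g1 x) ->
    (forall x, ~ A x -> f1 x = g1 x) -> \int[mu]_x f1 x <= \int[mu]_x g1 x.
  move=> f0 g0 fg; rewrite [leLHS]ge0_integralTE// [leRHS]ge0_integralTE//.
  apply: ub_ereal_sup => _ [h hf <-].
  have mC := measurableC mA; pose h' := mul_nnsfun h (indic_nnsfun R mC).
  apply: ereal_sup_ubound; exists h' => /=.
    move=> x; rewrite /= /mindic indicE; have [Ax|nAx] := pselect (A x).
      by rewrite memNset ?mulr0//; apply/not_notP.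
    by rewrite mem_set// mulr1 -fg.
  have e (k : {nnsfun T >-> R}) := integralT_nnsfun mu k.
  rewrite -(e h) -(e h'); apply: ae_eq_integral => //.
  - by apply/measurable_EFinP; exact: (measurable_funPT h').
  - by apply/measurable_EFinP; exact: (measurable_funPT h).
  exists A; split => // x /= hx; apply: contrapT => nAx; apply: hx => _.
  by rewrite /= /mindic indicE mem_set// mulr1.
have main' (f1 g1 : T -> \bar R) : (forall x, 0 <= f1 x) -> (forall x, 0 <= g1 x) ->
    (forall x, ~ A x -> f1 x = g1 x) -> \int[mu]_x f1 x = \int[mu]_x g1 x.
  by move=> f0 g0 fg; apply/eqP; rewrite eq_le !main// => x nAx; rewrite fg.
move=> fg; rewrite [LHS]integral_mkcond [RHS]integral_mkcond [LHS]integralE [RHS]integralE.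
have e x : ~ A x -> (f \_ D) x = (g \_ D) x by move=> nA; rewrite /patch fg.
congr (_ - _); apply: main' => x //.
- by move=> nA; rewrite unlock e.
- by move=> nA; rewrite unlock e.
Qed.

End integral_negligible.

Lemma funepos_comp (T1 T2 : Type) (R : realType) (f : T2 -> \bar R) (g : T1 -> T2) :
  ((fun x => f (g x))^\+ = fun x => f^\+ (g x))%E.
Proof. by rewrite unlock. Qed.

Lemma funeneg_comp (T1 T2 : Type) (R : realType) (f : T2 -> \bar R) (g : T1 -> T2) :
  ((fun x => f (g x))^\- = fun x => f^\- (g x))%E.
Proof. by rewrite unlock. Qed.

(** * The Gaussian space spanned by the field *)

Section gaussian_law.
Context {d} {Omega : measurableType d} {R : realType} (P : probability Omega R).

Lemma gaussian_variable_law (Y : Omega -> R) : measurable_fun setT Y -> gaussian_variable P Y ->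
  exists m s : R, forall F : R -> \bar R, measurable_fun setT F ->
    (\int[P]_w F (Y w) = \int[std_normal]_x F (m + `|s| * x)%R)%E.
Proof.
move=> mY [m [s hY]]; exists m, s => F mF.
suff main G : measurable_fun setT G -> (forall x, 0 <= G x)%E ->
    (\int[P]_w G (Y w) = \int[std_normal]_x G (m + `|s| * x)%R)%E.
  rewrite [LHS]integralE [RHS]integralE; congr (_ - _)%E.
  - rewrite (funepos_comp F Y) (funepos_comp F (fun x => m + `|s| * x)); exact: (main _ (measurable_funepos mF) (funepos_ge0 F)).
  - rewrite (funeneg_comp F Y) (funeneg_comp F (fun x => m + `|s| * x)); exact: (main _ (measurable_funeneg mF) (funeneg_ge0 F)).
move=> mG G0; have mY' : measurable_fun setT (Y : Omega -> measurableTypeR R) by [].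
rewrite -(ge0_integral_pushm P mY')//.
have [s0|s0] := eqVneq s 0.
  transitivity (\int[\d_(m : measurableTypeR R)]_x G x)%E.
    apply: eq_measure_integral => A mA _; by have := hY A mA; rewrite s0 eqxx; exact.
  rewrite integral_dirac// diracT mul1e s0 normr0.
  under [RHS]eq_integral do rewrite mul0r addr0.
  by rewrite integral_cst//= probability_setT mule1.
rewrite -(integral_normal_prob m s0 mG G0); apply: eq_measure_integral => A mA _.
by have := hY A mA; rewrite (negbTE s0); exact.
Qed.

Lemma sqint_cst (c : R) : sqint P (fun=> c).
Proof.
split; first exact: measurable_cst.
by apply: (@bounded_integrable _ _ _ P (fun=> c ^+ 2) `|c ^+ 2|).
Qed.

Lemma sqint_std : sqint (@std_normal R) (fun x : R => x).
Proof.
split; first exact: measurable_id.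
apply/integrableP; split; first exact/measurable_EFinP/measurable_funX.
under eq_integral do rewrite gee0_abs ?lee_fin ?sqr_ge0//.
by rewrite std_normal_sqr ltry.
Qed.

Lemma gs_mean (H : set (Omega -> R)) f : gaussian_space P H -> H f ->
  (\int[P]_w (f w)%:E = 0)%E.
Proof.
move=> gH Hf; have mE : measurable_fun setT (fun x : R => x%:E) by exact/measurable_EFinP.
have -> : (\int[P]_w (f w)%:E = \int[std_normal]_x (nrm2 P f * x)%:E)%E.
  rewrite [LHS]integralE [RHS]integralE; congr (_ - _)%E.
  - rewrite (funepos_comp EFin f) (funepos_comp EFin (fun x => nrm2 P f * x)); exact: (gs_law1 gH Hf (measurable_funepos mE) (funepos_ge0 _)).
  - rewrite (funeneg_comp EFin f) (funeneg_comp EFin (fun x => nrm2 P f * x)); exact: (gs_law1 gH Hf (measurable_funeneg mE) (funeneg_ge0 _)).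
have [m0 i0] := @std_normal_mean R.
under eq_integral do rewrite EFinM.
rewrite integralZl//; rewrite /Rintegral in m0.
by rewrite -(fineK (integrable_fin_num measurableT i0)) m0 mule0.
Qed.

Lemma gaussian_variable_sqint (Y : Omega -> R) : measurable_fun setT Y ->
  gaussian_variable P Y -> sqint P Y.
Proof.
move=> mY gY; have [m [s hs]] := gaussian_variable_law mY gY; split=> //.
apply/integrableP; split; first exact/measurable_EFinP/measurable_funX.
under eq_integral do rewrite gee0_abs ?lee_fin ?sqr_ge0//.
rewrite (hs (fun x => (x ^+ 2)%:E)); last exact/measurable_EFinP/measurable_funX.
have scm : sqint (@std_normal R) (fun=> m).
  split; first exact: measurable_cst.
  by apply: (@bounded_integrable _ _ _ std_normal (fun=> m ^+ 2) `|m ^+ 2|).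
have [_ /integrableP[_]] := sqintDZ `|s| sqint_std scm.
under eq_integral do rewrite gee0_abs ?lee_fin ?sqr_ge0//.
by under eq_integral do rewrite addrC.
Qed.

(** By polarization it suffices to treat variances, where [gaussian_limit] applies. Limits and
    derivatives of covariances then follow from pointwise limits of paths. *)
Lemma gs_cov_cvg (H : set (Omega -> R)) (f_ g_ : nat -> Omega -> R) f g :
  gaussian_space P H -> l2_closed P H -> (forall n, H (f_ n)) -> (forall n, H (g_ n)) ->
  (forall w, f_ ^~ w @ \oo --> f w) -> (forall w, g_ ^~ w @ \oo --> g w) ->
  cov P (f_ n) (g_ n) @[n --> \oo] --> cov P f g.
Proof.
move=> gH cH Hf_ Hg_ cf cg.
have pol (x y : Omega -> R) : H x -> H y ->
    cov P x y = (cov P (fun w => 1 * x w + y w) (fun w => 1 * x w + y w) -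
                 cov P (fun w => -1 * x w + y w) (fun w => -1 * x w + y w)) / 4.
  move=> Hx Hy; have sx := gs_sqint gH Hx; have sy := gs_sqint gH Hy.
  by rewrite !cov_sqrDZ//; field.
have sq (h_ : nat -> Omega -> R) h : (forall n, H (h_ n)) -> (forall w, h_ ^~ w @ \oo --> h w) ->
    H h /\ cov P (h_ n) (h_ n) @[n --> \oo] --> cov P h h.
  move=> Hh ch; have [Hl c0] := gaussian_limit gH cH Hh ch; split => //.
  have sh n := gs_sqint gH (Hh n); have sl := gs_sqint gH Hl.
  have cn : nrm2 P (h_ n) @[n --> \oo] --> nrm2 P h.
    have c1 : nrm2 P (fun w => h_ n w - h w) @[n --> \oo] --> (0 : R).
      rewrite -(@sqrtr0 R); apply: continuous_cvg; first exact: sqrt_continuous.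
      exact: c0.
    apply/cvgrPdist_le => e e0; near=> n; rewrite distrC.
    apply: le_trans (nrm2B_close (sh n) sl) _.
    rewrite -[leLHS]ger0_norm ?nrm2_ge0//.
    by near: n; apply: cvgr0_norm_le.
  under eq_fun do rewrite -sqr_nrm2.
  by rewrite -sqr_nrm2; apply: cvgM.
have comb (e : R) (x y : Omega -> R) (x_ y_ : nat -> Omega -> R) : (forall n, H (x_ n)) -> (forall n, H (y_ n)) ->
    (forall w, x_ ^~ w @ \oo --> x w) -> (forall w, y_ ^~ w @ \oo --> y w) ->
    cov P (fun w => e * x_ n w + y_ n w) (fun w => e * x_ n w + y_ n w) @[n --> \oo] -->
    cov P (fun w => e * x w + y w) (fun w => e * x w + y w).
  move=> Hx Hy cx cy; apply: (sq (fun n w => e * x_ n w + y_ n w) (fun w => e * x w + y w) _ _).2.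
    by move=> n; exact: (gsDZ gH).
  by move=> w; apply: cvgD => //; apply: cvgM => //; exact: cvg_cst.
under eq_fun do rewrite pol//.
rewrite pol ?(sq _ _ Hf_ cf).1 ?(sq _ _ Hg_ cg).1//; last 2 first.
- exact: (sq _ _ Hf_ cf).1.
- exact: (sq _ _ Hg_ cg).1.
by apply: cvgM; [apply: cvgB; apply: comb|exact: cvg_cst].
Unshelve. all: by end_near. Qed.

End gaussian_law.

Section span.
Context {d} {Omega : measurableType d} {R : realType} (P : probability Omega R).
Context {I : Type} (T : set I) (X : I -> {RV P >-> R}) (Y : I -> Omega -> R) (A : set Omega).
Hypotheses (gX : gaussian_field T X) (cX : centered T X).
Hypotheses (mA : measurable A) (A0 : P A = 0%E) (mY : forall t, measurable_fun setT (Y t)).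
Hypothesis YX : forall t w, ~ A w -> Y t w = X t w.

Definition span_of : set (Omega -> R) := [set f | exists n (t : 'I_n -> I) (c : 'I_n -> R),
  (forall i, T (t i)) /\ f = fun w => \sum_(i < n) c i * Y (t i) w].

Lemma span_of_law f : span_of f -> measurable_fun setT f /\
  exists s : R, forall F : R -> \bar R, measurable_fun setT F ->
    (\int[P]_w F (f w) = \int[std_normal]_x F (s * x)%R)%E.
Proof.
move=> [n [t [c [Tt ->]]]].
have mf : measurable_fun setT (fun w => \sum_(i < n) c i * Y (t i) w).
  by apply: measurable_sum => i; exact: measurable_funM.
split=> //; pose g w := \sum_(i < n) c i * X (t i) w.
have mg : measurable_fun setT g by apply: measurable_sum => i; exact: measurable_funM.
have [m [s hs]] := gaussian_variable_law mg (gX c Tt).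
have fg (F : R -> \bar R) : (\int[P]_w F (\sum_(i < n) c i * Y (t i) w)%R = \int[P]_w F (g w))%E.
  apply: (eq_integral_off _ mA A0) => w nA; congr F.
  by apply: eq_bigr => i _; rewrite YX.
exists `|s| => F mF; rewrite fg hs//.
suff -> : m = 0 by under eq_integral do rewrite add0r.
have sX i : sqint P (X (t i)).
  apply: gaussian_variable_sqint => //.
  have := gX (fun=> 1) (fun _ : 'I_1 => Tt i); congr gaussian_variable.
  by apply/funext => w; rewrite big_ord1 mul1r.
have mE : measurable_fun setT (fun x : R => x%:E) by exact/measurable_EFinP.
have := congr1 fine (hs _ mE); rewrite -/(Rintegral P setT g) -/(Rintegral std_normal setT (fun x => m + `|s| * x)).
have -> : \int[P]_w g w = 0.
  transitivity (cov P g (fun=> 1)); first by apply: eq_Rintegral => w _; rewrite mulr1.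
  rewrite cov_suml//; last exact: sqint_cst.
  rewrite big1// => i _; rewrite /cov.
  have := cX (Tt i); rewrite unlock => /(congr1 fine) => e.
  by under eq_Rintegral do rewrite mulr1; rewrite /Rintegral e mulr0.
move=> ->; have [ms0 _] := @std_normal_mean R.
transitivity (cov std_normal (fun x : R => `|s| * x + m) (fun=> 1)).
  rewrite (covDZl _ sqint_std (sqint_cst _ m) (sqint_cst _ 1)).
  have -> : cov std_normal (fun x : R => x) (fun=> 1) = 0.
    by rewrite /cov -[RHS]ms0; apply: eq_Rintegral => x _; rewrite mulr1.
  rewrite mulr0 add0r /cov Rintegral_cst// mulr1 /=.
  by rewrite (congr1 fine (probability_setT std_normal)) mulr1.
by apply: eq_Rintegral => x _; rewrite mulr1 addrC.
Qed.

Lemma span_of_gaussian : gaussian_space P span_of.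
Proof.
have law f : span_of f -> sqint P f /\ exists s : R, cov P f f = s ^+ 2 /\
    forall F : R -> \bar R, measurable_fun setT F ->
    (\int[P]_w F (f w) = \int[std_normal]_x F (s * x)%R)%E.
  move=> /span_of_law[mf [s hs]].
  have m2 : measurable_fun setT (fun x : R => (x ^+ 2)%:E) by exact/measurable_EFinP/measurable_funX.
  have e : (\int[P]_w (f w ^+ 2)%:E = (s ^+ 2)%:E)%E.
    rewrite (hs _ m2); under eq_integral do rewrite exprMn EFinM.
    rewrite ge0_integralZl_EFin ?sqr_ge0//; last first.
      by move=> x _; rewrite lee_fin sqr_ge0.
    by rewrite std_normal_sqr mule1.
  split.
    split=> //; apply/integrableP; split; first exact/measurable_EFinP/measurable_funX.
    by under eq_integral do rewrite gee0_abs ?lee_fin ?sqr_ge0//; rewrite e ltry.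
  by exists s; split => //; rewrite /cov /Rintegral -[RHS]/(fine (s ^+ 2)%:E) -e.
split.
- by move=> f /law[].
- exists 0%N, (fun i : 'I_0 => match notF (ltn_ord i) return I with end), (fun=> 0).
  by split=> [[]//|]; apply/funext => w; rewrite big_ord0.
- move=> r f g [n [t [c [Tt ->]]]] [m [t' [c' [Tt' ->]]]].
  exists (n + m)%N, (fun i => match fintype.split i with inl j => t j | inr j => t' j end),
    (fun i => match fintype.split i with inl j => r * c j | inr j => c' j end).
  split=> [i|]; first by case: fintype.split.
  apply/funext => w; rewrite big_split_ord/= mulr_sumr; congr (_ + _); apply: eq_bigr => i _.
    by rewrite (unsplitK (inl i)) mulrA.
  by rewrite (unsplitK (inr i)).
- move=> f c /law[sf [s [e hs]]]; rewrite e -std_normal_cos /Rintegral; congr fine.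
  rewrite (hs (fun x => (cos (x + c))%:E))//.
  apply/measurable_EFinP; apply: measurableT_comp; first by apply: continuous_measurable_fun; exact: continuous_cos.
  exact: measurable_funD.
Qed.

End span.

Section jets.
Context {d} {Omega : measurableType d} {R : realType} (P : probability Omega R) {N : nat}.
Implicit Types (F : 'rV[R]_N -> Omega -> R) (i j : 'I_N) (t : 'rV[R]_N).

Definition D1 F i t : Omega -> R := fun w => partial i (F ^~ w) t.
Definition D2 F i j t : Omega -> R := fun w => partial i (partial j (F ^~ w)) t.

Lemma measurable_D1 F i t : (forall w, C1 (F ^~ w)) -> (forall t, measurable_fun setT (F t)) ->
  measurable_fun setT (D1 F i t).
Proof.
move=> cF mF.
apply: (@measurable_fun_cvg _ _ _ setT (fun n w => n.+1%:R * (F (n.+1%:R^-1 *: e_ i + t) w - F t w))).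
  by move=> n; apply: measurable_funM => //; exact: measurable_funB.
move=> w _; have := @cvg_first_difference _ _ (F ^~ w) t (e_ i) (cF w).
rewrite (bigD1 i)//= e_E eqxx mul1r big1 ?addr0// => j ji.
by rewrite e_E eq_sym (negbTE ji) mul0r.
Qed.

Context (H : set (Omega -> R)) (gH : gaussian_space P H) (cH : l2_closed P H).
Context (a b : 'rV[R]_N) (hab : forall i, a ord0 i < b ord0 i).

(* The increments are taken towards the inside of the box. *)
Lemma gs_D1 F i t : (forall w, C1 (F ^~ w)) -> (forall t, box a b t -> H (F t)) ->
  box a b t -> H (D1 F i t).
Proof.
move=> cF HF Tt.
have [c [c0 hc]] : exists c : R, c != 0 /\ forall x, 0 <= x <= 1 -> box a b (x *: (c *: e_ i) + t).
  have [h|h] := ltP (t ord0 i) (b ord0 i).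
    exists (b ord0 i - t ord0 i); split; first by rewrite gt_eqF// subr_gt0.
    move=> x /andP[x0 x1] j; rewrite !mxE eqxx /=; have /andP[h1 h2] := Tt j.
    case: eqVneq => [e|_]; last by rewrite !mulr0 add0r h1.
    rewrite mulr1 e in h1 h2 *; apply/andP; split; nra.
  exists (a ord0 i - t ord0 i); split.
    by rewrite lt_eqF// subr_lt0; exact: lt_le_trans (hab i) h.
  move=> x /andP[x0 x1] j; rewrite !mxE eqxx /=; have /andP[h1 h2] := Tt j.
  case: eqVneq => [e|_]; last by rewrite !mulr0 add0r h1.
  rewrite mulr1 e in h1 h2 *; apply/andP; split; nra.
pose f n w := n.+1%:R * (F (n.+1%:R^-1 *: (c *: e_ i) + t) w - F t w).
have Hf n : H (f n).
  apply: (gsZ _ gH); apply: (gsB gH); apply: HF => //; apply: hc.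
  by rewrite invr_ge0 ler0n invf_le1// ler1n.
have ch w : f ^~ w @ \oo --> c * D1 F i t w.
  have := @cvg_first_difference _ _ (F ^~ w) t (c *: e_ i) (cF w).
  rewrite (bigD1 i)//= !mxE !eqxx mulr1 big1 ?addr0// => j ji.
  by rewrite !mxE eqxx /= (negbTE ji) mulr0 mul0r.
have [Hl _] := gaussian_limit gH cH Hf ch.
have := gsZ c^-1 gH Hl; congr H; apply/funext => w.
by rewrite mulrA mulVf// mul1r.
Qed.

End jets.

Section nondegeneracy.
Context {d} {Omega : measurableType d} {R : realType} (P : probability Omega R).
Context (H : set (Omega -> R)) (gH : gaussian_space P H).
Context (A : set Omega) (mA : measurable A) (A0 : P A = 0%E).

Lemma covariance_off (f g f' g' : Omega -> R) : H f' -> H g' ->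
  (forall w, ~ A w -> f w = f' w) -> (forall w, ~ A w -> g w = g' w) ->
  fine (covariance P f g) = cov P f' g'.
Proof.
move=> Hf Hg ff gg.
have E0 h h' : H h' -> (forall w, ~ A w -> h w = h' w) -> fine ('E_P[h])%E = 0.
  move=> Hh hh; rewrite unlock (eq_integral_off (g := fun w => (h' w)%:E) _ mA A0); last by move=> w /hh ->.
  by rewrite (gs_mean gH Hh).
rewrite unlock (E0 _ _ Hf ff) (E0 _ _ Hg gg) unlock /cov /Rintegral; congr fine.
apply: (eq_integral_off _ mA A0) => w nA.
by rewrite /= /GRing.mul /= !subr0 ff// gg.
Qed.

(** By Cauchy-Schwarz a combination of zero variance is orthogonal to every entry, so its
    coefficients lie in the kernel of the covariance matrix. Coefficients are indexed by [nat]
    because the vector is a concatenated list. *)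
Lemma nondegenerate_free (V V' : seq (Omega -> R)) (c : nat -> R) : size V = size V' ->
  (forall k, H (nth (fun=> 0 : R) V' k)) ->
  (forall k w, ~ A w -> nth (fun=> 0 : R) V k w = nth (fun=> 0 : R) V' k w) -> Defs.nondegenerate P V ->
  let f := fun w : Omega => \sum_(0 <= k < size V) c k * nth (fun=> 0 : R) V' k w in
  cov P f f = 0 -> forall k, (k < size V)%N -> c k = 0.
Proof.
move=> sV HV VV nd f f0 k kV.
have fE : f = fun w => \sum_(i < size V) c i * nth (fun=> 0 : R) V' i w.
  by apply/funext => w; rewrite /f big_mkord.
have sV' i := gs_sqint gH (HV i).
have Hf : H f by rewrite fE; apply: (gs_sum _ gH) => i; exact: (gsZ _ gH).
pose v : 'rV[R]_(size V) := \row_i c i.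
have v0 : v *m covariance_matrix P V = 0.
  apply/rowP => j; rewrite !mxE.
  transitivity (cov P f (nth (fun=> 0 : R) V' j)).
    rewrite fE cov_suml//; apply: eq_bigr => i _; rewrite !mxE; congr (_ * _).
    by apply: covariance_off => // w nA; rewrite (tnth_nth (fun=> 0 : R)) /= VV.
  apply/eqP; rewrite -normr_eq0 eq_le normr_ge0 andbT.
  apply: le_trans (cov_le (gs_sqint gH Hf) (sV' j)) _.
  by rewrite /nrm2 f0 sqrtr0 mul0r.
have /rowP/(_ (Ordinal kV)) : v = 0 by rewrite -(mulmxK nd v) v0 mul0mx.
by rewrite !mxE.
Qed.

End nondegeneracy.

Section nth2.
Context {A B : Type} (Q : A -> B -> Prop) (x : A) (y : B) (Qxy : Q x y).

Lemma nth2_cat s1 s2 t1 t2 : size s1 = size t1 ->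
  (forall k, Q (nth x s1 k) (nth y t1 k)) -> (forall k, Q (nth x s2 k) (nth y t2 k)) ->
  forall k, Q (nth x (s1 ++ s2) k) (nth y (t1 ++ t2) k).
Proof. by move=> st h1 h2 k; rewrite !nth_cat st; case: ifP. Qed.

Lemma nth2_map (I : Type) (s : seq I) f g : (forall i, Q (f i) (g i)) ->
  forall k, Q (nth x (map f s) k) (nth y (map g s) k).
Proof.
by move=> h; elim: s => [|i s IH] [|k] //=; rewrite ?nth_nil.
Qed.

Definition jet_of (C I J : Type) (c : C) (f : I -> C) (g : J -> C) r s := c :: map f r ++ map g s.

Lemma nth2_jet (I J : Type) c c' f f' g g' (r : seq I) (s : seq J) : Q c c' ->
  (forall i, Q (f i) (f' i)) -> (forall i, Q (g i) (g' i)) ->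
  forall k, Q (nth x (jet_of c f g r s) k) (nth y (jet_of c' f' g' r s) k).
Proof.
move=> hc hf hg [|k] //=; apply: nth2_cat; rewrite ?size_map// => k'; exact: nth2_map.
Qed.

End nth2.

Lemma size_jet_of (C I J : Type) (c : C) (f : I -> C) (g : J -> C) r s :
  size (jet_of c f g r s) = (size r + size s).+1.
Proof. by rewrite /= size_cat !size_map. Qed.

Lemma nth_jet_of (C I J : Type) (x c : C) (f : I -> C) (g : J -> C) r s l k : (k < size r)%N ->
  nth x (jet_of c f g r s ++ l) k.+1 = nth x (map f r) k.
Proof. by move=> kr; rewrite /= -catA nth_cat size_map kr. Qed.

(** * The smooth version of the field *)

Section model.
Context {d} {Omega : measurableType d} {R : realType} (P : probability Omega R) {N : nat}.
Context (a b : 'rV[R]_N).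
Local Notation T := (box a b).

(** The interface of the later arguments, in which every path is smooth. [gm_jet] and [gm_pair] are
    the forms of regularity that compactness turns into uniform bounds: no combination of the value
    and the gradient at one point, and no difference of two values, is degenerate. *)
Record gaussian_model (H : set (Omega -> R)) (F : 'rV[R]_N -> Omega -> R) : Prop := {
  gm_space : gaussian_space P H ;
  gm_closed : l2_closed P H ;
  gm_path : forall w, C2 (F ^~ w) ;
  gm_measurable : forall t, measurable_fun setT (F t) ;
  gm_field : forall t, T t -> H (F t) ;
  gm_holder : exists K delta : R, [/\ 0 < K, 0 < delta & forall (r : R) s t i j, 0 <= r ->
    T s -> T t -> close r s t ->
    nrm2 P (fun w => D2 F i j s w - D2 F i j t w) <= K * r `^ delta] ;
  gm_jet : forall t (c0 : R) (c : 'I_N -> R), T t ->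
    let f := fun w : Omega => c0 * F t w + \sum_i c i * D1 F i t w in
    cov P f f = 0 -> c0 = 0 /\ forall i, c i = 0 ;
  gm_pair : forall s t, T s -> T t -> s != t ->
    0 < cov P (fun w => F s w - F t w) (fun w => F s w - F t w) }.

Lemma enorm_le (r : R) (s t : 'rV[R]_N) : 0 <= r -> close r s t -> enorm (s - t) <= Num.sqrt N%:R * r.
Proof.
move=> r0 st; rewrite /enorm -[leRHS]ger0_norm ?mulr_ge0 ?sqrtr_ge0// -sqrtr_sqr ler_wsqrtr//.
rewrite exprMn sqr_sqrtr// mulr_natl -[X in _ *+ X]card_ord -sumr_const ler_sum// => i _.
by rewrite !mxE; have := st i; rewrite ler_norml => /andP[h1 h2]; rewrite !expr2; nra.
Qed.

Context (X : 'rV[R]_N -> {RV P >-> R}).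
Hypotheses (N0 : (0 < N)%N) (hab : forall i, a ord0 i < b ord0 i).
Hypotheses (hgauss : gaussian_field (box a b) X) (hcent : centered (box a b) X).
Hypotheses (hsmooth : smooth a b X) (hreg : regular a b X).

Lemma gaussian_model_exists : exists (A : set Omega) (H : set (Omega -> R)) (F : 'rV[R]_N -> Omega -> R),
  [/\ measurable A, P A = 0%E, forall w, ~ A w -> sample_path X w = F ^~ w & gaussian_model H F].
Proof.
have [[A [mA A0 hA]] [C [delta [C0 d0 hC]]]] := hsmooth.
have cA w : ~ A w -> C2 (sample_path X w) by move=> nA; apply: contrapT => nC; apply: nA; exact: hA.
(* On the null set the path becomes the zero function, which is of class C2; measurability in [w] is
   kept. *)
pose F t w := X t w * \1_(~` A) w.
have FX t w : ~ A w -> F t w = X t w by move=> nA; rewrite /F indicE mem_set ?mulr1.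
have Fp w : ~ A w -> sample_path X w = F ^~ w by move=> nA; apply/funext => t; rewrite FX.
have mF t : measurable_fun setT (F t).
  by apply: measurable_funM => //; apply: measurable_indic; exact: measurableC.
have cF w : C2 (F ^~ w).
  have [Aw|nA] := pselect (A w); last by rewrite -Fp//; exact: cA.
  have -> : F ^~ w = fun=> 0.
    by apply/funext => t; rewrite /F indicE memNset ?mulr0//; exact/not_notP.
  have p0 (i : 'I_N) : partial i (fun=> 0 : R) = (fun=> 0 : R).
    by apply/funext => t; rewrite /partial derive_cst.
  have c1 : C1 (fun _ : 'rV[R]_N => 0 : R).
    split; first exact: cst_continuous.
    move=> i; split=> [t|]; last by rewrite p0; exact: cst_continuous.
    exact: derivable_cst.
  by split=> // i; rewrite p0.
pose S := span_of (box a b) F.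
have gS : gaussian_space P S := span_of_gaussian hgauss hcent mA A0 mF FX.
pose H := l2_closure P S.
have gH : gaussian_space P H by exact: l2_closure_gaussian.
have cH : l2_closed P H by exact: l2_closure_closed.
have HF t : T t -> H (F t).
  move=> Tt; apply: (sub_l2_closure gS); exists 1%N, (fun=> t), (fun=> 1); split=> //.
  by apply/funext => w; rewrite big_ord1 mul1r.
have H1 i t : T t -> H (D1 F i t).
  by apply: (gs_D1 gH cH hab) => // w; have [] := cF w.
have H2 i j t : T t -> H (D2 F i j t).
  move=> Tt; apply: (@gs_D1 _ _ _ P N H gH cH a b hab (fun t => D1 F j t) i t) => // [w|s]; last exact: H1.
  by have [_ h] := cF w; exact: h.
have [E1 E1e] : exists E, E = enum 'I_N by exists (enum 'I_N).
have [E2 E2e] : exists E, E = enum [pred p : 'I_N * 'I_N | (p.1 <= p.2)%N] by eexists.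
pose jet' t := jet_of (F t) (fun i => D1 F i t) (fun p : 'I_N * 'I_N => D2 F p.1 p.2 t) E1 E2.
have jetE t : jet X t = jet_of (X t : Omega -> R) (fun i => grad X i t)
    (fun p : 'I_N * 'I_N => hess X p.1 p.2 t) E1 E2 by rewrite E1e E2e.
have jet'_size t : size (jet X t) = size (jet' t) by rewrite (jetE t); apply: (etrans (size_jet_of _ _ _ _ _)); exact/esym/size_jet_of.
pose Q (f f' : Omega -> R) := H f' /\ forall w, ~ A w -> f w = f' w.
have Q0 : Q (fun=> 0) (fun=> 0) by split=> //; exact: (gs0 gH).
have G1 i t w : ~ A w -> grad X i t w = D1 F i t w by move=> nA; rewrite /grad Fp.
have G2 i j t w : ~ A w -> hess X i j t w = D2 F i j t w by move=> nA; rewrite /hess Fp.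
have Qjet t k : T t -> Q (nth (fun=> 0 : R) (jet X t) k) (nth (fun=> 0 : R) (jet' t) k).
  move=> Tt; rewrite jetE; apply: (nth2_jet Q0) => [|i|p]; split => [|w nA].
  - exact: HF.
  - by rewrite FX.
  - exact: H1.
  - exact: G1.
  - exact: H2.
  - exact: G2.
have Q2 s t k : T s -> T t -> Q (nth (fun=> 0 : R) (jet X s ++ jet X t) k) (nth (fun=> 0 : R) (jet' s ++ jet' t) k).
  by move=> Ts Tt; apply: nth2_cat => // k'; exact: Qjet.
have free s t c : T s -> T t -> s != t ->
    let f := fun w : Omega => \sum_(0 <= k < size (jet X s ++ jet X t)) c k * nth (fun=> 0 : R) (jet' s ++ jet' t) k w in
    cov P f f = 0 -> forall k, (k < size (jet X s ++ jet X t))%N -> c k = 0.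
  move=> Ts Tt st; apply: (nondegenerate_free gH mA A0) => //.
  - exact: (etrans (size_cat _ _) (etrans (congr2 addn (jet'_size s) (jet'_size t)) (esym (size_cat _ _)))).
  - by move=> k; exact: (Q2 _ _ _ Ts Tt).1.
  - by move=> k; exact: (Q2 _ _ _ Ts Tt).2.
  - exact: hreg.
exists A, H, F; split => //; split => //.
- exists (Num.sqrt C * Num.sqrt N%:R `^ delta), delta; split => //.
    by rewrite mulr_gt0 ?powR_gt0 ?sqrtr_gt0 ?ltr0n.
  move=> r s t i j r0 Ts Tt st.
  rewrite -mulrA -powRM ?sqrtr_ge0//.
  have e0 : 0 <= enorm (s - t) by exact: sqrtr_ge0.
  apply: le_trans (_ : Num.sqrt (C * enorm (s - t) `^ (2 * delta)) <= _); last first.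
    rewrite sqrtrM ?(ltW C0)// ler_wpM2l ?sqrtr_ge0//.
    rewrite mulrC powRrM powR_mulrn ?powR_ge0// sqrtr_sqr ger0_norm ?powR_ge0//.
    by rewrite ge0_ler_powR ?nnegrE ?(ltW d0) ?mulr_ge0 ?sqrtr_ge0 ?enorm_le.
  rewrite /nrm2 ler_wsqrtr// -lee_fin; apply: le_trans (hC s t i j Ts Tt).
  rewrite unlock -(cov_sqr_integral (gs_sqint gH (gsB gH (H2 i j s Ts) (H2 i j t Tt)))).
  rewrite le_eqVlt; apply/orP; left; apply/eqP; apply: (eq_integral_off _ mA A0) => w nA.
  by rewrite /= expr2 /GRing.mul /= -!G2 ?expr2.
- move=> t c0 c Tt f f0.
  (* Regularity concerns two distinct points. A second point of the box exists since [N] is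
     positive, and all coefficients beyond the value and gradient at [t] are taken to be 0. *)
  have [t' [Tt' tt']] : exists t', T t' /\ t != t'.
    have Ta : T a by move=> i; rewrite lexx ltW.
    have Tb : T b by move=> i; rewrite lexx ltW.
    have [ta|ta] := eqVneq t a; [exists b|by exists a].
    split=> //; rewrite ta; apply/eqP => /rowP/(_ (Ordinal N0)) e.
    by have := hab (Ordinal N0); rewrite e ltxx.
  have sE1 : size E1 = N by rewrite E1e size_enum_ord.
  have nE1 i0 (i : 'I_N) : nth i0 E1 i = i by rewrite E1e nth_ord_enum.
  pose cs := c0 :: [seq c i | i <- E1].
  have scs : size cs = N.+1 by rewrite /= size_map sE1.
  have sS : (N.+1 <= size (jet X t ++ jet X t'))%N.
    by rewrite size_cat jetE size_jet_of sE1 -addSn -addnA leq_addr.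
  have := free t t' (fun k => nth 0 cs k) Tt Tt' tt'; move: sS; set S' := size _ => sS; cbv zeta.
  have -> : (fun w => \sum_(0 <= k < S') nth 0 cs k *
      nth (fun=> 0 : R) (jet' t ++ jet' t') k w) = f.
    apply/funext => w; rewrite (big_cat_nat _ (n := N.+1))//= [X in _ + X]big1_seq ?addr0; last first.
      by move=> k /andP[_]; rewrite mem_index_iota => /andP[kN _]; rewrite nth_default ?mul0r// scs.
    rewrite big_nat_recl//; congr (_ + _).
    rewrite big_mkord; apply: eq_bigr => i _.
    have iN : (i < size E1)%N by rewrite sE1.
    by rewrite (nth_jet_of _ _ _ _ _ _ iN) -[nth 0 cs i.+1]/(nth 0 [seq c i | i <- E1] i) 2!(nth_map i _ _ iN) nE1.
  move=> /(_ f0) h; split; first exact: (h 0%N (leq_trans _ sS)).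
  move=> i; have := h i.+1 (leq_trans _ sS); rewrite ltnS => /(_ (ltn_ord i)) /=.
  by rewrite (nth_map i) ?sE1// nE1.
- move=> s t Ts Tt st; rewrite lt_neqAle cov_ge0 andbT eq_sym; apply/eqP => f0.
  (* [q] is the position of the value at [t] in the concatenated jets; the coefficients are 1 at 0
     and -1 at [q]. *)
  pose q := size (jet X s).
  have q0 : (0 < q)%N by rewrite /q jetE.
  have Q0S : jet' s = F s :: behead (jet' s) by [].
  have qS : (q < size (jet X s ++ jet X t))%N by rewrite size_cat -[X in (X < _)%N]addn0 ltn_add2l jetE.
  have sel (g : nat -> R) m S' : (m < S')%N -> \sum_(0 <= k < S') (k == m)%:R * g k = g m.
    move=> mS; rewrite big_mkord (bigD1 (Ordinal mS))//= eqxx mul1r big1 ?addr0// => k km.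
    by rewrite (_ : (k == m :> nat) = false) ?mul0r//; apply/negbTE; apply: contra km => /eqP e; apply/eqP/val_inj.
  have := free s t (fun k => (k == 0%N)%:R - (k == q)%:R) Ts Tt st; cbv zeta.
  have -> : (fun w => \sum_(0 <= k < size (jet X s ++ jet X t)) ((k == 0%N)%:R - (k == q)%:R) *
      nth (fun=> 0 : R) (jet' s ++ jet' t) k w) = (fun w => F s w - F t w).
    apply/funext => w; under eq_bigr do rewrite mulrBl.
    rewrite sumrB (sel (fun k => nth (fun=> 0 : R) (jet' s ++ jet' t) k w) _ _ (ltn_trans q0 qS)).
    rewrite (sel (fun k => nth (fun=> 0 : R) (jet' s ++ jet' t) k w) _ _ qS).
    have -> : nth (fun=> 0 : R) (jet' s ++ jet' t) 0 = F s by [].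
    suff -> : nth (fun=> 0 : R) (jet' s ++ jet' t) q = F t by [].
    by rewrite nth_cat -jet'_size -/q ltnn subnn.
  move=> /(_ f0 0%N (ltn_trans q0 qS)) /eqP.
  by rewrite eqxx (ltn_eqF q0) subr0 oner_eq0.
Qed.

End model.

(** * Geometry of the variance *)

Section box_sequences.
Context {R : realType}.

(** For each [n] an index at least [n] is chosen close to a cluster point. The condition [n <= g n]
    suffices to keep limits, so [g] is not asked to be increasing. *)
Lemma box_extract k (a b : 'rV[R]_k) (u : nat -> 'rV[R]_k) : (forall n, box a b (u n)) ->
  exists t (g : nat -> nat), [/\ box a b t, forall n, (n <= g n)%N &
    forall i, u (g n) ord0 i @[n --> \oo] --> t ord0 i].
Proof.
move=> Tu.
have cT : compact (box a b).
  have -> : box a b = [set v : 'rV[R]_k | forall i, `[a ord0 i, b ord0 i]%classic (v ord0 i)].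
    by rewrite predeqE => v; split => h i; have := h i; rewrite /= in_itv.
  exact: (@rV_compact R k (fun i => `[a ord0 i, b ord0 i]%classic) (fun i => @segment_compact R _ _)).
have FT : (u @ \oo) (box a b) by exists 0%N => // n _; exact: Tu.
have [t [Tt ct]] := cT (u @ \oo) _ FT.
have /choice[g hg] : forall n : nat, exists m, (n <= m)%N /\ close n.+1%:R^-1 t (u m).
  move=> n; have [||z [[m [nm <-]] h]] := ct [set u m | m in [set m | (n <= m)%N]] [set z | close n.+1%:R^-1 t z].
  - by exists n => // m nm; exists m.
  - apply/nbhs_rowP; exists n.+1%:R^-1; first by rewrite invr_gt0.
    by move=> y h i; exact: ltW.
  - by exists m.
exists t, g; split => // [n|]; first exact: (hg n).1.
apply: (@cvg_row_close _ _ _ _ (fun n => 1 / n.+1%:R)); last exact: cvg_harmonicZ.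
by move=> n; rewrite div1r; exact: (hg n).2.
Qed.

Lemma cvg_extract (u : nat -> R) (l : R) (g : nat -> nat) : (forall n, (n <= g n)%N) ->
  u n @[n --> \oo] --> l -> u (g n) @[n --> \oo] --> l.
Proof.
move=> hg ul; apply: (cvg_comp g u _ ul) => A [M _ MA]; exists M => // n /= Mn.
by apply: MA; exact: leq_trans Mn (hg n).
Qed.

Lemma cvg_inv_extract (g : nat -> nat) : (forall n, (n <= g n)%N) ->
  (g n).+1%:R^-1 @[n --> \oo] --> (0 : R).
Proof. by move=> hg; exact: (@cvg_extract (fun n => n.+1%:R^-1) 0 g hg (@cvg_harmonic R)). Qed.

Lemma cvg_ge_bound (u v : nat -> R) (l m : R) :
  u n @[n --> \oo] --> l -> v n @[n --> \oo] --> m -> (forall n, u n <= v n) -> l <= m.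
Proof. by move=> ul vm uv; apply: (ler_cvg_to ul vm); exact: nearW. Qed.

End box_sequences.

Section geometry.
Context {d} {Omega : measurableType d} {R : realType} (P : probability Omega R) {N : nat}.
Context (a b : 'rV[R]_N) (hab : forall i, a ord0 i < b ord0 i).
Context (H : set (Omega -> R)) (F : 'rV[R]_N -> Omega -> R) (gm : gaussian_model P a b H F).
Local Notation T := (box a b).

Let gH := gm_space gm.
Let cH := gm_closed gm.

Definition vr t := cov P (F t) (F t).
(** Half of the derivative of the variance in direction [i], by [partial_within_vr]. *)
Definition c1 i t := cov P (F t) (D1 F i t).
Definition c2 i j t := cov P (F t) (D2 F i j t).

Lemma gm_C1 w : C1 (F ^~ w). Proof. by have [] := gm_path gm w. Qed.

Lemma gm_C1' j w : C1 (fun t => D1 F j t w). Proof. by have [_ h] := gm_path gm w; exact: h. Qed.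

Lemma gm_D1 i t : T t -> H (D1 F i t).
Proof. by apply: (@gs_D1 _ _ _ P N H gH cH a b hab F) => // [w|s]; [exact: gm_C1|exact: (gm_field gm)]. Qed.

Lemma gm_D2 i j t : T t -> H (D2 F i j t).
Proof.
apply: (@gs_D1 _ _ _ P N H gH cH a b hab (fun t => D1 F j t)); first exact: gm_C1'.
by move=> s; exact: gm_D1.
Qed.

Definition row_cvg (p : nat -> 'rV[R]_N) (t : 'rV[R]_N) := forall i, p n ord0 i @[n --> \oo] --> t ord0 i.

Lemma gm_cvg0 p t w : row_cvg p t -> F (p n) w @[n --> \oo] --> F t w.
Proof. by move=> pt; apply: (@continuous_row_cvg _ _ (F ^~ w)) => //; have [c _] := gm_C1 w; exact: c. Qed.

Lemma gm_cvg1 i p t w : row_cvg p t -> D1 F i (p n) w @[n --> \oo] --> D1 F i t w.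
Proof.
move=> pt; apply: (@continuous_row_cvg _ _ (fun t => D1 F i t w)) => //.
by have [c _] := gm_C1' i w; exact: c.
Qed.

Lemma gm_cvg2 i j p t w : row_cvg p t -> D2 F i j (p n) w @[n --> \oo] --> D2 F i j t w.
Proof.
move=> pt; apply: (@continuous_row_cvg _ _ (fun t => D2 F i j t w)) => //.
exact: (C1_partial (gm_C1' j w)).
Qed.

Lemma cvg_vr p t : (forall n, T (p n)) -> row_cvg p t -> vr (p n) @[n --> \oo] --> vr t.
Proof.
move=> Tp pt; apply: (gs_cov_cvg gH cH) => [n|n|w|w]; try exact: (gm_field gm); exact: gm_cvg0.
Qed.

Lemma cvg_c1 i p t : (forall n, T (p n)) -> row_cvg p t -> c1 i (p n) @[n --> \oo] --> c1 i t.
Proof.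
move=> Tp pt; apply: (gs_cov_cvg gH cH) => [n|n|w|w].
- exact: (gm_field gm). - exact: gm_D1. - exact: gm_cvg0. - exact: gm_cvg1.
Qed.

Lemma cvg_c2 i j p t : (forall n, T (p n)) -> row_cvg p t -> c2 i j (p n) @[n --> \oo] --> c2 i j t.
Proof.
move=> Tp pt; apply: (gs_cov_cvg gH cH) => [n|n|w|w].
- exact: (gm_field gm). - exact: gm_D2. - exact: gm_cvg0. - exact: gm_cvg2.
Qed.

Definition jet1 (e : 'rV[R]_N.+1) t w := e ord0 ord0 * F t w + \sum_i e ord0 (lift ord0 i) * D1 F i t w.

Lemma gs_jet1 e t : T t -> H (jet1 e t).
Proof.
move=> Tt; apply: (gsDZ gH); first exact: (gm_field gm).
by apply: (gs_sum _ gH) => i; apply: (gsZ _ gH); exact: gm_D1.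
Qed.

(** Compactness of the box and of the unit sphere of coefficients: if the variances of unit
    combinations had no positive lower bound, a limit point would be a degenerate combination at a
    single point, against [gm_jet]. *)
Lemma gm_lambda : exists2 lambda : R, 0 < lambda & forall t (e : 'rV[R]_N.+1), T t ->
  lambda * \sum_i e ord0 i ^+ 2 <= cov P (jet1 e t) (jet1 e t).
Proof.
apply: contrapT => nl.
have /choice[te hte] : forall n : nat, exists te : 'rV[R]_N * 'rV[R]_N.+1,
    [/\ T te.1, \sum_i te.2 ord0 i ^+ 2 = 1 & cov P (jet1 te.2 te.1) (jet1 te.2 te.1) <= n.+1%:R^-1].
  move=> n; apply: contrapT => nn; apply: nl; exists n.+1%:R^-1; first by rewrite invr_gt0.
  move=> t e Tt; rewrite leNgt; apply/negP => h; apply: nn.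
  set S := \sum_i _ in h.
  have S0 : 0 < S.
    rewrite lt_neqAle eq_sym sumr_ge0 ?andbT => [|i _]; last exact: sqr_ge0.
    by apply: contraTneq h => ->; rewrite mulr0 -leNgt cov_ge0.
  have sS : Num.sqrt S ^+ 2 = S by rewrite sqr_sqrtr// ltW.
  have sS0 : Num.sqrt S != 0 by rewrite gt_eqF// sqrtr_gt0.
  exists (t, (Num.sqrt S)^-1 *: e); split => //=.
    under eq_bigr do rewrite mxE exprMn exprVn sS.
    by rewrite -mulr_sumr mulVf// gt_eqF.
  have -> : jet1 ((Num.sqrt S)^-1 *: e) t = fun w => (Num.sqrt S)^-1 * jet1 e t w.
    apply/funext => w; rewrite /jet1 !mxE mulrDr mulr_sumr mulrA; congr (_ + _).
    by apply: eq_bigr => i _; rewrite mxE mulrA.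
  rewrite -sqr_nrm2 (nrm2Z _ (gs_sqint gH (gs_jet1 e Tt))) exprMn real_normK ?num_real//.
  rewrite exprVn sS sqr_nrm2 mulrC ler_pdivrMr//; exact: ltW.
have T1 n : T (te n).1 by have [] := hte n.
have [t [g [Tt hg cg]]] := box_extract T1.
have Be n : box (const_mx (-1) : 'rV[R]_N.+1) (const_mx 1) (te (g n)).2.
  have [_ h _] := hte (g n); move=> i; rewrite !mxE -ler_norml.
  rewrite -(@expr_le1 _ 2)// real_normK ?num_real// -h (bigD1 i)//= lerDl sumr_ge0// => j _.
  exact: sqr_ge0.
have [e [g' [_ hg' cg']]] := box_extract Be.
pose k n := g (g' n); have hk n : (n <= k n)%N by apply: leq_trans (hg' n) (hg _).
have ct : row_cvg (fun n => (te (k n)).1) t by move=> i; apply: (cvg_extract hg' (cg i)).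
have Tk n : T (te (k n)).1 by have [] := hte (k n).
have e1 : \sum_i e ord0 i ^+ 2 = 1.
  apply: (@cvg_uniqueR _ (fun n => \sum_i (te (k n)).2 ord0 i ^+ 2)).
    apply: cvg_sumr => i; rewrite expr2; under eq_fun do rewrite expr2.
    by apply: cvgM; exact: cg'.
  have -> : (fun n => \sum_i (te (k n)).2 ord0 i ^+ 2) = fun=> 1.
    by apply/funext => n; have [] := hte (k n).
  exact: cvg_cst.
have c0 : cov P (jet1 e t) (jet1 e t) <= 0.
  have Hj n := gs_jet1 (te (k n)).2 (Tk n).
  have cj w : jet1 (te (k n)).2 (te (k n)).1 w @[n --> \oo] --> jet1 e t w.
    apply: cvgD; first by apply: cvgM; [exact: cg'|exact: gm_cvg0].
    by apply: cvg_sumr => i; apply: cvgM; [exact: cg'|exact: gm_cvg1].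
  apply: (cvg_ge_bound (gs_cov_cvg gH cH Hj Hj cj cj) (cvg_inv_extract hk)) => n.
  by have [] := hte (k n).
have [] := gm_jet gm (c0 := e ord0 ord0) (c := fun i => e ord0 (lift ord0 i)) Tt.
  by apply/eqP; rewrite eq_le c0 cov_ge0.
move=> e0 ei; move: e1; rewrite big_ord_recl e0 expr0n add0r big1 => [/esym/eqP|i _].
  by rewrite oner_eq0.
by rewrite ei expr0n.
Qed.

Lemma vr_gt0 t : T t -> 0 < vr t.
Proof.
move=> Tt; have [l l0 /(_ t (delta_mx ord0 ord0) Tt)] := gm_lambda.
have -> : jet1 (delta_mx ord0 ord0) t = F t.
  apply/funext => w; rewrite /jet1 mxE !eqxx mul1r big1 ?addr0// => i _.
  by rewrite mxE eqxx /= mul0r.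
rewrite (bigD1 ord0)//= mxE !eqxx expr1n big1 ?addr0 ?mulr1 => [|i /negbTE i0]; last first.
  by rewrite mxE i0 andbF expr0n.
exact: lt_le_trans.
Qed.

Lemma vr_bounded : exists M, forall t, T t -> vr t <= M.
Proof.
apply: contrapT => nM.
have /choice[t ht] : forall n : nat, exists t, T t /\ n%:R <= vr t.
  move=> n; apply: contrapT => nn; apply: nM; exists n%:R => t Tt.
  by rewrite leNgt; apply/negP => h; apply: nn; exists t; split=> //; exact: ltW.
have [s [g [Ts hg cg]]] := box_extract (fun n => (ht n).1).
have cv := cvg_vr (fun n => (ht (g n)).1) cg.
have /cvgrPdist_le/(_ 1 ltr01)[m _ hm] := cv.
pose n := (m + (Num.truncn (vr s + 1)).+1)%N.
have := hm n (leq_addr _ _); rewrite /= ler_norml => /andP[h _].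
have h1 := (ht (g n)).2.
have h2 : vr s + 1 < n%:R by apply: lt_le_trans (truncnS_gt _) _; rewrite ler_nat leq_addl.
have h3 : n%:R <= (g n)%:R :> R by rewrite ler_nat.
lra.
Qed.

Definition sig2 : R := sup [set vr t | t in T].

Lemma box_a : T a. Proof. by move=> i; rewrite lexx ltW. Qed.

Lemma vr_le t : T t -> vr t <= sig2.
Proof.
move=> Tt; apply: sup_upper_bound; last by exists t.
split; first by exists (vr t), t.
by have [M hM] := vr_bounded; exists M => _ [s Ts <-]; exact: hM.
Qed.

Lemma sig2_gt0 : 0 < sig2.
Proof. exact: lt_le_trans (vr_gt0 box_a) (vr_le box_a). Qed.

Lemma cov_half s t : T s -> T t ->
  cov P (fun w => 2^-1 * (F s w + F t w)) (fun w => 2^-1 * (F s w + F t w)) =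
  (vr s + vr t) / 2 - cov P (fun w => F s w - F t w) (fun w => F s w - F t w) / 4.
Proof.
move=> Ts Tt; have Hs := gm_field gm Ts; have Ht := gm_field gm Tt.
have ss := gs_sqint gH Hs; have st := gs_sqint gH Ht.
have -> : (fun w => 2^-1 * (F s w + F t w)) = (fun w => 2^-1 * (1 * F s w + F t w) + 0).
  by apply/funext => w; rewrite mul1r addr0.
have -> : (fun w => F s w - F t w) = (fun w => (-1) * F t w + F s w).
  by apply/funext => w; rewrite mulN1r addrC.
have s0 := sqint0 P; have sD := sqintDZ 1 ss st.
rewrite (cov_sqrDZ _ sD s0) (covC _ _ (fun=> 0)) !cov0l cov_sqrDZ// cov_sqrDZ// (covC P (F t) (F s)).
by rewrite /vr; field.
Qed.

(** If [F] is high at two distant points, so is the half sum, whose variance falls short of [sig2]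
    by a quarter of the variance of the difference ([cov_half]). Compactness and [gm_pair] make this
    deficit uniform; it forces high values to cluster. *)
Lemma gm_far (r : R) : 0 < r -> exists2 kappa : R, 0 < kappa & forall s t, T s -> T t ->
  ~ close r s t -> cov P (fun w => 2^-1 * (F s w + F t w)) (fun w => 2^-1 * (F s w + F t w)) <= sig2 - kappa.
Proof.
move=> r0; apply: contrapT => nk.
have /choice[st hst] : forall n : nat, exists st : 'rV[R]_N * 'rV[R]_N,
    [/\ T st.1, T st.2, r <= \sum_i `|st.1 ord0 i - st.2 ord0 i| &
     cov P (fun w => F st.1 w - F st.2 w) (fun w => F st.1 w - F st.2 w) <= 4 / n.+1%:R].
  move=> n; apply: contrapT => nn; apply: nk; exists n.+1%:R^-1; first by rewrite invr_gt0.
  move=> s t Ts Tt nc; rewrite leNgt; apply/negP => h; apply: nn; exists (s, t); split => //=.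
    rewrite leNgt; apply/negP => h'; apply: nc => i; apply: le_trans (ltW h').
    by rewrite (bigD1 i)//= lerDl sumr_ge0.
  move: h; rewrite cov_half// => h; have h1 := vr_le Ts; have h2 := vr_le Tt.
  by rewrite mulrC; set q := n.+1%:R^-1 in h *; lra.
have T1 n : T (st n).1 by have [] := hst n.
have [s [g [Ts hg cg]]] := box_extract T1.
have T2 n : T (st (g n)).2 by have [] := hst (g n).
have [t [g' [Tt hg' cg']]] := box_extract T2.
pose k n := g (g' n); have hk n : (n <= k n)%N by apply: leq_trans (hg' n) (hg _).
have cs : row_cvg (fun n => (st (k n)).1) s by move=> i; apply: (cvg_extract hg' (cg i)).
have rs : r <= \sum_i `|s ord0 i - t ord0 i|.
  apply: (@cvg_ge_bound _ (fun=> r) (fun n => \sum_i `|(st (k n)).1 ord0 i - (st (k n)).2 ord0 i|)).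
  - exact: cvg_cst.
  - by apply: cvg_sumr => i; apply: cvg_norm; apply: cvgB; [exact: cs|exact: cg'].
  - by move=> n; have [] := hst (k n).
have st' : s != t.
  by apply: contraTneq rs => ->; rewrite big1 -?ltNge// => i _; rewrite subrr normr0.
have := gm_pair gm Ts Tt st'; rewrite ltNge => /negP; apply.
have Hf n : H (fun w => F (st (k n)).1 w - F (st (k n)).2 w).
  by have [h1 h2 _ _] := hst (k n); apply: (gsB gH); exact: (gm_field gm).
have cf w : F (st (k n)).1 w - F (st (k n)).2 w @[n --> \oo] --> F s w - F t w.
  by apply: cvgB; apply: gm_cvg0.
have c4 : 4 / (k n).+1%:R @[n --> \oo] --> (0 : R).
  by rewrite -[X in _ --> X](mulr0 4); apply: cvgM; [exact: cvg_cst|exact: (cvg_inv_extract hk)].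
apply: (cvg_ge_bound (gs_cov_cvg gH cH Hf Hf cf cf) c4) => n.
by have [] := hst (k n).
Qed.

(** The increment of the variance is the covariance of the difference and the sum of the two values;
    after division by [h n] both factors converge pathwise. *)
Lemma cvg_vr_quotient i t (h : nat -> R) : T t -> (forall n, h n != 0) ->
  (forall n, T (h n *: e_ i + t)) -> h n @[n --> \oo] --> (0 : R) ->
  (h n)^-1 * (vr (h n *: e_ i + t) - vr t) @[n --> \oo] --> 2 * c1 i t.
Proof.
move=> Tt h0 Th ch.
have ct : row_cvg (fun n => h n *: e_ i + t) t.
  apply: (@cvg_row_close _ _ _ _ (fun n => `|h n|)); last by rewrite -(@normr0 _ R); exact: cvg_norm.
  move=> n j; rewrite !mxE eqxx /= opprD addrCA subrr addr0 normrN normrM ler_piMr//.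
  by case: (j == i); rewrite ?normr1 ?normr0.
have HF s : T s -> H (F s) by exact: (gm_field gm).
pose f n w := (h n)^-1 * (F (h n *: e_ i + t) w - F t w).
pose g n w := F (h n *: e_ i + t) w + F t w.
have -> : (fun n => (h n)^-1 * (vr (h n *: e_ i + t) - vr t)) = (fun n => cov P (f n) (g n)).
  apply/funext => n; have s1 := gs_sqint gH (HF _ (Th n)); have s2 := gs_sqint gH (HF _ Tt).
  have sB : sqint P (fun w => -1 * F t w + F (h n *: e_ i + t) w) by exact: sqintDZ.
  have -> : f n = fun w => (h n)^-1 * (-1 * F t w + F (h n *: e_ i + t) w) + 0.
    by apply/funext => w; rewrite /f addr0 mulN1r addrC.
  have -> : g n = fun w => 1 * F (h n *: e_ i + t) w + F t w by apply/funext => w; rewrite mul1r.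
  rewrite covDZl ?cov0l; [|exact: sB|exact: sqint0|exact: sqintDZ].
  rewrite covDZl; [|exact: s2|exact: s1|exact: sqintDZ].
  by rewrite !covDZr// (covC P (F t) (F (_ + _))) /vr addr0; ring.
have -> : 2 * c1 i t = cov P (D1 F i t) (fun w => F t w + F t w).
  have s2 := gs_sqint gH (HF _ Tt).
  have -> : (fun w => F t w + F t w) = fun w => 1 * F t w + F t w by apply/funext => w; rewrite mul1r.
  by rewrite covDZr//; [rewrite covC /c1; ring|exact: (gs_sqint gH (gm_D1 i Tt))].
apply: (gs_cov_cvg gH cH) => [n|n|w|w].
- by apply: (gsZ _ gH); apply: (gsB gH); exact: HF.
- by apply: (gsD gH); exact: HF.
- have := @cvg_difference_quotient _ _ (F ^~ w) t (e_ i) h (gm_C1 w) h0 ch.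
  rewrite (bigD1 i)//= e_E eqxx mul1r big1 ?addr0// => j ji.
  by rewrite e_E eq_sym (negbTE ji) mul0r.
- by apply: cvgD; [exact: gm_cvg0|exact: cvg_cst].
Qed.

Lemma partial_within_vr i t (nu' : 'rV[R]_N -> R) : T t -> (forall s, T s -> nu' s = vr s) ->
  partial_within T i nu' t = 2 * c1 i t.
Proof.
move=> Tt nuE; rewrite /partial_within.
set D := [set h : R | _]; set q := fun h : R => _.
have DE x : D x <-> a ord0 i <= x + t ord0 i <= b ord0 i.
  split=> [/(_ i)|h j]; rewrite !mxE eqxx /=; first by rewrite eqxx mulr1.
  by case: eqVneq => [->|_]; rewrite ?mulr1// mulr0 add0r; exact: Tt.
(* From any point of the box one can move along [e_ i] inside it on at least one side, so the
   restricted filter is proper. The limit is then tested on sequences. *)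
have Dpf : ProperFilter (within D 0^').
  apply: Build_ProperFilter_ex => // A /nbhs_ballP[e /= e0 eA].
  have /andP[h1 h2] := Tt i; have ab := hab i.
  pose w := Num.min (e / 2) ((b ord0 i - a ord0 i) / 2).
  have w0 : 0 < w by rewrite lt_min !divr_gt0// subr_gt0.
  have we : w < e by rewrite gt_min; apply/orP; left; lra.
  have wb : w <= (b ord0 i - a ord0 i) / 2 by rewrite ge_min lexx orbT.
  have [h|h] := leP (t ord0 i) ((a ord0 i + b ord0 i) / 2).
    exists w; apply: eA => /=; rewrite ?gt_eqF//.
      by rewrite /ball/= sub0r normrN gtr0_norm.
    by apply/DE; apply/andP; split; lra.
  exists (- w); apply: eA => /=; rewrite ?oppr_eq0 ?gt_eqF//.
    by rewrite /ball/= sub0r opprK gtr0_norm.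
  by apply/DE; apply/andP; split; lra.
apply: cvg_lim => //; move=> A /nbhs_ballP[e /= e0 eA]; apply: contrapT => nA.
have /choice[h hh] : forall n : nat, exists h : R, [/\ `|h| <= n.+1%:R^-1, h != 0, D h & ~ A (q h)].
  move=> n; apply: contrapT => nn; apply: nA; apply/nbhs_ballP; exists n.+1%:R^-1 => /=.
    by rewrite invr_gt0.
  move=> y /= hy y0 Dy; apply: contrapT => nAy; apply: nn; exists y; split => //.
  by move: hy; rewrite /ball/= sub0r normrN => /ltW.
have ch : h n @[n --> \oo] --> (0 : R).
  apply/cvgrPdist_le => x x0; near=> n; rewrite sub0r normrN.
  have [h1 _ _ _] := hh n; apply: le_trans h1 _; near: n.
  have := @cvg_harmonic R => /cvgr_le; exact.
have h0 n : h n != 0 by have [] := hh n.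
have Th n : T (h n *: e_ i + t) by have [] := hh n.
have /cvgrPdist_lt/(_ e e0)[m _ hm] := cvg_vr_quotient Tt h0 Th ch.
have [_ _ _] := hh m; apply; apply: eA; rewrite /ball/=.
by have := hm m (leqnn m); rewrite /q /= !nuE.
Unshelve. all: by end_near. Qed.

Hypothesis hbd : forall (J : face N) t i, face_set a b J t -> vr t = sig2 -> i \notin tau J -> c1 i t != 0.

Definition outward (e : bool) : R := if e then 1 else -1.

Definition supported (J : face N) (v : 'rV[R]_N) := forall i, J i != None -> v ord0 i = 0.

(** A single constant serves as variance gap, radius, outward slope and curvature, so that one
    compactness argument provides it. The first condition on [J] says that points near [p] are
    interior in the free directions and off the side opposite to the one prescribed by [J] in the
    others. *)
Definition profile (kappa : R) p := vr p <= sig2 - kappa \/ exists J : face N,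
  [/\ forall s, T s -> close kappa p s -> forall i, match J i with
        | None => a ord0 i < s ord0 i < b ord0 i
        | Some e => s ord0 i != corner a b (~~ e) i end,
      forall i e, J i = Some e -> kappa <= outward e * c1 i p &
      forall v, supported J v ->
        \sum_i \sum_j v ord0 i * v ord0 j * c2 i j p <= - kappa * \sum_i v ord0 i ^+ 2].

Definition face_of (t : 'rV[R]_N) : face N := [ffun i =>
  if t ord0 i == a ord0 i then Some false else if t ord0 i == b ord0 i then Some true else None].

Lemma face_set_face_of t : T t -> face_set a b (face_of t) t.
Proof.
move=> Tt i; rewrite ffunE /corner; have /andP[h1 h2] := Tt i.
case: eqVneq => [->|h3]; first by rewrite mulr0n subr0 mul1r mul0r addr0.
case: eqVneq => [->|h4]; first by rewrite subrr mul0r mul1r add0r.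
by rewrite !lt_neqAle h1 h2 eq_sym h3 h4.
Qed.

(** Moving into the box cannot increase a maximal variance, which gives the weak inequality; the
    boundary condition makes it strict. *)
Lemma outward_c1 t i e : T t -> vr t = sig2 -> face_of t i = Some e -> 0 < outward e * c1 i t.
Proof.
move=> Tt vt Ji; have iJ : i \notin tau (face_of t) by rewrite inE Ji.
have n0 := hbd (face_set_face_of Tt) vt iJ.
have ab := hab i; pose w := b ord0 i - a ord0 i; have w0 : 0 < w by rewrite subr_gt0.
pose h n : R := - outward e * (w / n.+1%:R).
have oe : outward e != 0 by case: (e); rewrite ?oppr_eq0 oner_eq0.
have q0 (m : nat) : (0 : R) < (m.+1%:R^-1 : R) /\ (m.+1%:R^-1 : R) <= 1.
  by rewrite invr_gt0 ltr0n invf_le1 ?ler1n.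
have h0 n : h n != 0 by rewrite mulf_neq0 ?oppr_eq0// gt_eqF// divr_gt0.
have Th n : T (h n *: e_ i + t).
  move=> j; rewrite !mxE eqxx /=; case: eqVneq => [->|_]; last by rewrite mulr0 add0r.
  rewrite mulr1 /h; have [] := q0 n; set q := n.+1%:R^-1 => q1 q2.
  move: Ji; rewrite ffunE; case: eqVneq => [-> [<-]|_].
    by rewrite /outward opprK mul1r; apply/andP; split; rewrite /w; nra.
  case: eqVneq => // -> [<-].
  by rewrite /outward mulN1r; apply/andP; split; rewrite /w; nra.
have ch : h n @[n --> \oo] --> (0 : R).
  by rewrite -(mulr0 (- outward e)); apply: cvgM; [exact: cvg_cst|exact: cvg_harmonicZ].
have cq := cvg_vr_quotient Tt h0 Th ch.
have c' : outward e * ((h n)^-1 * (vr (h n *: e_ i + t) - vr t)) @[n --> \oo] --> outward e * (2 * c1 i t).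
  by apply: cvgM => //; exact: cvg_cst.
have ge0 : 0 <= outward e * (2 * c1 i t).
  apply: (@cvg_ge_bound _ (fun=> 0) _ 0 _ (@cvg_cst _ _ _ _ _) c') => n.
  rewrite /h invfM mulrA mulrA invrN mulrN mulfV// mulN1r mulNr -mulrN opprB mulr_ge0//.
    by rewrite invr_ge0 ltW// divr_gt0.
  by rewrite subr_ge0 vt; apply: vr_le; exact: Th n.
have : outward e * c1 i t != 0 by rewrite mulf_neq0.
rewrite lt_neqAle eq_sym => -> /=.
by move: ge0; rewrite mulrCA pmulr_rge0.
Qed.

(** The second difference of the variance at its maximum is nonpositive. It expands into the
    variances of the two first differences plus twice the covariance of [F t] with the second
    difference. In the limit the covariance with the Hessian form is at most minus the variance of
    the derivative along [v], which the nondegeneracy of the gradient bounds below. *)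
Lemma face_c2 lambda t v : (forall t (e : 'rV[R]_N.+1), T t ->
    lambda * \sum_i e ord0 i ^+ 2 <= cov P (jet1 e t) (jet1 e t)) ->
  T t -> vr t = sig2 -> supported (face_of t) v ->
  \sum_i \sum_j v ord0 i * v ord0 j * c2 i j t <= - lambda * \sum_i v ord0 i ^+ 2.
Proof.
move=> hl Tt vt sv.
have inner i : face_of t i = None -> a ord0 i < t ord0 i < b ord0 i.
  by move=> Ji; have := face_set_face_of Tt i; rewrite Ji.
(* [t] has positive distance to the sides in the free coordinates of its face, and [v] vanishes in
   the others: a small multiple of [v] can be followed in both directions. *)
have [r r0 hr] : exists2 r : R, 0 < r & forall x, `|x| <= 1 -> T (x *: (r *: v) + t).
  pose m i := Num.min (t ord0 i - a ord0 i) (b ord0 i - t ord0 i) / (1 + `|v ord0 i|).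
  have v1 i : 0 < 1 + `|v ord0 i| by rewrite ltr_wpDr.
  exists (\big[Num.min/1]_(i | face_of t i == None) m i).
    apply: lt_bigmin => // i /eqP/inner/andP[h1 h2].
    by rewrite divr_gt0// lt_min !subr_gt0 h1.
  move=> x x1 i; rewrite !mxE; have /andP[h1 h2] := Tt i.
  case Ji : (face_of t i) => [e|]; first by rewrite (sv i) ?Ji// !mulr0 add0r h1.
  set r := \big[_/_]_(_ | _) _.
  have rm : r <= m i by apply: bigmin_le_cond; rewrite Ji.
  have r1 : 0 <= r.
    by apply: le_bigmin => // j /eqP/inner/andP[g1 g2]; rewrite ltW// divr_gt0// lt_min !subr_gt0 g1.
  have rv : `|x * (r * v ord0 i)| <= Num.min (t ord0 i - a ord0 i) (b ord0 i - t ord0 i).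
    rewrite normrM; apply: le_trans (ler_piMl (normr_ge0 _) x1) _.
    rewrite normrM ger0_norm//; apply: le_trans (_ : r * (1 + `|v ord0 i|) <= _).
      by rewrite ler_wpM2l// lerDr.
    by rewrite -ler_pdivlMr.
  move: rv; rewrite le_min !ler_norml => /andP[/andP[g1 g2] /andP[g3 g4]].
  by set y := x * _ in g1 g2 g3 g4 *; apply/andP; split; lra.
set v' := r *: v in hr.
pose Fp n w := F (n.+1%:R^-1 *: v' + t) w; pose Fm n w := F (t - n.+1%:R^-1 *: v') w.
have n1 n : `|n.+1%:R^-1| <= 1 :> R by rewrite ger0_norm ?invr_ge0// invf_le1// ler1n.
have Tp n : T (n.+1%:R^-1 *: v' + t) by exact: hr.
have Tm n : T (t - n.+1%:R^-1 *: v').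
  by rewrite addrC -scaleNr; apply: hr; rewrite normrN.
have HF s : T s -> H (F s) by exact: (gm_field gm).
have Ht := HF _ Tt; have st := gs_sqint gH Ht.
pose dp n w := n.+1%:R * (Fp n w - F t w); pose dm n w := n.+1%:R * (Fm n w - F t w).
pose d2 n w := n.+1%:R ^+ 2 * (Fp n w + Fm n w - 2 * F t w).
have Hdp n : H (dp n) by apply: (gsZ _ gH); apply: (gsB gH) => //; exact: HF.
have Hdm n : H (dm n) by apply: (gsZ _ gH); apply: (gsB gH) => //; exact: HF.
have Hd2 n : H (d2 n).
  by apply: (gsZ _ gH); apply: (gsB gH); [apply: (gsD gH); exact: HF|exact: (gsZ _ gH)].
have ineq n : cov P (dp n) (dp n) + cov P (dm n) (dm n) + 2 * cov P (F t) (d2 n) <= 0.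
  have sp := gs_sqint gH (HF _ (Tp n)); have sm := gs_sqint gH (HF _ (Tm n)).
  have s0 := sqint0 P.
  have E (G : Omega -> R) : sqint P G ->
      cov P (fun w => n.+1%:R * (G w - F t w)) (fun w => n.+1%:R * (G w - F t w)) =
      n.+1%:R ^+ 2 * (cov P G G + vr t - 2 * cov P (F t) G).
    move=> sG; have sB := sqintDZ (-1) st sG.
    have -> : (fun w => n.+1%:R * (G w - F t w)) = fun w => n.+1%:R * (-1 * F t w + G w) + 0.
      by apply/funext => w; rewrite addr0 mulN1r addrC.
    by rewrite (cov_sqrDZ _ sB s0) (covC _ _ (fun=> 0)) !cov0l cov_sqrDZ// /vr; ring.
  rewrite (E _ sp) (E _ sm).
  have -> : cov P (F t) (d2 n) = n.+1%:R ^+ 2 * (cov P (F t) (Fp n) + cov P (F t) (Fm n) - 2 * vr t).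
    have sB := sqintDZ 1 sp sm; have sC := sqintDZ (-2) st sB.
    have -> : d2 n = fun w => n.+1%:R ^+ 2 * (-2 * F t w + (1 * F (n.+1%:R^-1 *: v' + t) w + F (t - n.+1%:R^-1 *: v') w)) + 0.
      by apply/funext => w; rewrite /d2 /Fp /Fm; ring.
    rewrite (covDZr _ sC s0 st) (covC _ _ (fun=> 0)) cov0l (covDZr _ st sB st) (covDZr _ sp sm st).
    by rewrite /vr /Fp /Fm; ring.
  have h1 := vr_le (Tp n); have h2 := vr_le (Tm n); rewrite -vt /vr in h1 h2.
  have h3 : 0 <= n.+1%:R ^+ 2 :> R by rewrite sqr_ge0.
  rewrite /vr /Fp /Fm; set q := n.+1%:R ^+ 2 in h3 *.
  rewrite [leLHS](_ : _ = q * ((cov P (F (n.+1%:R^-1 *: v' + t)) (F (n.+1%:R^-1 *: v' + t)) - cov P (F t) (F t)) +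
     (cov P (F (t - n.+1%:R^-1 *: v')) (F (t - n.+1%:R^-1 *: v')) - cov P (F t) (F t)))); last by ring.
  by rewrite mulr_ge0_le0//; lra.
pose G w := \sum_i v' ord0 i * D1 F i t w.
pose G' w := \sum_i (- v') ord0 i * D1 F i t w.
pose K w := \sum_i \sum_j v' ord0 i * v' ord0 j * D2 F i j t w.
have cdp w : dp n w @[n --> \oo] --> G w by exact: (@cvg_first_difference _ _ (F ^~ w) t v' (gm_C1 w)).
have cdm w : dm n w @[n --> \oo] --> G' w.
  have := @cvg_first_difference _ _ (F ^~ w) t (- v') (gm_C1 w).
  by under eq_fun do rewrite scalerN (addrC (- _) t).
have cd2 w : d2 n w @[n --> \oo] --> K w by exact: (@cvg_second_difference _ _ (F ^~ w) t v' (gm_path gm w)).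
have lim0 : cov P G G + cov P G' G' + 2 * cov P (F t) K <= 0.
  apply: (cvg_ge_bound _ (@cvg_cst _ (0 : R) _ \oo _) ineq); apply: cvgD; first apply: cvgD.
  - exact: (gs_cov_cvg gH cH Hdp Hdp cdp cdp).
  - exact: (gs_cov_cvg gH cH Hdm Hdm cdm cdm).
  - apply: cvgM; first exact: cvg_cst.
    by apply: (gs_cov_cvg gH cH _ Hd2 _ cd2) => [n|w]; [exact: HF|exact: cvg_cst].
have s1 i := gs_sqint gH (gm_D1 i Tt); have s2 i j := gs_sqint gH (gm_D2 i j Tt).
have KE : cov P (F t) K = \sum_i \sum_j v' ord0 i * v' ord0 j * c2 i j t.
  have -> : K = fun w => \sum_i 1 * (\sum_j v' ord0 i * v' ord0 j * D2 F i j t w).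
    by apply/funext => w; apply: eq_bigr => i _; rewrite mul1r.
  rewrite cov_sumr//; last by move=> i; apply: sqint_sum.
  by apply: eq_bigr => i _; rewrite mul1r cov_sumr.
have jl (u : 'rV[R]_N) : lambda * \sum_i u ord0 i ^+ 2 <=
    cov P (fun w => \sum_i u ord0 i * D1 F i t w) (fun w => \sum_i u ord0 i * D1 F i t w).
  pose e : 'rV[R]_N.+1 := \row_i if unlift ord0 i is Some j then u ord0 j else 0.
  have := hl t e Tt; rewrite big_ord_recl mxE unlift_none expr0n add0r.
  under eq_bigr do rewrite mxE liftK.
  suff -> : jet1 e t = fun w => \sum_i u ord0 i * D1 F i t w by [].
  apply/funext => w; rewrite /jet1 mxE unlift_none mul0r add0r.
  by apply: eq_bigr => i _; rewrite mxE liftK.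
have j1 := jl v'; have j2 := jl (- v'); rewrite -/G -/G' in j1 j2.
have e2 : \sum_i (- v') ord0 i ^+ 2 = \sum_i v' ord0 i ^+ 2.
  by apply: eq_bigr => i _; rewrite mxE sqrrN.
rewrite e2 in j2.
have e3 : \sum_i v' ord0 i ^+ 2 = r ^+ 2 * \sum_i v ord0 i ^+ 2.
  by rewrite mulr_sumr; apply: eq_bigr => i _; rewrite mxE exprMn.
have e4 : \sum_i \sum_j v' ord0 i * v' ord0 j * c2 i j t = r ^+ 2 * \sum_i \sum_j v ord0 i * v ord0 j * c2 i j t.
  by rewrite mulr_sumr; apply: eq_bigr => i _; rewrite mulr_sumr; apply: eq_bigr => j _; rewrite !mxE; ring.
rewrite KE e4 in lim0; rewrite e3 in j1 j2.
rewrite -(@ler_pM2l _ (r ^+ 2)) ?exprn_gt0//.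
set S := \sum_i v ord0 i ^+ 2 in j1 j2 *; set Q := \sum_i \sum_j _ in lim0 *.
by rewrite mulrCA mulNr; lra.
Qed.

(** Points violating the profile with constants tending to 0 accumulate at some [t]. If the variance
    of [t] is not maximal, the first alternative holds nearby; otherwise the face of [t] is a valid
    [J] at nearby points, because [outward_c1] and [face_c2] are strict and the covariances are
    continuous. *)
Lemma gm_profile : exists2 kappa : R, 0 < kappa & forall p, T p -> profile kappa p.
Proof.
have [lambda l0 hl] := gm_lambda.
apply: contrapT => nk.
have /choice[p hp] : forall n : nat, exists p, T p /\ ~ profile n.+1%:R^-1 p.
  move=> n; apply: contrapT => nn; apply: nk; exists n.+1%:R^-1; first by rewrite invr_gt0.
  by move=> p Tp; apply: contrapT => h; apply: nn; exists p.
have [t [g [Tt hg cg]]] := box_extract (fun n => (hp n).1).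
pose k n : R := (g n).+1%:R^-1.
have k0 n : 0 < k n by rewrite /k invr_gt0.
have ck : k n @[n --> \oo] --> (0 : R) by exact: cvg_inv_extract.
have Tp n : T (p (g n)) by exact: (hp (g n)).1.
have cv := cvg_vr Tp cg.
have [vt|vt] := eqVneq (vr t) sig2; last first.
  have lt : vr t < sig2 by rewrite lt_neqAle vt vr_le.
  have : \forall n \near \oo, vr (p (g n)) + k n < sig2.
    have : vr (p (g n)) + k n @[n --> \oo] --> vr t.
      by rewrite -[X in _ --> X]addr0; exact: cvgD.
    by move=> /cvgr_lt; exact.
  move=> [n _ /(_ n (leqnn n)) /= h]; apply: (hp (g n)).2; left.
  by rewrite -/(k n); lra.
set J := face_of t.
pose m i := if J i is Some _ then b ord0 i - a ord0 i else Num.min (t ord0 i - a ord0 i) (b ord0 i - t ord0 i).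
have fJ := face_set_face_of Tt.
have m0 i : 0 < m i.
  rewrite /m; case Ji : (J i) => [e|]; first by rewrite subr_gt0.
  by have := fJ i; rewrite -/J Ji lt_min !subr_gt0.
have A1 : \forall n \near \oo, forall i, k n + `|p (g n) ord0 i - t ord0 i| < m i.
  apply: filter_forall => i.
  have : k n + `|p (g n) ord0 i - t ord0 i| @[n --> \oo] --> (0 : R).
    rewrite -[X in _ --> X](addr0 0); apply: cvgD => //.
    rewrite -(@normr0 _ R) -(subrr (t ord0 i)); apply: cvg_norm; apply: cvgB; [exact: cg|exact: cvg_cst].
  by move=> /cvgr_lt; exact.
have A2 : \forall n \near \oo, forall i, if J i is Some e then k n < outward e * c1 i (p (g n)) else true.
  apply: filter_forall => i; case Ji : (J i) => [e|]; last exact: nearW.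
  have pos := outward_c1 Tt vt Ji.
  have : k n - outward e * c1 i (p (g n)) @[n --> \oo] --> (0 - outward e * c1 i t).
    by apply: cvgB => //; apply: cvgM; [exact: cvg_cst|exact: cvg_c1].
  move=> /cvgr_lt/(_ 0); rewrite sub0r oppr_lt0 => /(_ pos).
  by apply: filterS => n; rewrite subr_lt0.
pose D n := \sum_i \sum_j `|c2 i j (p (g n)) - c2 i j t|.
have A3 : \forall n \near \oo, D n + k n < lambda.
  have : D n + k n @[n --> \oo] --> (0 : R).
    rewrite -[X in _ --> X](addr0 0); apply: cvgD => //.
    have -> : 0 = \sum_(i < N) \sum_(j < N) `|c2 i j t - c2 i j t|.
      by rewrite big1// => i _; rewrite big1// => j _; rewrite subrr normr0.
    apply: cvg_sumr => i; apply: cvg_sumr => j; apply: cvg_norm; apply: cvgB; last exact: cvg_cst.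
    exact: cvg_c2.
  by move=> /cvgr_lt; exact.
have [n _ hn] : \forall n \near \oo, [/\ forall i, k n + `|p (g n) ord0 i - t ord0 i| < m i,
    forall i, if J i is Some e then k n < outward e * c1 i (p (g n)) else true & D n + k n < lambda].
  by apply: filterS3 A1 A2 A3 => n.
have {hn} [h1 h2 h3] := hn n (leqnn n).
apply: (hp (g n)).2; right; exists J; rewrite -/(k n); split.
- move=> s Ts ps i; have := h1 i; have := ps i; have := fJ i; rewrite -/J /m.
  have st : `|s ord0 i - t ord0 i| <= `|p (g n) ord0 i - s ord0 i| + `|p (g n) ord0 i - t ord0 i|.
    rewrite -(subrKA (p (g n) ord0 i)) (distrC (p _ _ _) (s _ _)); exact: ler_normD.
  case: (J i) => [e|] => e1 h4 h5.
    have {}st : `|s ord0 i - t ord0 i| < b ord0 i - a ord0 i.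
      by apply: le_lt_trans st _; apply: le_lt_trans h5; rewrite lerD2r.
    apply: contraTneq st => ->; rewrite e1 -leNgt /corner; have ab := hab i.
    case: (e) => /=; rewrite ?mulr0n ?mulr1n ?subr0 ?subrr ?mul1r ?mul0r ?addr0 ?add0r.
      by rewrite -normrN opprB ler_norm.
    by rewrite ler_norm.
  have {}st : `|s ord0 i - t ord0 i| < Num.min (t ord0 i - a ord0 i) (b ord0 i - t ord0 i).
    by apply: le_lt_trans st _; apply: le_lt_trans h5; rewrite lerD2r.
  move: st; rewrite lt_min !ltr_norml => /andP[/andP[? ?] /andP[? ?]]; apply/andP; split; lra.
- by move=> i e Ji; have := h2 i; rewrite Ji => /ltW.
- move=> v sv; have := face_c2 hl Tt vt sv => h4.
  have h5 : `|\sum_i \sum_j v ord0 i * v ord0 j * (c2 i j (p (g n)) - c2 i j t)| <= D n * \sum_i v ord0 i ^+ 2.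
    apply: le_trans (ler_norm_sum _ _ _) _; rewrite /D mulr_suml; apply: ler_sum => i _.
    apply: le_trans (ler_norm_sum _ _ _) _; rewrite mulr_suml; apply: ler_sum => j _.
    rewrite normrM mulrC ler_wpM2l//.
    have vi l : v ord0 l ^+ 2 <= \sum_i v ord0 i ^+ 2.
      by rewrite (bigD1 l)//= lerDl sumr_ge0// => x _; rewrite sqr_ge0.
    have := vi i; have := vi j; have := sqr_ge0 (v ord0 i - v ord0 j); have := sqr_ge0 (v ord0 i + v ord0 j).
    by rewrite ler_norml !expr2 => ? ? ? ?; apply/andP; split; lra.
  have -> : \sum_i \sum_j v ord0 i * v ord0 j * c2 i j (p (g n)) =
     \sum_i \sum_j v ord0 i * v ord0 j * c2 i j t + \sum_i \sum_j v ord0 i * v ord0 j * (c2 i j (p (g n)) - c2 i j t).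
    rewrite -[RHS]big_split; apply: eq_bigr => i _; rewrite -[RHS]big_split; apply: eq_bigr => j _ /=.
    by rewrite mulrBr addrC subrK.
  have h6 := ler_normlP _ _ h5; have [_ h7] := h6.
  have S0 : 0 <= \sum_i v ord0 i ^+ 2 by rewrite sumr_ge0// => i _; rewrite sqr_ge0.
  move: h4 h7 S0; set S := \sum_i v ord0 i ^+ 2 => h4 h7 S0.
  have h8 : (D n + k n) * S <= lambda * S by rewrite ler_wpM2r// ltW.
  rewrite mulrDl in h8; rewrite mulNr in h4 *; lra.
Qed.

End geometry.

(** * Excursions above a high level *)

Section good_event.
Context {d} {Omega : measurableType d} {R : realType} (P : probability Omega R) {N : nat}.
Context (a b : 'rV[R]_N) (hab : forall i, a ord0 i < b ord0 i).
Context (H : set (Omega -> R)) (F : 'rV[R]_N -> Omega -> R) (gm : gaussian_model P a b H F).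
Local Notation T := (box a b).
Local Notation s2 := (sig2 P a b F).
Local Notation vr := (vr P F).
Local Notation D1 := (D1 F).
Local Notation D2 := (D2 F).

Let gH := gm_space gm.
Let cH := gm_closed gm.
Let s20 : 0 < s2 := sig2_gt0 hab gm.

Lemma rare0 : rare P H s2 (fun=> set0).
Proof.
split => //; exists 1 => // C c C0 c0; exists 0 => // q sq u u1.
by rewrite /mass integral_set0 mul0r.
Qed.

Lemma rare_if (c : bool) B : (c -> rare P H s2 B) -> rare P H s2 (fun u => if c then B u else set0).
Proof. by case: c => h; [exact: h|exact: rare0]. Qed.

Lemma rare_scaled f (c : R) : 0 < c -> H f -> cov P f f < c ^+ 2 * s2 ->
  rare P H s2 (fun u => above f (c * u)).
Proof.
move=> c0 Hf fc.
have -> : (fun u => above f (c * u)) = above (fun w => c^-1 * f w).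
  by apply/funext => u; apply/funext => w; apply/propext; rewrite /above/= mulrC -ler_pdivlMr// mulrC.
apply: (rare_tail gH) => //; first exact: (gsZ _ gH).
rewrite -sqr_nrm2 (nrm2Z _ (gs_sqint gH Hf)) exprMn real_normK ?num_real// sqr_nrm2.
by rewrite exprVn mulrC ltr_pdivrMr ?exprn_gt0// mulrC.
Qed.

(* [D - r X0] is independent of [X0], so that a large deviation of [D] from its regression on [X0]
   makes a high level of [X0] much more expensive. *)
Lemma rare_regression X0 D (S2 c kappa beta : R) : H X0 -> H D -> 0 < cov P X0 X0 -> cov P X0 X0 <= s2 ->
  cov P D D <= S2 -> 0 < beta -> 0 < 1 - c + beta * kappa ->
  s2 + beta ^+ 2 * S2 < (1 - c + beta * kappa) ^+ 2 * s2 ->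
  rare P H s2 (fun u => above X0 ((1 - c) * u) `&`
    above (fun w => cov P D X0 / cov P X0 X0 * X0 w - D w) (kappa * u)).
Proof.
move=> HX HD v0 vs DS b0 cb0 hs; set r := cov P D X0 / _; set v := cov P X0 X0 in v0 vs r *.
have sX := gs_sqint gH HX; have sD := gs_sqint gH HD.
pose V w := -1 * D w + r * X0 w.
have HV : H V by apply: (gsDZ gH) => //; exact: (gsZ _ gH).
have VE : (fun w => r * X0 w - D w) = V by apply/funext => w; rewrite /V mulN1r addrC.
have VE' : V = fun w => r * X0 w + -1 * D w by apply/funext => w; rewrite /V addrC.
have sD' := gs_sqint gH (gsZ (-1) gH HD).
have covND g : sqint P g -> cov P (fun w => -1 * D w) g = - cov P D g.
  move=> sg; have -> : (fun w => -1 * D w) = fun w => -1 * D w + 0 by apply/funext => w; rewrite addr0.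
  by rewrite covDZl ?cov0l//; [rewrite addr0 mulN1r|exact: sqint0].
have XV : cov P X0 V = 0.
  by rewrite covC VE' covDZl// covND// /r divfK ?subrr// gt_eqF.
have VV : cov P V V <= S2.
  have -> : cov P V V = cov P D D - r ^+ 2 * v.
    rewrite VE' cov_sqrDZ// (covC P X0) covND//.
    have -> : cov P (fun w => -1 * D w) (fun w => -1 * D w) = cov P D D.
      by rewrite covND// covC covND// opprK.
    have -> : cov P D X0 = r * v by rewrite /r divfK// gt_eqF.
    by rewrite -/v; ring.
  by apply: le_trans DS; rewrite gerBl mulr_ge0 ?sqr_ge0// ltW.
(* On the event, [beta * V + X0] exceeds [(1 - c + beta * kappa) * u]. Since [V] and [X0] are
   uncorrelated, its variance is at most [s2 + beta ^+ 2 * S2]: the threshold gains at first order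
   in [beta], the variance only at second order. *)
apply: (@rare_subset _ _ _ P H s2 _ (fun u => above (fun w => beta * V w + X0 w) ((1 - c + beta * kappa) * u))).
- apply: rare_scaled => //; first exact: (gsDZ gH).
  rewrite (cov_sqrDZ beta (gs_sqint gH HV) sX) (covC P V) XV mulr0 addr0.
  by apply: le_lt_trans hs; rewrite addrC lerD// ler_wpM2l// sqr_ge0.
- move=> u; rewrite VE; apply: measurableI; apply: measurable_above; exact: (gs_measurable gH).
- move=> u w [] h1; rewrite VE /above/= => h2; rewrite /above/= in h1.
  have h3 : beta * (kappa * u) <= beta * V w by rewrite ler_pM2l.
  by rewrite mulrDl -mulrA addrC lerD.
Qed.

Lemma box_bounded (phi : 'rV[R]_N -> R) : (forall (p : nat -> 'rV[R]_N) t, (forall n, T (p n)) -> T t -> row_cvg p t ->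
  phi (p n) @[n --> \oo] --> phi t) -> exists M, forall t, T t -> phi t <= M.
Proof.
move=> cphi; apply: contrapT => nM.
have /choice[t ht] : forall n : nat, exists t, T t /\ n%:R <= phi t.
  move=> n; apply: contrapT => nn; apply: nM; exists n%:R => t Tt.
  by rewrite leNgt; apply/negP => h; apply: nn; exists t; split=> //; exact: ltW.
have [s [g [Ts hg cg]]] := box_extract (fun n => (ht n).1).
have cv := cphi _ _ (fun n => (ht (g n)).1) Ts cg.
have /cvgrPdist_le/(_ 1 ltr01)[m _ hm] := cv.
pose n := (m + (Num.truncn (phi s + 1)).+1)%N.
have := hm n (leq_addr _ _); rewrite /= ler_norml => /andP[h _].
have h1 := (ht (g n)).2.
have h2 : phi s + 1 < n%:R by apply: lt_le_trans (truncnS_gt _) _; rewrite ler_nat leq_addl.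
have h3 : n%:R <= (g n)%:R :> R by rewrite ler_nat.
lra.
Qed.

Lemma moments_bounded : exists2 S2 : R, 0 < S2 & forall t i j, T t ->
  cov P (D1 i t) (D1 i t) <= S2 /\ cov P (D2 i j t) (D2 i j t) <= S2.
Proof.
have [S hS] : exists S, forall t, T t -> 1 + \sum_i cov P (D1 i t) (D1 i t) +
    \sum_i \sum_j cov P (D2 i j t) (D2 i j t) <= S.
  apply: box_bounded => p t Tp Tt pt; apply: cvgD; first (apply: cvgD; first exact: cvg_cst).
    apply: cvg_sumr => i; apply: (gs_cov_cvg gH cH) => [n|n|w|w]; try exact: (gm_D1 hab gm);
    exact: (gm_cvg1 gm).
  apply: cvg_sumr => i; apply: cvg_sumr => j.
  apply: (gs_cov_cvg gH cH) => [n|n|w|w]; try exact: (gm_D2 hab gm); exact: (gm_cvg2 gm).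
have p1 t : 0 <= \sum_i cov P (D1 i t) (D1 i t) by apply: sumr_ge0 => i _; exact: cov_ge0.
have p2 t i : 0 <= \sum_j cov P (D2 i j t) (D2 i j t) by apply: sumr_ge0 => j _; exact: cov_ge0.
have p3 t : 0 <= \sum_i \sum_j cov P (D2 i j t) (D2 i j t) by apply: sumr_ge0.
exists S.
  by apply: lt_le_trans (hS a (box_a hab)); rewrite -addrA ltr_pwDl// addr_ge0.
have aux (x y z A : R) : x <= y -> y <= z -> 0 <= A -> x <= 1 + A + z by lra.
have aux' (x y A : R) : x <= y -> 0 <= A -> x <= 1 + y + A by lra.
have tls (f : 'I_N -> R) k : (forall l, 0 <= f l) -> f k <= \sum_l f l.
  by move=> f0; rewrite (bigD1 k (P := xpredT))// lerDl; apply: sumr_ge0.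
move=> t i j Tt; have h := hS t Tt; split; apply: le_trans h.
  have h1 := tls (fun k => cov P (D1 k t) (D1 k t)) i (fun k => cov_ge0 P _).
  exact: (aux' _ _ _ h1 (p3 t)).
have h1 := tls (fun k => cov P (D2 i k t) (D2 i k t)) j (fun k => cov_ge0 P _).
have h2 := tls (fun k => \sum_l cov P (D2 k l t) (D2 k l t)) i (p2 t).
exact: (aux _ _ _ _ h1 h2 (p1 t)).
Qed.

Lemma grid_exists (r : R) : 0 < r -> exists2 M : nat, (0 < M)%N &
  forall t, T t -> exists z, close r (@grid_point R N a b M z) t.
Proof.
move=> r0; have w0 := width_gt0 hab; pose M := (Num.truncn (width a b / r)).+1.
exists M => // t Tt; have [//|z hz] := grid_approx hab (M := M) _ Tt; exists z => i.
apply: le_trans (hz i) _; rewrite ler_pdivrMr// mulrC -ler_pdivrMr// ltW// truncnS_gt//.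
Qed.

Lemma rare_osc2 (kappa : R) : 0 < kappa -> exists2 r : R, 0 < r & exists2 B, rare P H s2 B &
  forall u w s t i j, 0 < u -> ~ B u w -> T s -> T t -> close r s t ->
    `|D2 i j s w - D2 i j t w| <= kappa * u.
Proof.
move=> k0; have [K [delta [K0 d0 hK]]] := gm_holder gm.
have k4 : 0 < kappa / 4 by rewrite divr_gt0.
have osc (ij : 'I_N * 'I_N) : exists rB : R * (R -> set Omega), [/\ 0 < rB.1, rare P H s2 rB.2 &
    forall u w s t, 0 < u -> ~ rB.2 u w -> T s -> T t -> close rB.1 s t ->
      `|D2 ij.1 ij.2 s w - D2 ij.1 ij.2 t w| <= kappa * u].
  have [|r s t|w t_ t Tt_ Tt ct|r r0 [B rB hB]] := @rare_oscillation _ _ _ P H gH N a b hab s2 K delta (kappa / 4)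
      (D2 ij.1 ij.2) s20 K0 d0 k4.
  - by move=> t; exact: (gm_D2 hab gm).
  - by move=> r0 Ts Tt st; exact: hK.
  - exact: (gm_cvg2 gm).
  - exists (r, B); split => // u w s t u0 nB Ts Tt st.
    by apply: le_trans (hB u w s t u0 nB Ts Tt st) _; rewrite mulrCA divff ?mulr1// lexx.
have /choice[rB hrB] := osc.
exists (\big[Num.min/1]_ij (rB ij).1).
  by apply: lt_bigmin => // ij _; have [] := hrB ij.
exists (fun u => \bigcup_ij (rB ij).2 u).
  by apply: (rare_fin_bigcup (B := fun ij => (rB ij).2)) => ij; have [] := hrB ij.
move=> u w s t i j u0 nB Ts Tt st; have [r0 _ h] := hrB (i, j); apply: h => //.
  by move=> hB; apply: nB; exists (i, j).
by move=> l; apply: le_trans (st l) _; exact: bigmin_le_cond.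
Qed.

Hypothesis hbd : forall (J : face N) t i, face_set a b J t -> vr t = s2 -> i \notin tau J -> c1 P F i t != 0.

(** In the last clause every Hessian entry has its own point [xi i j], because the mean value
    theorem, applied to each partial derivative in coordinates, produces a different point for each
    entry. *)
Definition good_point (mu eta r L u : R) (w : Omega) (t : 'rV[R]_N) (J : face N) := [/\
  forall s, T s -> (1 - eta) * u <= F s w -> close r t s,
  forall s i j, T s -> `|D2 i j s w| <= L * u,
  forall s, T s -> close r t s -> forall i, match J i with
    | None => a ord0 i < s ord0 i < b ord0 i
    | Some e => s ord0 i != corner a b (~~ e) i /\ mu * u <= outward e * D1 i s w end &
  forall xi : 'I_N -> 'I_N -> 'rV[R]_N, (forall i j, T (xi i j) /\ close r t (xi i j)) ->
    forall v, supported J v ->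
    \sum_i \sum_j v ord0 i * v ord0 j * D2 i j (xi i j) w <= - mu * u * \sum_i v ord0 i ^+ 2].

Lemma mul_le_half_sqr (x y : R) : - ((x ^+ 2 + y ^+ 2) / 2) <= x * y <= (x ^+ 2 + y ^+ 2) / 2.
Proof.
have := sqr_ge0 (x - y); have := sqr_ge0 (x + y); rewrite !expr2 => ? ?.
by apply/andP; split; lra.
Qed.

Let norm_le_cases (x y : R) : ~ (y <= x) -> ~ (y <= - x) -> `|x| <= y.
Proof.
move=> /negP; rewrite -ltNge => h1 /negP; rewrite -ltNge => h2.
by rewrite ler_norml; apply/andP; split; lra.
Qed.

Let dist_le_width (x y l h W : R) : h - l <= W -> l <= y <= h -> l <= x <= h -> `|x - y| <= W.
Proof. by move=> ? /andP[? ?] /andP[? ?]; rewrite ler_norml; apply/andP; split; lra. Qed.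

Let mean_ge (x y z : R) : z <= x -> z <= y -> z <= 2^-1 * (x + y).
Proof. by move=> ? ?; lra. Qed.

Let quarters (x r : R) : x <= r / 4 + r / 2 + r / 4 -> x <= r.
Proof. by move=> ?; lra. Qed.

Let double_quarter (x r : R) : 0 < r -> x <= r / 4 + r -> x <= 2 * r.
Proof. by move=> ? ?; lra. Qed.

Let half_le (c u z : R) : c * u <= 1 / 2 * u -> (1 - c) * u <= z -> u / 2 <= z.
Proof. by move=> ? ?; lra. Qed.

Let le_sqr_1DB (c x : R) : 1 + 2 * (x - c) <= (1 - c + x) ^+ 2.
Proof. by have := sqr_ge0 (x - c); rewrite !expr2; lra. Qed.

Lemma good_event : exists mu eta r L : R, [/\ 0 < mu, 0 < eta < 1, 0 < r, 0 < L &
  exists2 B, rare P H s2 B & forall u w, 0 < u -> ~ B u w ->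
    forall t, T t -> (1 - eta) * u <= F t w -> exists J, good_point mu eta r L u w t J].
Proof.
have [kappa k0 hprof] := gm_profile hab gm hbd.
have [S2 S20 hS2] := moments_bounded.
(* Error allowed, in units of [u], in the regressions and in the oscillations. The regressions yield
   [kappa / (2 * s2)]; with this choice the errors, summed over at most [N] coordinates, cost at
   most half of it, whence [mu = kappa / (4 * s2)]. *)
pose k1 := kappa / (8 * s2 * N.+1%:R).
have k10 : 0 < k1 by rewrite divr_gt0// !mulr_gt0.
have [r0 r00 [B4 rB4 hB4]] := rare_osc2 k10.
(* [L ^+ 2 * s2] exceeds the variances of all derivatives, so a derivative beyond [L * u] at a grid
   point is rare. *)
pose L := S2 / s2 + 1.
have L0 : 1 <= L by rewrite /L lerDr divr_ge0// ltW.
have LS : S2 < L ^+ 2 * s2.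
  have h0 : 0 <= S2 / s2 by rewrite divr_ge0// ltW.
  have -> : S2 = S2 / s2 * s2 by rewrite divfK// gt_eqF.
  by rewrite ltr_pM2r// /L; set x := S2 / s2 in h0 *; nra.
pose w0 := width a b; have w00 : 0 < w0 := width_gt0 hab.
(* Bounds on the whole box in units of [u]: [L2] for second derivatives, from the grid and their
   oscillation, and [L1] for first derivatives, from one grid point and the Lipschitz bound across
   the box. *)
pose L2 := L + k1; pose L1 := L + N%:R * (L2 * w0) + 1.
have L20 : 0 < L2 by rewrite /L2; lra.
have NL0 : 0 <= N%:R * (L2 * w0) by rewrite !mulr_ge0// ltW.
have L10 : 0 < L1 by rewrite /L1; lra.
have NN : N%:R <= N.+1%:R :> R by rewrite ler_nat.
(* Within distance [2 * r] of a grid point its profile is valid, the second derivatives move by at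
   most [k1 * u], and so do the first ones. *)
pose r := Num.min (kappa / 2) (Num.min (r0 / 2) (k1 / (2 * (N.+1%:R * L2)))).
have r_gt0 : 0 < r by rewrite !lt_min !divr_gt0// !mulr_gt0.
have rk : 2 * r <= kappa.
  by have : r <= kappa / 2 by [rewrite /r ge_min lexx]; lra.
have rr0 : 2 * r <= r0.
  by have : r <= r0 / 2 by [rewrite /r !ge_min lexx orbT]; lra.
have rL : N%:R * (L2 * (2 * r)) <= k1.
  have : r <= k1 / (2 * (N.+1%:R * L2)) by rewrite /r !ge_min lexx !orbT.
  rewrite ler_pdivlMr ?mulr_gt0// => h; apply: le_trans h.
  have -> : r * (2 * (N.+1%:R * L2)) = N.+1%:R * (L2 * (2 * r)) by ring.
  by rewrite ler_wpM2r// !mulr_ge0// ltW.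
have r2 : 0 < r / 2 by rewrite divr_gt0.
have [k3 k30 hfar] := gm_far gm r2.
(* Weight of the residual in [rare_regression]: its variance cost [beta ^+ 2 * S2] is at most half
   of the first order gain [2 * beta * k1 * s2]. *)
pose beta := k1 * s2 / (S2 + k1 ^+ 2 * s2).
have den0 : 0 < S2 + k1 ^+ 2 * s2 by rewrite addr_gt0// mulr_gt0// exprn_gt0.
have beta0 : 0 < beta by rewrite divr_gt0// mulr_gt0.
have bS : beta ^+ 2 * S2 <= beta * k1 * s2.
  rewrite expr2 -(mulrA beta beta) -(mulrA beta k1) ler_pM2l//.
  have -> : beta * S2 = k1 * s2 * (S2 / (S2 + k1 ^+ 2 * s2)) by rewrite /beta; ring.
  have frac : S2 / (S2 + k1 ^+ 2 * s2) <= 1.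
    by rewrite ler_pdivrMr// mul1r lerDl mulr_ge0 ?sqr_ge0// ltW.
  by rewrite ler_piMr// ltW// mulr_gt0.
have bk0 : 0 < beta * k1 by rewrite mulr_gt0.
pose c := Num.min (1 / 2) (Num.min (kappa / (4 * s2)) (Num.min (k3 / (4 * s2)) (beta * k1 / 4))).
have c0 : 0 < c by rewrite !lt_min !divr_gt0// ?mulr_gt0.
have c12 : c <= 1 / 2 by rewrite /c ge_min lexx.
have ck : c <= kappa / (4 * s2) by rewrite /c !ge_min lexx orbT.
have ck3 : c <= k3 / (4 * s2) by rewrite /c !ge_min lexx !orbT.
have cb : c <= beta * k1 / 4 by rewrite /c !ge_min lexx !orbT.
have csq (x : R) : 0 < x -> c <= x / (4 * s2) -> s2 - x < (1 - c) ^+ 2 * s2.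
  move=> x0; rewrite ler_pdivlMr ?mulr_gt0// => h.
  have : 0 <= c ^+ 2 * s2 by rewrite mulr_ge0 ?sqr_ge0// ltW.
  have -> : (1 - c) ^+ 2 * s2 = s2 - 2 * (c * s2) + c ^+ 2 * s2 by ring.
  by rewrite mulrCA in h; lra.
have rmin0 : 0 < Num.min (r / 4) (Num.min r0 (c / (2 * (N.+1%:R * L1)))).
  by rewrite !lt_min r00 !divr_gt0// !mulr_gt0.
have [M M0 hM] := grid_exists rmin0.
pose Z : finType := {ffun 'I_N -> 'I_M.+1}.
pose q (z : Z) := grid_point a b z.
have Tq z : T (q z) by exact: box_grid_point.
have HF t : T t -> H (F t) by exact: (gm_field gm).
have H1 i t : T t -> H (D1 i t) by exact: (gm_D1 hab gm).
have H2 i j t : T t -> H (D2 i j t) by exact: (gm_D2 hab gm).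
have c1' : 0 < 1 - c by rewrite subr_gt0 (le_lt_trans c12)// ltr_pdivrMr// mul1r ltr1n.
(* The bad events at grid points: a high value where the variance is not nearly maximal, a
   derivative below its regression on a high value ([sgnd] provides both signs), two distant high
   values, and a large derivative. The oscillation event [B4] completes them. *)
pose BE1 u := \bigcup_(z : Z) (if vr (q z) <= s2 - kappa then above (F (q z)) ((1 - c) * u) else set0).
have rE1 : rare P H s2 BE1.
  apply: (rare_fin_bigcup (B := fun (z : Z) u => if vr (q z) <= s2 - kappa then above (F (q z)) ((1 - c) * u) else set0)) => z.
  apply: rare_if => h; apply: rare_scaled => //; first exact: HF.
  by apply: le_lt_trans h _; exact: csq.
pose sgnd (e : bool) (D : Omega -> R) w := (if e then 1 else -1) * D w.
have Hs e D : H D -> H (sgnd e D) by move=> HD; exact: (gsZ _ gH).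
have cs e D : H D -> cov P (sgnd e D) (sgnd e D) = cov P D D.
  move=> HD; rewrite -sqr_nrm2 (nrm2Z _ (gs_sqint gH HD)) -sqr_nrm2.
  by case: e; rewrite ?normrN normr1 mul1r.
pose reg D z u := above (F (q z)) ((1 - c) * u) `&`
    above (fun w => cov P D (F (q z)) / cov P (F (q z)) (F (q z)) * F (q z) w - D w) (k1 * u).
have rreg D z : H D -> cov P D D <= S2 -> rare P H s2 (reg D z).
  move=> HD DS; apply: (rare_regression (S2 := S2) (beta := beta)) => //.
  - exact: HF.
  - exact: (vr_gt0 hab gm).
  - exact: (vr_le gm).
  - by rewrite addr_gt0.
  - have h := le_sqr_1DB c (beta * k1).
    apply: lt_le_trans (_ : (1 + 2 * (beta * k1 - c)) * s2 <= _); last by rewrite ler_pM2r.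
    have h3 : c * s2 <= beta * k1 / 4 * s2 by rewrite ler_pM2r.
    have h4 : 0 < beta * k1 * s2 by rewrite mulr_gt0.
    by rewrite mulrDl mul1r ltrD2l; lra.
pose B21 u := \bigcup_(x : Z * 'I_N * bool) reg (sgnd x.2 (D1 x.1.2 (q x.1.1))) x.1.1 u.
have rB21 : rare P H s2 B21.
  apply: (rare_fin_bigcup (B := fun (x : Z * 'I_N * bool) => reg (sgnd x.2 (D1 x.1.2 (q x.1.1))) x.1.1)) => x.
  apply: rreg; first by apply: Hs; exact: H1.
  by rewrite cs; [exact: (hS2 _ _ x.1.2 (Tq _)).1|exact: H1].
pose B22 u := \bigcup_(x : Z * ('I_N * 'I_N) * bool) reg (sgnd x.2 (D2 x.1.2.1 x.1.2.2 (q x.1.1))) x.1.1 u.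
have rB22 : rare P H s2 B22.
  apply: (rare_fin_bigcup (B := fun (x : Z * ('I_N * 'I_N) * bool) => reg (sgnd x.2 (D2 x.1.2.1 x.1.2.2 (q x.1.1))) x.1.1)) => x.
  apply: rreg; first by apply: Hs; exact: H2.
  by rewrite cs; [exact: (hS2 _ x.1.2.1 x.1.2.2 (Tq _)).2|exact: H2].
pose BE3 u := \bigcup_(x : Z * Z) (if ~~ `[< close (r / 2) (q x.1) (q x.2) >] then
   above (fun w => 2^-1 * (F (q x.1) w + F (q x.2) w)) ((1 - c) * u) else set0).
have rE3 : rare P H s2 BE3.
  apply: (rare_fin_bigcup (B := fun (x : Z * Z) u => if ~~ `[< close (r / 2) (q x.1) (q x.2) >] then
   above (fun w => 2^-1 * (F (q x.1) w + F (q x.2) w)) ((1 - c) * u) else set0)) => x.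
  apply: rare_if => /asboolPn h; apply: rare_scaled => //.
    by apply: (gsZ _ gH); apply: (gsD gH); exact: HF.
  by apply: le_lt_trans (hfar _ _ (Tq _) (Tq _) h) _; exact: csq.
have L0' : 0 < L by exact: lt_le_trans L0.
pose B51 u := \bigcup_(x : Z * 'I_N * bool) above (sgnd x.2 (D1 x.1.2 (q x.1.1))) (L * u).
have rB51 : rare P H s2 B51.
  apply: (rare_fin_bigcup (B := fun (x : Z * 'I_N * bool) u => above (sgnd x.2 (D1 x.1.2 (q x.1.1))) (L * u))) => x.
  apply: rare_scaled => //; first by apply: Hs; exact: H1.
  by apply: le_lt_trans LS; rewrite cs; [exact: (hS2 _ _ x.1.2 (Tq _)).1|exact: H1].
pose B52 u := \bigcup_(x : Z * ('I_N * 'I_N) * bool) above (sgnd x.2 (D2 x.1.2.1 x.1.2.2 (q x.1.1))) (L * u).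
have rB52 : rare P H s2 B52.
  apply: (rare_fin_bigcup (B := fun (x : Z * ('I_N * 'I_N) * bool) u => above (sgnd x.2 (D2 x.1.2.1 x.1.2.2 (q x.1.1))) (L * u))) => x.
  apply: rare_scaled => //; first by apply: Hs; exact: H2.
  by apply: le_lt_trans LS; rewrite cs; [exact: (hS2 _ x.1.2.1 x.1.2.2 (Tq _)).2|exact: H2].
exists (kappa / (4 * s2)), (c / 2), r, L2; split => //.
- by rewrite divr_gt0// mulr_gt0.
- rewrite divr_gt0//= ltr_pdivrMr// mul1r; apply: lt_trans (_ : 1 < _); last by rewrite ltr1n.
  by rewrite -subr_gt0.
exists (fun u => (BE1 u `|` (B21 u `|` B22 u)) `|` ((BE3 u `|` B4 u) `|` (B51 u `|` B52 u))).
  by apply: rareU; apply: rareU => //; apply: rareU.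
move=> u w u0 nB t Tt tu.
have n1 : ~ BE1 u w by move=> h; apply: nB; left; left.
have n21 : ~ B21 u w by move=> h; apply: nB; left; right; left.
have n22 : ~ B22 u w by move=> h; apply: nB; left; right; right.
have n3 : ~ BE3 u w by move=> h; apply: nB; right; left; left.
have n4 : ~ B4 u w by move=> h; apply: nB; right; left; right.
have n51 : ~ B51 u w by move=> h; apply: nB; right; right; left.
have n52 : ~ B52 u w by move=> h; apply: nB; right; right; right.
have absb (D : Omega -> R) : (forall e, ~ above (sgnd e D) (L * u) w) -> `|D w| <= L * u.
  move=> h; apply: norm_le_cases => h'; [have := h true|have := h false]; apply.
    by rewrite /above/= /sgnd mul1r.
  by rewrite /above/= /sgnd mulN1r.
have osc2 i j x y : T x -> T y -> close r0 x y -> `|D2 i j x w - D2 i j y w| <= k1 * u.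
  by move=> Tx Ty xy; exact: hB4.
have D2L i j x : T x -> `|D2 i j x w| <= L2 * u.
  move=> Tx; have [z hz] := hM x Tx.
  have h1 : `|D2 i j (q z) w| <= L * u.
    by apply: absb => e h; apply: n52; exists (z, (i, j), e).
  have h2 : `|D2 i j x w - D2 i j (q z) w| <= k1 * u.
    apply: osc2 => // l; rewrite distrC; apply: le_trans (hz l) _; by rewrite !ge_min lexx !orbT.
  rewrite -(subrK (D2 i j (q z) w) (D2 i j x w)); apply: le_trans (ler_normD _ _) _.
  by rewrite /L2 mulrDl; clear - h1 h2; lra.
have lip1 i x y rho : T x -> T y -> close rho x y -> `|D1 i x w - D1 i y w| <= N%:R * (L2 * u * rho).
  move=> Tx Ty xy; apply: (C1_lipschitz (gm_C1' gm i w) Tx Ty) => // j z Tz; exact: D2L.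
have cw x y : T x -> T y -> close w0 x y.
  move=> Tx Ty i; have := Tx i; have := Ty i; have := le_width hab i.
  exact: dist_le_width.
have D1L i x : T x -> `|D1 i x w| <= L1 * u.
  move=> Tx; have [z hz] := hM x Tx.
  have h1 : `|D1 i (q z) w| <= L * u.
    by apply: absb => e h; apply: n51; exists (z, i, e).
  have h2 := lip1 i _ _ _ Tx (Tq z) (cw _ _ Tx (Tq z)).
  rewrite -(subrK (D1 i (q z) w) (D1 i x w)); apply: le_trans (ler_normD _ _) _.
  have -> : L1 * u = N%:R * (L2 * u * w0) + L * u + u by rewrite /L1; ring.
  by clear - h1 h2 u0; lra.
have lip0 x y rho : T x -> T y -> close rho x y -> `|F x w - F y w| <= N%:R * (L1 * u * rho).
  by move=> Tx Ty xy; apply: (C1_lipschitz (gm_C1 gm w) Tx Ty) => // j z Tz; exact: D1L.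
(* The mesh is at most [c / (2 * (N + 1) * L1)], so the Lipschitz bound [L1 * u] loses at most
   [c / 2 * u] on the way to the grid; this is why [eta = c / 2]. *)
have net x : T x -> (1 - c / 2) * u <= F x w -> exists z, close (r / 4) (q z) x /\ (1 - c) * u <= F (q z) w.
  move=> Tx xu; have [z hz] := hM x Tx; exists z; split.
    by move=> i; apply: le_trans (hz i) _; rewrite ge_min lexx.
  have h := lip0 _ _ _ Tx (Tq z) (close_sym hz).
  have : N%:R * (L1 * u * Num.min (r / 4) (Num.min r0 (c / (2 * (N.+1%:R * L1))))) <= c / 2 * u.
    set m := Num.min _ _; have hm : m <= c / (2 * (N.+1%:R * L1)) by rewrite /m !ge_min lexx !orbT.
    have m0 : 0 < m by [].
    apply: le_trans (_ : N.+1%:R * (L1 * u * m) <= _).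
      by rewrite ler_wpM2r// !mulr_ge0// ltW.
    move: hm; rewrite ler_pdivlMr ?mulr_gt0// => hm.
    have : m * (2 * (N.+1%:R * L1)) * u <= c * u by rewrite ler_pM2r.
    have -> : m * (2 * (N.+1%:R * L1)) * u = 2 * (N.+1%:R * (L1 * u * m)) by ring.
    by move=> ?; rewrite [leRHS]mulrAC ler_pdivlMr// mulrC.
  by move: h; rewrite ler_norml => /andP[]; lra.
have [z [hz zu]] := net t Tt tu.
have [vz|[J [J1 J2 J3]]] := hprof (q z) (Tq z).
  by exfalso; apply: n1; exists z => //; rewrite vz.
pose v := cov P (F (q z)) (F (q z)).
have v0 : 0 < v by exact: (vr_gt0 hab gm).
have vs : v <= s2 by exact: (vr_le gm).
have regl e (D : Omega -> R) : ~ reg (sgnd e D) z u w ->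
    cov P (sgnd e D) (F (q z)) / v * F (q z) w - k1 * u < sgnd e D w.
  move=> h; rewrite ltNge; apply/negP => h'; apply: h; split=> //.
  by rewrite /above/= -/v; clear - h'; lra.
have covs e D : H D -> cov P (sgnd e D) (F (q z)) = (if e then 1 else -1) * cov P D (F (q z)).
  move=> HD; have -> : sgnd e D = fun w => (if e then 1 else -1) * D w + 0 by apply/funext => x; rewrite addr0.
  by rewrite covDZl ?cov0l ?addr0//; [exact: (gs_sqint gH)|exact: sqint0|apply: (gs_sqint gH); exact: HF].
have kv : kappa / s2 <= kappa / v by rewrite ler_pM2l// lef_pV2 ?posrE.
have half : u / 2 <= F (q z) w.
  by apply: half_le zu; rewrite ler_pM2r.
have Xq0 : 0 < F (q z) w by apply: lt_le_trans half; rewrite divr_gt0.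
(* The covariance bound [kappa] is multiplied by [F / v], which is at least [u / (2 * s2)] since the
   value exceeds [u / 2] and the variance is at most [s2]. *)
have big : kappa / (2 * s2) * u <= kappa / v * F (q z) w.
  apply: le_trans (_ : kappa / s2 * (u / 2) <= _).
    by rewrite le_eqVlt; apply/orP; left; apply/eqP; field; rewrite gt_eqF.
  by apply: ler_pM => //; rewrite ltW// divr_gt0.
have k1E : 8 * N.+1%:R * k1 = kappa / s2.
  by rewrite /k1; field; rewrite ?gt_eqF.
have N1 : 1 <= N.+1%:R :> R by rewrite ler1n.
have k1s : 8 * k1 <= kappa / s2.
  by rewrite -k1E mulrAC ler_peMr// mulr_ge0// ltW.
have mu_eq : kappa / (4 * s2) = kappa / s2 / 4 by field; rewrite gt_eqF.
have mu_eq2 : kappa / (2 * s2) = kappa / s2 / 2 by field; rewrite gt_eqF.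
have nearq s : close r t s -> close (2 * r) (q z) s.
  by move=> ts i; exact: double_quarter (close_trans hz ts i).
exists J; split.
- move=> s Ts su; apply: contrapT => nts; apply: n3.
  have [z' [hz' zu']] := net s Ts su.
  have far : ~ close (r / 2) (q z) (q z').
    move=> h; apply: nts => i; apply: quarters (close_trans (close_trans (close_sym hz) h) hz' i).
  exists (z, z') => //=; rewrite ifT; last exact/asboolPn.
  exact: mean_ge.
- by move=> s i j; exact: D2L.
- move=> s Ts ts i; have cs' := nearq s ts.
  have := J1 s Ts (fun i => le_trans (cs' i) rk) i.
  case Ji : (J i) => [e|] // se; split => //.
  have nr : ~ reg (sgnd e (D1 i (q z))) z u w by move=> h; apply: n21; exists (z, i, e).
  have h1 := regl _ _ nr; rewrite (covs e _ (H1 i _ (Tq z))) in h1.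
  have h2 := J2 i e Ji; rewrite /c1 covC /outward in h2.
  have h3 : kappa / v * F (q z) w <= (if e then 1 else -1) * cov P (D1 i (q z)) (F (q z)) / v * F (q z) w.
    by rewrite ler_pM2r// ler_pM2r// invr_gt0.
  have h4 := lip1 i _ _ _ Ts (Tq z) (close_sym cs').
  have h5 : N%:R * (L2 * u * (2 * r)) <= k1 * u.
    have -> : N%:R * (L2 * u * (2 * r)) = N%:R * (L2 * (2 * r)) * u by ring.
    by rewrite ler_pM2r.
  have h6 : 8 * k1 * u <= kappa / s2 * u by rewrite ler_pM2r.
  have h7 : 0 < k1 * u by rewrite mulr_gt0.
  rewrite mu_eq; rewrite mu_eq2 in big.
  have h8 := le_lt_trans (lerB (le_trans big h3) (lexx (k1 * u))) h1.
  move: h8 h4; rewrite /sgnd /outward ler_norml; set A := kappa / s2 in h6 *.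
  clear - h5 h6 h7; move: (D1 i s w) (D1 i (q z) w) (N%:R * _) h5 h6 h7 => x y e1 h5 h6 h7.
  have -> : A / 2 * u = A * u / 2 by ring.
  have -> : A / 4 * u = A * u / 4 by ring.
  rewrite -mulrA in h6.
  by case: (e) => h8 /andP[]; rewrite ?mul1r ?mulN1r in h8 *; lra.
- move=> xi hxi x sx.
  have d2 i j : `|D2 i j (xi i j) w - c2 P F i j (q z) / v * F (q z) w| <= 2 * (k1 * u).
    have [Txi cxi] := hxi i j.
    have h1 : `|D2 i j (xi i j) w - D2 i j (q z) w| <= k1 * u.
      by apply: osc2 => // l; rewrite distrC; apply: le_trans (nearq _ cxi l) rr0.
    have HD := H2 i j _ (Tq z).
    have e1 := regl true (D2 i j (q z)) (fun h => n22 (ex_intro2 _ _ (z, (i, j), true) I h)).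
    have e2 := regl false (D2 i j (q z)) (fun h => n22 (ex_intro2 _ _ (z, (i, j), false) I h)).
    rewrite covs// mul1r in e1; rewrite covs// mulN1r !mulNr in e2.
    move: h1; rewrite !ler_norml /c2 covC => /andP[g1 g2].
    move: e1 e2; rewrite /sgnd mul1r mulN1r; set A := cov _ _ _ / v * _ => e1 e2.
    clear - e1 e2 g1 g2; move: (D2 i j (xi i j) w) (D2 i j (q z) w) (k1 * u) e1 e2 g1 g2 => y1 y2 y3 e1 e2 g1 g2.
    by apply/andP; split; lra.
  have h1 := J3 x sx.
  have h2 : \sum_i \sum_j x ord0 i * x ord0 j * (c2 P F i j (q z) / v * F (q z) w) =
     F (q z) w / v * \sum_i \sum_j x ord0 i * x ord0 j * c2 P F i j (q z).
    rewrite mulr_sumr; apply: eq_bigr => i _; rewrite mulr_sumr; apply: eq_bigr => j _; ring.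
  set Q := \sum_i x ord0 i ^+ 2 in h1 *.
  have Q0 : 0 <= Q by apply: sumr_ge0 => i _; exact: sqr_ge0.
  have h3 : \sum_i \sum_j x ord0 i * x ord0 j * (D2 i j (xi i j) w - c2 P F i j (q z) / v * F (q z) w) <=
      N%:R * (2 * (k1 * u)) * Q.
    apply: le_trans (_ : \sum_i \sum_j (x ord0 i ^+ 2 + x ord0 j ^+ 2) / 2 * (2 * (k1 * u)) <= _).
      apply: ler_sum => i _; apply: ler_sum => j _; apply: le_trans (ler_norm _) _; rewrite normrM.
      apply: ler_pM => //; rewrite ler_norml; exact: mul_le_half_sqr.
    have -> : \sum_i \sum_j (x ord0 i ^+ 2 + x ord0 j ^+ 2) / 2 * (2 * (k1 * u)) = N%:R * (2 * (k1 * u)) * Q; last by [].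
    under eq_bigr do rewrite -mulr_suml -mulr_suml big_split/= sumr_const card_ord -/Q.
    rewrite -mulr_suml -mulr_suml big_split/= sumrMnl -/Q sumr_const card_ord.
    by rewrite -!(mulr_natl Q N); field.
  have h4 : \sum_i \sum_j x ord0 i * x ord0 j * D2 i j (xi i j) w =
    \sum_i \sum_j x ord0 i * x ord0 j * (D2 i j (xi i j) w - c2 P F i j (q z) / v * F (q z) w) +
    \sum_i \sum_j x ord0 i * x ord0 j * (c2 P F i j (q z) / v * F (q z) w).
    rewrite -[RHS]big_split; apply: eq_bigr => i _; rewrite -[RHS]big_split; apply: eq_bigr => j _ /=.
    by rewrite -mulrDr subrK.
  rewrite h4 h2.
  have h5 : F (q z) w / v * \sum_i \sum_j x ord0 i * x ord0 j * c2 P F i j (q z) <= F (q z) w / v * (- kappa * Q).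
    by rewrite ler_pM2l// divr_gt0.
  have h6 : kappa / (2 * s2) * u * Q <= kappa / v * F (q z) w * Q by rewrite ler_wpM2r.
  have h7 : F (q z) w / v * (- kappa * Q) = - (kappa / v * F (q z) w * Q) by ring.
  have h8 : 8 * N%:R * k1 <= kappa / s2 by rewrite -k1E ler_pM2r// ler_pM2l.
  have h9 : 8 * N%:R * k1 * (u * Q) <= kappa / s2 * (u * Q) by rewrite ler_wpM2r// mulr_ge0// ltW.
  rewrite mu_eq2 in h6; rewrite mu_eq mulNr mulNr -mulrA.
  set A := kappa / s2 in h6 h9 *.
  have h10 : N%:R * (2 * (k1 * u)) * Q = 8 * N%:R * k1 * (u * Q) / 4 by field.
  have h11 : A / 2 * u * Q = A / 2 * (u * Q) by rewrite mulrA.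
  by clear - h3 h5 h6 h7 h9 h10 h11; rewrite mulrA in h11 *; lra.
Qed.

End good_event.

(** * Counting critical points along a path *)

Section linear_change.
Context {R : realType}.
Local Notation tup k := (k.-tuple (measurableTypeR R)).
Local Notation lebR := (@lebesgue_measure R).

Definition coercive k (c : R) (A : 'M[R]_k) := forall x : 'I_k -> R,
  c * \sum_i x i ^+ 2 <= \sum_i \sum_j x i * x j * A i j.

Definition affine k (A : 'M[R]_k) (v : 'I_k -> R) (x : tup k) : tup k :=
  [tuple \sum_j A i j * tnth x j + v i | i < k].

Lemma measurable_affine k (A : 'M[R]_k) v : measurable_fun setT (affine A v).
Proof.
apply: measurable_mktuple => i; apply: measurable_funD => //.
apply: measurable_sum => j; apply: measurable_funM => //; exact: measurable_tnth.
Qed.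

Definition schur k (A : 'M[R]_k.+1) : 'M[R]_k :=
  \matrix_(i, j) (A (lift ord0 i) (lift ord0 j) - A (lift ord0 i) ord0 * A ord0 (lift ord0 j) / A ord0 ord0).

Lemma det_schur k (A : 'M[R]_k.+1) : A ord0 ord0 != 0 -> \det A = A ord0 ord0 * \det (schur A).
Proof.
move=> A0; pose B : 'M[R]_(1 + k) := A.
pose L : 'M[R]_(1 + k) := block_mx 1 0 (- (A ord0 ord0)^-1 *: dlsubmx B) 1%:M.
have BE : B = block_mx (ulsubmx B) (ursubmx B) (dlsubmx B) (drsubmx B) by rewrite submxK.
have dL : \det L = 1 by rewrite det_lblock !det1 mulr1.
have -> : \det A = \det (L *m B) by rewrite det_mulmx dL mul1r.
rewrite BE /L mulmx_block !mul1mx !mul0mx !addr0.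
have ul : ulsubmx B = (A ord0 ord0)%:M.
  by apply/matrixP => i j; rewrite !mxE !ord1 eqxx mulr1n; congr (A _ _); exact/val_inj.
have -> : - (A ord0 ord0)^-1 *: dlsubmx B *m ulsubmx B + dlsubmx B = 0.
  by rewrite ul mul_mx_scalar scalerA mulrN divff// scaleN1r addNr.
rewrite det_ublock ul det_scalar1; congr (_ * \det _); apply/matrixP => i j.
rewrite !mxE big_ord1 !mxE !rshift1 !lshift0.
rewrite /B (_ : lift 0 i = lift ord0 i)// (_ : lift 0 j = lift ord0 j)// (_ : 0 = ord0)//; first by ring.
Qed.

Lemma coercive_pivot k c (A : 'M[R]_k.+1) : 0 < c -> coercive c A -> 0 < A ord0 ord0.
Proof.
move=> c0 /(_ (fun i => (i == ord0)%:R)).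
have -> : \sum_(i < k.+1) (i == ord0)%:R ^+ 2 = 1 :> R.
  by rewrite (bigD1 ord0)//= big1 ?addr0 ?expr1n// => i /negbTE ->; rewrite expr0n.
have -> : \sum_(i < k.+1) \sum_(j < k.+1) (i == ord0)%:R * (j == ord0)%:R * A i j = A ord0 ord0.
  rewrite (bigD1 ord0)//= [X in _ + X]big1 ?addr0 => [|i /negbTE ->]; last first.
    by rewrite big1 // => j _; rewrite !mul0r.
  by rewrite (bigD1 ord0)//= big1 ?addr0 ?mul1r// => i /negbTE ->; rewrite mulr0 mul0r.
by rewrite mulr1; exact: lt_le_trans.
Qed.

(** The first variable is set to the value for which the first row contributes nothing to the
    quadratic form; what remains is the form of the Schur complement. The choice refers to the row
    because [A] may be nonsymmetric. *)
Lemma coercive_schur k c (A : 'M[R]_k.+1) : 0 < c -> coercive c A -> coercive c (schur A).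
Proof.
move=> c0 cA x; have A0 := coercive_pivot c0 cA.
pose s := \sum_j A ord0 (lift ord0 j) * x j.
have := cA (fun i => if unlift ord0 i is Some j then x j else - s / A ord0 ord0).
rewrite !big_ord_recl/= !unlift_none.
under eq_bigr do rewrite liftK.
under [X in _ <= _ + X + _]eq_bigr do rewrite liftK.
under [X in _ <= _ + X]eq_bigr => i _.
  rewrite big_ord_recl/= unlift_none liftK; under eq_bigr do rewrite liftK; over.
have e1 : \sum_(i < k) - s / A ord0 ord0 * x i * A ord0 (lift ord0 i) = - s / A ord0 ord0 * s.
  by rewrite mulr_sumr; apply: eq_bigr => i _; rewrite -mulrA (mulrC (x i)).
have e2 : \sum_i \sum_j x i * x j * schur A i j =
    \sum_i (x i * (- s / A ord0 ord0) * A (lift ord0 i) ord0 +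
      \sum_j x i * x j * A (lift ord0 i) (lift ord0 j)).
  apply: eq_bigr => i _; rewrite addrC.
  under eq_bigr do rewrite mxE mulrBr.
  rewrite big_split/= sumrN; congr (_ + _).
  rewrite (_ : _ * _ * _ = - ((x i * A (lift ord0 i) ord0 / A ord0 ord0) * s)); last by ring.
  by congr (- _); rewrite mulr_sumr; apply: eq_bigr => j _; ring.
rewrite e1 e2 => h; apply: le_trans (le_trans h _).
  by rewrite ler_wpM2l ?(ltW c0)// lerDr sqr_ge0.
by rewrite gerDr le_eqVlt; apply/orP; left; apply/eqP; field; rewrite gt_eqF.
Qed.

(* Integrating out the first variable replaces the matrix by its Schur complement. *)
Lemma affine_change k : forall (c : R) (A : 'M[R]_k) (v : 'I_k -> R), 0 < c -> coercive c A ->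
  0 < \det A /\ forall F : tup k -> \bar R, measurable_fun setT F -> (forall x, 0 <= F x)%E ->
    (\int[lebesgue_tuple R k]_x F (affine A v x) =
     (\det A)^-1%:E * \int[lebesgue_tuple R k]_x F x)%E.
Proof.
elim: k => [|k IH] c A v c0 cA.
  split=> [|F mF F0]; first by rewrite det_mx00.
  rewrite det_mx00 invr1 mul1e; apply: eq_integral => x _.
  by congr F; apply: eq_from_tnth => -[].
have A0 := coercive_pivot c0 cA; have cS := coercive_schur c0 cA.
have [dS _] := IH _ _ (fun=> 0) c0 cS.
rewrite det_schur ?gt_eqF//; split=> [|F mF F0]; first by rewrite mulr_gt0.
pose m := A ord0 ord0; rewrite -/m in A0 *.
pose bb (y : tup k) := \sum_j A ord0 (lift ord0 j) * tnth y j + v ord0.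
pose G (s : R) (y : tup k) : tup k.+1 := [the tup k.+1 of s ::
  [tuple A (lift ord0 i) ord0 * ((s - bb y) / m) + \sum_j A (lift ord0 i) (lift ord0 j) * tnth y j
   + v (lift ord0 i) | i < k]].
have GE (x : R) (y : tup k) : affine A v [the tup k.+1 of x :: y] = G (m * x + bb y) y.
  apply: eq_from_tnth => i; rewrite tnth_mktuple big_ord_recl.
  have tl j : tnth [the tup k.+1 of x :: y] (lift ord0 j) = tnth y j by rewrite !(tnth_nth 0).
  under eq_bigr do rewrite tl.
  have [j ->|->] := unliftP ord0 (i : 'I_k.+1); last by rewrite !(tnth_nth 0)/= -addrA.
  rewrite [RHS](_ : _ = tnth [tuple A (lift ord0 i) ord0 * ((m * x + bb y - bb y) / m) +
    \sum_j A (lift ord0 i) (lift ord0 j) * tnth y j + v (lift ord0 i) | i < k] j); last first.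
    by rewrite !(tnth_nth 0).
  rewrite tnth_mktuple addrK mulrAC divff ?gt_eqF// mul1r.
  by congr (_ * _ + _ + _); rewrite (tnth_nth 0).
have mbb : measurable_fun setT bb.
  apply: measurable_funD => //; apply: measurable_sum => j; apply: measurable_funM => //.
  exact: measurable_tnth.
have mG : measurable_fun setT (fun z : R * tup k => G z.1 z.2).
  apply: measurable_cons; first exact: measurable_fst.
  apply: measurable_mktuple => i; apply: measurable_funD => //; apply: measurable_funD.
    apply: measurable_funM => //; apply: measurable_funM => //; apply: measurable_funB.
      exact: measurable_fst.
    exact: (measurableT_comp mbb measurable_snd).
  apply: measurable_sum => j; apply: measurable_funM => //.
  exact: (measurableT_comp (measurable_tnth j) measurable_snd).
have mFG : measurable_fun setT (fun z : R * tup k => F (G z.1 z.2)) by exact: measurableT_comp mF mG.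
rewrite ge0_integral_lebesgue_tupleS//; last exact: measurableT_comp mF (measurable_affine _ _).
transitivity (\int[lebR]_x \int[lebesgue_tuple R k]_y F (G (m * x + bb y)%R y))%E.
  by apply: eq_integral => x _; apply: eq_integral => y _; rewrite GE.
have mGy y : measurable_fun setT (fun s : measurableTypeR R => F (G s y)).
  exact: (measurableT_comp mFG (measurable_pair2 y)).
have mGs s : measurable_fun setT (fun y : tup k => F (G s y)).
  exact: (measurableT_comp mFG (measurable_pair1 s)).
rewrite (lebesgue_tuple_fubini (F := fun z => F (G (m * z.1 + bb z.2)%R z.2)))//; last first.
  have mz : measurable_fun setT (fun z : R * tup k => ((m * z.1 + bb z.2)%R, z.2)).
    apply: measurable_fun_pair; last exact: measurable_snd.
    apply: measurable_funD; first by apply: measurable_funM => //; exact: measurable_fst.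
    exact: (measurableT_comp mbb measurable_snd).
  exact: (measurableT_comp mFG mz).
transitivity (\int[lebesgue_tuple R k]_y (m^-1%:E * \int[lebR]_s F (G s y)))%E.
  by apply: eq_integral => y _; apply: (@ge0_integral_affine R m (bb y) (fun s => F (G s y)) A0 (mGy y)).
rewrite ge0_integralZl//; first last.
- by rewrite lee_fin invr_ge0 ltW.
- by move=> y _; exact: integral_ge0.
- exact: (measurable_fun_fubini_tonelli_G (m1 := lebR) (fun z : R * tup k => F (G z.1 z.2))).
rewrite invfM EFinM -muleA; congr (_ * _)%E.
rewrite -(lebesgue_tuple_fubini (F := fun z => F (G z.1 z.2)))//.
rewrite [in RHS]ge0_integral_lebesgue_tupleS// -ge0_integralZl//; first last.
- by rewrite lee_fin invr_ge0 ltW.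
- by move=> x _; exact: integral_ge0.
- apply: (measurable_fun_fubini_tonelli_F (m2 := lebesgue_tuple R k) (fun z : R * tup k => F [the tup k.+1 of z.1 :: z.2])) => //.
  exact: measurableT_comp mF (@measurable_cons_pair _ _ k).
apply: eq_integral => s _ /=.
pose v' i := A (lift ord0 i) ord0 * (s - v ord0) / m + v (lift ord0 i).
have [_ /(_ (fun y => F [the tup k.+1 of s :: y])) <-//] := IH _ _ v' c0 cS; last first.
  apply: (measurableT_comp mF).
  by apply: (@measurable_cons _ _ (tup k) (measurableTypeR R) (fun=> s) k (fun y => y)).
apply: eq_integral => y _; rewrite /G (_ : [tuple _ | i < k] = affine (schur A) v' y)//.
apply: eq_from_tnth => i; rewrite !tnth_mktuple.
under [in RHS]eq_bigr do rewrite mxE mulrBl.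
rewrite big_split/= sumrN.
have -> : \sum_(j < k) A (lift ord0 i) ord0 * A ord0 (lift ord0 j) / A ord0 ord0 * tnth y j =
    A (lift ord0 i) ord0 / m * \sum_(j < k) A ord0 (lift ord0 j) * tnth y j.
  by rewrite mulr_sumr; apply: eq_bigr => j _; rewrite /m; ring.
by rewrite /v' /bb; ring.
Qed.

Definition cube k (r : R) (x : tup k) : bool := [forall i, `|tnth x i| <= r].

Lemma measurable_cube k r : measurable_fun setT (fun x : tup k => (cube r x)%:R : R).
Proof.
have -> : (fun x : tup k => (cube r x)%:R : R) = fun x => \prod_i (\1_(`[- r, r]%classic) (tnth x i)).
  apply/funext => x; have [|] := boolP (cube r x).
    move=> /forallP h; rewrite big1// => i _; rewrite indicE mem_set//=.
    by rewrite in_itv/= -ler_norml; exact: h.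
  rewrite negb_forall => /existsP[i hi]; rewrite (bigD1 i)//= indicE memNset ?mul0r//=.
  by rewrite in_itv/= -ler_norml; exact/negP.
apply: measurable_prod => i _; apply: (measurableT_comp _ (measurable_tnth i)).
exact: measurable_indic.
Qed.

Lemma cube0 r (x : tup 0) : cube r x. Proof. by apply/forallP => -[]. Qed.

Lemma cube_cons k r (x : R) (y : tup k) : cube r [the tup k.+1 of x :: y] = (`|x| <= r) && cube r y.
Proof.
apply/forallP/andP => [h|[hx /forallP hy] i].
  split; first by have := h ord0; rewrite (tnth_nth 0).
  by apply/forallP => i; have := h (lift ord0 i); rewrite !(tnth_nth 0).
have [j ->|->] := unliftP ord0 (i : 'I_k.+1); last by rewrite (tnth_nth 0).
by have := hy j; rewrite !(tnth_nth 0).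
Qed.

Lemma integral_cube k (r : R) : 0 <= r ->
  (\int[lebesgue_tuple R k]_x ((cube r x)%:R)%:E = ((2 * r) ^+ k)%:E)%E.
Proof.
move=> r0; elim: k => [|k IH].
  rewrite ge0_integral_lebesgue_tuple0 ?cube0//.
  by apply/measurable_EFinP; exact: measurable_cube.
rewrite ge0_integral_lebesgue_tupleS//; first last.
- by apply/measurable_EFinP; exact: measurable_cube.
transitivity (\int[lebR]_x ((\1_(`[- r, r]%classic) x)%:E * ((2 * r) ^+ k)%:E))%E.
  apply: eq_integral => x _; rewrite -IH -ge0_integralZl//; first last.
  - by apply/measurable_EFinP; exact: measurable_cube.
  apply: eq_integral => y _; rewrite cube_cons -EFinM indicE.
  have -> : (x \in `[- r, r]%classic) = (`|x| <= r).
    by apply/idP/idP => [/set_mem|h]; [|apply/mem_set]; rewrite /= in_itv/= -ler_norml.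
  by case: (_ <= _); case: cube; rewrite /= ?mulr1 ?mulr0.
rewrite ge0_integralZr//; first last.
- by rewrite lee_fin exprn_ge0// mulr_ge0.
- by apply/measurable_EFinP; exact: measurable_indic.
rewrite integral_indic//= setIT lebesgue_measure_itv/= lte_fin.
have -> : (if - r < r then (r%:E - (- r)%:E)%E else 0%E) = (2 * r)%:E.
  case: ltP => h; first by rewrite -EFinB; congr (_%:E); ring.
  by congr (_%:E); lra.
by rewrite -EFinM exprS.
Qed.

End linear_change.

Lemma cvg_prodr {R : realType} {T : Type} (F : set_system T) {FF : Filter F} (I : Type)
    (r : seq I) (f : I -> T -> R) (l : I -> R) : (forall i, f i t @[t --> F] --> l i) ->
  \prod_(i <- r) f i t @[t --> F] --> \prod_(i <- r) l i.
Proof.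
move=> fl; elim: r => [|i r IH].
  by rewrite big_nil; under eq_fun do rewrite big_nil; exact: cvg_cst.
by rewrite big_cons; under eq_fun do rewrite big_cons; exact: cvgM.
Qed.

Lemma cvg_det {R : realType} k (A_ : nat -> 'M[R]_k) (A : 'M[R]_k) :
  (forall i j, A_ n i j @[n --> \oo] --> A i j) -> \det (A_ n) @[n --> \oo] --> \det A.
Proof.
move=> cA; apply: cvg_sumr => s; apply: cvgM; first exact: cvg_cst.
by apply: cvg_prodr.
Qed.

Lemma det_le {R : realType} k (A : 'M[R]_k) (L : R) : (forall i j, `|A i j| <= L) ->
  `|\det A| <= #|'S_k|%:R * L ^+ k.
Proof.
move=> AL; apply: le_trans (ler_norm_sum _ _ _) _.
apply: le_trans (_ : \sum_(s : 'S_k) L ^+ k <= _); last by rewrite sumr_const mulr_natl.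
apply: ler_sum => s _; rewrite normrM normrX normrN1 expr1n mul1r normr_prod.
apply: le_trans (_ : \prod_(i < k) L <= _); last by rewrite prodr_const card_ord.
by apply: ler_prod => i _; rewrite normr_ge0 AL.
Qed.

Lemma measurable_det {d} {T : measurableType d} {R : realType} k (A : T -> 'M[R]_k) :
  (forall i j, measurable_fun setT (fun x => A x i j)) -> measurable_fun setT (fun x => \det (A x)).
Proof.
move=> mA; apply: measurable_sum => s; apply: measurable_funM => //.
by apply: measurable_prod => i _.
Qed.

Section dominated.
Context {d} {T : measurableType d} {R : realType} (mu : {measure set T -> \bar R}).

Lemma dominated_cvg_off (f_ : nat -> T -> R) (f g : T -> R) (N : set T) :
  (forall n, measurable_fun setT (f_ n)) -> measurable_fun setT f ->
  measurable N -> mu N = 0%E -> (forall x, ~ N x -> f_ ^~ x @ \oo --> f x) ->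
  (forall n x, `|f_ n x| <= g x) -> mu.-integrable setT (EFin \o g) ->
  (\int[mu]_x (f_ n x)%:E @[n --> \oo] --> \int[mu]_x (f x)%:E)%E.
Proof.
move=> mf_ mf mN N0 cf fg ig.
have [] := @dominated_convergence _ _ _ mu setT measurableT (fun n x => (f_ n x)%:E) (EFin \o f) (EFin \o g) => //.
- by move=> n; exact/measurable_EFinP.
- exact/measurable_EFinP.
- exists N; split => // x /= h; apply: contrapT => nN; apply: h => _.
  by apply: cvg_EFin; [exact: nearW|exact: cf].
- by apply: aeW => x n _; rewrite /= lee_fin.
Qed.

Lemma integral0_null (f : T -> R) (S : set T) : measurable_fun setT f -> (forall x, 0 <= f x) ->
  (\int[mu]_x (f x)%:E = 0)%E -> (forall x, S x -> 0 < f x) ->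
  exists N, [/\ measurable N, mu N = 0%E & S `<=` N].
Proof.
move=> mf f0 If Sf; exists [set x | 0 < f x]; split => [||x /Sf//].
  have -> : [set x | 0 < f x] = f @^-1` `]0, +oo[%classic.
    by apply/seteqP; split => x /=; rewrite in_itv/= andbT.
  by rewrite -[X in measurable X]setTI; exact: mf.
have : (\int[mu]_(x in setT) `|(f x)%:E| = 0)%E.
  by rewrite -[RHS]If; apply: eq_integral => x _; rewrite gee0_abs// lee_fin.
move=> /(ae_eq_integral_abs mu measurableT (f := EFin \o f)) h.
have [|N [mN N0 hN]] := h; first exact/measurable_EFinP.
apply/eqP; rewrite eq_le measure_ge0 andbT -N0; apply: le_measure; rewrite ?inE//.
  have -> : [set x | 0 < f x] = f @^-1` `]0, +oo[%classic.
    by apply/seteqP; split => x /=; rewrite in_itv/= andbT.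
  by rewrite -[X in measurable X]setTI; exact: mf.
by move=> x /= fx; apply: hN => /(_ I) [] e; rewrite e ltxx in fx.
Qed.

End dominated.

Section sphere.
Context {R : realType} (k : nat).
Local Notation tup := (k.-tuple (measurableTypeR R)).

Definition open_cube (x : tup) : bool := [forall i, `|tnth x i| < 1].

Lemma measurable_open_cube : measurable_fun setT (fun x : tup => (open_cube x)%:R : R).
Proof.
have -> : (fun x : tup => (open_cube x)%:R : R) = fun x => \prod_i (\1_(`](-1), 1[%classic) (tnth x i)).
  apply/funext => x; have [|] := boolP (open_cube x).
    move=> /forallP h; rewrite big1// => i _; rewrite indicE mem_set//=.
    by rewrite in_itv/= -ltr_norml; exact: h.
  rewrite negb_forall => /existsP[i hi]; rewrite (bigD1 i)//= indicE memNset ?mul0r//=.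
  by rewrite in_itv/= -ltr_norml; exact/negP.
apply: measurable_prod => i _; apply: (measurableT_comp _ (measurable_tnth i)).
exact: measurable_indic.
Qed.

Lemma open_cube_sub x : open_cube x -> cube 1 x.
Proof. by move=> /forallP h; apply/forallP => i; exact: ltW. Qed.

(** The smoothed integrands converge off the boundary of the cube. The boundary is null because the
    volumes of the inner cubes of half side [rho n] tend to that of the unit cube. *)
Lemma integral_sphere : (\int[lebesgue_tuple R k]_x ((cube 1 x)%:R - (open_cube x)%:R)%:E = 0)%E.
Proof.
have s0 (x : tup) : 0 <= (cube 1 x)%:R - (open_cube x)%:R :> R.
  by have := @open_cube_sub x; case: open_cube => [->//|_]; rewrite ?subrr// subr0.
have ms : measurable_fun setT (fun x : tup => (cube 1 x)%:R - (open_cube x)%:R : R).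
  by apply: measurable_funB; [exact: measurable_cube|exact: measurable_open_cube].
pose rho n : R := 1 - n.+1%:R^-1.
have le n : (\int[lebesgue_tuple R k]_x ((cube 1 x)%:R - (open_cube x)%:R)%:E <=
    ((2 * 1) ^+ k - (2 * rho n) ^+ k)%:E)%E.
  have r0 : 0 <= rho n by rewrite subr_ge0 invf_le1// ler1n.
  have r1 : rho n < 1 by rewrite gtrBl invr_gt0.
  rewrite EFinB leeBrDr// -!integral_cube// -ge0_integralD//; first last.
  - by apply/measurable_EFinP; exact: measurable_cube.
  - by apply/measurable_EFinP.
  - by move=> x _; rewrite lee_fin.
  apply: ge0_le_integral => //.
  - by move=> x _; rewrite -EFinD lee_fin addr_ge0.
  - by apply: emeasurable_funD; apply/measurable_EFinP => //; exact: measurable_cube.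
  - by apply/measurable_EFinP; exact: measurable_cube.
  move=> x _; rewrite -EFinD lee_fin.
  have [/forallP c|_] := boolP (cube (rho n) x); last by rewrite addr0 gerBl.
  have -> : open_cube x by apply/forallP => i; apply: le_lt_trans (c i) r1.
  by rewrite subrK.
apply/eqP; rewrite eq_le integral_ge0 ?andbT; last by move=> x _; rewrite lee_fin.
have fin : (\int[lebesgue_tuple R k]_x ((cube 1 x)%:R - (open_cube x)%:R)%:E)%E \is a fin_num.
  rewrite ge0_fin_numE; last by apply: integral_ge0 => x _; rewrite lee_fin.
  exact: le_lt_trans (le 0%N) (ltry _).
pose I := fine (\int[lebesgue_tuple R k]_x ((cube 1 x)%:R - (open_cube x)%:R)%:E)%E.
have IE : (\int[lebesgue_tuple R k]_x ((cube 1 x)%:R - (open_cube x)%:R)%:E = I%:E)%E by rewrite fineK.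
rewrite IE lee_fin.
have c2 : (2 * 1) ^+ k - (2 * rho n) ^+ k @[n --> \oo] --> ((2 * 1) ^+ k - (2 * (1 - 0)) ^+ k : R).
  apply: cvgB; first exact: cvg_cst.
  apply: (@cvg_comp _ _ _ (fun n => 2 * rho n) (fun x : R => x ^+ k) _ (nbhs (2 * (1 - 0) : R))); last exact: exprn_continuous.
  apply: cvgM; first exact: cvg_cst.
  apply: cvgB; first exact: cvg_cst.
  by have := @cvg_harmonicZ R 1; under eq_fun do rewrite div1r.
rewrite -[0](subrr ((2 * 1) ^+ k)) -[X in _ <= _ - (2 * X) ^+ _](subr0 1).
by apply: (cvg_ge_bound (cvg_cst I) c2) => n; rewrite -lee_fin -IE; exact: le.
Qed.

End sphere.

Lemma near_all {k : nat} (P : 'I_k -> nat -> Prop) : (forall i, \forall n \near \oo, P i n) ->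
  \forall n \near \oo, forall i, P i n.
Proof.
move=> h; have /choice[m hm] : forall i, exists m : nat, forall n, (m <= n)%N -> P i n.
  by move=> i; have [m _ hm] := h i; exists m => n mn; exact: hm.
exists (\max_i m i)%N => // n /= mn i; apply: hm; apply: leq_trans mn; exact: leq_bigmax.
Qed.

(** * Coordinates on the faces *)

Section faces.
Context {R : realType} {N : nat} (a b : 'rV[R]_N).
Implicit Types K J : face N.

Lemma tauP K j : (j \in tau K) = (K j == None). Proof. by rewrite inE. Qed.

Lemma tau_enum K j : K j = None -> exists i : 'I_#|tau K|, j = enum_val i.
Proof.
move=> /eqP; rewrite -tauP => jK; exists (enum_rank_in jK j).
by rewrite (enum_rankK_in jK).
Qed.

Lemma enum_tau K (i : 'I_#|tau K|) : K (enum_val i) = None.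
Proof. by apply/eqP; rewrite -tauP; exact: enum_valP. Qed.

Lemma face_point_enum_val K (v : #|tau K|.-tuple R) i :
  face_point a b K v ord0 (enum_val i) = tnth v i.
Proof.
rewrite mxE enum_tau (tnth_nth 0); congr nth.
by rewrite (enum_val_nth (enum_val i)) index_uniq ?enum_uniq// -cardE.
Qed.

Lemma face_point_Some K (v : seq R) j e : K j = Some e -> face_point a b K v ord0 j = corner a b e j.
Proof. by rewrite mxE => ->. Qed.

Definition in_face K (v : #|tau K|.-tuple R) : bool :=
  [forall i, a ord0 (enum_val i) < tnth v i < b ord0 (enum_val i)].

Lemma in_faceP K (v : #|tau K|.-tuple R) : in_face v <-> face_set a b K (face_point a b K v).
Proof.
split=> [/forallP h j|h].
  case Kj : (K j) => [e|]; first exact: face_point_Some.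
  by have [i ->] := tau_enum Kj; rewrite face_point_enum_val.
by apply/forallP => i; have := h (enum_val i); rewrite enum_tau face_point_enum_val.
Qed.

Lemma face_set_box (hab : forall i, a ord0 i < b ord0 i) K t : face_set a b K t -> box a b t.
Proof.
move=> h i; have := h i; case: (K i) => [e ->|/andP[? ?]]; last by rewrite !ltW.
by rewrite /corner; case: e => /=; rewrite ?subrr ?subr0 ?mul0r ?mul1r ?addr0 ?add0r ?lexx ?(ltW (hab i)).
Qed.

Lemma sum_tau K (g : 'I_N -> R) : (forall j, K j != None -> g j = 0) ->
  \sum_j g j = \sum_(i < #|tau K|) g (enum_val i).
Proof.
move=> g0; rewrite (bigID (mem (tau K)))/= addrC big1 ?add0r => [|j].
  exact: (big_enum_val (A := mem (tau K))).
by rewrite tauP; exact: g0.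
Qed.

Lemma quad_tau K (v : 'rV[R]_N) (Q : 'I_N -> 'I_N -> R) : supported K v ->
  \sum_i \sum_j v ord0 i * v ord0 j * Q i j =
  \sum_(i < #|tau K|) \sum_(j < #|tau K|) v ord0 (enum_val i) * v ord0 (enum_val j) * Q (enum_val i) (enum_val j).
Proof.
move=> sv; rewrite (sum_tau (K := K)) => [|i Ki]; last by apply: big1 => j _; rewrite sv ?mul0r.
apply: eq_bigr => i _; rewrite (sum_tau (K := K))// => j Kj.
by rewrite (sv j)// mulr0 mul0r.
Qed.

Lemma cvg_face_point K (v_ : nat -> #|tau K|.-tuple R) v :
  (forall i, tnth (v_ n) i @[n --> \oo] --> tnth v i) ->
  row_cvg (fun n => face_point a b K (v_ n)) (face_point a b K v).
Proof.
move=> cv j; case Kj : (K j) => [e|].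
  rewrite (face_point_Some _ Kj); under eq_fun do rewrite (face_point_Some _ Kj); exact: cvg_cst.
have [i ->] := tau_enum Kj; rewrite face_point_enum_val.
under eq_fun do rewrite face_point_enum_val; exact: cv.
Qed.

Lemma measurable_face_point K (f : 'rV[R]_N -> R) : continuous f ->
  measurable_fun setT (fun v : #|tau K|.-tuple (measurableTypeR R) => f (face_point a b K v)).
Proof.
move=> cf; have cg : continuous (fun z : 'rV[R]_#|tau K| => f (face_point a b K [tuple z ord0 i | i < #|tau K|])).
  move=> z; apply: continuous_row_seq => u cu; apply: (continuous_row_cvg (f := f)); first exact: cf.
  by apply: cvg_face_point => i; rewrite tnth_mktuple; under eq_fun do rewrite tnth_mktuple; exact: cu.
have := measurable_continuous_row cg; congr measurable_fun; apply/funext => v; congr (f (face_point a b K _)).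
by congr val; apply: eq_from_tnth => i; rewrite tnth_mktuple mxE.
Qed.

Lemma measurable_in_face K :
  measurable_fun setT (fun v : #|tau K|.-tuple (measurableTypeR R) => (in_face v)%:R : R).
Proof.
have -> : (fun v : #|tau K|.-tuple (measurableTypeR R) => (in_face v)%:R : R) =
    fun v => \prod_i (\1_(`]a ord0 (enum_val i), b ord0 (enum_val i)[%classic) (tnth v i)).
  apply/funext => x; have [|] := boolP (in_face x).
    move=> /forallP h; rewrite big1// => i _; rewrite indicE mem_set//=.
    by rewrite in_itv/=; exact: h.
  rewrite negb_forall => /existsP[i hi]; rewrite (bigD1 i)//= indicE memNset ?mul0r//=.
  by rewrite in_itv/=; exact/negP.
apply: measurable_prod => i _; apply: (measurableT_comp _ (measurable_tnth i)).
exact: measurable_indic.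
Qed.

End faces.

(** * The smoothed count along one path *)

Section crit.
Context {d} {Omega : measurableType d} {R : realType} (P : probability Omega R) {N : nat}.
Context (a b : 'rV[R]_N) (hab : forall i, a ord0 i < b ord0 i).
Context (H : set (Omega -> R)) (F : 'rV[R]_N -> Omega -> R) (gm : gaussian_model P a b H F).
Local Notation T := (box a b).
Local Notation D1 := (D1 F).
Local Notation D2 := (D2 F).
Local Notation tup k := (k.-tuple (measurableTypeR R)).
Local Notation leb := (lebesgue_tuple R).

Definition neg_hess (K : face N) t w : 'M[R]_#|tau K| :=
  \matrix_(i, j) - D2 (enum_val i) (enum_val j) t w.

Lemma neg_hessE K t w i j : neg_hess K t w i j = - D2 (enum_val i) (enum_val j) t w.
Proof. by rewrite mxE. Qed.

Definition face_grad (K : face N) t w : #|tau K|.-tuple R :=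
  [tuple D1 (enum_val i) t w | i < #|tau K|].

(* With the determinant of minus the Hessian the sign [(-1) ^ k] of the Kac-Rice formula disappears. *)
Definition crit (K : face N) (chi : R -> bool) (eps : R) (t : 'rV[R]_N) (w : Omega) : R :=
  \det (neg_hess K t w) * (chi (F t w))%:R * (cube eps (face_grad K t w))%:R / (2 * eps) ^+ #|tau K|.

(** Extended by 0 outside the face, to be integrated over all tuples. The level condition [chi] is
    kept general: it is [u <= x] for the count, and a short interval around [u] when a maximum equal
    to [u] is excluded. *)
Definition crit_point K chi eps (v : tup #|tau K|) (w : Omega) : R :=
  (in_face a b v)%:R * crit K chi eps (face_point a b K v) w.

Section path.
Context (w : Omega) (u mu eta r L : R) (J : face N) (t : 'rV[R]_N).
Hypotheses (mu0 : 0 < mu) (u0 : 0 < u) (r0 : 0 < r) (L0 : 0 < L).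
Hypotheses (Tt : T t) (tmax : forall s, T s -> F s w <= F t w) (gt : good_point a b F mu eta r L u w t J).
Context (chi : R -> bool).
Hypothesis chi_ge : forall x, chi x -> (1 - eta) * u <= x.

Let close_refl : close r t t.
Proof. by move=> i; rewrite subrr normr0 ltW. Qed.

(** A counted point is high, hence close to [t], and some coordinate distinguishes [K] from [J]. If
    [K] fixes that coordinate, the point lies on a side excluded by the good event; if only [J]
    fixes it, the derivative there is at least [mu * u], more than [eps]. *)
Lemma crit_other K eps (v : tup #|tau K|) : K <> J -> 0 < eps < mu * u -> crit_point chi eps v w = 0.
Proof.
move=> KJ /andP[e0 eu]; rewrite /crit_point /crit.
have [iv|] := boolP (in_face a b v); last by rewrite mul0r.
have Kv := (in_faceP a b v).1 iv; have Tv := face_set_box hab Kv.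
have [cF|] := boolP (chi _); last by rewrite mulr0 !mul0r mulr0.
have [/forallP cg|] := boolP (cube _ _); last by rewrite mulr0 mul0r mulr0.
have [near _ side _] := gt; have cv := near _ Tv (chi_ge cF).
exfalso; apply: KJ; apply/ffunP => i; have := side _ Tv cv i; have := Kv i.
case Ki : (K i) => [e|]; case Ji : (J i) => [e'|] //.
- move=> -> [h _]; congr Some; case: e e' h {Ki Ji} => -[]//=; by rewrite eqxx.
- move=> ->; rewrite /corner; case: (e); rewrite /= ?subrr ?subr0 ?mul0r ?mul1r ?addr0 ?add0r ?ltxx ?andbF//.
- move=> _ [_ h]; have [i' ii'] := tau_enum Ki; have := cg i'; rewrite tnth_mktuple -ii' => h'.
  have : outward e' * D1 i (face_point a b K v) w <= eps.
    apply: le_trans h'; apply: le_trans (ler_norm _) _; rewrite normrM /outward.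
    by case: (e'); rewrite ?normrN normr1 mul1r.
  by move=> h2; have := le_lt_trans (le_trans h h2) eu; rewrite ltxx.
Qed.

Lemma interior_critical i : a ord0 i < t ord0 i < b ord0 i -> D1 i t w = 0.
Proof.
move=> /andP[ai bi]; have cF := gm_C1 gm w.
have dg (h : R) : is_derive h 1 (fun k : R => F (k *: e_ i + t) w) (D1 i (h *: e_ i + t) w).
  exact: (is_derive_line (C1_derive i (h *: e_ i + t) cF)).
have z : 0 \in `]a ord0 i - t ord0 i, b ord0 i - t ord0 i[.
  by rewrite in_itv/= subr_lt0 subr_gt0 ai bi.
have d0 : is_derive (0 : R) 1 (fun k : R => F (k *: e_ i + t) w) 0.
  apply: (@derive1_at_max R _ (a ord0 i - t ord0 i) (b ord0 i - t ord0 i)) => //.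
    by rewrite lerB// (ltW (hab i)).
  move=> h; rewrite in_itv/= => /andP[h1 h2]; rewrite scale0r add0r; apply: tmax => j.
  rewrite mxE [X in X + _]mxE e_E; have [<-|_] := eqVneq i j; last by rewrite mulr0 add0r; exact: Tt.
  by rewrite mulr1 -lerBlDr -[X in _ && X]lerBrDr (ltW h1) (ltW h2).
have := dg 0; rewrite scale0r add0r => d1.
by have := @derive_val _ _ _ _ _ _ _ d1; rewrite (@derive_val _ _ _ _ _ _ _ d0).
Qed.

(** If the maximizer were off the side prescribed by [J] in some direction, it would be interior in
    that direction, being also off the opposite side. Its derivative there would vanish, whereas the
    good event makes it positive outwards. *)
Lemma max_corner : face_set a b J t.
Proof.
have [_ _ side _] := gt => i; have := side t Tt close_refl i.
case Ji : (J i) => [e|] // -[ne h]; apply: contrapT => nc.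
have : D1 i t w = 0.
  apply: interior_critical; have /andP[] := Tt i; rewrite !le_eqVlt => /predU1P[ai|->] /predU1P[bi|->]//.
  - by move: (hab i); rewrite ai bi ltxx.
  - by case: e nc ne {Ji h} => /= nc ne; [move: ne|exfalso; apply: nc]; rewrite -ai /corner/= subr0 mul1r mul0r addr0 ?eqxx.
  - by case: e nc ne {Ji h} => /= nc ne; [exfalso; apply: nc|move: ne]; rewrite bi /corner/= subrr mul1r mul0r add0r ?eqxx.
by move=> e0; move: h; rewrite e0 mulr0; apply/negP; rewrite -ltNge mulr_gt0.
Qed.

Let k := #|tau J|.
Let x0 : tup k := [tuple t ord0 (enum_val i) | i < k].

Let tE : t = face_point a b J x0.
Proof.
apply/rowP => j; case Jj : (J j) => [e|].
  by rewrite (face_point_Some _ _ _ Jj); have := max_corner j; rewrite Jj.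
by have [i ->] := tau_enum Jj; rewrite face_point_enum_val tnth_mktuple.
Qed.

Let x0E i : t ord0 (enum_val i) = tnth x0 i. Proof. by rewrite tnth_mktuple. Qed.

Lemma critical_grad (i : 'I_k) : D1 (enum_val i) t w = 0.
Proof. by apply: interior_critical; have := max_corner (enum_val i); rewrite enum_tau. Qed.

Lemma neg_hess_coercive s : T s -> close r t s -> coercive (mu * u) (neg_hess J s w).
Proof.
move=> Ts ts x; pose v : 'rV[R]_N := face_point 0 0 J [tuple x i | i < k].
have sv : supported J v.
  move=> i; case Ji : (J i) => [e|] // _; rewrite (face_point_Some _ _ _ Ji) /corner !mxE.
  by rewrite !mulr0 addr0.
have vE i : v ord0 (enum_val i) = x i by rewrite face_point_enum_val tnth_mktuple.
have [_ _ _ h] := gt; have := h (fun _ _ => s) (fun _ _ => conj Ts ts) v sv.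
rewrite (quad_tau _ sv) (sum_tau (K := J)) => [|j Jj]; last by rewrite sv// expr0n.
under [X in X <= _ -> _]eq_bigr do under eq_bigr do rewrite !vE.
under [X in _ <= _ * X -> _]eq_bigr do rewrite vE.
have -> : \sum_i \sum_j x i * x j * neg_hess J s w i j =
    - \sum_(i < k) \sum_(j < k) x i * x j * D2 (enum_val i) (enum_val j) s w.
  by rewrite -sumrN; apply: eq_bigr => i _; rewrite -sumrN; apply: eq_bigr => j _; rewrite mxE mulrN.
by rewrite mulNr mulNr lerNr.
Qed.

(* [- grad F] is strongly monotone near [t], hence its small values are only taken near [t]. *)
Lemma crit_support eps (v : tup k) (p := face_point a b J v) : 0 < eps ->
  in_face a b v -> chi (F p w) -> cube eps (face_grad J p w) ->
  forall i, `|tnth v i - tnth x0 i| <= eps * (N.+1%:R / (mu * u)).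
Proof.
move=> e0 iv cF /forallP cg; have muu : 0 < mu * u by rewrite mulr_gt0.
have Jp : face_set a b J p := (in_faceP a b v).1 iv; have Tp := face_set_box hab Jp.
have [near _ _ h] := gt; have cp := near _ Tp (chi_ge cF).
pose y := p - t.
have yE j : y ord0 j = p ord0 j - t ord0 j by rewrite !mxE.
have sy : supported J y.
  move=> j; rewrite yE; have := Jp j; have := max_corner j; case: (J j) => [e -> ->|//] _.
  by rewrite subrr.
(* The increment of each partial derivative has its own intermediate points, one per Hessian entry;
   the last clause of [good_point] is applied to this whole family. *)
have /choice[xi hxi] : forall i, exists xi : 'I_N -> 'rV[R]_N, (forall j, between t p (xi j)) /\
    D1 i p w - D1 i t w = \sum_j y ord0 j * D2 j i (xi j) w.
  move=> i; have [xi [b1 e1]] := C1_mvt t p (gm_C1' gm i w); exists xi; split => //.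
  by rewrite e1; apply: eq_bigr => j _; rewrite yE.
have := h (fun j i => xi i j) _ y sy.
have mem i j : T (xi i j) /\ close r t (xi i j).
  by split; [apply: between_box Tt Tp ((hxi i).1 j)|apply: between_close cp ((hxi i).1 j)].
move=> /(_ (fun i j => mem j i)).
rewrite exchange_big/=.
have -> : \sum_j \sum_i y ord0 i * y ord0 j * D2 i j (xi j i) w = \sum_j y ord0 j * (D1 j p w - D1 j t w).
  apply: eq_bigr => j _; rewrite (hxi j).2 mulr_sumr; apply: eq_bigr => i _; ring.
rewrite (sum_tau (K := J)) => [|j Jj]; last by rewrite sy// mul0r.
rewrite [X in _ <= _ * X](sum_tau (K := J)) => [|j Jj]; last by rewrite sy// expr0n.
pose z (i : 'I_k) := y ord0 (enum_val i).
have zE i : z i = tnth v i - tnth x0 i by rewrite /z yE face_point_enum_val x0E.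
pose lam : R := eps / (mu * u); have lam0 : 0 < lam by rewrite divr_gt0.
move=> h1.
have h2 : mu * u * \sum_i z i ^+ 2 <= \sum_i `|z i| * eps.
  apply: le_trans (_ : - \sum_(i < k) z i * (D1 (enum_val i) p w - D1 (enum_val i) t w) <= _).
    by move: h1; rewrite !mulNr lerNr.
  rewrite -sumrN; apply: ler_sum => i _; rewrite critical_grad subr0.
  apply: le_trans (ler_norm _) _; rewrite normrN normrM ler_wpM2l//.
  by have := cg i; rewrite tnth_mktuple.
have h3 : \sum_i z i ^+ 2 <= k%:R * lam ^+ 2.
  have h4 : \sum_i z i ^+ 2 <= \sum_i `|z i| * lam.
    have -> : \sum_i `|z i| * lam = (\sum_i `|z i| * eps) / (mu * u).
      by rewrite mulr_suml; apply: eq_bigr => i _; rewrite mulrA.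
    by rewrite ler_pdivlMr// mulrC.
  have h5 : \sum_i `|z i| * lam <= \sum_i (z i ^+ 2 + lam ^+ 2) / 2.
    apply: ler_sum => i _; have /andP[_] := mul_le_half_sqr `|z i| lam.
    by rewrite real_normK ?num_real.
  have h6 : \sum_i (z i ^+ 2 + lam ^+ 2) / 2 = (\sum_i z i ^+ 2) / 2 + k%:R * lam ^+ 2 / 2.
    by rewrite -mulr_suml big_split/= mulrDl sumr_const card_ord mulr_natl.
  by move: (le_trans h4 h5); rewrite h6; set s := \sum_i _; set s' := k%:R * _; lra.
move=> i; rewrite -zE.
have kN : k%:R <= N.+1%:R :> R.
  by rewrite ler_nat; apply: leq_trans (max_card _) _; rewrite card_ord.
have h7 : z i ^+ 2 <= (N.+1%:R * lam) ^+ 2.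
  apply: le_trans (_ : \sum_i z i ^+ 2 <= _).
    by rewrite (bigD1 i (P := xpredT))// lerDl; apply: sumr_ge0 => j _; exact: sqr_ge0.
  apply: le_trans h3 _; rewrite [(N.+1%:R * lam) ^+ 2]exprMn; apply: ler_pM; rewrite ?sqr_ge0 ?ler0n//.
  by apply: le_trans kN _; rewrite expr2 ler_peMr// ler1n.
have -> : eps * (N.+1%:R / (mu * u)) = N.+1%:R * lam by rewrite /lam; ring.
rewrite -ler_sqr ?nnegrE// ?real_normK ?num_real//.
by rewrite mulr_ge0// ltW.
Qed.

Lemma local_grad (v_ : nat -> tup k) : (forall i, tnth (v_ n) i @[n --> \oo] --> tnth x0 i) ->
  forall i j, neg_hess J (face_point a b J (v_ n)) w i j @[n --> \oo] --> neg_hess J t w i j.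
Proof.
move=> cv i j; under eq_fun do rewrite neg_hessE; rewrite neg_hessE; apply: cvgN.
by apply: (gm_cvg2 gm); rewrite [X in row_cvg _ X]tE; exact: cvg_face_point.
Qed.

Hypothesis chi_loc : \forall x \near F t w, chi x = chi (F t w).
Context (e : nat -> R) (e0 : forall n, 0 < e n) (e_cvg : e n @[n --> \oo] --> (0 : R)).

(** Blow-up around the maximizer at the rate [e n], on which the gradient is of order [e n]. *)
Let scale (n : nat) (x : tup k) : tup k := affine (e n)%:M (tnth x0) x.
Let p (n : nat) (x : tup k) := face_point a b J (scale n x).

Let scaleE n x i : tnth (scale n x) i = e n * tnth x i + tnth x0 i.
Proof.
rewrite tnth_mktuple (bigD1 i (P := xpredT))//= mxE eqxx mulr1n big1 ?addr0// => j ji.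
by rewrite mxE eq_sym (negbTE ji) mulr0n mul0r.
Qed.

Let scale_cvg x i : tnth (scale n x) i @[n --> \oo] --> tnth x0 i.
Proof.
under eq_fun do rewrite scaleE.
have : e n * tnth x i + tnth x0 i @[n --> \oo] --> 0 * tnth x i + tnth x0 i.
  by apply: cvgD; [apply: cvgM => //; exact: cvg_cst|exact: cvg_cst].
by rewrite mul0r add0r.
Qed.

Let p_cvg x : row_cvg (fun n => p n x) t.
Proof. by rewrite [X in row_cvg _ X]tE; apply: cvg_face_point => i; exact: scale_cvg. Qed.

(** Expanding [D1 i] along the face brings in [D2 j i]; hence the transpose, which has the same
    determinant and the same quadratic form. *)
Let A : 'M[R]_k := (neg_hess J t w)^T.

Let A_coercive : coercive (mu * u) A.
Proof.
move=> x; apply: le_trans (neg_hess_coercive Tt close_refl x) _; rewrite exchange_big/= le_eqVlt; apply/orP; left.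
by apply/eqP; apply: eq_bigr => i _; apply: eq_bigr => j _; rewrite /A !mxE (mulrC (x j)).
Qed.

Let grad_cvg x i : D1 (enum_val i) (p n x) w / e n @[n --> \oo] --> - tnth (affine A (fun=> 0) x) i.
Proof.
have /choice[xi hxi] : forall n, exists xi : 'I_N -> 'rV[R]_N, (forall j, between t (p n x) (xi j)) /\
    D1 (enum_val i) (p n x) w - D1 (enum_val i) t w =
      \sum_j (p n x ord0 j - t ord0 j) * D2 j (enum_val i) (xi j) w.
  by move=> n; exact: (C1_mvt t (p n x) (gm_C1' gm (enum_val i) w)).
have cxi j : row_cvg (fun n => xi n j) t.
  move=> l; have cp := @p_cvg x l.
  apply/cvgrPdist_le => eps eps0; have /cvgrPdist_le/(_ eps eps0) := cp.
  apply: filterS => n; apply: le_trans.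
  have := (hxi n).1 j l; move: (t ord0 l) (p n x ord0 l) (xi n j ord0 l) => y1 y2 y3.
  by case: (leP y1 y2) => h /andP[h1 h2]; rewrite !ler_norml; [rewrite ler0_norm|rewrite gtr0_norm]; rewrite ?subr_le0 ?subr_gt0//; apply/andP; split; lra.
have DE : (fun n => D1 (enum_val i) (p n x) w / e n) =
    fun n => \sum_(j < k) tnth x j * D2 (enum_val j) (enum_val i) (xi n (enum_val j)) w.
  apply/funext => n; have := (hxi n).2; rewrite critical_grad subr0 => ->.
  rewrite (sum_tau (K := J)) => [|j Jj].
    rewrite mulr_suml; apply: eq_bigr => j _.
    rewrite face_point_enum_val scaleE x0E addrK mulrC !mulrA mulVf ?mul1r//.
    by rewrite gt_eqF.
  have := max_corner j; case Je : (J j) Jj => [f|] // _ ->.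
  by rewrite (face_point_Some _ _ _ Je) subrr mul0r.
rewrite DE tnth_mktuple addr0 -sumrN.
apply: cvg_sumr => j; rewrite -mulNr mulrC; rewrite [X in _ --> X](_ : _ = tnth x j * D2 (enum_val j) (enum_val i) t w).
  by apply: cvgM; [exact: cvg_cst|exact: (gm_cvg2 gm)].
by rewrite mulrN !mxE; ring.
Qed.

Let f n (x : tup k) : R := e n ^+ k * crit_point chi (e n) (scale n x) w.
Let g (x : tup k) : R := \det A / 2 ^+ k * (chi (F t w))%:R * (cube 1 (affine A (fun=> 0) x))%:R.
Let C1 : R := #|'S_k|%:R * (L * u) ^+ k / 2 ^+ k.
Let c : R := N.+1%:R / (mu * u).

Let fE n x : f n x = (in_face a b (scale n x))%:R * \det (neg_hess J (p n x) w) *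
  (chi (F (p n x) w))%:R * (cube (e n) (face_grad J (p n x) w))%:R / 2 ^+ k.
Proof.
rewrite /f /crit_point /crit -/(p n x) exprMn; field.
by rewrite !expf_neq0// gt_eqF.
Qed.

(** By [crit_support] the rescaled integrands live in a cube that does not depend on [n]; the
    determinant is bounded through [L * u]. *)
Let f_bound n x : `|f n x| <= C1 * (cube c x)%:R.
Proof.
rewrite fE; have bool01 (bb : bool) : `|bb%:R : R| <= 1 by case: bb; rewrite ?normr1 ?normr0.
have C10 : 0 <= C1 by rewrite /C1 !mulr_ge0// ?invr_ge0 ?exprn_ge0// mulr_ge0// ltW.
have [iv|] := boolP (in_face a b _); last by rewrite !mul0r normr0 mulr_ge0.
have [cF|] := boolP (chi _); last by rewrite mulr0 !mul0r normr0 mulr_ge0.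
have [cg|] := boolP (cube (e n) _); last by rewrite mulr0 mul0r normr0 mulr_ge0.
have sup := crit_support (e0 n) iv cF cg.
have -> : cube c x.
  apply/forallP => i; have := sup i; rewrite scaleE addrK normrM gtr0_norm// ler_pM2l//.
rewrite mul1r !mulr1 normrM (gtr0_norm (_ : 0 < 2 ^- k)) ?invr_gt0 ?exprn_gt0//.
rewrite /C1 ler_pM2r ?invr_gt0 ?exprn_gt0//; apply: det_le => i j; rewrite mxE normrN.
have [_ hL _ _] := gt; apply: hL.
by apply: (face_set_box hab (K := J)); apply/in_faceP.
Qed.

Let f_cvg x : ~ (0 < (cube 1 (affine A (fun=> 0) x))%:R - (open_cube (affine A (fun=> 0) x))%:R :> R) ->
  f ^~ x @ \oo --> g x.
Proof.
move=> nx; set y := affine A _ x in nx *.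
have -> : f ^~ x = fun n => (in_face a b (scale n x))%:R * \det (neg_hess J (p n x) w) *
  (chi (F (p n x) w))%:R * (cube (e n) (face_grad J (p n x) w))%:R / 2 ^+ k by apply/funext => n; rewrite fE.
have -> : g x = 1 * \det (neg_hess J t w) * (chi (F t w))%:R * (cube 1 y)%:R / 2 ^+ k.
  by rewrite /g /A det_tr mul1r; ring.
have cst_lim (B : nat -> bool) bb : (\forall n \near \oo, B n = bb) -> (B n)%:R @[n --> \oo] --> (bb%:R : R).
  by move=> h; apply: cvg_near_cst; apply: filterS h => n ->.
apply: cvgM; last exact: cvg_cst.
apply: cvgM; first (apply: cvgM; first apply: cvgM).
- rewrite -[1]/(true%:R : R); apply: cst_lim.
  have [_ _ side _] := gt.
  have : \forall n \near \oo, forall i : 'I_k, a ord0 (enum_val i) < tnth (scale n x) i < b ord0 (enum_val i).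
    apply: near_all => i; have := max_corner (enum_val i); rewrite enum_tau x0E => /andP[h1 h2].
    have := @scale_cvg x i => cs.
    have ha : \forall n \near \oo, a ord0 (enum_val i) < tnth (scale n x) i by move: cs => /cvgr_gt; exact.
    have hb : \forall n \near \oo, tnth (scale n x) i < b ord0 (enum_val i) by move: cs => /cvgr_lt; exact.
    by apply: filterS2 ha hb => n -> ->.
  by apply: filterS => n h; apply/forallP.
- apply: cvg_det => i j; exact: (local_grad (v_ := fun n => scale n x) (@scale_cvg x)).
- apply: (cst_lim (fun n => chi (F (p n x) w))).
  have h : F (p n x) w @[n --> \oo] --> F t w by apply: (gm_cvg0 gm); exact: p_cvg.
  exact: h chi_loc.
- apply: cst_lim; have [oy|noy] := boolP (open_cube y).
    rewrite (open_cube_sub oy).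
    have : \forall n \near \oo, forall i : 'I_k, `|D1 (enum_val i) (p n x) w / e n| < 1.
      apply: near_all => i.
      have : `|D1 (enum_val i) (p n x) w / e n| @[n --> \oo] --> `|- tnth y i| by apply: cvg_norm; exact: grad_cvg.
      have y1 : `|- tnth y i| < 1 by rewrite normrN; move/forallP: oy; exact.
      by move=> /cvgr_lt; exact.
    apply: filterS => n h; apply/forallP => i; rewrite tnth_mktuple; have := h i.
    by rewrite normrM normfV (gtr0_norm (e0 n)) ltr_pdivrMr// mul1r => /ltW.
  have ncy : cube 1 y = false.
    by apply/negP => cy; apply: nx; rewrite cy (negbTE noy) subr0.
  rewrite ncy; move: ncy => /negbT; rewrite negb_forall => /existsP[i]; rewrite -ltNge => yi.
  have : `|D1 (enum_val i) (p n x) w / e n| @[n --> \oo] --> `|- tnth y i| by apply: cvg_norm; exact: grad_cvg.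
  rewrite normrN => /cvgr_gt/(_ 1 yi); apply: filterS => n.
  rewrite normrM normfV (gtr0_norm (e0 n)) ltr_pdivlMr// mul1r => h.
  by apply/negP => /forallP/(_ i); rewrite tnth_mktuple leNgt h.
Qed.

Hypothesis mchi : measurable_fun setT (fun x : R => (chi x)%:R : R).

Let muu0 : 0 < mu * u. Proof. exact: mulr_gt0. Qed.

Lemma crit_point_ge0 eps (v : tup k) : 0 < eps -> 0 <= crit_point chi eps v w.
Proof.
move=> ep0; rewrite /crit_point /crit.
have [iv|] := boolP (in_face a b v); last by rewrite mul0r.
have [cF|] := boolP (chi _); last by rewrite mulr0 !mul0r mulr0.
have Tv := face_set_box hab ((in_faceP a b v).1 iv).
have [near _ _ _] := gt; have cv := near _ Tv (chi_ge cF).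
have [d0 _] := affine_change (fun=> 0) muu0 (neg_hess_coercive Tv cv).
rewrite mul1r mulr1; apply: divr_ge0; first by rewrite mulr_ge0// ltW.
by rewrite exprn_ge0// mulr_ge0// ltW.
Qed.

Let measurable_crit eps : measurable_fun setT (fun v : tup k => crit_point chi eps v w).
Proof.
apply: measurable_funM; first exact: measurable_in_face.
have mD2 i j : measurable_fun setT (fun v : tup k => D2 i j (face_point a b J v) w).
  have h := @measurable_face_point R N a b J (fun s => D2 i j s w).
  by apply: h; exact: C1_partial (gm_C1' gm j w).
have mD1 i : measurable_fun setT (fun v : tup k => D1 i (face_point a b J v) w).
  exact: (@measurable_face_point R N a b J (fun s => D1 i s w) (C1_continuous (gm_C1' gm i w))).
have mF : measurable_fun setT (fun v : tup k => F (face_point a b J v) w).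
  exact: (@measurable_face_point R N a b J (fun s => F s w) (C1_continuous (gm_C1 gm w))).
apply: measurable_funM => //; apply: measurable_funM; first apply: measurable_funM.
- apply: measurable_det => i j; under eq_fun do rewrite neg_hessE; exact: measurableT_comp.
- exact: (measurableT_comp mchi mF).
- apply: (measurableT_comp (@measurable_cube R k eps)).
  exact: measurable_mktuple.
Qed.

Let scalar_coercive n : coercive (e n) ((e n)%:M : 'M[R]_k).
Proof.
move=> x; rewrite mulr_sumr le_eqVlt; apply/orP; left; apply/eqP; apply: eq_bigr => i _.
rewrite (bigD1 i (P := xpredT))//= mxE eqxx mulr1n big1 ?addr0 => [|j ji].
  by rewrite mulrC expr2.
by rewrite mxE eq_sym (negbTE ji) mulr0n mulr0.
Qed.

Let integralE n : (\int[leb k]_v (crit_point chi (e n) v w)%:E = \int[leb k]_x (f n x)%:E)%E.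
Proof.
have [_ /(_ (fun v => (crit_point chi (e n) v w)%:E))] := affine_change (tnth x0) (e0 n) (@scalar_coercive n).
move=> h; rewrite -[LHS]mul1e; have en : (1 = (e n ^+ k)%:E * ((\det ((e n)%:M : 'M[R]_k))^-1)%:E)%E.
  by rewrite det_scalar -EFinM divff// expf_neq0// gt_eqF.
rewrite en -muleA -h//; first last.
- by move=> v; rewrite lee_fin crit_point_ge0.
- by apply/measurable_EFinP; exact: measurable_crit.
rewrite -ge0_integralZl//.
- apply/measurable_EFinP; exact: (measurableT_comp (@measurable_crit (e n)) (@measurable_affine R k _ _)).
- by move=> x _; rewrite lee_fin crit_point_ge0.
- by rewrite lee_fin exprn_ge0// ltW.
Qed.

Let mf n : measurable_fun setT (f n).
Proof.
apply: measurable_funM => //.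
exact: (measurableT_comp (@measurable_crit (e n)) (@measurable_affine R k _ _)).
Qed.

Let c_ge0 : 0 <= c. Proof. by rewrite /c divr_ge0// ltW. Qed.

Let C1_ge0 : 0 <= C1.
Proof. by rewrite /C1 !mulr_ge0// ?invr_ge0 ?exprn_ge0// mulr_ge0// ltW. Qed.

Let integral_dom : (\int[leb k]_x (C1 * (cube c x)%:R)%:E = (C1 * (2 * c) ^+ k)%:E)%E.
Proof.
under eq_integral do rewrite EFinM.
rewrite ge0_integralZl//; last by apply/measurable_EFinP; exact: measurable_cube.
by rewrite integral_cube.
Qed.

Lemma crit_bound n : (0 <= \int[leb k]_v (crit_point chi (e n) v w)%:E <= (C1 * (2 * c) ^+ k)%:E)%E.
Proof.
apply/andP; split; first by apply: integral_ge0 => v _; rewrite lee_fin crit_point_ge0.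
rewrite integralE -integral_dom; apply: ge0_le_integral => //.
- by move=> x _; rewrite lee_fin mulr_ge0 ?crit_point_ge0 ?exprn_ge0// ltW.
- exact/measurable_EFinP.
- by apply/measurable_EFinP; apply: measurable_funM => //; exact: measurable_cube.
- by move=> x _; rewrite lee_fin; apply: le_trans (f_bound n x); exact: ler_norm.
Qed.

(** After the blow-up the gradient divided by [e n] tends to [- A x]. The integrand therefore tends
    to [\det A / 2 ^+ k] on the set where the coordinates of [A x] are at most 1 in absolute value,
    a set of volume [2 ^+ k / \det A]: the count is exactly one critical point, weighted by
    [chi]. *)
Lemma crit_limit : (\int[leb k]_v (crit_point chi (e n) v w)%:E @[n --> \oo] --> ((chi (F t w))%:R)%:E)%E.
Proof.
have [dA change] := affine_change (fun=> 0) muu0 A_coercive.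
have mA := @measurable_affine R k A (fun=> 0).
have mc : measurable_fun setT (fun x : tup k => (cube 1 (affine A (fun=> 0) x))%:R : R).
  exact: (measurableT_comp (@measurable_cube R k 1) mA).
have [|x||x|M [mM M0 hM]] := @integral0_null _ (tup k) R (leb k)
    (fun x => (cube 1 (affine A (fun=> 0) x))%:R - (open_cube (affine A (fun=> 0) x))%:R)
    [set x | 0 < (cube 1 (affine A (fun=> 0) x))%:R - (open_cube (affine A (fun=> 0) x))%:R :> R].
- by apply: measurable_funB => //; exact: (measurableT_comp (@measurable_open_cube R k) mA).
- have := @open_cube_sub R k (affine A (fun=> 0) x).
  by case: open_cube => [->//|_]; rewrite ?subrr// subr0.
- rewrite (change (fun y => ((cube 1 y)%:R - (open_cube y)%:R)%:E)).
  + by rewrite integral_sphere mule0.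
  + apply/measurable_EFinP; apply: measurable_funB; [exact: measurable_cube|exact: measurable_open_cube].
  + move=> y; rewrite lee_fin; have := @open_cube_sub R k y.
    by case: open_cube => [->//|_]; rewrite ?subrr// subr0.
- by [].
have -> : (fun n => \int[leb k]_v (crit_point chi (e n) v w)%:E)%E = fun n => (\int[leb k]_x (f n x)%:E)%E.
  by apply/funext => n; exact: integralE.
have -> : (((chi (F t w))%:R)%:E = \int[leb k]_x (g x)%:E)%E.
  under eq_integral do rewrite EFinM.
  rewrite ge0_integralZl//; first last.
  - by rewrite lee_fin !mulr_ge0// ?invr_ge0 ?exprn_ge0// ltW.
  - exact/measurable_EFinP.
  rewrite (change (fun y => ((cube 1 y)%:R)%:E))//; last by apply/measurable_EFinP; exact: measurable_cube.
  rewrite integral_cube// mulr1 -!EFinM; congr EFin; field.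
  by rewrite expf_neq0// gt_eqF.
apply: (@dominated_cvg_off _ _ _ _ f g (fun x => C1 * (cube c x)%:R) M) => //.
- by apply: measurable_funM.
- by move=> x nM; apply: f_cvg => h; apply: nM; exact: hM.
- apply/integrableP; split.
    by apply/measurable_EFinP; apply: measurable_funM => //; exact: measurable_cube.
  have -> : (\int[leb k]_x `|(EFin \o (fun x => C1 * (cube c x)%:R)%R) x| =
      \int[leb k]_x (C1 * (cube c x)%:R)%:E)%E.
    by apply: eq_integral => x _; rewrite /= ger0_norm// mulr_ge0.
  by rewrite integral_dom ltry.
Qed.

End path.
End crit.

(** * Mean number of critical points *)

Section maximum.
Context {R : realType} {N : nat} (a b : 'rV[R]_N) (hab : forall i, a ord0 i < b ord0 i).
Local Notation T := (box a b).

Lemma box_max (f : 'rV[R]_N -> R) : continuous f -> exists t, T t /\ forall s, T s -> f s <= f t.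
Proof.
move=> cf.
have cs p t : row_cvg p t -> f (p n) @[n --> \oo] --> f t by apply: continuous_row_cvg; exact: cf.
have [M hM] : exists M, forall t, T t -> f t <= M by apply: box_bounded => p t _ _; exact: cs.
pose S := [set f t | t in T].
have hS : has_sup S.
  split; first by exists (f a), a => //; exact: box_a.
  by exists M => _ [t Tt <-]; exact: hM.
have /choice[p hp] : forall n : nat, exists t, T t /\ sup S - n.+1%:R^-1 < f t.
  move=> n; have n0 : 0 < n.+1%:R^-1 :> R by rewrite invr_gt0.
  by have [_ [t Tt <-] h] := sup_adherent n0 hS; exists t.
have [t [g [Tt hg cg]]] := box_extract (fun n => (hp n).1).
exists t; split => // s Ts; apply: le_trans (_ : sup S <= _).
  by apply: ub_le_sup; [exact: hS.2|exists s].
have c1 : sup S - (g n).+1%:R^-1 @[n --> \oo] --> sup S - 0.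
  by apply: cvgB; [exact: cvg_cst|exact: cvg_inv_extract].
rewrite -[leLHS]subr0; apply: (cvg_ge_bound c1 (cs _ _ cg)) => n.
exact/ltW/(hp (g n)).2.
Qed.

End maximum.

Section joint_measurability.
Context {d} {Omega : measurableType d} {R : realType} (P : probability Omega R) {N : nat}.
Context (a b : 'rV[R]_N) (hab : forall i, a ord0 i < b ord0 i).
Context (H : set (Omega -> R)) (F : 'rV[R]_N -> Omega -> R) (gm : gaussian_model P a b H F).
Local Notation D1 := (D1 F).
Local Notation D2 := (D2 F).
Local Notation tup k := (k.-tuple (measurableTypeR R)).

Lemma measurable_D1T i t : measurable_fun setT (D1 i t).
Proof. by apply: measurable_D1 => [w|s]; [exact: (gm_C1 gm)|exact: (gm_measurable gm)]. Qed.

Lemma measurable_D2T i j t : measurable_fun setT (D2 i j t).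
Proof.
apply: (@measurable_D1 _ _ _ _ (D1 j)) => [w|s]; [exact: (gm_C1' gm)|exact: measurable_D1T].
Qed.

Lemma joint_face K (G : 'rV[R]_N -> Omega -> R) : (forall t, measurable_fun setT (G t)) ->
  (forall w, continuous (G ^~ w)) ->
  measurable_fun setT (fun z : tup #|tau K| * Omega => G (face_point a b K z.1) z.2).
Proof.
move=> mG cG; apply: (@measurable_caratheodory _ _ _ _ (fun v : tup #|tau K| => G (face_point a b K v))) => [v|v w].
  exact: mG.
apply: (@continuous_row_cvg R N (fun s => G s w) _ _ (cG w _)).
apply: cvg_face_point => i; under eq_fun do rewrite tnth_mktuple; exact: cvg_rnd.
Qed.

Lemma joint_crit K (chi : R -> bool) eps : measurable_fun setT (fun x : R => (chi x)%:R : R) ->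
  measurable_fun setT (fun z : tup #|tau K| * Omega => crit_point a b F chi eps z.1 z.2).
Proof.
move=> mchi; apply: measurable_funM.
  exact: (measurableT_comp (@measurable_in_face R N a b K) measurable_fst).
have m2 i j : measurable_fun setT (fun z : tup #|tau K| * Omega => D2 i j (face_point a b K z.1) z.2).
  by apply: (@joint_face K (D2 i j)) => [t|w]; [exact: measurable_D2T|exact: C1_partial (gm_C1' gm j w)].
have m1 i := @joint_face K (D1 i) (@measurable_D1T i) (fun w => C1_continuous (gm_C1' gm i w)).
have m0 := @joint_face K F (gm_measurable gm) (fun w => C1_continuous (gm_C1 gm w)).
apply: measurable_funM => //; apply: measurable_funM; first apply: measurable_funM.
- apply: measurable_det => i j; under eq_fun do rewrite neg_hessE; exact: measurableT_comp.
- exact: (measurableT_comp mchi m0).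
- apply: (measurableT_comp (@measurable_cube R _ eps)).
  exact: measurable_mktuple.
Qed.

End joint_measurability.

(** * Exponential moments of the smoothed count *)

Section tilted.
Context {d} {Omega : measurableType d} {R : realType} (P : probability Omega R) {N : nat}.
Context (a b : 'rV[R]_N) (hab : forall i, a ord0 i < b ord0 i).
Context (H : set (Omega -> R)) (F : 'rV[R]_N -> Omega -> R) (gm : gaussian_model P a b H F).
Local Notation T := (box a b).
Local Notation D1 := (D1 F).
Local Notation D2 := (D2 F).
Local Notation tup k := (k.-tuple (measurableTypeR R)).
Local Notation leb := (lebesgue_tuple R).

Let gH := gm_space gm.

Lemma det_le_expR k (A : 'M[R]_k) : `|\det A| <= #|'S_k|%:R * expR (\sum_i \sum_j `|A i j|).
Proof.
apply: le_trans (ler_norm_sum _ _ _) _.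
apply: le_trans (_ : \sum_(s : 'S_k) expR (\sum_i \sum_j `|A i j|) <= _); last by rewrite sumr_const mulr_natl.
apply: ler_sum => s _; rewrite normrM normrX normrN1 expr1n mul1r normr_prod expR_sum.
apply: ler_prod => i _; rewrite normr_ge0/=; apply: le_trans (_ : expR `|A i (s i)| <= _).
  by apply: le_trans (expR_ge1Dx _); rewrite lerDr.
by rewrite ler_expR (bigD1 (s i) (P := xpredT))// lerDl; apply: sumr_ge0.
Qed.

Let pairs (K : face N) := ('I_#|tau K| * 'I_#|tau K|)%type.

(** Signed sums of all Hessian entries. The determinant is bounded by an exponential of absolute
    values, hence by finitely many exponentials of these elements of [H], which can be merged with
    the tilt [Y]. *)
Definition hess_comb (K : face N) t (s : {ffun 'I_#|{: pairs K}| -> bool}) w : R :=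
  \sum_l (-1) ^+ s l * D2 (enum_val (enum_val l).1) (enum_val (enum_val l).2) t w.

Lemma neg_hess_le K t w : `|\det (neg_hess F K t w)| <=
  #|'S_#|tau K| |%:R * \sum_(s : {ffun 'I_#|{: pairs K}| -> bool}) expR (hess_comb t s w).
Proof.
apply: le_trans (det_le_expR _) _; rewrite ler_wpM2l//.
have -> : \sum_i \sum_j `|neg_hess F K t w i j| =
    \sum_(l < #|{: pairs K}|) `|D2 (enum_val (enum_val l).1) (enum_val (enum_val l).2) t w|.
  rewrite pair_big/= (big_enum_val (A := {: pairs K}) (fun p => `|neg_hess F K t w p.1 p.2|)).
  by apply: eq_bigr => l _; rewrite neg_hessE normrN.
exact: expR_sum_norm_le.
Qed.

Lemma gs_hess_comb K t s : T t -> H (@hess_comb K t s).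
Proof.
move=> Tt; apply: (gs_lincomb gH) => l.
exact: (gm_D2 hab gm).
Qed.

Lemma hess_comb_bounded K : exists2 c : R, 0 <= c & forall t s, T t -> nrm2 P (@hess_comb K t s) <= c.
Proof.
have [S S0 hS] := moments_bounded hab gm.
exists (\sum_(l < #|{: pairs K}|) Num.sqrt S); first by apply: sumr_ge0 => l _; exact: sqrtr_ge0.
move=> t s Tt; rewrite /hess_comb.
have sq l : sqint P (D2 (enum_val (enum_val l).1) (enum_val (enum_val l).2) t : Omega -> R).
  by apply: (gs_sqint gH); exact: (gm_D2 hab gm).
elim: (index_enum _) => [|l r IH].
  rewrite big_nil (_ : (fun w => _) = fun=> 0); last by apply/funext => w; rewrite big_nil.
  by rewrite /nrm2 cov0l sqrtr0.
rewrite big_cons (_ : (fun w => _) = fun w => (-1) ^+ s l * D2 (enum_val (enum_val l).1) (enum_val (enum_val l).2) t w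
   + \sum_(i <- r) (-1) ^+ s i * D2 (enum_val (enum_val i).1) (enum_val (enum_val i).2) t w); last first.
  by apply/funext => w; rewrite big_cons.
have sZ : sqint P (fun w => (-1) ^+ s l * D2 (enum_val (enum_val l).1) (enum_val (enum_val l).2) t w).
  by apply: (gs_sqint gH); apply: (gsZ _ gH); exact: (gm_D2 hab gm).
apply: le_trans (nrm2D sZ _) _; first by apply: sqint_sum => i; exact: sq.
apply: lerD IH; rewrite nrm2Z// normrX normrN1 expr1n mul1r /nrm2 ler_wsqrtr//.
exact: (hS _ _ _ Tt).2.
Qed.

(* The Gaussian factor [expR Y] and the exponential bound on the determinant are absorbed by a
   Gaussian density computed under the tilted measure. *)
Lemma tilted_bound K n (lambda : R) : 0 < lambda -> exists C c : R, [/\ 0 <= C, 0 <= c &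
  forall t (Z : 'I_n -> Omega -> R) (G : tup n -> R) (m : R) Y, T t -> (forall i, H (Z i)) ->
    posdef P lambda Z -> measurable_fun setT G -> (forall v, 0 <= G v) -> 0 <= m ->
    (\int[leb n]_v (G v)%:E = m%:E)%E -> H Y ->
    (\int[P]_w (expR (Y w) * (`|\det (neg_hess F K t w)| * G [tuple Z i w | i < n]))%:E <=
     (C * m * expR ((nrm2 P Y + c) ^+ 2 / 2))%:E)%E].
Proof.
move=> l0; have [c c0 hc] := hess_comb_bounded K.
pose M := (@std_peak R / Num.sqrt lambda) ^+ n.
have M0 : 0 <= M by rewrite exprn_ge0// divr_ge0// ?sqrtr_ge0// ltW// std_peak_gt0.
pose S := {ffun 'I_#|{: pairs K}| -> bool}.
exists (#|'S_#|tau K| |%:R * (\sum_(s : S) M)), c; split => //.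
  by rewrite mulr_ge0//; apply: sumr_ge0.
move=> t Z G m Y Tt HZ pZ mG G0 m0 IG HY.
have HYW (s : S) : H (fun w => Y w + hess_comb t s w) by apply: (gsD gH) => //; exact: gs_hess_comb.
have mZ : measurable_fun setT (fun w => [tuple Z i w | i < n] : tup n).
  by apply: measurable_mktuple => i; exact: (gs_measurable gH).
have mGZ : measurable_fun setT (fun w => G [tuple Z i w | i < n]) by exact: (measurableT_comp mG mZ).
have mdet : measurable_fun setT (fun w => `|\det (neg_hess F K t w)|).
  apply: measurableT_comp => //; apply: measurable_det => i j; under eq_fun do rewrite neg_hessE.
  apply: measurableT_comp => //; exact: (measurable_D2T gm).
have mexp (f : Omega -> R) : measurable_fun setT f -> measurable_fun setT (fun w : Omega => expR (f w)).
  by move=> mf; exact: (measurableT_comp (@measurable_expR R) mf).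
have mS (s : S) : measurable_fun setT (fun w => (expR (Y w + hess_comb t s w) * G [tuple Z i w | i < n])%:E).
  apply/measurable_EFinP; apply: measurable_funM => //; apply: mexp; exact: (gs_measurable gH (HYW s)).
have S0 (s : S) w : (0 <= (expR (Y w + hess_comb t s w) * G [tuple Z i w | i < n])%:E)%E.
  by rewrite lee_fin mulr_ge0// expR_ge0.
apply: (@le_trans _ _ (\int[P]_w ((#|'S_#|tau K| |%:R)%:E *
   \sum_(s : S) (expR (Y w + hess_comb t s w) * G [tuple Z i w | i < n])%:E)%E)%E).
  apply: ge0_le_integral => //.
  - by move=> w _; rewrite lee_fin !mulr_ge0// expR_ge0.
  - apply/measurable_EFinP; apply: measurable_funM; last exact: measurable_funM.
    by apply: mexp; exact: (gs_measurable gH).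
  - by apply: measurable_funeM; apply: emeasurable_sum.
  move=> w _; rewrite sumEFin -EFinM lee_fin.
  have -> : \sum_(s : S) expR (Y w + hess_comb t s w) * G [tuple Z i w | i < n] =
      expR (Y w) * (\sum_(s : S) expR (hess_comb t s w)) * G [tuple Z i w | i < n].
    by rewrite mulr_sumr mulr_suml; apply: eq_bigr => s _; rewrite expRD.
  apply: (@le_trans _ _ (expR (Y w) * ((#|'S_#|tau K| |%:R * \sum_(s : S) expR (hess_comb t s w)) *
    G [tuple Z i w | i < n]))).
    by rewrite ler_wpM2l ?expR_ge0// ler_wpM2r//; exact: neg_hess_le.
  by rewrite le_eqVlt; apply/orP; left; apply/eqP; ring.
rewrite ge0_integralZl//; first last.
- by move=> w _; apply: sume_ge0.
- exact: emeasurable_sum.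
rewrite ge0_integral_sum// -(mulrA _ m) -(mulrA #|'S_#|tau K| |%:R) EFinM; apply: lee_wpmul2l => //.
rewrite mulr_suml -sumEFin; apply: lee_sum => s _.
have [p [cp pb hp]] := gaussian_density gH l0 HZ (HYW s) pZ.
have -> : (\int[P]_w (expR (Y w + hess_comb t s w) * G [tuple Z i w | i < n])%:E =
    \int[P]_w ((expR (Y w + hess_comb t s w))%:E * (EFin \o G) [tuple Z i w | i < n]))%E.
  by apply: eq_integral => w _; rewrite /= EFinM.
rewrite hp; [|exact/measurable_EFinP|by move=> v; rewrite lee_fin].
apply: (@le_trans _ _ (\int[leb n]_v ((M * expR ((nrm2 P Y + c) ^+ 2 / 2))%:E * (G v)%:E))%E).
  apply: ge0_le_integral => //.
  - by move=> v _; rewrite -EFinM lee_fin mulr_ge0//; have /andP[] := pb (row_of_tuple v).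
  - apply: emeasurable_funM; first exact/measurable_EFinP.
    by apply/measurable_EFinP; exact: measurable_continuous_row.
  - by apply: measurable_funeM; exact/measurable_EFinP.
  move=> v _; rewrite -!EFinM lee_fin mulrC ler_wpM2r//.
  have /andP[_ h] := pb (row_of_tuple v); apply: le_trans h _; rewrite ler_wpM2l// ler_expR.
  rewrite ler_pM2r// -sqr_nrm2 ler_sqr ?nnegrE ?nrm2_ge0 ?addr_ge0 ?nrm2_ge0//.
  apply: le_trans (nrm2D (gs_sqint gH HY) (gs_sqint gH (gs_hess_comb s Tt))) _.
  by rewrite lerD2l hc.
rewrite ge0_integralZl//; first last.
- by rewrite lee_fin mulr_ge0// expR_ge0.
- by move=> v _; rewrite lee_fin.
- exact/measurable_EFinP.
by rewrite IG -EFinM lee_fin le_eqVlt; apply/orP; left; apply/eqP; ring.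
Qed.

Lemma face_posdef : exists2 lambda : R, 0 < lambda & forall K t, T t ->
  posdef P lambda (fun i : 'I_#|tau K|.+1 => if unlift ord0 i is Some j then D1 (enum_val j) t else F t).
Proof.
have [lambda l0 hl] := gm_lambda hab gm; exists lambda => // K t Tt c.
pose v : 'rV[R]_N := face_point 0 0 K [tuple c (lift ord0 i) | i < #|tau K|].
pose e : 'rV[R]_N.+1 := \row_i if unlift ord0 i is Some j then v ord0 j else c ord0.
have vE (i : 'I_#|tau K|) : v ord0 (enum_val i) = c (lift ord0 i).
  by rewrite face_point_enum_val tnth_mktuple.
have v0 j : K j != None -> v ord0 j = 0.
  case Kj : (K j) => [f|] // _; rewrite (face_point_Some _ _ _ Kj) /corner !mxE.
  by rewrite !mulr0 addr0.
have e0 : e ord0 ord0 = c ord0 by rewrite mxE unlift_none.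
have eS j : e ord0 (lift ord0 j) = v ord0 j by rewrite mxE liftK.
have := hl t e Tt; rewrite big_ord_recl e0.
under eq_bigr do rewrite eS.
rewrite (sum_tau (K := K)) => [|j Kj]; last by rewrite v0// expr0n.
under eq_bigr do rewrite vE.
rewrite -(big_ord_recl _ (fun i => c i ^+ 2)).
have -> : jet1 F e t = fun w => \sum_i c i * (if unlift ord0 i is Some j then D1 (enum_val j) t else F t) w.
  apply/funext => w; rewrite /jet1 e0 big_ord_recl unlift_none; congr (_ + _).
  under eq_bigr do rewrite eS.
  rewrite (sum_tau (K := K)) => [|j Kj]; last by rewrite v0// mul0r.
  by apply: eq_bigr => i _; rewrite vE liftK.
by [].
Qed.

Definition crit_weight K eps t w : R :=
  `|\det (neg_hess F K t w)| * ((cube eps (face_grad F K t w))%:R / (2 * eps) ^+ #|tau K|).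

Lemma measurable_cube_grad K eps t : measurable_fun setT (fun w => (cube eps (face_grad F K t w))%:R : R).
Proof.
apply: (measurableT_comp (@measurable_cube R _ eps)).
by apply: measurable_mktuple => i; exact: (measurable_D1T gm).
Qed.

Lemma crit_weight_weight K eps t : 0 < eps -> weight (crit_weight K eps t).
Proof.
move=> e0; split => [|w]; last by rewrite mulr_ge0// divr_ge0// exprn_ge0// mulr_ge0// ltW.
apply: measurable_funM; last by apply: measurable_funM => //; exact: measurable_cube_grad.
apply: measurableT_comp => //; apply: measurable_det => i j; under eq_fun do rewrite neg_hessE.
apply: measurableT_comp => //; exact: (measurable_D2T gm).
Qed.

(** [tilted_bound] sees the smoothed indicator of the gradient only through its Lebesgue integral,
    which is 1 for every [eps]; uniformity in [t] comes from the common [lambda]. *)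
Lemma crit_weight_subgaussian K : exists C c : R, [/\ 0 <= C, 0 <= c & forall eps t, 0 < eps -> T t ->
  subgaussian P H C c (crit_weight K eps t)].
Proof.
have [lambda l0 hl] := face_posdef.
have [C [c [C0 c0 h]]] := tilted_bound K #|tau K| l0.
exists C, c; split => // eps t e0 Tt; split; first exact: crit_weight_weight.
move=> Y HY; have := h t (fun i => D1 (enum_val i) t) (fun v => (cube eps v)%:R / (2 * eps) ^+ #|tau K|) 1 Y Tt.
rewrite mulr1; apply => //.
- by move=> i; exact: (gm_D1 hab gm).
- have := posdef_lift (hl K t Tt); congr (posdef P lambda _); apply/funext => i.
  by rewrite liftK.
- by apply: measurable_funM => //; exact: measurable_cube.
- by move=> v; rewrite divr_ge0// exprn_ge0// mulr_ge0// ltW.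
- under eq_integral do rewrite EFinM.
  rewrite ge0_integralZr//; first last.
  + by rewrite lee_fin invr_ge0 exprn_ge0// mulr_ge0// ltW.
  + by apply/measurable_EFinP; exact: measurable_cube.
  rewrite integral_cube ?ltW// -EFinM divff// expf_neq0// gt_eqF// mulr_gt0//.
Qed.

(** The value joins the gradient in [tilted_bound]: the density of both together is bounded, so a
    window of width [2 * h] costs a factor proportional to [h]. *)
Lemma crit_window K : exists2 C : R, 0 <= C & forall eps t u h, 0 < eps -> 0 < h -> T t ->
  (\int[P]_w (crit_weight K eps t w * ((u - h <= F t w <= u + h)%R)%:R)%:E <= (C * h)%:E)%E.
Proof.
have [lambda l0 hl] := face_posdef.
have [C [c [C0 c0 hC]]] := tilted_bound K #|tau K|.+1 l0.
exists (C * 2 * expR ((nrm2 P (fun=> 0) + c) ^+ 2 / 2)); first by rewrite !mulr_ge0// expR_ge0.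
move=> eps t u h e0 h0 Tt.
have en : (2 * eps) ^+ #|tau K| != 0 :> R by rewrite expf_neq0// gt_eqF// mulr_gt0.
pose bt (v : tup #|tau K|.+1) : tup #|tau K| := [tuple of behead v].
pose G (v : tup #|tau K|.+1) : R := \1_(`[u - h, u + h]%classic) (tnth v ord0) *
   ((cube eps (bt v))%:R / (2 * eps) ^+ #|tau K|).
have mG : measurable_fun setT G.
  apply: measurable_funM; first exact: (measurableT_comp (measurable_indic _) (measurable_tnth _)).
  apply: measurable_funM => //; apply: (measurableT_comp (@measurable_cube R _ eps)).
  exact: measurable_behead.
have G0 v : 0 <= G v by rewrite mulr_ge0// divr_ge0// exprn_ge0// mulr_ge0// ltW.
have := hC t _ G (2 * h) (fun=> 0) Tt _ (hl K t Tt) mG G0.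
have -> : C * (2 * h) * expR ((nrm2 P (fun=> 0) + c) ^+ 2 / 2) =
  C * 2 * expR ((nrm2 P (fun=> 0) + c) ^+ 2 / 2) * h by ring.
move=> hh; apply: le_trans (hh _ _ _ _).
- apply: ge0_le_integral => //.
  + by move=> w _; rewrite lee_fin mulr_ge0//; exact: (crit_weight_weight K t e0).2.
  + apply/measurable_EFinP; apply: measurable_funM; first exact: (crit_weight_weight K t e0).1.
    have -> : (fun w => ((u - h <= F t w <= u + h)%R)%:R) = fun w => \1_(`[u - h, u + h]%classic) (F t w) :> R.
      apply/funext => w; rewrite indicE; congr (_%:R); congr nat_of_bool.
      by apply/idP/idP => [h'|/set_mem]; [apply/mem_set|]; rewrite /= in_itv.
    exact: (measurableT_comp (measurable_indic _) (gm_measurable gm t)).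
  + apply/measurable_EFinP; apply: measurable_funM => //; apply: measurable_funM.
      apply: measurableT_comp => //; apply: measurable_det => i j; under eq_fun do rewrite neg_hessE.
      apply: measurableT_comp => //; exact: (measurable_D2T gm).
    apply: (measurableT_comp mG); apply: measurable_mktuple => i.
    by case: (unlift ord0 i) => [j|]; [exact: (measurable_D1T gm)|exact: (gm_measurable gm)].
  move=> w _; rewrite lee_fin expR0 mul1r /crit_weight -mulrA ler_wpM2l// /G.
  rewrite tnth_mktuple unlift_none indicE.
  have -> : (F t w \in `[u - h, u + h]%classic) = (u - h <= F t w <= u + h).
    by apply/idP/idP => [/set_mem|h']; [|apply/mem_set]; rewrite /= in_itv.
  rewrite mulrC; set X := [tuple _ | i < _].
  rewrite (_ : bt X = face_grad F K t w)//; apply: eq_from_tnth => i.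
  have e : i.+1 = lift ord0 i :> nat by [].
  by rewrite (tnth_nth 0) nth_behead e -tnth_nth !tnth_mktuple liftK.
- by move=> i; case: (unlift ord0 i) => [j|]; [exact: (gm_D1 hab gm)|exact: (gm_field gm)].
- by rewrite mulr_ge0// ltW.
- rewrite ge0_integral_lebesgue_tupleS//; last exact/measurable_EFinP.
  have mc : measurable_fun setT (fun y : tup #|tau K| => ((cube eps y)%:R / (2 * eps) ^+ #|tau K|)%:E : \bar R).
    by apply/measurable_EFinP; apply: measurable_funM => //; exact: measurable_cube.
  have c0' (y : tup #|tau K|) : (0 <= ((cube eps y)%:R / (2 * eps) ^+ #|tau K|)%:E :> \bar R)%E.
    by rewrite lee_fin divr_ge0// exprn_ge0// mulr_ge0// ltW.
  have Ic : (\int[leb #|tau K|]_y ((cube eps y)%:R / (2 * eps) ^+ #|tau K|)%:E = 1)%E.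
    under eq_integral do rewrite EFinM.
    rewrite ge0_integralZr//; first last.
    + by rewrite lee_fin invr_ge0 exprn_ge0// mulr_ge0// ltW.
    + by apply/measurable_EFinP; exact: measurable_cube.
    by rewrite integral_cube ?ltW// -EFinM divff.
  transitivity (\int[@lebesgue_measure R]_x (\1_(`[u - h, u + h]%classic) x)%:E)%E.
    apply: eq_integral => x _.
    transitivity ((\1_(`[u - h, u + h]%classic) x)%:E * \int[leb #|tau K|]_y ((cube eps y)%:R / (2 * eps) ^+ #|tau K|)%:E)%E; last by rewrite Ic mule1.
    rewrite -ge0_integralZl//; apply: eq_integral => y _.
    rewrite /G -EFinM (tnth_nth 0)/=; congr ((_ * ((cube eps _)%:R / _))%:E).
    exact/val_inj.
  rewrite integral_indic//= setIT lebesgue_measure_itv/= lte_fin ifT; last by lra.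
  by rewrite -EFinB; congr (_%:E); ring.
- exact: (gs0 gH).
Qed.

End tilted.

(** * The Kac-Rice integrand at one point *)

Section local_average.
Context {R : realType} {k : nat}.
Local Notation tup := (k.-tuple (measurableTypeR R)).

Lemma borel_cube (r : R) : borel [set z : 'rV[R]_k | forall i, `|z ord0 i| <= r].
Proof.
have oU : open [set z : 'rV[R]_k | exists i, r < `|z ord0 i|].
  rewrite openE => z [i hi]; apply/nbhs_rowP; exists (`|z ord0 i| - r); first by rewrite subr_gt0.
  move=> y /(_ i) h; exists i; have := ler_distD 0 (z ord0 i) (y ord0 i).
  have := lerB_dist (z ord0 i) (y ord0 i); lra.
have -> : [set z : 'rV[R]_k | forall i, `|z ord0 i| <= r] = ~` [set z | exists i, r < `|z ord0 i|].
  apply/seteqP; split => z /= h.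
    by move=> [i hi]; have := h i; rewrite leNgt hi.
  by move=> i; rewrite leNgt; apply/negP => hi; apply: h; exists i.
have : @measurable _ (g_sigma_algebraType [set U : set 'rV[R]_k | open U]) (~` [set z | exists i, r < `|z ord0 i|]).
  by apply: measurableC; exact: sub_sigma_algebra.
exact.
Qed.

Lemma cube_row r (v : tup) : cube r v <-> [set z : 'rV[R]_k | forall i, `|z ord0 i| <= r] (row_of_tuple v).
Proof.
split=> [/forallP h i|h]; first by rewrite mxE; exact: h.
by apply/forallP => i; have := h i; rewrite mxE.
Qed.

Lemma continuous0_row (p : 'rV[R]_k -> R) (delta : R) : continuous p -> 0 < delta ->
  exists2 e0 : R, 0 < e0 & forall v : tup, forall e, e < e0 -> cube e v -> `|p 0 - p (row_of_tuple v)| < delta.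
Proof.
move=> cp d0; have /nbhs_rowP[e0 e00 h] : nbhs (0 : 'rV[R]_k) [set y | `|p 0 - p y| < delta].
  by have /cvgrPdist_lt/(_ _ d0) := cp 0.
exists e0 => // v e ee /forallP cv; apply: h => i; rewrite !mxE sub0r normrN.
exact: le_lt_trans (cv i) ee.
Qed.

Lemma local_average (p : 'rV[R]_k -> R) (I : R -> R) (e : nat -> R) : continuous p -> (forall z, 0 <= p z) ->
  (forall r, 0 < r -> (\int[lebesgue_tuple R k]_v ((cube r v)%:R * p (row_of_tuple v))%:E = (I r)%:E)%E) ->
  (forall n, 0 < e n) -> e n @[n --> \oo] --> (0 : R) ->
  I (e n) / (2 * e n) ^+ k @[n --> \oo] --> p 0.
Proof.
move=> cp p0 hI e0 ce; apply/cvgrPdist_le => delta d0.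
have [r r0 hr] := continuous0_row cp d0.
have : \forall n \near \oo, e n < r by move: ce => /cvgr_lt; exact.
apply: filterS => n en.
have q0 : 0 < (2 * e n) ^+ k by rewrite exprn_gt0// mulr_gt0.
have mc : measurable_fun setT (fun v : tup => (cube (e n) v)%:R : R) by exact: measurable_cube.
have mp : measurable_fun setT (fun v : tup => p (row_of_tuple v)) by exact: measurable_continuous_row.
have Ic (c : R) : 0 <= c -> (\int[lebesgue_tuple R k]_v ((cube (e n) v)%:R * c)%:E = ((2 * e n) ^+ k * c)%:E)%E.
  move=> c0; under eq_integral do rewrite EFinM.
  by rewrite ge0_integralZr//; [rewrite integral_cube ?ltW// -EFinM|exact/measurable_EFinP].
have near v : cube (e n) v -> p 0 - delta <= p (row_of_tuple v) <= p 0 + delta.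
  by move=> cv; have := ltW (hr v _ en cv); rewrite ler_distlC; exact.
have pd : 0 <= p 0 + delta by rewrite addr_ge0// ltW.
have up : I (e n) <= (2 * e n) ^+ k * (p 0 + delta).
  rewrite -lee_fin -hI// -(Ic _ pd); apply: ge0_le_integral => //.
  - by move=> v _; rewrite lee_fin mulr_ge0.
  - by apply/measurable_EFinP; exact: measurable_funM.
  - by apply/measurable_EFinP; exact: measurable_funM.
  move=> v _; rewrite lee_fin; have [cv|_] := boolP (cube _ v); last by rewrite !mul0r.
  by rewrite !mul1r; have /andP[] := near v cv.
have lo : (2 * e n) ^+ k * (p 0 - delta) <= I (e n).
  have [neg|pos] := ltP (p 0 - delta) 0.
    apply: le_trans (_ : 0 <= _); first by rewrite nmulr_lle0// ltW.
    by rewrite -lee_fin -hI//; apply: integral_ge0 => v _; rewrite lee_fin mulr_ge0.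
  rewrite -lee_fin -hI// -Ic//; apply: ge0_le_integral => //.
  - by move=> v _; rewrite lee_fin mulr_ge0.
  - by apply/measurable_EFinP; exact: measurable_funM.
  - by apply/measurable_EFinP; exact: measurable_funM.
  move=> v _; rewrite lee_fin; have [cv|_] := boolP (cube _ v); last by rewrite !mul0r.
  by rewrite !mul1r; have /andP[] := near v cv.
rewrite ler_distlC; apply/andP; split.
  by rewrite ler_pdivlMr// mulrC.
by rewrite ler_pdivrMr// mulrC.
Qed.

End local_average.

Section kac_rice_point.
Context {d} {Omega : measurableType d} {R : realType} (P : probability Omega R) {N : nat}.
Context (a b : 'rV[R]_N) (hab : forall i, a ord0 i < b ord0 i).
Context (H : set (Omega -> R)) (F : 'rV[R]_N -> Omega -> R) (gm : gaussian_model P a b H F).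
Context (X : 'rV[R]_N -> {RV P >-> R}) (A : set Omega) (mA : measurable A) (A0 : P A = 0%E).
Hypothesis XF : forall w, ~ A w -> sample_path X w = F ^~ w.
Local Notation T := (box a b).
Local Notation D1 := (D1 F).
Local Notation D2 := (D2 F).
Local Notation tup k := (k.-tuple (measurableTypeR R)).
Local Notation leb := (lebesgue_tuple R).

Let gH := gm_space gm.

(** The density and the regression are defined with the original field, which is only known off [A];
    this transfers their defining integrals to the smooth version, domains of integration
    included. *)
Lemma eq_integral_mod (D D' : set Omega) (f g : Omega -> R) :
  (forall w, ~ A w -> (D w <-> D' w)) -> (forall w, ~ A w -> f w = g w) ->
  (\int[P]_(w in D) (f w)%:E = \int[P]_(w in D') (g w)%:E)%E.
Proof.
move=> DD fg; rewrite [LHS]integral_mkcond [RHS]integral_mkcond.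
apply: (@eq_integral_off _ _ _ P A setT _ _ mA A0) => w nA; rewrite !patchE fg//.
case: ifPn => [/set_mem/(DD w nA)|/negP nD]; first by move=> h; rewrite mem_set.
by rewrite memNset// => /(DD w nA) h; apply: nD; rewrite mem_set.
Qed.

Context (K : face N) (t : 'rV[R]_N) (Tt : T t) (u : R).
Let k := #|tau K|.
Let Z w := grad_face X K t w.
Let W w := \det (hess_face X K t w) * \1_(exceeds X t u) w.
Let Z' w : tup k := face_grad F K t w.
Let W' w := \det (\matrix_(i < k, j < k) D2 (enum_val i) (enum_val j) t w) * (u <= F t w)%R%:R.

Let ZZ w : ~ A w -> Z w = row_of_tuple (Z' w).
Proof. by move=> nA; apply/rowP => i; rewrite !mxE tnth_mktuple /grad XF. Qed.

Let WW w : ~ A w -> W w = W' w.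
Proof.
move=> nA; have XFt : X t w = F t w by have := XF nA; move=> /(congr1 (fun f => f t)).
have h1 : hess_face X K t w = \matrix_(i < k, j < k) D2 (enum_val i) (enum_val j) t w.
  by apply: eq_mx => i j; rewrite /hess (XF nA).
have h2 : \1_(exceeds X t u) w = (u <= F t w)%R%:R :> R.
  rewrite indicE; congr (_%:R); congr nat_of_bool; rewrite /exceeds.
  by apply/idP/idP => [/set_mem|h]; [|apply/mem_set]; rewrite /= XFt.
by rewrite /W /W' h1 h2.
Qed.

Let HZ (i : 'I_k) : H (D1 (enum_val i) t). Proof. exact: (gm_D1 hab gm). Qed.

Let posdefZ : exists2 lambda : R, 0 < lambda & posdef P lambda (fun i : 'I_k => D1 (enum_val i) t) /\
  posdef P lambda (fun i : 'I_k.+1 => if unlift ord0 i is Some j then D1 (enum_val j) t else F t).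
Proof.
have [lambda l0 hl] := face_posdef hab gm; exists lambda => //; split; last exact: hl.
have := posdef_lift (hl K t Tt); congr (posdef P lambda _); apply/funext => i.
by rewrite liftK.
Qed.

Let density_exists : exists p0 : 'rV[R]_k -> R, [/\ continuous p0, forall z, 0 <= p0 z &
  forall G : tup k -> R, measurable_fun setT G -> (forall v, 0 <= G v) ->
    (\int[P]_w (G (Z' w))%:E = \int[leb k]_v (G v * p0 (row_of_tuple v))%:E)%E].
Proof.
have [lambda l0 [pZ _]] := posdefZ.
have [p0 [cp pb hp]] := gaussian_density gH l0 HZ (gs0 gH) pZ.
exists p0; split => // [z|G mG G0]; first by have /andP[] := pb z.
transitivity (\int[P]_w ((expR 0)%:E * (EFin \o G) [tuple D1 (enum_val i) t w | i < k]))%E.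
  by apply: eq_integral => w _; rewrite expR0 mul1e.
rewrite hp//; exact/measurable_EFinP.
Qed.

Let is_density_mod (p : 'rV[R]_k -> R) : continuous p -> (forall z, 0 <= p z) ->
  (is_continuous_density P Z p <-> forall B, borel B ->
    (\int[P]_w (\1_B (row_of_tuple (Z' w)))%:E = \int[leb k]_v (\1_B (row_of_tuple v) * p (row_of_tuple v))%:E)%E).
Proof.
move=> cp p0.
have e1 B : ('E_P[\1_(Z @^-1` B)] = \int[P]_w (\1_B (row_of_tuple (Z' w)))%:E)%E.
  rewrite unlock; apply: (@eq_integral_off _ _ _ P A setT _ _ mA A0) => w nA; congr EFin.
  by rewrite !indicE -ZZ//; congr (_%:R); congr nat_of_bool.
have e2 B : (\int[leb k]_(v in row_of_tuple @^-1` B) (p (row_of_tuple v))%:E =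
    \int[leb k]_v (\1_B (row_of_tuple v) * p (row_of_tuple v))%:E)%E.
  rewrite integral_mkcond; apply: eq_integral => v _; rewrite patchE indicE.
  have -> : (v \in row_of_tuple @^-1` B) = (row_of_tuple v \in B).
    by apply/idP/idP => /set_mem h; apply/mem_set.
  by case: ifP => _; rewrite ?mul1r ?mul0r.
split=> [[_ _ h] B bB|h]; first by rewrite -e1 -e2; exact: h.
by split => // B bB; rewrite e1 e2; exact: h.
Qed.

Let is_regression_mod (phi : 'rV[R]_k -> R) B :
  (\int[P]_(w in Z @^-1` B) (W w)%:E = \int[P]_(w in Z @^-1` B) (phi (Z w))%:E)%E <->
  (\int[P]_(w in (fun w => row_of_tuple (Z' w)) @^-1` B) (W' w)%:E =
   \int[P]_(w in (fun w => row_of_tuple (Z' w)) @^-1` B) (phi (row_of_tuple (Z' w)))%:E)%E.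
Proof.
have ZZB w : ~ A w -> ((Z @^-1` B) w <-> ((fun w => row_of_tuple (Z' w)) @^-1` B) w).
  move=> nA; have e := ZZ nA; split=> h; first exact: (eq_ind _ B h _ e).
  exact: (eq_ind _ B h _ (esym e)).
have E1 := eq_integral_mod ZZB WW.
have E2 := eq_integral_mod (f := fun w => phi (Z w)) ZZB (fun w nA => congr1 phi (ZZ nA)).
by rewrite E1 E2.
Qed.

Let pairs := ('I_k * 'I_k)%type.
(** The value followed by all the Hessian entries, a layout in which [gaussian_regression] applies:
    its threshold acts on the entry 0, and [D] below is the determinant read from the other
    entries. *)
Let V (l : 'I_#|{: pairs}|.+1) : Omega -> R :=
  if unlift ord0 l is Some l' then D2 (enum_val (enum_val l').1) (enum_val (enum_val l').2) t else F t.
Let D (v : tup #|{: pairs}|.+1) : R := \det (\matrix_(i < k, j < k) tnth v (lift ord0 (enum_rank (i, j)))).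

Let VD w : D [tuple V i w | i < _] * (u <= tnth [tuple V i w | i < _] ord0)%R%:R = W' w.
Proof.
rewrite /W' /D tnth_mktuple /V unlift_none; congr (\det _ * _); apply/matrixP => i j.
by rewrite !mxE tnth_mktuple liftK enum_rankK.
Qed.

Let regression_exists : exists phi : 'rV[R]_k -> R, [/\ continuous phi,
  P.-integrable setT (EFin \o W') & is_continuous_regression P W Z phi].
Proof.
have [lambda l0 [_ pZ]] := posdefZ.
have HV l : H (V l) by rewrite /V; case: unlift => [l'|]; [exact: (gm_D2 hab gm)|exact: (gm_field gm)].
have pd : posdef P lambda (fun i : 'I_k.+1 => if unlift ord0 i is Some j then D1 (enum_val j : 'I_N) t else V ord0).
  by rewrite /V unlift_none.
have mD : measurable_fun setT D.
  by apply: measurable_det => i j; under eq_fun do rewrite mxE; exact: measurable_tnth.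
have DC v : `|D v| <= #|'S_k|%:R * expR (\sum_i `|tnth v i|).
  apply: le_trans (det_le_expR _) _; rewrite ler_wpM2l// ler_expR big_ord_recl.
  apply: le_trans (_ : \sum_l `|tnth v (lift ord0 l)| <= _); last by rewrite lerDr.
  rewrite pair_big/= (reindex (enum_val (A := {: pairs})))/=; last first.
    by apply: onW_bij; exact: enum_val_bij.
  by apply: ler_sum => l _; rewrite mxE -surjective_pairing enum_valK.
have cD (v_ : nat -> tup #|{: pairs}|.+1) v :
  (forall i, tnth (v_ m) i @[m --> \oo] --> tnth v i) -> D (v_ m) @[m --> \oo] --> D v.
  by move=> cv; apply: cvg_det => i j; rewrite mxE; under eq_fun do rewrite mxE; exact: cv.
have [phi [cphi iphi hphi]] := gaussian_regression gH u l0 HV HZ pd mD DC cD.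
have PsiE : (fun w => (D [tuple V i w | i < _] * (u <= tnth [tuple V i w | i < _] ord0)%R%:R)%:E) = EFin \o W'.
  by apply/funext => w; rewrite VD.
exists phi; split; [exact: cphi|by rewrite -PsiE; exact: iphi|split; first exact: cphi].
move=> B bB; apply: (is_regression_mod phi B).2.
have ZrE : (fun w => \row_i D1 (enum_val i : 'I_N) t w) = fun w => row_of_tuple (Z' w).
  by apply/funext => w; apply/rowP => i; rewrite !mxE tnth_mktuple.
have := hphi B bB.
have -> : (fun w => \row_(i < k) D1 (enum_val i) t w) = fun w => row_of_tuple (Z' w) by [].
under eq_integral do rewrite VD.
move=> ->; apply: eq_integral => w _.
by congr (phi _)%:E; apply/rowP => i; rewrite !mxE tnth_mktuple.
Qed.

Let cubeE r w : \1_[set z : 'rV[R]_k | forall i, `|z ord0 i| <= r] (row_of_tuple (Z' w)) = (cube r (Z' w))%:R :> R.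
Proof.
rewrite indicE; congr (_%:R); congr nat_of_bool.
by apply/idP/idP => [/set_mem|] h; [apply/cube_row|apply/mem_set/cube_row].
Qed.

Let cubeE' r (v : tup k) : \1_[set z : 'rV[R]_k | forall i, `|z ord0 i| <= r] (row_of_tuple v) = (cube r v)%:R :> R.
Proof.
rewrite indicE; congr (_%:R); congr nat_of_bool.
by apply/idP/idP => [/set_mem|] h; [apply/cube_row|apply/mem_set/cube_row].
Qed.

Let Pr (r : R) : R := \int[P]_w ((cube r (Z' w))%:R : R).

Let mcube r : measurable_fun setT (fun w => (cube r (Z' w))%:R : R).
Proof. exact: (measurable_cube_grad gm). Qed.

Let PrE r : (\int[P]_w ((cube r (Z' w))%:R)%:E = (Pr r)%:E)%E.
Proof.
rewrite /Pr /Rintegral fineK//; apply: integrable_fin_num => //.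
apply: (@bounded_integrable _ _ _ P (fun w => (cube r (Z' w))%:R) 1) => // w.
by case: cube; rewrite ?normr1 ?normr0.
Qed.

Let prob_cube (p : 'rV[R]_k -> R) (e : nat -> R) : is_continuous_density P Z p ->
  (forall n, 0 < e n) -> e n @[n --> \oo] --> (0 : R) -> Pr (e n) / (2 * e n) ^+ k @[n --> \oo] --> p 0.
Proof.
move=> ip; have [cp p0 _] := ip; apply: local_average => // r r0.
rewrite -PrE; have := (is_density_mod cp p0).1 ip _ (borel_cube r).
under eq_integral do rewrite cubeE; move=> ->.
by apply: eq_integral => v _; rewrite cubeE'.
Qed.

Lemma density_is : is_continuous_density P Z (density P Z).
Proof.
have [p0 [cp p00 hp]] := density_exists; apply: (@xgetPex _ (cst 0) [set p | is_continuous_density P Z p]).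
exists p0; apply/is_density_mod => // B bB.
rewrite (hp (fun v => \1_B (row_of_tuple v)))// ?(fun v => _ : 0 <= _)//.
have mB := measurable_row_of_tuple_borel bB.
have -> : (fun v : tup k => \1_B (row_of_tuple v) : R) = \1_((row_of_tuple : tup k -> 'rV[R]_k) @^-1` B).
  by apply/funext => v; rewrite !indicE; congr (_%:R).
exact: measurable_indic.
Qed.

Lemma regression_is : is_continuous_regression P W Z (cond_expectation P W Z).
Proof.
have [phi [_ _ h]] := regression_exists.
by apply: (@xgetPex _ (cst 0) [set phi | is_continuous_regression P W Z phi]); exists phi.
Qed.

Let detE w : \det (neg_hess F K t w) = (-1) ^+ k * \det (\matrix_(i < k, j < k) D2 (enum_val i) (enum_val j) t w).
Proof. by rewrite -detZ; congr (\det _); apply/matrixP => i j; rewrite !mxE mulN1r. Qed.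

Let mW' : measurable_fun setT W'.
Proof.
by have [phi [_ iW _]] := regression_exists; apply/measurable_EFinP; have /integrableP[] := iW.
Qed.

Let iW' r : P.-integrable setT (EFin \o (fun w => W' w * (cube r (Z' w))%:R)).
Proof.
have [_ [_ iW _]] := regression_exists; apply: le_integrable iW => //.
  by apply/measurable_EFinP; exact: measurable_funM mW' (mcube r).
move=> w _; rewrite /= lee_fin normrM ler_piMr//.
by case: cube; rewrite ?normr1 ?normr0.
Qed.

Let crit_intE (e : R) : \int[P]_w crit F K (fun x => u <= x) e t w =
  (-1) ^+ k * (\int[P]_w (W' w * (cube e (Z' w))%:R) / (2 * e) ^+ k).
Proof.
rewrite -RintegralZr//.
rewrite -RintegralZl//.
  by apply: eq_Rintegral => w _; rewrite /crit detE /W'; ring.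
have := integrableZr measurableT (((2 * e) ^+ k)^-1) (iW' e).
by congr (integrable _ _ _); apply/funext => w.
Qed.

(** Both factors are identified through cubes shrinking to 0. The mass of the cube divided by its
    volume tends to the density at 0. On the cube the defining property of the regression replaces
    the conditioned variable by [phi] of the gradient, which is nearly [phi 0]. *)
Lemma kac_rice_point (e : nat -> R) : (forall n, 0 < e n) -> e n @[n --> \oo] --> (0 : R) ->
  \int[P]_w crit F K (fun x => u <= x) (e n) t w @[n --> \oo] -->
  (-1) ^+ k * (cond_expectation P W Z 0 * density P Z 0).
Proof.
move=> e0 ce; set phi := cond_expectation P W Z; set p := density P Z.
have [cphi hphi] := regression_is; have cPr := prob_cube density_is e0 ce.
have -> : (fun n => \int[P]_w crit F K (fun x => u <= x) (e n) t w) =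
    fun n => (-1) ^+ k * (\int[P]_w (W' w * (cube (e n) (Z' w))%:R) / (2 * e n) ^+ k).
  by apply/funext => n; exact: crit_intE.
apply: cvgM; first exact: cvg_cst.
pose J r := \int[P]_w (W' w * (cube r (Z' w))%:R).
have Jphi r : J r = \int[P]_w (phi (row_of_tuple (Z' w)) * (cube r (Z' w))%:R).
  rewrite /J /Rintegral; congr fine.
  have := (is_regression_mod phi _).1 (hphi _ (borel_cube r)).
  have mk (f : Omega -> R) : (\int[P]_(w in (fun w => row_of_tuple (Z' w)) @^-1` [set z : 'rV[R]_k | forall i, (`|z ord0 i| <= r)%R]) (f w)%:E =
      \int[P]_w (f w * (cube r (Z' w))%:R)%:E)%E.
    rewrite integral_mkcond; apply: eq_integral => w _; rewrite patchE -cubeE indicE.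
    set c := (w \in _); have -> : c = (row_of_tuple (Z' w) \in [set z : 'rV[R]_k | forall i, (`|z ord0 i| <= r)%R]).
      by apply/idP/idP => /set_mem h; exact: mem_set.
    by case: (_ \in _); rewrite ?mulr1 ?mulr0.
  by rewrite !mk.
have dif : J (e n) / (2 * e n) ^+ k - phi 0 * (Pr (e n) / (2 * e n) ^+ k) @[n --> \oo] --> (0 : R).
  have p1 : 0 < p 0 + 1 by have [_ pp _] := density_is; apply: ltr_wpDl => //; exact: pp.
  apply/cvgrPdist_le => delta d0.
  pose d' := delta / (p 0 + 1); have d'0 : 0 < d' by rewrite divr_gt0.
  have [r r0 hr] := continuous0_row cphi d'0.
  have H1 : \forall n \near \oo, e n < r by move: ce => /cvgr_lt; exact.
  have H2 : \forall n \near \oo, Pr (e n) / (2 * e n) ^+ k < p 0 + 1.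
    by move: cPr => /cvgr_lt; apply; rewrite ltrDl.
  apply: filterS2 H1 H2 => n er pr; rewrite sub0r normrN.
  have q0 : 0 < (2 * e n) ^+ k by rewrite exprn_gt0// mulr_gt0.
  have bi (f : Omega -> R) (M : R) : measurable_fun setT f -> (forall w, `|f w| <= M) -> P.-integrable setT (EFin \o f).
    exact: bounded_integrable.
  pose g w := phi (row_of_tuple (Z' w)) * (cube (e n) (Z' w))%:R.
  have mg : measurable_fun setT g.
    apply: measurable_funM => //; apply: (measurableT_comp (measurable_continuous_row cphi)).
    by apply: measurable_mktuple => i; exact: (measurable_D1T gm).
  have gb w : `|g w - phi 0 * (cube (e n) (Z' w))%:R| <= d' * (cube (e n) (Z' w))%:R.
    rewrite /g -mulrBl; have [cz|_] := boolP (cube _ _); last by rewrite !mulr0 normr0.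
    by rewrite !mulr1 distrC ltW// (hr _ _ er cz).
  have ig : P.-integrable setT (EFin \o g).
    apply: (bi _ (`|phi 0| + d')) => // w; have := gb w.
    case: cube; rewrite ?mulr1 ?mulr0 => h.
      by have := ler_normD (g w - phi 0) (phi 0); rewrite subrK; lra.
    by move: h; rewrite subr0 normr_le0 => /eqP ->; rewrite normr0 addr_ge0// ltW.
  have ic c : P.-integrable setT (EFin \o (fun w => c * (cube (e n) (Z' w))%:R)).
    apply: (bi _ `|c|); first exact: measurable_funM.
    by move=> w; case: cube; rewrite ?mulr1// mulr0 normr0.
  have -> : J (e n) / (2 * e n) ^+ k - phi 0 * (Pr (e n) / (2 * e n) ^+ k) =
      (\int[P]_w (g w - phi 0 * (cube (e n) (Z' w))%:R)) / (2 * e n) ^+ k.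
    rewrite RintegralB// Jphi RintegralZl//; first by rewrite /Pr; ring.
    by have := ic 1; congr (integrable _ _ _); apply/funext => w; rewrite /= mul1r.
  rewrite normrM normfV (gtr0_norm q0) ler_pdivrMr//.
  apply: le_trans (_ : d' * Pr (e n) <= _).
    apply: le_trans (le_normr_Rintegral _ _) _ => //.
      by have := integrableB measurableT ig (ic (phi 0)); congr (integrable _ _ _).
    rewrite /Pr -RintegralZl//; last first.
      by have := ic 1; congr (integrable _ _ _); apply/funext => w; rewrite /= mul1r.
    apply: le_Rintegral => //.
    have := integrableB measurableT ig (ic (phi 0)) => /integrable_abse; congr (integrable _ _ _).
  move: pr; rewrite ltr_pdivrMr// => pr.
  apply: le_trans (_ : d' * ((p 0 + 1) * (2 * e n) ^+ k) <= _); first by rewrite ler_pM2l// ltW.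
  by rewrite /d' mulrA divfK// gt_eqF.
have : (J (e n) / (2 * e n) ^+ k - phi 0 * (Pr (e n) / (2 * e n) ^+ k)) + phi 0 * (Pr (e n) / (2 * e n) ^+ k)
    @[n --> \oo] --> 0 + phi 0 * p 0.
  by apply: cvgD => //; apply: cvgM => //; exact: cvg_cst.
by rewrite add0r; under eq_fun do rewrite subrK.
Qed.

End kac_rice_point.

(** * The mean count on a face in both orders of integration *)

Section kac_rice.
Context {d} {Omega : measurableType d} {R : realType} (P : probability Omega R) {N : nat}.
Context (a b : 'rV[R]_N) (hab : forall i, a ord0 i < b ord0 i).
Context (H : set (Omega -> R)) (F : 'rV[R]_N -> Omega -> R) (gm : gaussian_model P a b H F).
Local Notation T := (box a b).
Local Notation tup k := (k.-tuple (measurableTypeR R)).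
Local Notation leb := (lebesgue_tuple R).

Let gH := gm_space gm.

Lemma in_face_finite K : exists2 V : R, 0 <= V &
  (\int[leb #|tau K|]_v ((in_face a b v)%:R)%:E <= V%:E)%E.
Proof.
pose M := \sum_j (`|a ord0 j| + `|b ord0 j|).
have M0 : 0 <= M by apply: sumr_ge0 => j _; rewrite addr_ge0.
exists ((2 * M) ^+ #|tau K|); first by rewrite exprn_ge0// mulr_ge0.
rewrite -integral_cube//; apply: ge0_le_integral => //.
- by apply/measurable_EFinP; exact: measurable_in_face.
- by apply/measurable_EFinP; exact: measurable_cube.
move=> v _; rewrite lee_fin; have [/forallP iv|_] := boolP (in_face a b v); last by [].
have -> // : cube M v; apply/forallP => i; have /andP[h1 h2] := iv i.
apply: le_trans (_ : `|a ord0 (enum_val i)| + `|b ord0 (enum_val i)| <= _).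
  rewrite ler_norml; have := ler_norm (b ord0 (enum_val i)); have := ler_norm (- a ord0 (enum_val i)).
  have := normr_ge0 (a ord0 (enum_val i)); have := normr_ge0 (b ord0 (enum_val i)); rewrite normrN.
  by move: h1 h2; move: (tnth v i) (a ord0 _) (b ord0 _) => x y z ? ? ? ? ? ?; apply/andP; split; lra.
rewrite /M (bigD1 (enum_val i) (P := xpredT))// lerDl; apply: sumr_ge0 => j _; exact: addr_ge0.
Qed.

Section level.
Context (chi : R -> bool) (mchi : measurable_fun setT (fun x : R => (chi x)%:R : R)).

Definition weighted K eps (D : set Omega) (z : tup #|tau K| * Omega) : R :=
  crit_point a b F chi eps z.1 z.2 * \1_D z.2.

Lemma norm_weighted K eps D (z : tup #|tau K| * Omega) : 0 < eps ->
  `|weighted eps D z| = (in_face a b z.1)%:R * (crit_weight F K eps (face_point a b K z.1) z.2 *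
    (chi (F (face_point a b K z.1) z.2))%:R * \1_D z.2).
Proof.
move=> e0; rewrite /weighted /crit_point /crit /crit_weight !indicE !normrM normfV !normr_nat.
by rewrite (gtr0_norm (_ : 0 < (2 * eps) ^+ _)) ?exprn_gt0 ?mulr_gt0//; ring.
Qed.

Lemma measurable_weighted K eps D : measurable D ->
  measurable_fun setT (fun z : tup #|tau K| * Omega => weighted eps D z).
Proof.
move=> mD; apply: measurable_funM; first exact: (joint_crit gm).
exact: (measurableT_comp (measurable_indic mD) measurable_snd).
Qed.

Lemma weighted_bound K (V : R) eps D c : (\int[leb #|tau K|]_v ((in_face a b v)%:R)%:E <= V%:E)%E ->
  0 < eps -> measurable D -> 0 <= c ->
  (forall t, T t -> (\int[P]_w (crit_weight F K eps t w * (chi (F t w))%:R * \1_D w)%:E <= c%:E)%E) ->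
  (\int[leb #|tau K|]_v \int[P]_w `|(weighted eps D (v, w))%:E| <= (V * c)%:E)%E.
Proof.
move=> hV e0 mD c0 h.
have mw := @measurable_weighted K eps D mD.
apply: (@le_trans _ _ (\int[leb #|tau K|]_v (((in_face a b v)%:R)%:E * c%:E))%E).
  apply: ge0_le_integral => //.
  - by move=> v _; apply: integral_ge0.
  - apply: (measurable_fun_fubini_tonelli_F (m2 := P) (fun z : tup #|tau K| * Omega => `|(weighted eps D z)%:E|%E)) => //.
    by apply: measurableT_comp => //; exact/measurable_EFinP.
  - by apply: emeasurable_funM => //; apply/measurable_EFinP; exact: measurable_in_face.
  move=> v _.
  have [iv|niv] := boolP (in_face a b v); last first.
    by rewrite mul0e integral0_eq// => w _; rewrite /= norm_weighted// (negbTE niv) mul0r.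
  rewrite mul1e; apply: le_trans (h _ (face_set_box hab ((in_faceP a b v).1 iv))).
  rewrite le_eqVlt; apply/orP; left; apply/eqP; apply: eq_integral => w _.
  by rewrite /= norm_weighted// iv mul1r.
rewrite ge0_integralZr//; last by apply/measurable_EFinP; exact: measurable_in_face.
by rewrite EFinM; apply: lee_wpmul2r.
Qed.

Lemma crit_weight_bounded K : exists2 C : R, 0 <= C & forall eps t D, 0 < eps -> T t -> measurable D ->
  (\int[P]_w (crit_weight F K eps t w * (chi (F t w))%:R * \1_D w)%:E <= C%:E)%E.
Proof.
have [C [c [C0 c0 h]]] := crit_weight_subgaussian hab gm K.
exists (C * expR ((nrm2 P (fun=> 0) + c) ^+ 2 / 2)); first by rewrite mulr_ge0// expR_ge0.
move=> eps t D e0 Tt mD; have [[mq q0] hq] := h eps t e0 Tt.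
apply: le_trans (hq _ (gs0 gH)); apply: ge0_le_integral => //.
- by move=> w _; rewrite lee_fin mulr_ge0// mulr_ge0.
- apply/measurable_EFinP; apply: measurable_funM => //; apply: measurable_funM => //.
  exact: (measurableT_comp mchi (gm_measurable gm t)).
- by apply/measurable_EFinP; exact: measurable_funM.
move=> w _; rewrite lee_fin expR0 mul1r -mulrA ler_piMr// indicE.
by case: chi; case: (_ \in _); rewrite ?mulr1 ?mulr0.
Qed.

Lemma integrable_weighted K eps D : 0 < eps -> measurable D ->
  (leb #|tau K| \x P)%E.-integrable setT (EFin \o (@weighted K eps D)).
Proof.
move=> e0 mD; have [V V0 hV] := in_face_finite K; have [C C0 hC] := crit_weight_bounded K.
apply/integrable12ltyP; first by apply/measurable_EFinP; exact: measurable_weighted.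
by apply: le_lt_trans (weighted_bound hV e0 mD C0 _) (ltry _) => t Tt; exact: hC.
Qed.

(** One integral on the product space: [face_count_paths] computes it path by path,
    [face_count_slices] point by point. The set [D] separates good paths from bad ones. *)
Definition face_count K eps D : R := \int[(leb #|tau K| \x P)%E]_z weighted (K := K) eps D z.

Lemma face_countE K eps D : 0 < eps -> measurable D ->
  ((face_count K eps D)%:E = \int[(leb #|tau K| \x P)%E]_z (weighted (K := K) eps D z)%:E)%E.
Proof.
move=> e0 mD; rewrite /face_count /Rintegral fineK//; apply: integrable_fin_num => //.
exact: integrable_weighted.
Qed.

Lemma face_count_le K (V : R) eps D c : (\int[leb #|tau K|]_v ((in_face a b v)%:R)%:E <= V%:E)%E ->
  0 < eps -> measurable D -> 0 <= c ->
  (forall t, T t -> (\int[P]_w (crit_weight F K eps t w * (chi (F t w))%:R * \1_D w)%:E <= c%:E)%E) ->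
  `|face_count K eps D| <= V * c.
Proof.
move=> hV e0 mD c0 h.
have mw := @measurable_weighted K eps D mD.
rewrite -lee_fin -abse_EFin face_countE//; apply: le_trans (le_abse_integral _ _ _) _ => //.
  exact/measurable_EFinP.
apply: le_trans (weighted_bound hV e0 mD c0 h); rewrite le_eqVlt; apply/orP; left; apply/eqP.
rewrite (fubini_tonelli1 (fun z : tup #|tau K| * Omega => `|(weighted eps D z)%:E|%E))//.
by apply: measurableT_comp => //; exact/measurable_EFinP.
Qed.

Lemma face_count_split K eps D : 0 < eps -> measurable D -> face_count K eps setT = face_count K eps D + face_count K eps (~` D).
Proof.
move=> e0 mD; rewrite /face_count -RintegralD//; first last.
- by apply: integrable_weighted => //; exact: measurableC.
- exact: integrable_weighted.
apply: eq_Rintegral => z _; rewrite /weighted -mulrDr !indicE in_setT in_setC.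
by case: (_ \in _); rewrite ?addr0 ?add0r.
Qed.

Definition slice K eps (v : tup #|tau K|) : R :=
  (in_face a b v)%:R * \int[P]_w crit F K chi eps (face_point a b K v) w.

Lemma sliceE K eps v : 0 < eps ->
  (\int[P]_w (weighted (K := K) eps setT (v, w))%:E = (slice eps v)%:E)%E.
Proof.
move=> e0; have [C C0 hC] := crit_weight_bounded K; rewrite /slice.
have [iv|niv] := boolP (in_face a b v); last first.
  by rewrite mul0r integral0_eq// => w _; rewrite /weighted /crit_point (negbTE niv) !mul0r.
have Tv := face_set_box hab ((in_faceP a b v).1 iv).
rewrite mul1r /Rintegral fineK.
  by apply: eq_integral => w _; rewrite /weighted /crit_point iv mul1r indicT mulr1.
apply: integrable_fin_num => //; apply/integrableP; split.
  have := measurableT_comp (@measurable_weighted K eps setT measurableT) (measurable_pair1 v).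
  move=> h; apply/measurable_EFinP; move: h; congr measurable_fun; apply/funext => w.
  by rewrite /= /weighted /crit_point iv mul1r indicT mulr1.
apply: (@le_lt_trans _ _ C%:E); last exact: ltry.
apply: le_trans (hC eps _ setT e0 Tv measurableT).
rewrite le_eqVlt; apply/orP; left; apply/eqP; apply: eq_integral => w _ /=.
have := norm_weighted setT (v, w) e0; rewrite /weighted /crit_point/= iv !mul1r indicT mulr1 => ->.
by [].
Qed.

Lemma slice_le K : exists2 C : R, 0 <= C & forall eps v, 0 < eps -> `|slice (K := K) eps v| <= (in_face a b v)%:R * C.
Proof.
have [C C0 hC] := crit_weight_bounded K; exists C => // eps v e0.
rewrite -lee_fin -abse_EFin -sliceE//.
have mv : measurable_fun setT (fun w => (weighted (K := K) eps setT (v, w))%:E).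
  apply/measurable_EFinP; exact: measurableT_comp (@measurable_weighted K eps setT measurableT) (measurable_pair1 v).
apply: le_trans (le_abse_integral _ _ mv) _ => //.
have [iv|niv] := boolP (in_face a b v); last first.
  by rewrite mul0r integral0_eq// => w _; rewrite /weighted /crit_point (negbTE niv) !mul0r abse0.
have Tv := face_set_box hab ((in_faceP a b v).1 iv).
rewrite mul1r; apply: le_trans (hC eps _ setT e0 Tv measurableT).
rewrite le_eqVlt; apply/orP; left; apply/eqP; apply: eq_integral => w _.
by rewrite abse_EFin norm_weighted//= iv mul1r.
Qed.

Lemma measurable_slice K eps : 0 < eps -> measurable_fun setT (slice (K := K) eps).
Proof.
move=> e0; apply/measurable_EFinP.
have := measurable_fubini_F (@integrable_weighted K eps setT e0 measurableT).
by congr measurable_fun; apply/funext => v; exact: sliceE.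
Qed.

Lemma face_count_slices K eps : 0 < eps ->
  ((face_count K eps setT)%:E = \int[leb #|tau K|]_v (slice eps v)%:E)%E.
Proof.
move=> e0; rewrite face_countE// -(integral12_prod_meas1 (@integrable_weighted K eps setT e0 measurableT)).
by apply: eq_integral => v _; rewrite -sliceE.
Qed.

Lemma face_count_paths K eps D : 0 < eps -> measurable D ->
  ((face_count K eps D)%:E = \int[P]_w (\int[leb #|tau K|]_v (crit_point a b F chi eps v w * \1_D w)%:E))%E.
Proof.
move=> e0 mD; rewrite face_countE// -(integral21_prod_meas1 (@integrable_weighted K eps D e0 mD)).
by [].
Qed.

Lemma measurable_paths K eps D : 0 < eps -> measurable D ->
  measurable_fun setT (fun w => \int[leb #|tau K|]_v (crit_point a b F chi eps v w * \1_D w)%:E)%E.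
Proof. by move=> e0 mD; have := measurable_fubini_G (@integrable_weighted K eps D e0 mD); exact. Qed.

End level.
End kac_rice.

Lemma integral_leb0 {R : realType} m (f : m.-tuple (measurableTypeR R) -> \bar R) v : m = 0%N ->
  measurable_fun setT f -> (\int[lebesgue_tuple R m]_x f x = f v)%E.
Proof.
move=> m0; subst m => mf; rewrite ge0_integral_lebesgue_tuple0//; congr f.
by apply: eq_from_tnth => -[].
Qed.

Lemma det_mx0 {R : comNzRingType} m (A : 'M[R]_m) : m = 0%N -> \det A = 1.
Proof. by move=> m0; subst m; rewrite det_mx00. Qed.

Lemma indicator_ge {R : realType} (u : R) : measurable_fun setT (fun x : R => (u <= x)%R%:R : R).
Proof.
have -> : (fun x : R => (u <= x)%R%:R : R) = \1_(`[u, +oo[%classic).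
  apply/funext => x; rewrite indicE; congr (_%:R); congr nat_of_bool.
  by apply/idP/idP => [h|/set_mem]; [apply/mem_set|]; rewrite /= in_itv/= andbT.
exact: measurable_indic.
Qed.

Lemma indicator_itv {R : realType} (u v : R) : measurable_fun setT (fun x : R => (u <= x <= v)%R%:R : R).
Proof.
have -> : (fun x : R => (u <= x <= v)%R%:R : R) = \1_(`[u, v]%classic).
  apply/funext => x; rewrite indicE; congr (_%:R); congr nat_of_bool.
  by apply/idP/idP => [h|/set_mem]; [apply/mem_set|]; rewrite /= in_itv.
exact: measurable_indic.
Qed.

(** * From the counts to the law of the maximum *)

Section paths.
Context {d} {Omega : measurableType d} {R : realType} (P : probability Omega R) {N : nat}.
Context (a b : 'rV[R]_N) (hab : forall i, a ord0 i < b ord0 i).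
Context (H : set (Omega -> R)) (F : 'rV[R]_N -> Omega -> R) (gm : gaussian_model P a b H F).
Local Notation T := (box a b).
Local Notation leb := (lebesgue_tuple R).

Context (tm : Omega -> 'rV[R]_N).
Hypothesis tm_max : forall w, T (tm w) /\ forall s, T s -> F s w <= F (tm w) w.
Let M w := F (tm w) w.

(** The maximizer [tm] is an arbitrary choice, but its value is a supremum over countably many grid
    points by continuity of the paths. *)
Lemma measurable_max_gt y : measurable [set w | y < M w].
Proof.
have -> : [set w | y < M w] = \bigcup_n \bigcup_(z : {ffun 'I_N -> 'I_n.+2}) [set w | y < F (grid_point a b z) w].
  apply/seteqP; split => w /=; last first.
    move=> [n _ [z _ h]]; apply: lt_le_trans h _; apply: (tm_max w).2; exact: box_grid_point.
  move=> yM; have /choice[p hp] : forall n : nat, exists p, (exists z : {ffun 'I_N -> 'I_n.+2}, p = grid_point a b z) /\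
      close (width a b / n.+1%:R) p (tm w).
    move=> n; have [//|z hz] := grid_approx hab (M := n.+1) _ (tm_max w).1.
    by exists (grid_point a b z); split => //; exists z.
  have cF : F (p n) w @[n --> \oo] --> M w.
    apply: (gm_cvg0 gm); apply: (cvg_row_close (r := fun n => width a b / n.+1%:R)); last exact: cvg_harmonicZ.
    by move=> n; apply: close_sym; exact: (hp n).2.
  have : \forall n \near \oo, y < F (p n) w by move: cF => /cvgr_gt; exact.
  move=> [n _ /(_ n (leqnn n)) h]; have [[z zE] _] := hp n.
  by exists n => //; exists z => //; rewrite /= -zE.
apply: bigcupT_measurable => n; apply: fin_bigcup_measurable => [|z _]; first exact: finite_finset.
have -> : [set w | y < F (grid_point a b z) w] = F (grid_point a b z) @^-1` `]y, +oo[%classic.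
  by apply/seteqP; split => w /=; rewrite in_itv/= andbT.
by rewrite -[X in measurable X]setTI; exact: (gm_measurable gm).
Qed.

Lemma measurable_max_ge y : measurable [set w | y <= M w].
Proof.
have -> : [set w | y <= M w] = \bigcap_(n : nat) [set w | y - n.+1%:R^-1 < M w].
  apply/seteqP; split => w /= h.
    by move=> n _; apply: lt_le_trans h; rewrite ltrBlDr ltrDl invr_gt0.
  have c1 : y - n.+1%:R^-1 @[n --> \oo] --> y - 0.
    apply: cvgB; first exact: cvg_cst.
    by have := @cvg_harmonicZ R 1; under eq_fun do rewrite div1r.
  by rewrite subr0 in c1; apply: (cvg_le_bound c1) => n; apply: ltW; exact: h.
by apply: bigcap_measurableType => n _; exact: measurable_max_gt.
Qed.

Context (mu eta r L u : R) (mu0 : 0 < mu) (eta01 : 0 < eta < 1) (r0 : 0 < r) (L0 : 0 < L) (u0 : 0 < u).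
Context (B : set Omega) (mB : measurable B).
Hypothesis good : forall w, ~ B w -> forall t, T t -> (1 - eta) * u <= F t w ->
  exists J, good_point a b F mu eta r L u w t J.
Context (e : nat -> R) (e_pos : forall n, 0 < e n < mu * u) (e_cvg : e n @[n --> \oo] --> (0 : R)).

Let e0 n : 0 < e n. Proof. by case/andP: (e_pos n). Qed.

Section level.
Context (chi : R -> bool) (mchi : measurable_fun setT (fun x : R => (chi x)%:R : R)).
Hypothesis chi_ge : forall x, chi x -> (1 - eta) * u <= x.

Let C0 (J : face N) : R := #|'S_#|tau J| |%:R * (L * u) ^+ #|tau J| / 2 ^+ #|tau J| *
  (2 * (N.+1%:R / (mu * u))) ^+ #|tau J|.

Let C0_ge0 J : 0 <= C0 J.
Proof.
have h1 : 0 <= L * u by rewrite mulr_ge0// ltW.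
have h2 : 0 <= 2 * (N.+1%:R / (mu * u)) by rewrite mulr_ge0// divr_ge0// ltW// mulr_gt0.
by rewrite /C0 mulr_ge0 ?exprn_ge0// divr_ge0 ?exprn_ge0// mulr_ge0// exprn_ge0.
Qed.

Let cnt K n w := (\int[leb #|tau K|]_v (crit_point a b F chi (e n) v w)%:E)%E.

Let low w : M w < (1 - eta) * u -> forall K n, cnt K n w = 0%E.
Proof.
move=> lowM K n; apply: integral0_eq => v _; congr EFin; rewrite /crit_point /crit.
have [iv|_] := boolP (in_face a b v); last by rewrite mul0r.
have Tv := face_set_box hab ((in_faceP a b v).1 iv).
have [/chi_ge h|_] := boolP (chi _); last by rewrite mulr0 !mul0r mulr0.
by have := lt_le_trans lowM (le_trans h ((tm_max w).2 _ Tv)); rewrite ltxx.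
Qed.

Let other w J : good_point a b F mu eta r L u w (tm w) J -> forall K n, K != J -> cnt K n w = 0%E.
Proof.
move=> gJ K n KJ; apply: integral0_eq => v _; congr EFin.
by apply: (crit_other hab gJ chi_ge); [exact/eqP|exact: e_pos].
Qed.

Lemma path_count_bound w K n : ~ B w -> (0 <= cnt K n w <= (C0 K)%:E)%E.
Proof.
move=> nB; have [lowM|highM] := ltP (M w) ((1 - eta) * u).
  by rewrite low// lexx lee_fin C0_ge0.
have [J gJ] := good nB (tm_max w).1 highM.
have [->|KJ] := eqVneq K J; last by rewrite (other gJ)// lexx lee_fin C0_ge0.
exact: (crit_bound hab gm mu0 u0 r0 L0 (tm_max w).1 (tm_max w).2 gJ chi_ge e0 mchi).
Qed.

(** If the maximum is below [(1 - eta) * u], every count and [chi] vanish; otherwise only the face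
    [J] of the good event contributes, and there is one critical point on it. *)
Lemma path_count_cvg w : ~ B w -> (\forall x \near M w, chi x = chi (M w)) ->
  \sum_(K : face N) fine (cnt K n w) @[n --> \oo] --> ((chi (M w))%:R : R).
Proof.
move=> nB loc; have [lowM|highM] := ltP (M w) ((1 - eta) * u).
  have -> : chi (M w) = false.
    by apply/negP => /chi_ge h; have := lt_le_trans lowM h; rewrite ltxx.
  under eq_fun => n do under eq_bigr do rewrite low//.
  by under eq_fun do rewrite big1//; exact: cvg_cst.
have [J gJ] := good nB (tm_max w).1 highM.
have -> : (fun n => \sum_(K : face N) fine (cnt K n w)) = fun n => fine (cnt J n w).
  apply/funext => n; rewrite (bigD1 J (P := xpredT))//= big1 ?addr0// => K KJ.
  by rewrite (other gJ).
apply: fine_cvg; rewrite /=.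
exact: (crit_limit hab gm mu0 u0 r0 L0 (tm_max w).1 (tm_max w).2 gJ chi_ge loc e0 e_cvg mchi).
Qed.

Lemma good_count D : measurable D -> (forall w, D w -> ~ B w) ->
  (forall w, D w -> \forall x \near M w, chi x = chi (M w)) ->
  \sum_(K : face N) face_count P a b F chi K (e n) D @[n --> \oo] --> \int[P]_w ((chi (M w))%:R * \1_D w).
Proof.
move=> mD DB loc.
pose g K n w : R := fine (cnt K n w) * \1_D w.
have gE K n w : (\int[leb #|tau K|]_v (crit_point a b F chi (e n) v w * \1_D w)%:E)%E = (g K n w)%:E.
  rewrite /g indicE; have [/set_mem Dw|_] := boolP (w \in D).
    have /andP[h1 h2] := path_count_bound K n (DB w Dw).
    rewrite mulr1 fineK; last by rewrite ge0_fin_numE// (le_lt_trans h2)// ltry.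
    by apply: eq_integral => v _; rewrite mulr1.
  by rewrite mulr0 integral0_eq// => v _; rewrite mulr0.
have mg K n : measurable_fun setT (g K n).
  have := measurable_paths hab gm mchi K (e0 n) mD; move=> h; apply/measurable_EFinP.
  by move: h; congr measurable_fun; apply/funext => w; exact: gE.
have gb K n w : `|g K n w| <= C0 K.
  rewrite /g indicE; have [/set_mem Dw|_] := boolP (w \in D); last by rewrite mulr0 normr0.
  have /andP[h1 h2] := path_count_bound K n (DB w Dw); rewrite mulr1.
  rewrite ger0_norm ?fine_ge0// -lee_fin fineK//.
  by rewrite ge0_fin_numE// (le_lt_trans h2)// ltry.
have cE K n : face_count P a b F chi K (e n) D = \int[P]_w g K n w.
  apply: EFin_inj; rewrite (face_count_paths hab gm mchi K (e0 n) mD) /Rintegral fineK.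
    by apply: eq_integral => w _; exact: gE.
  by apply: integrable_fin_num => //; exact: (bounded_integrable P (mg K n) (gb K n)).
have sE n : \sum_(K : face N) face_count P a b F chi K (e n) D = \int[P]_w \sum_(K : face N) g K n w.
  under eq_bigr do rewrite cE.
  have ig K : P.-integrable setT (EFin \o g K n) by exact: (bounded_integrable P (mg K n) (gb K n)).
  elim: (index_enum _) => [|K s IH].
    by rewrite big_nil; under eq_Rintegral do rewrite big_nil; rewrite /Rintegral integral0.
  rewrite big_cons IH; under [RHS]eq_Rintegral do rewrite big_cons.
  rewrite RintegralD//.
  have -> : (EFin \o (fun w => \sum_(K <- s) g K n w)) = (fun w => \sum_(K <- s) (EFin \o g K n) w)%E.
    by apply/funext => w; rewrite /= sumEFin.
  by apply: integrable_sum => // K' _.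
have lim w : \sum_(K : face N) g K n w @[n --> \oo] --> ((chi (M w))%:R * \1_D w : R).
  under eq_fun do rewrite -mulr_suml; rewrite indicE.
  have [/set_mem Dw|_] := boolP (w \in D).
    by apply: cvgM; [apply: path_count_cvg; [exact: DB|exact: loc]|exact: cvg_cst].
  by rewrite mulr0; under eq_fun do rewrite mulr0; exact: cvg_cst.
have ms n : measurable_fun setT (fun w => \sum_(K : face N) g K n w) by apply: measurable_sum.
under eq_fun do rewrite sE.
apply: (@bounded_cvg_Rintegral _ _ _ P _ _ (\sum_(K : face N) C0 K)) => //.
- exact: (measurable_fun_cvg ms (fun w _ => lim w)).
- move=> n w; apply: le_trans (ler_norm_sum _ _ _) _.
  by apply: ler_sum => K _.
Qed.

End level.
Let G := [set w | M w = u] `&` ~` B.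

Let mMu : measurable [set w | M w = u].
Proof.
have -> : [set w | M w = u] = [set w | u <= M w] `\` [set w | u < M w].
  apply/seteqP; split => w /=; first by move=> ->; rewrite lexx ltxx.
  by move=> [h /negP]; rewrite -leNgt => h'; apply/eqP; rewrite eq_le h h'.
by apply: measurableD; [exact: measurable_max_ge|exact: measurable_max_gt].
Qed.

Let mG : measurable G.
Proof. by apply: measurableI => //; exact: measurableC. Qed.

Let prob_indic D : measurable D -> \int[P]_w (\1_D w : R) = fine (P D).
Proof. by move=> mD; rewrite /Rintegral integral_indic// setIT. Qed.

Let integrable_bool (f : Omega -> R) : measurable_fun setT f -> (forall w, `|f w| <= 1) ->
  P.-integrable setT (EFin \o f).
Proof. by move=> mf f1; exact: (bounded_integrable P mf f1). Qed.

(* A maximum equal to [u] produces a critical point at level in [[u - h, u + h]], whose expected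
   number is of order [h]. *)
Lemma max_null : P G = 0%E.
Proof.
have /choice[V hV] : forall K : face N, exists V : R, 0 <= V /\ (\int[leb #|tau K|]_v ((in_face a b v)%:R)%:E <= V%:E)%E.
  by move=> K; have [V V0 h] := @in_face_finite R N a b K; exists V.
have /choice[C hC] : forall K : face N, exists C : R, 0 <= C /\ forall eps t h, 0 < eps -> 0 < h -> T t ->
    (\int[P]_w (crit_weight F K eps t w * ((u - h <= F t w <= u + h)%R)%:R)%:E <= (C * h)%:E)%E.
  by move=> K; have [C C0 h] := crit_window hab gm K; exists C; split => // eps t h0; exact: h.
pose S := \sum_(K : face N) V K * C K.
have S0 : 0 <= S by apply: sumr_ge0 => K _; rewrite mulr_ge0 ?(hV K).1 ?(hC K).1.
(* The condition on [h] keeps the window above [(1 - eta) * u], where the good event describes the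
   path. The window is a neighbourhood of [u], so [chi] is locally constant at a maximum equal to
   [u]. *)
have key h : 0 < h -> h <= eta * u -> fine (P G) <= S * h.
  move=> h0 hu; pose chi (x : R) := u - h <= x <= u + h.
  have mchi : measurable_fun setT (fun x : R => (chi x)%:R : R) by exact: indicator_itv.
  have chi_ge x : chi x -> (1 - eta) * u <= x.
    by move=> /andP[h1 _]; apply: le_trans h1; rewrite mulrBl mul1r; lra.
  have chiu : chi u by rewrite /chi; apply/andP; split; lra.
  have c := good_count mchi chi_ge mG (fun w (Gw : G w) => Gw.2).
  have {}c : \sum_(K : face N) face_count P a b F chi K (e n) G @[n --> \oo] --> \int[P]_w ((chi (M w))%:R * \1_G w).
    apply: c => w [/= Mu _]; rewrite Mu chiu; exists h => //= x; rewrite /ball/= => hx.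
    by move: hx; rewrite ltr_distlC => /andP[h1 h2]; apply/andP; split; exact: ltW.
  have -> : fine (P G) = \int[P]_w ((chi (M w))%:R * \1_G w).
    rewrite -prob_indic//; apply: eq_Rintegral => w _; rewrite indicE.
    have [/set_mem[/= -> _]|_] := boolP (w \in G); last by rewrite mulr0.
    by rewrite chiu mul1r.
  apply: (cvg_le_bound c) => n; apply: le_trans (ler_norm _) _; apply: le_trans (ler_norm_sum _ _ _) _.
  rewrite /S mulr_suml; apply: ler_sum => K _; rewrite -mulrA.
  apply: (face_count_le hab gm mchi (hV K).2) => //; first by rewrite mulr_ge0 ?(hC K).1// ltW.
  move=> t Tt; apply: le_trans ((hC K).2 (e n) t h (e0 n) h0 Tt).
  have [mq q0] := crit_weight_weight gm K t (e0 n).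
  have mc : measurable_fun setT (fun w => (chi (F t w))%:R : R) by exact: (measurableT_comp mchi (gm_measurable gm t)).
  apply: ge0_le_integral => //.
  - by move=> w _; rewrite lee_fin mulr_ge0// mulr_ge0.
  - by apply/measurable_EFinP; apply: measurable_funM; [exact: measurable_funM|exact: measurable_indic].
  - by apply/measurable_EFinP; exact: measurable_funM.
  move=> w _; rewrite lee_fin; apply: ler_piMr; first by rewrite mulr_ge0.
  by rewrite indicE; case: (_ \in _).
have p0 : 0 <= fine (P G) by exact: fine_ge0.
have Pf : P G \is a fin_num by rewrite ge0_fin_numE// (le_lt_trans (probability_le1 P mG))// ltry.
suff : fine (P G) = 0 by move=> h; rewrite -(fineK Pf) h.
apply/eqP; rewrite eq_le p0 andbT leNgt; apply/negP => pp.
have eu : 0 < eta * u by have /andP[h _] := eta01; rewrite mulr_gt0.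
have S1 : 0 < 2 * (S + 1) by lra.
pose h := Num.min (eta * u) (fine (P G) / (2 * (S + 1))).
have h0 : 0 < h by rewrite lt_min eu divr_gt0.
have := key h h0; rewrite ge_min lexx => /(_ isT).
have h1 : S * h <= S * (fine (P G) / (2 * (S + 1))) by rewrite ler_wpM2l// ge_min lexx orbT.
have h2 : S * (fine (P G) / (2 * (S + 1))) <= fine (P G) / 2.
  rewrite mulrA ler_pdivrMr//; move: (fine (P G)) pp => p pp; nra.
by move: h1 h2 pp; move: (fine (P G)) => p; lra.
Qed.

(** On [D], the good paths whose maximum is not [u], the counts converge to the probability that the
    maximum is at least [u]. Up to a null set the complement is [B]: there the counts are bounded by
    [\sum_K V K * A K] and the probability by [A1], and both errors add up. *)
Lemma level_estimate (V A : face N -> R) (A1 Lim : R) :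
  (forall K, 0 <= V K) -> (forall K, 0 <= A K) ->
  (forall K : face N, \int[leb #|tau K|]_v ((in_face a b v)%:R)%:E <= (V K)%:E)%E ->
  (forall (K : face N) t n, T t -> (mass P (crit_weight F K (e n) t) B <= (A K)%:E)%E) ->
  (P B <= A1%:E)%E ->
  \sum_(K : face N) face_count P a b F (fun x => u <= x) K (e n) setT @[n --> \oo] --> Lim ->
  `|fine (P [set w | u <= M w]) - Lim| <= A1 + \sum_K V K * A K.
Proof.
move=> V0 A0 hV hA hB cLim; pose chi (x : R) := u <= x.
have mchi : measurable_fun setT (fun x : R => (chi x)%:R : R) by exact: indicator_ge.
have chi_ge x : chi x -> (1 - eta) * u <= x.
  move=> h; apply: le_trans h; rewrite mulrBl mul1r gerBl mulr_ge0// ltW//.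
  by case/andP: eta01.
pose D := ~` B `&` ~` [set w | M w = u].
have mD : measurable D by apply: measurableI; exact: measurableC.
have offG w : ~ G w -> \1_(~` D) w = \1_B w :> R.
  move=> nG; rewrite !indicE; congr (_%:R); congr nat_of_bool.
  apply/idP/idP => /set_mem h; apply/mem_set; last by move=> [].
  by apply: contrapT => nB; apply: h; split => // Mu; apply: nG; split.
have PD : fine (P (~` D)) = fine (P B).
  rewrite -!prob_indic//; last exact: measurableC.
  rewrite /Rintegral; congr fine; apply: (eq_integral_off _ mG max_null) => w nG.
  by rewrite /= offG.
have cD : \sum_(K : face N) face_count P a b F chi K (e n) D @[n --> \oo] --> \int[P]_w ((chi (M w))%:R * \1_D w).
  apply: good_count => // w [nB /= nMu]; first by [].
  have [lt|gt|] := ltgtP (M w) u; last by move/nMu.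
    exists (u - M w); rewrite /= ?subr_gt0// => x; rewrite /ball/= ltr_distlC => /andP[_ h].
    have xu : x < u by move: h; lra.
    by rewrite /chi !leNgt xu lt.
  exists (M w - u); rewrite /= ?subr_gt0// => x; rewrite /ball/= ltr_distlC => /andP[h _].
  have xu : u <= x by move: h; lra.
  by rewrite /chi xu (ltW gt).
have cC : \sum_(K : face N) face_count P a b F chi K (e n) (~` D) @[n --> \oo] --> Lim - \int[P]_w ((chi (M w))%:R * \1_D w).
  have -> : (fun n => \sum_(K : face N) face_count P a b F chi K (e n) (~` D)) =
    fun n => \sum_(K : face N) face_count P a b F chi K (e n) setT - \sum_(K : face N) face_count P a b F chi K (e n) D.
    apply/funext => n; rewrite -sumrB; apply: eq_bigr => K _.
    by rewrite (face_count_split hab gm mchi K (e0 n) mD) addrAC subrr add0r.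
  exact: cvgB.
have bC : `|Lim - \int[P]_w ((chi (M w))%:R * \1_D w)| <= \sum_K V K * A K.
  apply: (cvg_norm_bound cC) => n; apply: le_trans (ler_norm_sum _ _ _) _; apply: ler_sum => K _.
  apply: (face_count_le hab gm mchi (hV K)) => //; first exact: measurableC.
  move=> t Tt; apply: le_trans (hA K t n Tt); rewrite mass_indic.
  have [mq q0] := crit_weight_weight gm K t (e0 n).
  have mc : measurable_fun setT (fun w => (chi (F t w))%:R : R) by exact: (measurableT_comp mchi (gm_measurable gm t)).
  have -> : (\int[P]_w (crit_weight F K (e n) t w * (chi (F t w))%:R * \1_(~` D) w)%:E =
      \int[P]_w (crit_weight F K (e n) t w * (chi (F t w))%:R * \1_B w)%:E)%E.
    by apply: (eq_integral_off _ mG max_null) => w nG; rewrite offG.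
  apply: ge0_le_integral => //.
  - by move=> w _; rewrite lee_fin mulr_ge0// mulr_ge0.
  - by apply/measurable_EFinP; apply: measurable_funM; [exact: measurable_funM|exact: measurable_indic].
  - by apply/measurable_EFinP; apply: measurable_funM => //; exact: measurable_indic.
  by move=> w _; rewrite lee_fin ler_wpM2r// ler_piMr//; case: (chi _).
have mM : measurable [set w | u <= M w] by exact: measurable_max_ge.
have chiM w : (chi (M w))%:R = \1_[set w | u <= M w] w :> R.
  rewrite indicE; congr (_%:R); congr nat_of_bool.
  by apply/idP/idP => [h|/set_mem]; [exact: mem_set|].
have i1 (E : set Omega) : measurable E -> P.-integrable setT (EFin \o (fun w => (chi (M w))%:R * \1_E w : R)).
  move=> mE; apply: integrable_bool.
    apply: measurable_funM; last exact: measurable_indic.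
    by rewrite (_ : (fun w => _) = \1_[set w | u <= M w]); [exact: measurable_indic|apply/funext => w; exact: chiM].
  by move=> w; rewrite indicE -natrM; case: (chi _); case: (_ \in _); rewrite ?normr1 ?normr0.
have mDc : measurable (~` D) by exact: measurableC.
have split : fine (P [set w | u <= M w]) = \int[P]_w ((chi (M w))%:R * \1_D w) + \int[P]_w ((chi (M w))%:R * \1_(~` D) w).
  rewrite -prob_indic// -RintegralD//; [|exact: i1|exact: i1].
  apply: eq_Rintegral => w _; rewrite -mulrDr -chiM !indicE in_setC.
  by case: (w \in D); rewrite ?addr0 ?add0r mulr1.
have small : 0 <= \int[P]_w ((chi (M w))%:R * \1_(~` D) w) <= A1.
  apply/andP; split; first by apply: Rintegral_ge0 => w _; rewrite mulr_ge0// indicE.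
  apply: le_trans (_ : fine (P (~` D)) <= _).
    rewrite -prob_indic//; apply: le_Rintegral => //; first exact: i1.
      by apply: integrable_bool; [exact: measurable_indic|move=> w; rewrite indicE normr_nat; case: (_ \in _)].
    by move=> w _; rewrite ler_piMl// ?indicE//; case: (chi _).
  by rewrite PD -lee_fin fineK// ge0_fin_numE// (le_lt_trans (probability_le1 P mB))// ltry.
rewrite split; move: small bC; move: (\int[P]_w _) (\int[P]_w _) => x y /andP[h1 h2].
rewrite !ler_norml => /andP[h3 h4]; apply/andP; split; lra.
Qed.

End paths.

(** * Limits on the faces and conclusion *)

Section face_limit.
Context {d} {Omega : measurableType d} {R : realType} (P : probability Omega R) {N : nat}.
Context (a b : 'rV[R]_N) (hab : forall i, a ord0 i < b ord0 i).
Context (H : set (Omega -> R)) (F : 'rV[R]_N -> Omega -> R) (gm : gaussian_model P a b H F).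
Context (X : 'rV[R]_N -> {RV P >-> R}) (A : set Omega) (mA : measurable A) (A0 : P A = 0%E).
Hypothesis XF : forall w, ~ A w -> sample_path X w = F ^~ w.
Local Notation tup k := (k.-tuple (measurableTypeR R)).
Local Notation leb := (lebesgue_tuple R).

Lemma sample_pathE w t : ~ A w -> X t w = F t w.
Proof. by move=> /XF/(congr1 (fun f => f t)). Qed.

Lemma prob_off (S S' : set Omega) : measurable S' -> (forall w, ~ A w -> S w <-> S' w) ->
  prob P S = fine (P S').
Proof.
move=> mS' SS'; rewrite /prob unlock (eq_integral_off (g := fun w => (\1_S' w : R)%:E) _ mA A0).
  by rewrite integral_indic// setIT.
move=> w nA; rewrite !indicE; congr ((_%:R)%:E); congr nat_of_bool.
by apply/idP/idP => /set_mem/(SS' w nA) h; exact/mem_set.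
Qed.

Lemma prob_exceeds t u : prob P (exceeds X t u) = fine (P [set w | u <= F t w]).
Proof.
apply: prob_off; last by move=> w nA; rewrite /exceeds/= sample_pathE.
rewrite -[X in measurable X]setTI; apply: measurable_fun_le => //; exact: (gm_measurable gm).
Qed.

Lemma vertex_limit (K : face N) (e : R) u : #|tau K| = 0%N -> 0 < e ->
  face_count P a b F (fun x => u <= x) K e setT = face_term a b X K u.
Proof.
move=> K0 e0; rewrite /face_term ifT; last exact/eqP.
rewrite prob_exceeds; apply: EFin_inj.
rewrite (face_count_slices hab gm (indicator_ge u) K e0).
have ms := measurable_slice hab gm (indicator_ge u) (K := K) e0.
pose v : tup #|tau K| := [tuple 0 | i < #|tau K|].
rewrite (integral_leb0 v K0)//; last exact/measurable_EFinP.
rewrite /slice; have -> : in_face a b v = true.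
  by apply/forallP => i; have := ltn_ord i; rewrite [X in (_ < X)%N]K0.
have -> : val v = [::] by apply: size0nil; rewrite size_tuple.
rewrite mul1r /Rintegral; congr (fine _)%:E.
rewrite -[X in P X]setIT -integral_indic//; last first.
  rewrite -[X in measurable X]setTI; apply: measurable_fun_le => //; exact: (gm_measurable gm).
have p1 : (2 * e) ^+ #|tau K| = 1 by rewrite K0 expr0.
apply: eq_integral => w _; rewrite /crit det_mx0// p1 mul1r divr1 indicE.
have -> : cube e (face_grad F K (face_point a b K [::]) w) = true.
  by apply/forallP => i; have := ltn_ord i; rewrite [X in (_ < X)%N]K0.
rewrite mulr1; congr ((_%:R)%:E); congr nat_of_bool.
by apply/idP/idP => [h|/set_mem//]; exact/mem_set.
Qed.

Lemma face_count_limit (K : face N) (e : nat -> R) u : (forall n, 0 < e n) ->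
  e n @[n --> \oo] --> (0 : R) ->
  face_count P a b F (fun x => u <= x) K (e n) setT @[n --> \oo] -->
    (-1) ^+ #|tau K| * face_term a b X K u.
Proof.
move=> e0 ce; have [K0|Kn0] := eqVneq #|tau K| 0%N.
  by under eq_cvg do rewrite vertex_limit//; rewrite K0 expr0 mul1r; exact: cvg_cst.
have mchi := indicator_ge u.
pose s n (v : tup #|tau K|) : R := slice P a b F (fun x => u <= x) (e n) v.
pose G t := cond_expectation P (fun w => \det (hess_face X K t w) * \1_(exceeds X t u) w)
  (grad_face X K t) 0 * density P (grad_face X K t) 0.
pose g (v : tup #|tau K|) := (in_face a b v)%:R * G (face_point a b K v).
have ms n : measurable_fun setT (s n) by exact: (measurable_slice hab gm mchi).
have sg v : s n v @[n --> \oo] --> (-1) ^+ #|tau K| * g v.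
  rewrite /s /slice /g; have [iv|niv] := boolP (in_face a b v); last first.
    by under eq_cvg do rewrite mul0r; rewrite mul0r mulr0; exact: cvg_cst.
  have Tv := face_set_box hab ((in_faceP a b v).1 iv).
  under eq_cvg do rewrite mul1r.
  by rewrite mul1r; exact: (kac_rice_point hab gm mA A0 XF).
have [C C0 hC] := slice_le hab gm mchi K.
have [V V0 hV] := @in_face_finite R N a b K.
have iC : (leb #|tau K|).-integrable setT (EFin \o (fun v => (in_face a b v)%:R * C)).
  apply/integrableP; split.
    by apply/measurable_EFinP; apply: measurable_funM => //; exact: measurable_in_face.
  under eq_integral do rewrite /= normrM normr_nat EFinM.
  rewrite ge0_integralZr//; last by apply/measurable_EFinP; exact: measurable_in_face.
  apply: (@le_lt_trans _ _ (V%:E * `|C|%:E)%E); last by rewrite -EFinM ltry.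
  by apply: lee_wpmul2r.
(* The Kac-Rice integrand is built from chosen functions at each point; its measurability is
   obtained as that of a limit of the slices. *)
have mg' : measurable_fun setT (fun v => (-1) ^+ #|tau K| * g v).
  by apply: (measurable_fun_cvg ms) => v _; exact: sg.
have mg : measurable_fun setT g.
  have -> : g = fun v => (-1) ^+ #|tau K| * ((-1) ^+ #|tau K| * g v).
    by apply/funext => v; rewrite signrMK.
  exact: measurable_funM.
have gC v : `|g v| <= (in_face a b v)%:R * C.
  have <- : `|(-1) ^+ #|tau K| * g v| = `|g v| by rewrite normrMsign.
  have /cvg_norm sg' := sg v.
  by rewrite -(cvg_lim _ sg')//; apply: limr_le; [apply: cvgP sg'|apply: nearW => n; exact: hC].
have ig : (leb #|tau K|).-integrable setT (EFin \o g).
  apply: (le_integrable _ _ _ iC) => //; first exact/measurable_EFinP.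
  move=> v _ /=; rewrite lee_fin (le_trans (gC v))//; exact: ler_norm.
have := dominated_cvg_off (mu := leb #|tau K|) ms mg' measurable0 (measure0 _)
  (fun v _ => sg v) (fun n v => hC (e n) v (e0 n)) iC.
under eq_cvg do rewrite -(face_count_slices hab gm mchi K (e0 _)).
have -> : (\int[leb #|tau K|]_v ((-1) ^+ #|tau K| * g v)%:E =
    ((-1) ^+ #|tau K| * face_term a b X K u)%:E)%E.
  rewrite (_ : face_term a b X K u = \int[leb #|tau K|]_v g v).
    rewrite -RintegralZl// fineK//; apply: integrable_fin_num => //.
    have := integrableZl measurableT ((-1) ^+ #|tau K|) ig.
    by congr integrable; apply/funext => v; rewrite /= EFinM.
  rewrite /face_term (negbTE Kn0) /face_integral /Rintegral; congr fine.
  rewrite integral_mkcond; apply: eq_integral => v _; rewrite patchE /g.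
  have [iv|niv] := boolP (in_face a b v).
    by rewrite mem_set ?mul1r//=; exact/in_faceP.
  by rewrite memNset ?mul0r//= => /in_faceP; exact/negP.
by move/fine_cvg.
Qed.

End face_limit.

Lemma mean_euler_charE {d} {Omega : measurableType d} {R : realType} (P : probability Omega R) {N : nat}
  (a b : 'rV[R]_N) (X : 'rV[R]_N -> {RV P >-> R}) u :
  mean_euler_char a b X u = \sum_(K : face N) (-1) ^+ #|tau K| * face_term a b X K u.
Proof.
rewrite [RHS](partition_big (fun K : face N => inord #|tau K| : 'I_N.+1) xpredT)//.
apply: eq_bigr => k _; apply: eq_big => [K|K /eqP -> //].
have hK : (#|tau K| < N.+1)%N by rewrite ltnS -[X in (_ <= X)%N]card_ord max_card.
by rewrite -val_eqE /= inordK.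
Qed.

Section euler_approximation.
Context {d} {Omega : measurableType d} {R : realType} (P : probability Omega R) {N : nat}.
Context (a b : 'rV[R]_N) (hab : forall i, a ord0 i < b ord0 i).
Context (H : set (Omega -> R)) (F : 'rV[R]_N -> Omega -> R) (gm : gaussian_model P a b H F).
Context (X : 'rV[R]_N -> {RV P >-> R}) (A : set Omega) (mA : measurable A) (A0 : P A = 0%E).
Hypothesis XF : forall w, ~ A w -> sample_path X w = F ^~ w.
Local Notation T := (box a b).
Local Notation s2 := (sig2 P a b F).
Hypothesis hbd : forall (J : face N) t i, face_set a b J t -> vr P F t = s2 -> i \notin tau J ->
  c1 P F i t != 0.

Lemma prob_sup_exceeds (tm : Omega -> 'rV[R]_N) u :
  (forall w, T (tm w) /\ forall s, T s -> F s w <= F (tm w) w) ->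
  prob P (sup_exceeds a b X u) = fine (P [set w | u <= F (tm w) w]).
Proof.
move=> tm_max; apply: (prob_off mA A0); first exact: (measurable_max_ge hab gm tm_max).
move=> w nA; rewrite /sup_exceeds /=.
have -> : ereal_sup [set (X t w)%:E | t in T] = (F (tm w) w)%:E.
  apply/eqP; rewrite eq_le; apply/andP; split.
    apply: ge_ereal_sup => _ [t Tt <-]; rewrite lee_fin (sample_pathE XF)//.
    exact: (tm_max w).2.
  apply: ereal_sup_ubound; exists (tm w); first exact: (tm_max w).1.
  by rewrite (sample_pathE XF).
by rewrite lee_fin.
Qed.

Lemma euler_approximation : exists alpha C : R, [/\ 0 < alpha, 0 <= C & forall u, 1 <= u ->
  `|prob P (sup_exceeds a b X u) - mean_euler_char a b X u| <=
    C * expR (- u ^+ 2 / (2 * s2) - alpha * u ^+ 2)].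
Proof.
have [mu [eta [r [L [mu0 eta01 r0 L0 [B [mB [alpha alpha0 hB]] good]]]]]] := good_event hab gm hbd.
have /choice[tm tm_max] : forall w, exists t, T t /\ forall s, T s -> F s w <= F t w.
  by move=> w; apply: (box_max hab); exact: C1_continuous (gm_C1 gm w).
have [A1 A10 hA1] := hB 1 0 ler01 (lexx 0).
have hA1' := hA1 _ (subgaussian1 (gm_space gm)).
have /choice[A2 hA2] : forall K : face N, exists A2 : R, 0 <= A2 /\ forall eps t u, 0 < eps -> T t -> 1 <= u ->
    (mass P (crit_weight F K eps t) (B u) <= (A2 * expR (- u ^+ 2 / (2 * s2) - alpha * u ^+ 2))%:E)%E.
  move=> K; have [C [c [C0 c0 hC]]] := crit_weight_subgaussian hab gm K.
  have [A2 A20 hA2] := hB C c C0 c0; exists A2; split=> // eps t u e0 Tt u1.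
  exact: hA2 (hC _ _ e0 Tt) _ u1.
have /choice[V hV] : forall K : face N, exists V : R, 0 <= V /\
    (\int[lebesgue_tuple R #|tau K|]_v ((in_face a b v)%:R)%:E <= V%:E)%E.
  by move=> K; have [V V0 hV] := @in_face_finite R N a b K; exists V.
exists alpha, (A1 + \sum_K V K * A2 K); split => //.
  by rewrite addr_ge0// sumr_ge0// => K _; rewrite mulr_ge0//; [exact: (hV K).1|exact: (hA2 K).1].
move=> u u1; set E := expR _; have u0 : 0 < u by apply: lt_le_trans u1.
have E0 : 0 <= E by exact: expR_ge0.
(* The smoothing parameter stays below [mu * u], so that a gradient of size at most [e n] is
   excluded wherever the outward derivative is at least [mu * u]. *)
pose e (n : nat) := (mu * u / 2) / n.+1%:R.
have muu : 0 < mu * u by rewrite mulr_gt0.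
have e_pos n : 0 < e n < mu * u.
  rewrite divr_gt0 ?divr_gt0//= ltr_pdivrMr// ltr_pdivrMr//.
  have : 1 <= n.+1%:R :> R by rewrite ler1n.
  by move: muu; move: (mu * u) (n.+1%:R : R) => x y ? ?; nra.
have e_cvg : e n @[n --> \oo] --> (0 : R) by exact: cvg_harmonicZ.
rewrite (prob_sup_exceeds _ tm_max) mean_euler_charE.
have := @level_estimate _ _ _ P N a b hab H F gm tm tm_max mu eta r L u mu0 eta01 r0 L0 u0 (B u) (mB u)
  (fun w => good u w u0) e e_pos e_cvg V (fun K => A2 K * E) (A1 * E)
  (\sum_(K : face N) (-1) ^+ #|tau K| * face_term a b X K u).
have -> : (A1 + \sum_K V K * A2 K) * E = A1 * E + \sum_K V K * (A2 K * E).
  by rewrite mulrDl mulr_suml; congr (_ + _); apply: eq_bigr => K _; rewrite mulrA.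
apply.
- by move=> K; exact: (hV K).1.
- by move=> K; rewrite mulr_ge0//; exact: (hA2 K).1.
- by move=> K; exact: (hV K).2.
- by move=> K t n Tt; apply: (hA2 K).2 => //; have /andP[] := e_pos n.
- by have := hA1' u u1; rewrite /mass /= integral_cst// mul1e.
apply: cvg_sumr => K; apply: (face_count_limit hab gm mA A0 XF) => // n.
by have /andP[] := e_pos n.
Qed.

End euler_approximation.

(** Half of [alpha] is given up: the factor [expR (- (alpha / 2) * u ^+ 2)] tends to 0 and turns the
    uniform bound into a negligible term. *)
Lemma littleo_expR_sqr {R : realType} (f : R -> R) (s : R) :
  (exists alpha C : R, [/\ 0 < alpha, 0 <= C &
    forall u, 1 <= u -> `|f u| <= C * expR (- u ^+ 2 / (2 * s) - alpha * u ^+ 2)]) ->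
  exists2 alpha : R, 0 < alpha &
    f =o_ (pinfty_nbhs R) (fun u : R => expR (- u ^+ 2 / (2 * s) - alpha * u ^+ 2)).
Proof.
move=> [alpha [C [a0 C0 hf]]]; exists (alpha / 2); first by rewrite divr_gt0.
apply/eqoP => eps eps0; near=> u.
have u1 : 1 <= u by near: u; exact: nbhs_pinfty_ge.
apply: le_trans (hf u u1) _; rewrite ger0_norm ?expR_ge0//.
rewrite (_ : - u ^+ 2 / (2 * s) - alpha * u ^+ 2 =
  (- (alpha / 2 * u ^+ 2)) + (- u ^+ 2 / (2 * s) - alpha / 2 * u ^+ 2)); last first.
  by rewrite [in LHS](splitr alpha); ring.
rewrite expRD mulrA ler_wpM2r ?expR_ge0// expRN ler_pdivrMr ?expR_gt0//.
have u2 : 2 * C / (alpha * eps) <= u by near: u; apply: nbhs_pinfty_ge; exact: num_real.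
move: u2; rewrite ler_pdivrMr ?mulr_gt0// => u2.
apply: (@le_trans _ _ (eps * (1 + alpha / 2 * u ^+ 2))); last by rewrite ler_pM2l// expR_ge1Dx.
have uu : u <= u ^+ 2 by rewrite expr2 ler_peMr// (le_trans ler01 u1).
have h : 0 <= (alpha * eps) * (u ^+ 2 - u) by apply: mulr_ge0; [rewrite ltW// mulr_gt0|rewrite subr_ge0].
have -> : eps * (1 + alpha / 2 * u ^+ 2) = eps + (alpha * eps) * u ^+ 2 / 2 by field.
move: h u2 eps0; rewrite mulrBr (mulrC u) => h u2 eps0; lra.
Unshelve. all: by end_near.
Qed.

Section dimension0.
Context {d} {Omega : measurableType d} {R : realType} (P : probability Omega R).
Context (a b : 'rV[R]_0) (X : 'rV[R]_0 -> {RV P >-> R}).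

(** In dimension 0 the box is a single point and the only face is this vertex, so both sides are the
    same probability. The case is separate because the model uses two distinct points of the box. *)
Lemma euler_characteristic_dim0 u : prob P (sup_exceeds a b X u) = mean_euler_char a b X u.
Proof.
have tau0 (K : face 0) : #|tau K| = 0%N by apply/eqP; rewrite -leqn0 -[X in (_ <= X)%N]card_ord max_card.
pose K0 : face 0 := [ffun=> None].
rewrite mean_euler_charE (bigD1 K0)//= big1 ?addr0; last first.
  by move=> K /eqP; case; apply/ffunP => -[].
rewrite /face_term ifT ?tau0// expr0 mul1r; congr prob.
apply/funext => w; rewrite /sup_exceeds /exceeds/=.
have -> : [set (X t w)%:E | t in box a b] = [set (X (face_point a b K0 [::]) w)%:E].
  apply/seteqP; split => [_ [t _ <-]|_ ->]/=.
    by have -> : t = face_point a b K0 [::] by rewrite [LHS]thinmx0 [RHS]thinmx0.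
  by exists (face_point a b K0 [::]) => // -[].
by rewrite ereal_sup1 lee_fin.
Qed.

End dimension0.

Theorem theorem3p2 (d : measure_display) (Omega : measurableType d)
    (R : realType) (P : probability Omega R) (N : nat) (a b : 'rV[R]_N)
    (X : 'rV[R]_N -> {RV P >-> R})
    (hab : forall i, a ord0 i < b ord0 i)
    (hgauss : gaussian_field (box a b) X)
    (hcent : centered (box a b) X)
    (hsmooth : smooth a b X)
    (hreg : regular a b X)
    (hbd : boundary_condition a b X) :
  exists2 alpha : R, 0 < alpha &
    (fun u : R => prob P (sup_exceeds a b X u) - mean_euler_char a b X u)
    =o_ (pinfty_nbhs R)
    (fun u : R => expR (- u ^+ 2 / (2 * sigma2 a b X) - alpha * u ^+ 2)).
Proof.
apply: littleo_expR_sqr; have [N0|N0] := posnP N.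
  subst N; exists 1, 0; split=> // u _.
  by rewrite euler_characteristic_dim0 subrr normr0 mul0r.
have [A [H [F [mA A0 XF gm]]]] := gaussian_model_exists N0 hab hgauss hcent hsmooth hreg.
have nuE t : box a b t -> nu X t = vr P F t.
  move=> Tt; have Ht := gm_field gm Tt.
  by apply: (covariance_off (gm_space gm) mA A0) => // w; exact: sample_pathE.
have s2E : sigma2 a b X = sig2 P a b F.
  rewrite /sigma2 /sig2; congr sup; apply/seteqP.
  by split => _ [t Tt <-]; exists t => //; rewrite nuE.
rewrite s2E; apply: (euler_approximation hab gm mA A0 XF) => J t i Jt vt iJ.
apply/eqP => ci0; have Tt := face_set_box hab Jt.
suff : [set s | [/\ face_set a b J s, nu X s = sigma2 a b X &
    \prod_(j | j \notin tau J) nu_ a b X j s = 0]] t by rewrite (hbd J).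
split=> //; first by rewrite nuE// s2E.
by rewrite (bigD1 i)//= /nu_ (partial_within_vr hab gm i Tt nuE) ci0 mulr0 mul0r.
Qed.
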